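(* Let $\rho:=e^{\pi i/3}=\frac12+\frac{\sqrt3}{2}i$ and let $E_\rho=\mathbb{C}/(\mathbb{Z}+\mathbb{Z}\rho)$. Then the equation $$\Delta u+e^{u}=16\pi\,\delta_{0}\quad\text{on } E_\rho$$ has no solutions.
   Context: $\delta_0$ is the Dirac measure at the origin $0\in E_\rho$, and $\Delta=\partial_{x_1}^2+\partial_{x_2}^2$ is the flat Laplacian in the coordinate $z=x_1+ix_2$. A solution is a real-valued function $u$ on $E_\rho\setminus\{0\}$ (equivalently, a doubly periodic function with periods $1,\rho$ on $\mathbb{C}\setminus(\mathbb{Z}+\mathbb{Z}\rho)$), smooth away from $0$, with $e^u$ integrable on $E_\rho$, satisfying the equation in the sense of distributions on $E_\rho$. In particular $\Delta u+e^u=0$ away from $0$, and $u(z)-8\log|z|$ stays bounded near $0$. *)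

(* Defs.v *)
From mathcomp Require Import all_boot all_order all_algebra.
From mathcomp Require Import all_classical all_reals all_analysis.

Set Implicit Arguments.
Unset Strict Implicit.
Unset Printing Implicit Defensive.

Import Order.TTheory GRing.Theory Num.Theory numFieldNormedType.Exports.

Local Open Scope classical_set_scope.
Local Open Scope ring_scope.

(* The complex plane is R * R, with z = x1 + i x2 written (x1, x2).  A function
   on the torus C / (Z + Z tau) is a function on the plane with periods 1 and
   tau; a function on the punctured torus is a total function whose values at
   the lattice points are irrelevant: no condition below depends on them. *)

(* exp (i pi / 3) *)
Definition rho (R : realType) : R * R := (2^-1, Num.sqrt 3 / 2).

Definition lattice (R : realType) (tau : R * R) : set (R * R) :=
  [set z | exists m n : int, z = (1, 0) *~ m + tau *~ n].

Definition fundamental_domain (R : realType) (tau : R * R) : set (R * R) :=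
  [set z | exists s t : R,
     [/\ 0 <= s < 1, 0 <= t < 1 & z = s *: (1, 0) + t *: tau]].

Definition doubly_periodic_on (R : realType) (tau : R * R) (U : set (R * R))
    (f : R * R -> R) : Prop :=
  forall z, U z -> f (z + (1, 0)) = f z /\ f (z + tau) = f z.

(* C^infinity on the open set U: every iterated directional derivative of f is
   (Frechet) differentiable at every point of U. *)
Definition smooth_on (R : realType) (U : set (R * R)) (f : R * R -> R) : Prop :=
  forall (vs : seq (R * R)) (z : R * R), U z ->
    differentiable (foldr (fun v g => 'D_v g) f vs) z.

Definition laplacian (R : realType) (f : R * R -> R) : R * R -> R :=
  fun z => 'D_(1, 0) ('D_(1, 0) f) z + 'D_(0, 1) ('D_(0, 1) f) z.

Notation lebesgue2 R := (@lebesgue_measure R \x @lebesgue_measure R)%E.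

Definition torus_test_function (R : realType) (tau : R * R)
    (phi : R * R -> R) : Prop :=
  doubly_periodic_on tau setT phi /\ smooth_on setT phi.

(* Delta u + e^u = c delta_0 as distributions on C / (Z + Z tau): pairing with
   a test function phi moves the Laplacian onto phi, and
   <delta_0, phi> = phi 0. *)
Definition distributional_equation (R : realType) (tau : R * R) (c : R)
    (u : R * R -> R) : Prop :=
  forall phi, torus_test_function tau phi ->
    \int[lebesgue2 R]_(z in fundamental_domain tau) (u z * laplacian phi z)
    + \int[lebesgue2 R]_(z in fundamental_domain tau) (expR (u z) * phi z)
    = c * phi 0.

(* Integrability of u is what makes u a distribution on the torus; without it
   the first integral above would be meaningless. *)
Record mean_field_solution (R : realType) (tau : R * R) (c : R)
    (u : R * R -> R) : Prop := {
  solution_periodic : doubly_periodic_on tau (~` lattice tau) u;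
  solution_smooth : smooth_on (~` lattice tau) u;
  solution_integrable :
    (lebesgue2 R).-integrable (fundamental_domain tau) (fun z => (u z)%:E);
  solution_exp_integrable :
    (lebesgue2 R).-integrable (fundamental_domain tau)
      (fun z => (expR (u z))%:E);
  solution_equation : distributional_equation tau c u
}.

(* Main.v *)
(** Testing the equation against ln (T + eps), T a trigonometric polynomial vanishing
    like |z|^2 at the lattice, gives the pointwise equation and a limit of u - 8 ln |z|
    at 0.  So Q = u_zz - (u_z)^2 / 2 is holomorphic off the lattice, and a Bernstein
    estimate gives z^2 Q -> -12.  Splitting Q under rotation by pi / 3 and reflection and
    bounding the parts by Phragmen-Lindelof in a sector gives Q = - 12 p - 6 b, where
    p'^2 = 4 p^3 - 4 e^3, e > 0.  Then psi = exp (- u / 2) solves psi_zz = (6 p + 3 b) psi,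
    and pairing its Hermitian 2-jet with Y = p^2 - b p + b^2, a solution of the symmetric
    square of this Lame equation, yields a real doubly periodic G with G_z = nu / Y,
    nu^2 = 3 b^2 (b^3 + e^3).  Along a rotated real or imaginary period, a combination of
    G and ln |(p' - q) / (p' + q)|, q^2 = - 4 (b^3 + e^3), would be strictly monotone. *)
From HB Require Import structures.
Require Import Defs.
From mathcomp Require Import all_boot all_order all_algebra.
From mathcomp Require Import all_classical all_reals all_analysis.
From mathcomp Require Import measurable_realfun.
From mathcomp Require Import complex zify ring lra.
Import Order.TTheory GRing.Theory Num.Theory numFieldNormedType.Exports.
Local Open Scope classical_set_scope.
Local Open Scope ring_scope.
Set Implicit Arguments.
Unset Strict Implicit.
Unset Printing Implicit Defensive.

(** * Partial derivatives of real functions on the plane *)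

Section rd.
Context {R : realType}.
Implicit Types (f g : R * R -> R) (z w v : R * R) (a b c d : R).

(** The equation accepts only smooth test functions and gives [u] and [e^u] merely in [L^1], so
    nothing is known beforehand at the puncture. Boundedness of [e^u] there is a Brezis-Merle
    argument: near the lattice its mass is at most [pi], and a Jensen inequality bounds it by a
    potential with kernel [T^(-1/4)]. Complex analysis is done without contour integrals or power
    series: derivatives are bounded by maximum principles, and removable singularities, the
    relations for [p] and the exclusion of simple poles rest on the twelve symmetries of the
    hexagonal lattice. The limit -12 is [- 4 - 4^2 / 2], from [u_z ~ 4 / z]. Nothing makes [u]
    itself symmetric, so [b] is an arbitrary complex number. [Y] is a product of two Lame solutions
    and [nu] half their Wronskian. [G] is half the logarithm of a quotient of two positive Hermitian
    expressions, whose positivity is the Liouville equation again; hence it is single-valued.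
    Periodicity forbids [G] to increase along a period. If no period makes its derivative
    one-signed, the logarithm of the quotient in [p'] is added because its derivative has the same
    denominator [p^3 + b^3]. *)

Definition rd f z a b := is_diff z f (fun v => a * v.1 + b * v.2).

Lemma rd_eq f z a b a' b' : rd f z a b -> a = a' -> b = b' -> rd f z a' b'.
Proof. by move=> ? <- <-. Qed.
Lemma rd_diff f z a b : rd f z a b -> differentiable f z.
Proof. by case. Qed.
Lemma rd_derive f z a b v : rd f z a b -> 'D_v f z = a * v.1 + b * v.2.
Proof. by case=> df e; rewrite deriveE // e. Qed.

Lemma rdP f z : differentiable f z -> rd f z ('D_(1, 0) f z) ('D_(0, 1) f z).
Proof.
move=> df; apply: DiffDef => //.
apply/funext => -[x y] /=.
rewrite !deriveE // ![_ * x]mulrC ![_ * y]mulrC.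
rewrite -[x * _]/(x *: _) -[y * _]/(y *: _) -!linearZ -linearD /=.
congr ('d f z _); congr pair => /=; rewrite /GRing.scale /=; ring.
Qed.

Lemma rd_inj f z a b a' b' : rd f z a b -> rd f z a' b' -> a = a' /\ b = b'.
Proof.
move=> h h'.
have := rd_derive (1, 0) h'; have := rd_derive (0, 1) h'.
rewrite (rd_derive (1, 0) h) (rd_derive (0, 1) h) /=.
by rewrite !mulr0 !mulr1 !addr0 !add0r.
Qed.

Lemma rd_cst c z : rd (fun _ => c) z 0 0.
Proof.
have -> : (fun _ : R * R => c) = cst c by [].
by rewrite /rd; apply: is_diff_eq; apply/funext => v /=; rewrite !mul0r addr0.
Qed.

Lemma rd_fst z : rd fst z 1 0.
Proof.
have lin : linear (fst : R * R -> R) by move=> a [x y] [x' y'].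
pose M := GRing.isLinear.Build _ _ _ _ _ lin.
pose L : {linear (R * R)%type -> R} := HB.pack (fst : R * R -> R) M.
have c : continuous (L : R * R -> R) by move=> x; exact: cvg_fst.
apply: DiffDef; first exact: (linear_differentiable (f := L)).
by rewrite (diff_lin (f := L)) //; apply/funext => v; rewrite /= mul1r mul0r addr0.
Qed.

Lemma rd_snd z : rd snd z 0 1.
Proof.
have lin : linear (snd : R * R -> R) by move=> a [x y] [x' y'].
pose M := GRing.isLinear.Build _ _ _ _ _ lin.
pose L : {linear (R * R)%type -> R} := HB.pack (snd : R * R -> R) M.
have c : continuous (L : R * R -> R) by move=> x; exact: cvg_snd.
apply: DiffDef; first exact: (linear_differentiable (f := L)).
by rewrite (diff_lin (f := L)) //; apply/funext => v; rewrite /= mul1r mul0r add0r.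
Qed.

Lemma rdD f g z a b c d : rd f z a b -> rd g z c d ->
  rd (fun w => f w + g w) z (a + c) (b + d).
Proof.
rewrite /rd => hf hg; have -> : (fun w => f w + g w) = f + g by [].
apply: is_diff_eq; apply/funext => v.
rewrite -[LHS]/((a * v.1 + b * v.2) + (c * v.1 + d * v.2)); ring.
Qed.

Lemma rdN f z a b : rd f z a b -> rd (fun w => - f w) z (- a) (- b).
Proof.
rewrite /rd => hf; have -> : (fun w => - f w) = - f by [].
apply: is_diff_eq; apply/funext => v; rewrite -[LHS]/(- (a * v.1 + b * v.2)); ring.
Qed.

Lemma rdB f g z a b c d : rd f z a b -> rd g z c d ->
  rd (fun w => f w - g w) z (a - c) (b - d).
Proof. by move=> hf hg; apply: rdD => //; exact: rdN. Qed.

Lemma rdM f g z a b c d : rd f z a b -> rd g z c d ->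
  rd (fun w => f w * g w) z (a * g z + f z * c) (b * g z + f z * d).
Proof.
rewrite /rd => hf hg; have -> : (fun w => f w * g w) = f * g by [].
apply: is_diff_eq; apply/funext => v.
rewrite -[LHS]/(f z * (c * v.1 + d * v.2) + g z * (a * v.1 + b * v.2)); ring.
Qed.

Lemma rd_comp (g : R -> R) f z a b k : rd f z a b -> is_derive (f z) 1 g k ->
  rd (fun w => g (f w)) z (k * a) (k * b).
Proof.
rewrite /rd => hf hg; have -> : (fun w => g (f w)) = g \o f by [].
have : is_diff (f z) g (fun t : R => t * k).
  have dg : differentiable g (f z) by apply/derivable1_diffP; case: hg.
  apply: DiffDef => //.
  apply/funext => v; rewrite diff1E // derive1E.
  by case: hg => _ ->.
by move=> ?; apply: is_diff_eq; apply/funext => v /=; ring.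
Qed.

Lemma rd_affine f z a b (p q r s t u : R) :
  rd f (p * z.1 + q * z.2 + t, r * z.1 + s * z.2 + u) a b ->
  rd (fun w => f (p * w.1 + q * w.2 + t, r * w.1 + s * w.2 + u)) z
     (a * p + b * r) (a * q + b * s).
Proof.
move=> hf.
pose L (w : R * R) := (p * w.1 + q * w.2 + t, r * w.1 + s * w.2 + u).
have L1 : rd (fun w => p * w.1 + q * w.2 + t) z p q.
  apply: (@rd_eq _ _ (0 * z.1 + p * 1 + (0 * z.2 + q * 0) + 0)
                     (0 * z.1 + p * 0 + (0 * z.2 + q * 1) + 0)); try ring.
  apply: rdD (rd_cst _ _); apply: rdD; apply: rdM (rd_cst _ _) _.
    exact: rd_fst.
  exact: rd_snd.
have L2 : rd (fun w => r * w.1 + s * w.2 + u) z r s.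
  apply: (@rd_eq _ _ (0 * z.1 + r * 1 + (0 * z.2 + s * 0) + 0)
                     (0 * z.1 + r * 0 + (0 * z.2 + s * 1) + 0)); try ring.
  apply: rdD (rd_cst _ _); apply: rdD; apply: rdM (rd_cst _ _) _.
    exact: rd_fst.
  exact: rd_snd.
have hL : is_diff z L (fun v => (p * v.1 + q * v.2, r * v.1 + s * v.2)).
  exact: is_diff_pair L1 L2.
rewrite /rd -[X in is_diff _ X _]/(f \o L).
have hf' : is_diff (L z) f (fun v => a * v.1 + b * v.2) by [].
apply: (is_diff_eq (is_diff_comp hL hf')).
by apply/funext => v /=; ring.
Qed.

Lemma rd_line f z v t a b : rd f (z.1 + t * v.1, z.2 + t * v.2) a b ->
  is_derive t 1 (fun s => f (z.1 + s * v.1, z.2 + s * v.2)) (a * v.1 + b * v.2).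
Proof.
move=> hf.
pose L (s : R) := (z.1 + s * v.1, z.2 + s * v.2).
have L1 c d : is_diff t (fun s : R => c + s * d) (fun s => s * d).
  have -> : (fun s : R => c + s * d) = cst c + ( *:%R ^~ d) by [].
  apply: (is_diff_eq (is_diffD (is_diff_cst c t) (is_diff_scalel t d))).
  by apply/funext => x; rewrite -[LHS]/(0 + x * d) add0r.
have hL : is_diff t L (fun s => (s * v.1, s * v.2)).
  exact: is_diff_pair (L1 _ _) (L1 _ _).
have hf' : is_diff (L t) f (fun v => a * v.1 + b * v.2) by [].
have [df e] := is_diff_comp hL hf'.
apply: DeriveDef.
  by apply: diff_derivable.
by rewrite deriveE // e /= !mul1r.
Qed.

Lemma is_diff_near0 f z : (\forall w \near z, f w = 0) ->
  is_diff z f (fun=> 0).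
Proof.
move=> f0.
pose L : {linear (R * R)%type -> R} := \0.
have Lc : continuous (L : R * R -> R) by move=> x; exact: cst_continuous.
have fz : f z = 0 by exact: nbhs_singleton f0.
have dE : 'd f z = L :> (R * R -> R).
  apply: diff_unique => //.
  apply/eqaddoP => _/posnumP[e].
  near=> w.
  have -> : (f \o shift z - (cst (f z) + L)) w = f (w + z).
    by rewrite -[LHS]/(f (w + z) - (f z + 0)) fz addr0 subr0.
  have -> : f (w + z) = 0.
    near: w; move: f0; rewrite [X in X -> _](near_shift 0) /=.
    by apply: filterS => w; rewrite /= subr0.
  by rewrite normr0 mulr_ge0.
apply: DiffDef; last by rewrite dE.
apply/diff_locallyP; rewrite dE; split => //.
apply/eqaddoP => _/posnumP[e].
near=> w.
have -> : (f \o shift z - (cst (f z) + (L : R * R -> R))) w = f (w + z).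
  by rewrite -[LHS]/(f (w + z) - (f z + 0)) fz addr0 subr0.
have -> : f (w + z) = 0.
  near: w; move: f0; rewrite [X in X -> _](near_shift 0) /=.
  by apply: filterS => w; rewrite /= subr0.
by rewrite normr0 mulr_ge0.
Unshelve. all: by end_near. Qed.

(** Differentials depend on germs only: [g = f + (g - f)], and the second summand vanishes near [z].
    This lets formulas valid off the lattice, or on an open set, be substituted under a
    derivative. *)
Lemma rd_near f g z a b : (\forall w \near z, f w = g w) -> rd f z a b -> rd g z a b.
Proof.
rewrite /rd => fg hf.
have h : is_diff z (g - f) (fun=> 0).
  by apply: is_diff_near0; apply: filterS fg => w; rewrite -[(g - f) w]/(g w - f w) => ->; rewrite subrr.
have -> : g = f + (g - f) by rewrite addrC subrK.
apply: (is_diff_eq (is_diffD hf h)).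
by apply/funext => v; rewrite -[LHS]/(a * v.1 + b * v.2 + 0) addr0.
Qed.

Lemma rd_cts f z a b : rd f z a b -> {for z, continuous f}.
Proof. by move=> /rd_diff /differentiable_continuous. Qed.

End rd.

(** * Wirtinger derivatives of complex functions *)

Section wd.
Context {R : realType}.
Local Open Scope complex_scope.
Local Notation C := R[i].
Local Notation Re := (@complex.Re R).
Local Notation Im := (@complex.Im R).
Implicit Types (F G : R * R -> C) (z w v : R * R) (a b c d : C).

Lemma ReM (x y : C) : Re (x * y) = Re x * Re y - Im x * Im y.
Proof. by case: x; case: y. Qed.
Lemma ImM (x y : C) : Im (x * y) = Re x * Im y + Im x * Re y.
Proof. by case: x; case: y. Qed.
Lemma ReD (x y : C) : Re (x + y) = Re x + Re y. Proof. by case: x; case: y. Qed.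
Lemma ImD (x y : C) : Im (x + y) = Im x + Im y. Proof. by case: x; case: y. Qed.
Lemma ReN (x : C) : Re (- x) = - Re x. Proof. by case: x. Qed.
Lemma ImN (x : C) : Im (- x) = - Im x. Proof. by case: x. Qed.
Definition cj (x : C) : C := Re x -i* Im x.
Lemma ReJ (x : C) : Re (cj x) = Re x. Proof. by []. Qed.
Lemma ImJ (x : C) : Im (cj x) = - Im x. Proof. by []. Qed.
Definition ReImE := (ReM, ImM, ReD, ImD, ReN, ImN, ReJ, ImJ).

Lemma eqReIm (x y : C) : Re x = Re y -> Im x = Im y -> x = y.
Proof. by case: x; case: y => ? ? ? ? /= -> ->. Qed.

Definition ci : C := 0 +i* 1.
Lemma ciM : ci * ci = -1. Proof. by apply: eqReIm; rewrite !ReImE /=; ring. Qed.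
Lemma cJi : cj ci = - ci. Proof. by apply: eqReIm; rewrite !ReImE /= ?oppr0. Qed.
Lemma Re_ci (x : C) : Re (ci * x) = - Im x. Proof. by rewrite ReM /=; ring. Qed.
Lemma Im_ci (x : C) : Im (ci * x) = Re x. Proof. by rewrite ImM /=; ring. Qed.
Lemma cJ0 : (cj (0 : C)) = 0. Proof. by apply: eqReIm; rewrite !ReImE /= ?oppr0. Qed.
Lemma cJ1 : (cj (1 : C)) = 1. Proof. by apply: eqReIm; rewrite !ReImE /= ?oppr0. Qed.
Lemma cJD (x y : C) : (cj (x + y)) = (cj x) + (cj y). Proof. by apply: eqReIm; rewrite !ReImE //; ring. Qed.
Lemma cJN (x : C) : (cj (- x)) = - (cj x). Proof. by apply: eqReIm; rewrite !ReImE. Qed.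
Lemma cJM (x y : C) : (cj (x * y)) = (cj x) * (cj y). Proof. by apply: eqReIm; rewrite !ReImE //; ring. Qed.
Lemma cJK (x : C) : (cj ((cj x))) = x. Proof. by apply: eqReIm; rewrite !ReImE ?opprK. Qed.
Lemma cJR (x : R) : (cj (x%:C)) = x%:C. Proof. by apply: eqReIm; rewrite !ReImE /= ?oppr0. Qed.
Lemma cJX (x : C) n : cj (x ^+ n) = cj x ^+ n.
Proof. by elim: n => [|n IH]; rewrite ?expr0 ?cJ1 // !exprS cJM IH. Qed.
Lemma cJV (x : C) : (cj (x^-1)) = ((cj x))^-1. Proof. by case: x => a b; apply: eqReIm; rewrite /= ?sqrrN ?mulNr. Qed.
Lemma cJn n : (cj (n%:R : C)) = n%:R. Proof. by elim: n => [|n IH]; rewrite ?cJ0 // -natr1 cJD IH cJ1. Qed.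
Lemma cJ_eq0 (x : C) : (cj x == 0) = (x == 0).
Proof. by apply/eqP/eqP => [h|->]; rewrite ?cJ0 // -[x]cJK h cJ0. Qed.
Definition cJE := (cJ0, cJ1, cJi, cJD, cJN, cJM, cJK, cJR, cJX, cJV, cJn).
Lemma cRD (x y : R) : (x + y)%:C = x%:C + y%:C. Proof. exact: rmorphD. Qed.
Lemma cRN (x : R) : (- x)%:C = - x%:C. Proof. exact: rmorphN. Qed.
Lemma cRM (x y : R) : (x * y)%:C = x%:C * y%:C. Proof. exact: rmorphM. Qed.
Lemma cRX (x : R) n : (x ^+ n)%:C = x%:C ^+ n. Proof. exact: rmorphXn. Qed.
Lemma cRV (x : R) : (x^-1)%:C = (x%:C)^-1. Proof. exact: fmorphV. Qed.
Lemma cRn n : (n%:R : R)%:C = n%:R. Proof. exact: rmorph_nat. Qed.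
Definition cRE := (cRD, cRN, cRM, cRX, cRV, cRn).

(* [wd F z a b]: F is real-differentiable at z, with dF/dz = a and dF/dzbar = b *)
Definition wd F z a b :=
  rd (fun w => Re (F w)) z (Re (a + b)) (- Im (a - b)) /\
  rd (fun w => Im (F w)) z (Im (a + b)) (Re (a - b)).

Lemma wd_eq F z a b a' b' : wd F z a b -> a = a' -> b = b' -> wd F z a' b'.
Proof. by move=> ? <- <-. Qed.

Lemma wd_inj F z a b a' b' : wd F z a b -> wd F z a' b' -> a = a' /\ b = b'.
Proof.
move=> [h1 h2] [/(rd_inj h1)[+ +] /(rd_inj h2)[]].
rewrite !ReImE => e1 e2 e3 e4.
by split; apply: eqReIm; lra.
Qed.

Lemma wd_near F G z a b : (\forall w \near z, F w = G w) -> wd F z a b -> wd G z a b.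
Proof.
by move=> e [h1 h2]; split; [apply: rd_near h1|apply: rd_near h2];
  apply: filterS e => w ->.
Qed.

Lemma wd_cst c z : wd (fun _ => c) z 0 0.
Proof. by split; (apply: rd_eq; [exact: rd_cst|..]); rewrite !ReImE /= ?subr0 ?oppr0 ?addr0. Qed.

Lemma wdD F G z a b c d : wd F z a b -> wd G z c d ->
  wd (fun w => F w + G w) z (a + c) (b + d).
Proof.
move=> [h1 h2] [h3 h4]; split.
  have -> : (fun w => Re (F w + G w)) = (fun w => Re (F w) + Re (G w)).
    by apply/funext => w; rewrite ReD.
  by apply: rd_eq; [exact: (rdD h1 h3)|..]; rewrite !ReImE; cbv beta; ring.
have -> : (fun w => Im (F w + G w)) = (fun w => Im (F w) + Im (G w)).
  by apply/funext => w; rewrite ImD.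
by apply: rd_eq; [exact: (rdD h2 h4)|..]; rewrite !ReImE; cbv beta; ring.
Qed.

Lemma wdM F G z a b c d : wd F z a b -> wd G z c d ->
  wd (fun w => F w * G w) z (a * G z + F z * c) (b * G z + F z * d).
Proof.
move=> [h1 h2] [h3 h4]; split.
  have -> : (fun w => Re (F w * G w)) = (fun w => Re (F w) * Re (G w) - Im (F w) * Im (G w)).
    by apply/funext => w; rewrite ReM.
  by apply: rd_eq; [exact: (rdB (rdM h1 h3) (rdM h2 h4))|..]; rewrite !ReImE; cbv beta; ring.
have -> : (fun w => Im (F w * G w)) = (fun w => Re (F w) * Im (G w) + Im (F w) * Re (G w)).
  by apply/funext => w; rewrite ImM.
by apply: rd_eq; [exact: (rdD (rdM h1 h4) (rdM h2 h3))|..]; rewrite !ReImE; cbv beta; ring.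
Qed.

Lemma wdZ c F z a b : wd F z a b -> wd (fun w => c * F w) z (c * a) (c * b).
Proof. by move=> h; apply: wd_eq; [exact: (wdM (wd_cst c z) h)|..]; cbv beta; ring. Qed.

Lemma wdN F z a b : wd F z a b -> wd (fun w => - F w) z (- a) (- b).
Proof.
move=> /(wdZ (-1)) h; have -> : (fun w => - F w) = (fun w => -1 * F w).
  by apply/funext => w; rewrite mulN1r.
by apply: wd_eq h _ _; cbv beta; ring.
Qed.

Lemma wdB F G z a b c d : wd F z a b -> wd G z c d ->
  wd (fun w => F w - G w) z (a - c) (b - d).
Proof. by move=> h1 h2; apply: wdD h1 _; exact: wdN. Qed.

Lemma wdJ F z a b : wd F z a b -> wd (fun w => (cj (F w))) z (cj b) (cj a).
Proof.
move=> [h1 h2]; split.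
  have -> : (fun w => Re (cj (F w))) = (fun w => Re (F w)).
    by apply/funext => w; rewrite ReJ.
  by apply: rd_eq; [exact: h1|..]; rewrite !ReImE; cbv beta; ring.
have -> : (fun w => Im (cj (F w))) = (fun w => - Im (F w)).
  by apply/funext => w; rewrite ImJ.
by apply: rd_eq; [exact: (rdN h2)|..]; rewrite !ReImE; cbv beta; ring.
Qed.

Lemma wdX F n z a b : wd F z a b ->
  wd (fun w => F w ^+ n.+1) z (n.+1%:R * F z ^+ n * a) (n.+1%:R * F z ^+ n * b).
Proof.
move=> h; elim: n => [|n IH].
  by apply: wd_eq h _ _; rewrite expr0 mulr1 mul1r.
have -> : (fun w => F w ^+ n.+2) = (fun w => F w * F w ^+ n.+1).
  by apply/funext => w; rewrite exprS.
by apply: wd_eq; [exact: (wdM h IH)|..]; rewrite !exprS -[n.+2%:R]natr1; cbv beta; ring.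
Qed.

Definition cx z : C := z.1 +i* z.2.
Definition xc (c : C) : R * R := (Re c, Im c).
Lemma cxK : cancel cx xc. Proof. by case. Qed.
Lemma xcK : cancel xc cx. Proof. by case. Qed.

Lemma wd_cx z : wd cx z 1 0.
Proof.
split.
  by apply: rd_eq; [exact: rd_fst|..]; rewrite !ReImE /= ?subr0 ?addr0 ?oppr0.
by apply: rd_eq; [exact: rd_snd|..]; rewrite !ReImE /= ?subr0 ?addr0 ?oppr0.
Qed.

Lemma wd_real (f : R * R -> R) z x y : rd f z x y ->
  wd (fun w => (f w)%:C) z ((x / 2) -i* (y / 2)) ((x / 2) +i* (y / 2)).
Proof.
move=> h; split; first by apply: rd_eq; [exact: h|..]; rewrite !ReImE /=; lra.
by apply: rd_eq; [exact: rd_cst|..]; rewrite !ReImE /=; lra.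
Qed.

Lemma wd_Re F z a b : wd F z a b -> rd (fun w => Re (F w)) z (Re (a + b)) (- Im (a - b)).
Proof. by case. Qed.
Lemma wd_Im F z a b : wd F z a b -> rd (fun w => Im (F w)) z (Im (a + b)) (Re (a - b)).
Proof. by case. Qed.

(** The vanishing imaginary part of a real function forces [b] to be the conjugate of [a];
    multiplying both by the real [k] preserves this relation. *)
Lemma wd_rcomp (g : R -> R) (f : R * R -> R) z a b k :
  wd (fun w => (f w)%:C) z a b -> is_derive (f z) 1 g k ->
  wd (fun w => (g (f w))%:C) z (k%:C * a) (k%:C * b).
Proof.
move=> [h1 h2] hg.
have [e1 e2] := rd_inj h2 (rd_cst 0 z).
move: e1 e2; rewrite !ReImE => e1 e2.
split.
  by apply: rd_eq; [exact: (rd_comp h1 hg)|..]; rewrite !ReImE /=; cbv beta; ring.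
apply: rd_eq; [exact: rd_cst|..]; rewrite !ReImE /=.
  by rewrite !mul0r !addr0 -mulrDr e1 mulr0.
by rewrite !mul0r !subr0 -mulrBr e2 mulr0.
Qed.

Lemma wd_mulc F z (k l a b : C) : wd F (xc (k * cx z + l)) a b ->
  wd (fun w => F (xc (k * cx w + l))) z (k * a) ((cj k) * b).
Proof.
have e w : xc (k * cx w + l) =
    (Re k * w.1 + (- Im k) * w.2 + Re l, Im k * w.1 + Re k * w.2 + Im l).
  by rewrite /xc !ReImE /=; congr pair; cbv beta; ring.
rewrite /wd.
have e1 (f : R * R -> R) : (fun w => f (xc (k * cx w + l))) =
  (fun w => f (Re k * w.1 + (- Im k) * w.2 + Re l, Im k * w.1 + Re k * w.2 + Im l)).
  by apply/funext => w; rewrite e.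
rewrite (e1 (fun w => Re (F w))) (e1 (fun w => Im (F w))) e => -[h1 h2].
split.
  by apply: rd_eq; [exact: (rd_affine h1)|..]; rewrite !ReImE; cbv beta; ring.
by apply: rd_eq; [exact: (rd_affine h2)|..]; rewrite !ReImE; cbv beta; ring.
Qed.

Lemma wd_conjc F z a b : wd F (z.1, - z.2) a b ->
  wd (fun w => F (w.1, - w.2)) z b a.
Proof.
have e w : (w.1, - w.2) = (1 * w.1 + 0 * w.2 + 0, 0 * w.1 + (-1) * w.2 + 0).
  by congr pair; cbv beta; ring.
rewrite /wd.
have e1 (f : R * R -> R) : (fun w => f (w.1, - w.2)) =
  (fun w => f (1 * w.1 + 0 * w.2 + 0, 0 * w.1 + (-1) * w.2 + 0)).
  by apply/funext => w; rewrite e.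
rewrite (e1 (fun w => Re (F w))) (e1 (fun w => Im (F w))) e => -[h1 h2].
split.
  by apply: rd_eq; [exact: (rd_affine h1)|..]; rewrite !ReImE; cbv beta; ring.
by apply: rd_eq; [exact: (rd_affine h2)|..]; rewrite !ReImE; cbv beta; ring.
Qed.

Lemma rdV (f : R * R -> R) z (a b : R) : f z != 0 -> rd f z a b ->
  rd (fun w => (f w)^-1) z (- a / f z ^+ 2) (- b / f z ^+ 2).
Proof.
move=> f0 h.
have d : is_derive (f z) 1 (fun x : R => x^-1) (- (f z) ^- 2 *: 1).
  exact: (is_deriveV (f := id) f0).
apply: rd_eq; [exact: (rd_comp h d)|..]; rewrite /GRing.scale /= mulr1; ring.
Qed.

(** The squared modulus. Estimates are kept in this squared form: it is a polynomial in the real and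
    imaginary parts, accessible to [ring], [lra] and [nra], and it is smooth. *)
Definition nrm2 (x : C) : R := Re x ^+ 2 + Im x ^+ 2.

Lemma nrm2E (x : C) : (nrm2 x)%:C = x * (cj x).
Proof. by apply: eqReIm; rewrite !ReImE /nrm2 /=; ring. Qed.
Lemma nrm2_ge0 (x : C) : 0 <= nrm2 x.
Proof. by rewrite /nrm2; nra. Qed.

Lemma nrm2_eq0 (x : C) : (nrm2 x == 0) = (x == 0).
Proof.
apply/eqP/eqP => [|->]; last by rewrite /nrm2 /=; ring.
by rewrite /nrm2 => h; apply: eqReIm => /=; nra.
Qed.

Lemma nrm2M (x y : C) : nrm2 (x * y) = nrm2 x * nrm2 y.
Proof. by rewrite /nrm2 !ReImE; ring. Qed.

Lemma wd_nrm2 F z a b : wd F z a b ->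
  wd (fun w => (nrm2 (F w))%:C) z (a * (cj (F z)) + F z * (cj b)) (b * (cj (F z)) + F z * (cj a)).
Proof.
move=> h; have -> : (fun w => (nrm2 (F w))%:C) = (fun w => F w * (cj (F w))).
  by apply/funext => w; rewrite nrm2E.
exact: wdM h (wdJ h).
Qed.

(** [F^-1] is the conjugate of [F] times the inverse of the real function [|F|^2], which reduces the
    claim to the real chain rule. *)
Lemma wdV F z a b : F z != 0 -> wd F z a b ->
  wd (fun w => (F w)^-1) z (- a / F z ^+ 2) (- b / F z ^+ 2).
Proof.
move=> F0 h.
have F0' : (cj (F z)) != 0 by rewrite cJ_eq0.
have N0 : nrm2 (F z) != 0 by rewrite nrm2_eq0.
have -> : (fun w => (F w)^-1) = (fun w => (cj (F w)) * ((nrm2 (F w))^-1)%:C).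
  apply/funext => w; rewrite cRV nrm2E.
  have [->|Fw] := eqVneq (F w) 0; first by rewrite mul0r !invr0 mulr0.
  by rewrite invfM mulrCA divff ?cJ_eq0 // mulr1.
have d : is_derive (nrm2 (F z)) 1 (fun x : R => x^-1) (- (nrm2 (F z)) ^- 2 *: 1).
  exact: (is_deriveV (f := id) N0).
have h2 := wd_rcomp (wd_nrm2 h) d.
have e : (- nrm2 (F z) ^- 2 *: (1 : R))%:C = - (F z * (cj (F z))) ^- 2.
  by rewrite /GRing.scale /= mulr1 rmorphN /= fmorphV /= rmorphXn /= nrm2E.
apply: wd_eq; [exact: (wdM (wdJ h) h2)|..]; rewrite e fmorphV /= nrm2E; cbv beta; field; by rewrite F0 F0'.
Qed.

Lemma wd_div F G z a b c d : G z != 0 -> wd F z a b -> wd G z c d ->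
  wd (fun w => F w / G w) z ((a * G z - F z * c) / G z ^+ 2) ((b * G z - F z * d) / G z ^+ 2).
Proof.
move=> G0 h1 h2; apply: wd_eq; [exact: (wdM h1 (wdV G0 h2))|..]; cbv beta; field; exact: G0.
Qed.

End wd.

(** * The weak maximum principle *)

Section mp.
Context {R : realType}.
Local Open Scope complex_scope.
Local Notation C := R[i].
Local Notation Re := (@complex.Re R).
Local Notation Im := (@complex.Im R).

(** If [k > 0], then [g'] vanishes at [x] and is positive just to the right of it, so the mean value
    theorem makes [g] exceed [g x] there. *)
Lemma second_derivative_at_max (g g' : R -> R) (x k : R) :
  (\forall t \near x, is_derive (t : R) (1 : R) g (g' t)) -> is_derive x 1 g' k ->
  (\forall t \near x, g t <= g x) -> k <= 0.
Proof.
move=> dg [dg' kE] gmax; rewrite leNgt; apply/negP => k0.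
have [r r0 hr] : exists2 r : R, 0 < r & forall t, `|x - t| < r ->
    is_derive (t : R) (1 : R) g (g' t) /\ g t <= g x.
  have h : \forall t \near x, is_derive (t : R) (1 : R) g (g' t) /\ g t <= g x.
    by near=> t; split; near: t.
  by move: h => /nbhs_ballP[e /= e0 he]; exists e.
have g'x : g' x = 0.
  have [dgx ex] : is_derive x 1 g (g' x) by apply: (hr x _).1; rewrite subrr normr0.
  rewrite -ex.
  suff : is_derive x 1 g 0 by case.
  apply: (@derive1_at_max R g (x - r) (x + r) x).
  - by rewrite lerBlDr -addrA lerDl addr_ge0 // ltW.
  - move=> t; rewrite in_itv /= => /andP[t1 t2].
    by have [|[]//] := hr t _; rewrite ltr_distlC; lra.
  - by rewrite in_itv /=; lra.
  - move=> t; rewrite in_itv /= => /andP[t1 t2].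
    by have [|] // := hr t _; rewrite ltr_distlC; lra.
have : (fun h : R => h^-1 *: (g' (h *: (1 : R) + x) - g' x)) @ 0^' --> k.
  by rewrite -kE; exact: dg'.
move=> /cvgr_gt /(_ 0 k0) /nbhs_ballP[e /= e0 he].
pose d := Num.min (e / 2) (r / 2).
have d0 : 0 < d by rewrite lt_min !divr_gt0.
have de : d < e by rewrite /d gt_min ltr_pdivrMr // ltr_pMr // ltr1n.
have dr : d < r by rewrite /d gt_min orbC ltr_pdivrMr // ltr_pMr // ltr1n.
have dgt t : 0 <= t <= d -> is_derive (x + t : R) (1 : R) g (g' (x + t)).
  by move=> td; apply: (hr _ _).1; rewrite ltr_distlC; lra.
have xd : x < x + d by rewrite ltrDl.
have dgoo t : t \in `]x, x + d[%R -> is_derive (t : R) (1 : R) g (g' t).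
  rewrite in_itv /= => /andP[t1 t2].
  by rewrite -(subrKC x t); apply: dgt; lra.
have gc : {within `[x, x + d], continuous g}.
  apply: derivable_within_continuous => t; rewrite in_itv /= => /andP[t1 t2].
  by rewrite -(subrKC x t); have [] : is_derive (x + (t - x)) 1 g (g' (x + (t - x))) by apply: dgt; lra.
have [c] := MVT xd dgoo gc.
rewrite in_itv /= => /andP[c1 c2].
have [_] : is_derive (x + d) 1 g (g' (x + d)) /\ g (x + d) <= g x.
  by apply: hr; rewrite ltr_distlC; lra.
rewrite -subr_le0 => + E; rewrite E [x + d - x]addrAC subrr add0r.
rewrite pmulr_lle0 //.
have := he (c - x).
rewrite -ball_normE /ball_ /= sub0r normrN gtr0_norm ?subr_gt0 // => h.
have ce : c - x < e by lra.
have {h} := h ce; rewrite subr_eq0 gt_eqF // => /(_ isT).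
rewrite g'x subr0 /GRing.scale /= mulr1 subrK pmulr_rgt0 ?invr_gt0 ?subr_gt0 //.
by move=> h1 h2; have := lt_le_trans h1 h2; rewrite ltxx.
Unshelve. all: by end_near. Qed.

(** [d] is a quarter of the Laplacian of [S]: the second derivatives along the two axes are both
    nonpositive at a maximum, and they add up to [4 Re d]. *)
Lemma local_max_le0 (S : R * R -> R) (c : R * R -> C) (z : R * R) (a d : C) :
  (\forall w \near z, wd (fun w => (S w)%:C) w (c w) (cj (c w))) -> wd c z a d ->
  (\forall w \near z, S w <= S z) -> Re d <= 0.
Proof.
move=> dS dc Smax.
have line v : (fun t : R => (z.1 + t * v.1, z.2 + t * v.2)) t @[t --> 0] --> z.
  rewrite [X in _ --> X](_ : z = (z.1 + 0 * v.1, z.2 + 0 * v.2)); last first.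
    by case: z {dS dc Smax} => ? ?; rewrite !mul0r !addr0.
  have l (p q : R) : (p + t * q) @[t --> (0 : R)] --> p + 0 * q.
    by apply: cvgD; [exact: cvg_cst|apply: cvgMl; exact: cvg_id].
  exact: (cvg_pair (l z.1 v.1) (l z.2 v.2)).
have key v (k : R) : is_derive (0 : R) (1 : R) (fun t => Re (c (z.1 + t * v.1, z.2 + t * v.2) + (cj (c (z.1 + t * v.1, z.2 + t * v.2)))) * v.1 - Im (c (z.1 + t * v.1, z.2 + t * v.2) - (cj (c (z.1 + t * v.1, z.2 + t * v.2)))) * v.2) k -> k <= 0.
  move=> dk.
  apply: (@second_derivative_at_max (fun t => S (z.1 + t * v.1, z.2 + t * v.2))) dk _.
    have h0 : \forall t \near (0 : R), wd (fun w => (S w)%:C) (z.1 + t * v.1, z.2 + t * v.2) (c (z.1 + t * v.1, z.2 + t * v.2)) (cj (c (z.1 + t * v.1, z.2 + t * v.2))) := line v _ dS.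
    apply: filterS h0 => t [h _].
    by apply: (is_derive_eq (rd_line h)); rewrite mulNr.
  have h0 : \forall t \near (0 : R), S (z.1 + t * v.1, z.2 + t * v.2) <= S z := line v _ Smax.
  apply: filterS h0 => t.
  by rewrite !mul0r !addr0; case: (z).
have dcc : wd (fun w => c w + (cj (c w))) z (a + (cj d)) (d + (cj a)) by exact: wdD dc (wdJ dc).
have dcb : wd (fun w => c w - (cj (c w))) z (a - (cj d)) (d - (cj a)) by exact: wdB dc (wdJ dc).
have z0 v : z = (z.1 + 0 * v.1, z.2 + 0 * v.2) by case: (z) => ? ?; rewrite !mul0r !addr0.
have k1 := key (1, 0) (Re (a + (cj d) + (d + (cj a)))).
have k2 := key (0, 1) (Re (- (a - (cj d) - (d - (cj a))))).
have : Re (a + (cj d) + (d + (cj a))) <= 0.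
  apply: k1; rewrite /=.
  rewrite [X in is_derive _ _ X _](_ : _ = fun t : R => Re (c (z.1 + t * 1, z.2 + t * 0) + (cj (c (z.1 + t * 1, z.2 + t * 0))))); last first.
    by apply/funext => t; rewrite (mulr1 (Re _)) (mulr0 (Im _)) subr0.
  have := wd_Re dcc; rewrite [X in rd _ X](z0 (1, 0)) => h.
  by have := rd_line h; rewrite /= mulr1 mulr0 addr0.
have : Re (- (a - (cj d) - (d - (cj a)))) <= 0.
  apply: k2; rewrite /=.
  rewrite [X in is_derive _ _ X _](_ : _ = fun t : R => - Im (c (z.1 + t * 0, z.2 + t * 1) - (cj (c (z.1 + t * 0, z.2 + t * 1))))); last first.
    by apply/funext => t; rewrite (mulr0 (Re _)) (mulr1 (Im _)) sub0r.
  have := rdN (wd_Im dcb); rewrite [X in rd _ X](z0 (0, 1)) => h.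
  by have := rd_line h; rewrite /= mulr1 mulr0 add0r ReN.
by rewrite !ReImE; lra.
Qed.

(* A maximum of S + eps |z|^2 exceeding m would be an interior one. *)
Lemma weak_max_principle (K : set (R * R)) (S : R * R -> R) (m : R) :
  compact K -> {within K, continuous S} ->
  (forall z, K z -> S z <= m \/ exists (c : R * R -> C) (a d : C),
    [/\ nbhs z K, \forall w \near z, wd (fun w => (S w)%:C) w (c w) (cj (c w)),
        wd c z a d & 0 <= Re d]) ->
  forall z, K z -> S z <= m.
Proof.
move=> Kc Sc hK z0 Kz0; rewrite leNgt; apply/negP => mS.
pose N w := nrm2 (cx w : C).
have Nc : {within K, continuous N}.
  apply: continuous_subspaceT => w.
  apply: (@rd_cts _ _ _ (2 * w.1) (2 * w.2)).
  apply: rd_eq; [exact: (rdD (rdM (rd_fst w) (rd_fst w)) (rdM (rd_snd w) (rd_snd w)))|..]; ring.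
have K0 : K !=set0 by exists z0.
have [zM _ hM] := compact_EVT_max K0 Kc Nc.
pose M := N zM + 1.
have M0 : 0 < M by rewrite ltr_wpDl // nrm2_ge0.
pose e := (S z0 - m) / M / 2.
have e0 : 0 < e by rewrite !divr_gt0 ?subr_gt0.
have Sec : {within K, continuous (fun w => S w + e * N w)}.
  by move=> w; apply: cvgD; [exact: Sc|apply: cvgMr; exact: Nc].
have [z1 Kz1 hz1] := compact_EVT_max K0 Kc Sec.
have {}Kz1 : K z1 by rewrite inE in Kz1.
have Smz1 : m < S z1.
  have h1 : S z0 + e * N z0 <= S z1 + e * N z1 by apply: hz1; rewrite inE.
  have h2 : N z1 <= N zM by apply: hM; rewrite inE.
  have h3 : 0 <= N z0 by exact: nrm2_ge0.
  have : e * M = (S z0 - m) / 2 by rewrite /e; field; rewrite gt_eqF.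
  have : e * N z1 < e * M by rewrite ltr_pM2l // /M; lra.
  have : 0 <= e * N z0 by rewrite mulr_ge0 // ltW.
  lra.
have [|[c [a [d [nK dS dc d0]]]]] := hK z1 Kz1; first by rewrite leNgt Smz1.
pose ce w := c w + e%:C * (cj (cx w)).
have dce : wd ce z1 a (d + e%:C).
  apply: wd_eq; [exact: (wdD dc (wdZ e%:C (wdJ (wd_cx z1))))|..]; rewrite !cJE; ring.
have := @local_max_le0 (fun w => S w + e * N w) ce z1 a (d + e%:C) _ dce _.
rewrite ReD /= => h; have : Re d + e <= 0; last by lra.
apply: h.
  apply: filterS dS => w dSw.
  have -> : (fun w => (S w + e * N w)%:C) = (fun w => (S w)%:C + e%:C * (N w)%:C).
    by apply/funext => t; rewrite rmorphD rmorphM.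
  apply: wd_eq; [exact: (wdD dSw (wdZ e%:C (wd_nrm2 (wd_cx w))))|..];
    clearbody e; rewrite /ce !cJE; cbv beta; ring.
by apply: (filterS _ nK) => w Kw; apply: hz1; rewrite inE.
Qed.

End mp.

(** * Bernstein and Cauchy estimates on discs *)

Section disc.
Context {R : realType}.
Local Open Scope complex_scope.
Local Notation C := R[i].
Local Notation Re := (@complex.Re R).
Local Notation Im := (@complex.Im R).
Implicit Types (z w : R * R).

Definition disc z (r : R) : set (R * R) := [set w | nrm2 (cx w - cx z) <= r ^+ 2].

Lemma continuous_nrm2 z : continuous (fun w => nrm2 (cx w - cx z)).
Proof.
move=> w; have h := wd_nrm2 (wdB (wd_cx w) (wd_cst (cx z) w)).
exact: (rd_cts (wd_Re h)).
Qed.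

Lemma compact_box (K : set (R * R)) (a b c d : R) : closed K ->
  (forall w, K w -> a <= w.1 <= b /\ c <= w.2 <= d) -> compact K.
Proof.
move=> Kc Kb.
apply: (subclosed_compact Kc (compact_setX (@segment_compact _ a b) (@segment_compact _ c d))).
by move=> w /Kb[]; rewrite /setX /= !in_itv.
Qed.

Lemma closed_disc z r : closed (disc z r).
Proof.
rewrite (_ : disc z r = (fun w => nrm2 (cx w - cx z)) @^-1` [set x | x <= r ^+ 2]) //.
apply: closed_comp; last exact: closed_le.
by move=> w _; exact: continuous_nrm2.
Qed.

Lemma compact_disc z r : 0 <= r -> compact (disc z r).
Proof.
move=> r0; apply: (@compact_box _ (z.1 - r) (z.1 + r) (z.2 - r) (z.2 + r)).
  exact: closed_disc.
move=> w; rewrite /disc /mkset /nrm2 !ReImE /= => h.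
have h1 : `|w.1 - z.1| <= r.
  rewrite -(@ler_pXn2r _ 2) ?nnegrE // real_normK ?num_real //.
  by have := sqr_ge0 (w.2 - z.2); lra.
have h2 : `|w.2 - z.2| <= r.
  rewrite -(@ler_pXn2r _ 2) ?nnegrE // real_normK ?num_real //.
  by have := sqr_ge0 (w.1 - z.1); lra.
by move: h1 h2; rewrite !ler_distl => /andP[-> ->] /andP[-> ->].
Qed.

Lemma nbhs_disc z r w : nrm2 (cx w - cx z) < r ^+ 2 -> nbhs w (disc z r).
Proof.
move=> h.
have h1 : \forall t \near w, nrm2 (cx t - cx z) < r ^+ 2.
  exact: (cvgr_lt (nrm2 (cx w - cx z)) (@continuous_nrm2 z w) _ h).
by apply: filterS h1 => t /ltW.
Qed.

Lemma disc_max_principle z r (S : R * R -> R) (c a d : R * R -> C) (m : R) :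
  0 < r ->
  (forall w, disc z r w -> wd (fun w => (S w)%:C) w (c w) (cj (c w))) ->
  (forall w, disc z r w -> wd c w (a w) (d w) /\ 0 <= Re (d w)) ->
  (forall w, nrm2 (cx w - cx z) = r ^+ 2 -> S w <= m) -> S z <= m.
Proof.
move=> r0 dS dc bd.
apply: (@weak_max_principle _ (disc z r) S m).
- by apply: compact_disc; exact: ltW.
- apply: continuous_in_subspaceT => w; rewrite inE => /dS /wd_Re h.
  exact: rd_cts h.
- move=> w Dw; have := Dw; rewrite /disc /= le_eqVlt => /orP[/eqP/bd|lt]; first by left.
  right; exists c, (a w), (d w); have [h1 h2] := dc w Dw; split => //.
    exact: nbhs_disc.
  by apply: filterS (nbhs_disc lt) => t Dt; exact: dS.
- by rewrite /disc /= subrr /nrm2 /= expr0n /= addr0 sqr_ge0.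
Qed.

(** The function [(r^2 - |w - z|^2)^2 |f|^2 + H] has nonnegative Laplacian and agrees with [H] on
    the circle, so its value at the centre is at most [m]. The lower bound on [hd], the mixed
    derivative of [H], pays for the negative terms created by the cutoff. *)
Lemma bernstein z r (f fz fb fzb a b : R * R -> C) (H : R * R -> R)
    (hz e hd : R * R -> C) (m : R) : 0 < r ->
  (forall w, disc z r w -> [/\ wd f w (fz w) (fb w), wd fz w (a w) (fzb w) & wd fb w (fzb w) (b w)]) ->
  (forall w, disc z r w -> wd (fun w => (H w)%:C) w (hz w) (cj (hz w)) /\ wd hz w (e w) (hd w)) ->
  (forall w, disc z r w -> 8 * r ^+ 2 * nrm2 (f w) -
      2 * (r ^+ 2 - nrm2 (cx w - cx z)) ^+ 2 * Re (cj (f w) * fzb w) <= Re (hd w)) ->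
  (forall w, nrm2 (cx w - cx z) = r ^+ 2 -> H w <= m) ->
  r ^+ 4 * nrm2 (f z) + H z <= m.
Proof.
move=> r0 df dH ineq bd.
pose zeta w := cx w - cx z.
pose eta w : C := (r ^+ 2)%:C - zeta w * cj (zeta w).
have dze w : wd zeta w 1 0.
  by apply: wd_eq; [exact: (wdB (wd_cx w) (wd_cst (cx z) w))|..]; rewrite subr0.
have deta w : wd eta w (- cj (zeta w)) (- zeta w).
  by apply: wd_eq; [exact: (wdB (wd_cst _ w) (wdM (dze w) (wdJ (dze w))))|..]; rewrite ?cJE; cbv beta; ring.
have ceta w : cj (eta w) = eta w by rewrite /eta !cJE; ring.
have etaE w : eta w = (r ^+ 2 - nrm2 (zeta w))%:C by rewrite /eta cRD cRN nrm2E.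
clearbody eta.
have zE w : cx w - cx z = zeta w by [].
clearbody zeta.
pose E w := eta w * eta w.
pose N w := f w * cj (f w).
pose Nz w := fz w * cj (f w) + f w * cj (fb w).
pose S w := (r ^+ 2 - nrm2 (zeta w)) ^+ 2 * nrm2 (f w) + H w.
have SE : (fun w => (S w)%:C) = (fun w => E w * N w + (H w)%:C).
  by apply/funext => w; rewrite /S /E /N etaE cRD cRM cRX !nrm2E expr2.
pose c w := (-2) * eta w * cj (zeta w) * N w + E w * Nz w + hz w.
have dE w : wd E w (- 2 * eta w * cj (zeta w)) (- 2 * eta w * zeta w).
  by apply: wd_eq; [exact: (wdM (deta w) (deta w))|..]; cbv beta; ring.
have dN w : disc z r w -> wd N w (Nz w) (cj (Nz w)).
  move=> /df[h _ _].
  by apply: wd_eq; [exact: (wdM h (wdJ h))|..]; rewrite /Nz ?cJE; cbv beta; ring.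
have dS w : disc z r w -> wd (fun w => (S w)%:C) w (c w) (cj (c w)).
  move=> Dw; rewrite SE; have [h _] := dH w Dw.
  apply: wd_eq; [exact: (wdD (wdM (dE w) (dN w Dw)) h)|..]; rewrite /c.
    by cbv beta; ring.
  by rewrite /E /N !(ceta, cJE); cbv beta; ring.
have dc w : disc z r w -> exists a d, wd c w a d /\ 0 <= Re d.
  move=> Dw; have [h1 h2 h3] := df w Dw; have [_ h4] := dH w Dw.
  have dNz := wdD (wdM h2 (wdJ h1)) (wdM h1 (wdJ h3)).
  have dee := wdM (wdZ (-2) (deta w)) (wdJ (dze w)).
  do 2 eexists; split.
    exact: (wdD (wdD (wdM dee (dN w Dw)) (wdM (dE w) dNz)) h4).
  cbv beta.
  set t := (X in 0 <= Re X).
  (* Cross terms between derivatives of the cutoff and of [f] are absorbed in two squares at the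
     price [8 |zeta|^2 |f|^2]. Together with the contribution [2 |zeta|^2 - 2 eta] of the cutoff
     itself, the remaining coefficient of [|f|^2] is [4 eta + 2 r^2 - 8 r^2]. *)
  have -> : Re t = nrm2 (eta w * fz w - 2 * cj (zeta w) * f w) +
     nrm2 (eta w * fb w - 2 * zeta w * f w) +
     4 * (r ^+ 2 - nrm2 (zeta w)) * nrm2 (f w) + 2 * r ^+ 2 * nrm2 (f w) +
     (Re (hd w) - (8 * r ^+ 2 * nrm2 (f w) -
      2 * (r ^+ 2 - nrm2 (cx w - cx z)) ^+ 2 * Re (cj (f w) * fzb w))).
    rewrite /t !zE /E /Nz /N !cJE.
    rewrite ?ceta etaE.
    have -> : (2 : C) = (2 : R)%:C by rewrite cRn.
    move: (zeta w) (f w) (fz w) (fb w) (fzb w) (hd w) => [? ?] [? ?] [? ?] [? ?] [? ?] [? ?].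
    rewrite /nrm2 !ReImE /=; cbv beta; ring.
  have h6 := ineq w Dw; have h5 := nrm2_ge0 (f w).
  have h7 : 0 <= r ^+ 2 - nrm2 (zeta w) by rewrite subr_ge0 -zE.
  have h8 : 0 <= 4 * (r ^+ 2 - nrm2 (zeta w)) * nrm2 (f w) by rewrite !mulr_ge0.
  have h9 : 0 <= 2 * r ^+ 2 * nrm2 (f w) by rewrite !mulr_ge0 // ltW.
  have h10 := nrm2_ge0 (eta w * fz w - 2 * cj (zeta w) * f w).
  have h11 := nrm2_ge0 (eta w * fb w - 2 * zeta w * f w).
  by rewrite addr_ge0 ?subr_ge0 // addr_ge0 // addr_ge0 // addr_ge0.
have Sz : S z = r ^+ 4 * nrm2 (f z) + H z.
  by rewrite /S -zE subrr {1}/nrm2 /= expr0n /= addr0 subr0 -exprM.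
rewrite -Sz.
(* The derivatives are chosen pointwise; the value 0 outside the disc is a mere default. *)
pose ac w := if pselect (disc z r w) is left D then projT1 (cid (dc w D)) else 0.
pose dcf w := if pselect (disc z r w) is left D then projT1 (cid (projT2 (cid (dc w D)))) else 0.
apply: (@disc_max_principle z r S c ac dcf m r0 dS) => w Dw.
  rewrite /ac /dcf; case: pselect => // D.
  exact: (projT2 (cid (projT2 (cid (dc w D))))).
rewrite /S zE in Dw *.
by rewrite Dw subrr expr0n /= mul0r add0r; apply: bd; rewrite zE.
Qed.

Lemma bernstein_holo z r (f fz a : R * R -> C) (H : R * R -> R)
    (hz e hd : R * R -> C) (m : R) : 0 < r ->
  (forall w, disc z r w -> wd f w (fz w) 0 /\ wd fz w (a w) 0) ->
  (forall w, disc z r w -> wd (fun w => (H w)%:C) w (hz w) (cj (hz w)) /\ wd hz w (e w) (hd w)) ->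
  (forall w, disc z r w -> 8 * r ^+ 2 * nrm2 (f w) <= Re (hd w)) ->
  (forall w, nrm2 (cx w - cx z) = r ^+ 2 -> H w <= m) ->
  r ^+ 4 * nrm2 (f z) + H z <= m.
Proof.
move=> r0 df dH ineq bd.
apply: (@bernstein z r f fz (fun=> 0) (fun=> 0) a (fun=> 0) H hz e hd m r0) => //.
  by move=> w /df[h1 h2]; split => //; exact: wd_cst.
by move=> w Dw; rewrite mulr0 /= mulr0 subr0; exact: ineq.
Qed.

(** [(Im g)^2] has mixed derivative [|g'|^2 / 2], so [H = 16 r^2 (Im g)^2] meets the Bernstein
    condition for the holomorphic function [g'] with equality. A bound on the imaginary part alone
    thus controls the derivative. *)
Lemma cauchy_estimate_Im z r (g g1 g2 g3 : R * R -> C) (m : R) : 0 < r ->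
  (forall w, disc z r w -> [/\ wd g w (g1 w) 0, wd g1 w (g2 w) 0 & wd g2 w (g3 w) 0]) ->
  (forall w, disc z r w -> `|Im (g w)| <= m) ->
  r ^+ 2 * nrm2 (g1 z) <= 16 * m ^+ 2.
Proof.
move=> r0 dg gm.
have m0 : 0 <= m by rewrite (le_trans (normr_ge0 _) (gm z _)) // /disc /mkset subrr /nrm2 /= expr0n /= addr0 sqr_ge0.
have dIm w : disc z r w -> wd (fun w => (Im (g w))%:C) w (- ci / 2 * g1 w) (ci / 2 * cj (g1 w)).
  move=> /dg[h _ _].
  have -> : (fun w => (Im (g w))%:C) = (fun w => - ci / 2 * (g w - cj (g w))).
    apply/funext => t; have -> : g t - cj (g t) = 2 * (ci * (Im (g t))%:C).
      by rewrite -cRn; apply: eqReIm; rewrite !ReImE /=; ring.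
    rewrite (_ : - ci / 2 * (2 * (ci * (Im (g t))%:C)) = - (ci * ci) * (Im (g t))%:C); last by field.
    by rewrite ciM opprK mul1r.
  apply: wd_eq; [exact: (wdZ _ (wdB h (wdJ h)))|..]; rewrite ?cJE; cbv beta; ring.
have := @bernstein_holo z r g1 g2 g3 (fun w => 16 * r ^+ 2 * Im (g w) ^+ 2)
  (fun w => 16 * r%:C ^+ 2 * (- ci) * (Im (g w))%:C * g1 w)
  (fun w => 8 * r%:C ^+ 2 * - g1 w ^+ 2 + 16 * r%:C ^+ 2 * (- ci) * (Im (g w))%:C * g2 w)
  (fun w => 8 * r%:C ^+ 2 * (g1 w * cj (g1 w))) (16 * r ^+ 2 * m ^+ 2) r0.
have ii : ci * ci = -1 :> C := ciM.
move=> /(_ _ _ _ _) h.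
have : r ^+ 4 * nrm2 (g1 z) + 16 * r ^+ 2 * Im (g z) ^+ 2 <= 16 * r ^+ 2 * m ^+ 2.
  apply: h.
  - by move=> w /dg[].
  - move=> w Dw; have [h1 h2 h3] := dg w Dw; have h4 := dIm w Dw; split.
      have -> : (fun w => (16 * r ^+ 2 * Im (g w) ^+ 2)%:C) =
        (fun w => 16 * r%:C ^+ 2 * ((Im (g w))%:C * (Im (g w))%:C)).
        by apply/funext => t; rewrite !cRE expr2.
      apply: wd_eq; [exact: (wdZ _ (wdM h4 h4))|..]; cbv beta.
        by field.
      by rewrite !cJE; field.
    apply: wd_eq; [exact: (wdM (wdZ (16 * r%:C ^+ 2 * - ci) h4) h2)|..]; cbv beta.
      rewrite (_ : 16 * r%:C ^+ 2 * - ci * (- ci / 2 * g1 w) * g1 w = 8 * r%:C ^+ 2 * (ci * ci) * g1 w ^+ 2); last by field.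
      by rewrite ii; cbv beta; ring.
    rewrite mulr0 addr0 (_ : 16 * r%:C ^+ 2 * - ci * (ci / 2 * cj (g1 w)) * g1 w = - (8 * r%:C ^+ 2 * (ci * ci) * (g1 w * cj (g1 w)))); last by field.
    by rewrite ii; cbv beta; ring.
  - move=> w Dw; rewrite -nrm2E -cRX -cRn -!cRM /=.
    by [].
  - move=> w /eqP; rewrite eq_le => /andP[Dw _].
    rewrite ler_pM2l ?mulr_gt0 ?exprn_gt0 //.
    by rewrite -(real_normK (num_real (Im _))) ler_pXn2r ?nnegrE ?gm.
move=> h5.
have r2 : 0 < r ^+ 2 by rewrite exprn_gt0.
have : r ^+ 2 * (r ^+ 2 * nrm2 (g1 z)) <= r ^+ 2 * (16 * m ^+ 2).
  have : 0 <= 16 * r ^+ 2 * Im (g z) ^+ 2 by rewrite mulr_ge0 ?sqr_ge0 // mulr_ge0 // ltW.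
  by move: h5; rewrite (_ : r ^+ 4 = r ^+ 2 * r ^+ 2); [lra|rewrite -exprD].
by rewrite ler_pM2l.
Qed.

End disc.

(** * Lebesgue measure on the period parallelogram *)

Section measure.
Context {R : realType}.
Local Notation leb := (@lebesgue_measure R).
Local Notation mu := (lebesgue2 R).
Local Notation s3 := (Num.sqrt (3 : R)).
Local Notation hh := (s3 / 2).

Lemma s3_gt0 : 0 < s3. Proof. by rewrite sqrtr_gt0. Qed.
Lemma s3_sqr : s3 ^+ 2 = 3. Proof. by rewrite sqr_sqrtr. Qed.
Lemma hh_gt0 : 0 < hh. Proof. by rewrite divr_gt0 ?s3_gt0. Qed.

(** An open set is the union of the rational boxes contained in it. Boxes are enumerated through
    [unpickle]; a code that decodes to nothing, or to a box sticking out of [U], contributes the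
    empty set. *)
Lemma open_measurable2 (U : set (R * R)) : open U -> measurable U.
Proof.
move=> Uo.
pose box (q : rat * rat * (rat * rat)) : set (R * R) :=
  `]ratr q.1.1, ratr q.1.2[ `*` `]ratr q.2.1, ratr q.2.2[.
pose A n := if @unpickle (rat * rat * (rat * rat))%type n is Some q
  then (if pselect (box q `<=` U) is left _ then box q else set0) else set0.
have -> : U = \bigcup_n A n.
  apply/seteqP; split; last first.
    move=> w [n _]; rewrite /A; case: unpickle => // q; case: pselect => // qU.
    exact: qU.
  move=> w Uw; have [e /= e0 he] : nbhs_ball w U.
    by apply/nbhs_ballP; exact: open_nbhs_nbhs.
  have e1 (x : R) : x - e < x by rewrite gtrBl.
  have e2 (x : R) : x < x + e by rewrite ltrDl.
  have [a] := rat_in_itvoo (e1 w.1); rewrite in_itv /= => /andP[a1 a2].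
  have [b] := rat_in_itvoo (e2 w.1); rewrite in_itv /= => /andP[b1 b2].
  have [c] := rat_in_itvoo (e1 w.2); rewrite in_itv /= => /andP[c1 c2].
  have [d] := rat_in_itvoo (e2 w.2); rewrite in_itv /= => /andP[d1 d2].
  have qU : box ((a, b), (c, d)) `<=` U.
    move=> [x y]; rewrite /box /= !in_itv /= => -[/andP[x1 x2] /andP[y1 y2]].
    by apply: he; split; rewrite /= /ball /= ltr_distl; apply/andP; split; lra.
  have := pickleK ((a, b), (c, d)); move: (pickle _) => n En.
  exists n; first exact: Logic.I.
  rewrite /A En; case: pselect => // _.
  by rewrite /box /= !in_itv /= a2 b1 c2 d1.
apply: bigcup_measurable => n _; rewrite /A; case: unpickle => // q.
by case: pselect => // _; apply: measurableX.
Qed.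

Lemma cts_measurable2 (U : set (R * R)) (f : R * R -> R) : open U ->
  (forall w, U w -> {for w, continuous f}) -> measurable_fun U f.
Proof.
move=> Uo fc; move=> mU; apply: (measurability _ (measurable_realfun.RGenOInfty.measurableE R)) => //.
move=> /= _ [_ [a ->] <-].
apply: open_measurable2.
rewrite openE => w [Uw /= fw].
have h1 : nbhs w U by exact: open_nbhs_nbhs.
have h2 : \forall t \near w, (`]a, +oo[%classic : set R) (f t).
  by apply: (fc w Uw); apply: open_nbhs_nbhs; split => //; exact: interval_open.
by rewrite /interior; near=> t; split; near: t.
Unshelve. all: by end_near. Qed.

(** Translation keeps the length of half-open intervals, so the pushforward measure is Lebesgue
    measure by uniqueness. *)
Lemma ge0_integral_shift (f : R -> \bar R) (c : R) : measurable_fun [set: R] f ->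
  (forall x, 0 <= f x)%E ->
  (\int[leb]_x f (x + c)%R = \int[leb]_x f x)%E.
Proof.
move=> mf f0.
have mshift : measurable_fun [set: R] (fun x : R => x + c).
  exact: measurable_funD.
pose phi : measurableTypeR R -> measurableTypeR R := fun x => x + c.
pose mphi := isMeasurableFun.Build _ _ _ _ phi mshift.
pose phi' : {mfun measurableTypeR R >-> measurableTypeR R} := HB.pack phi mphi.
have push (A : set (measurableTypeR R)) : measurable A -> leb A = pushforward leb phi' A.
  apply: (@lebesgue_measure_unique R (pushforward leb phi')) => // X [[a b] /= _ <-].
  rewrite /pushforward.
  have -> : phi @^-1` `]a, b] = `]a - c, b - c]%classic.
    by apply/seteqP; split => x /=; rewrite !in_itv /= /phi ltrBlDr lerBrDr.
  rewrite !lebesgue_measure_itv /= !lte_fin ltrD2r; case: ifP => // _.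
  by rewrite -!EFinD opprB addrA subrK.
transitivity (\int[pushforward leb phi']_x f x)%E.
  rewrite (@ge0_integral_pushforward _ _ (measurableTypeR R) (measurableTypeR R) R phi' mshift leb setT f) //.
by apply: eq_measure_integral => A mA _; rewrite [RHS]push.
Qed.

Lemma ge0_integral_shift_itv (f : R -> \bar R) (a b c : R) : measurable_fun [set: R] f ->
  (forall x, 0 <= f x)%E ->
  (\int[leb]_(x in `[a, b[) f (x + c)%R = \int[leb]_(x in `[(a + c)%R, (b + c)%R[) f x)%E.
Proof.
move=> mf f0.
rewrite integral_mkcond [RHS]integral_mkcond.
rewrite -(@ge0_integral_shift (f \_ `[a + c, b + c[) c).
- apply: eq_integral => x _; rewrite /patch.
  have -> : (x \in `[a, b[%classic) = (x + c \in `[a + c, b + c[%classic) => //.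
  by apply/idP/idP; rewrite !inE /= !in_itv /= lerD2r ltrD2r.
- by apply/(measurable_restrictT _ _).1 => //; exact: measurable_funTS.
- by apply: erestrict_ge0.
Qed.

Lemma ge0_integral_itvU (f : R -> \bar R) (a b c : R) : measurable_fun [set: R] f ->
  (forall x, 0 <= f x)%E -> a <= b -> b <= c ->
  (\int[leb]_(x in `[a, c[) f x =
   \int[leb]_(x in `[a, b[) f x + \int[leb]_(x in `[b, c[) f x)%E.
Proof.
move=> mf f0 ab bc.
rewrite -ge0_integral_setU //.
- congr integral; apply/seteqP; split=> x /=; rewrite !in_itv /=.
    by case/andP=> -> ->; case: (ltP x b); [left|right].
  by case=> /andP[h1 h2]; [rewrite h1 (lt_le_trans h2)|rewrite h2 (le_trans ab)].
- exact: measurable_funTS.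
- by apply/disj_setPS => x /= []; rewrite !in_itv /= => /andP[_ h1] /andP[h2 _]; move: h1; rewrite ltNge h2.
Qed.

Lemma integral_period (f : R -> \bar R) (T a : R) : 0 < T -> measurable_fun [set: R] f ->
  (forall x, 0 <= f x)%E -> (forall x, f (x + T)%R = f x) ->
  (\int[leb]_(x in `[a, (a + T)%R[) f x = \int[leb]_(x in `[0%R, T[) f x)%E.
Proof.
move=> T0 mf f0 fT.
have fTz (n : int) x : f (x + T *~ n) = f x.
  have fTn (m : nat) y : f (y + T *+ m) = f y.
    by elim: m y => [|m IH] y; rewrite ?mulr0n ?addr0 // mulrS addrA IH fT.
  by case: n => n; [exact: fTn|rewrite NegzE mulrNz -{2}(subrK (T *+ n.+1) x) fTn].
pose n := Num.floor (a / T).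
pose t := a - T *~ n.
have t0 : 0 <= t < T.
  have /andP[h1 h2] := floor_itv (a / T).
  rewrite /t subr_ge0 -mulrzr mulrC -ler_pdivlMr // h1 /=.
  rewrite ltrBlDl -{2}[T]mul1r -mulrDl -ltr_pdivrMr // addrC.
  by move: h2; rewrite intrD addrC.
have -> : (\int[leb]_(x in `[a, (a + T)%R[) f x = \int[leb]_(x in `[t, (t + T)%R[) f x)%E.
  have := @ge0_integral_shift_itv f t (t + T) (T *~ n) mf f0.
  rewrite addrAC !subrK => <-.
  by apply: eq_integral => x _; rewrite fTz.
case/andP: t0 => t0 tT.
rewrite (@ge0_integral_itvU f t T (t + T)) // ?lerDr //; last exact: ltW.
rewrite (@ge0_integral_itvU f 0 t T) //; last exact: ltW.
rewrite addeC; congr (_ + _)%E.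
have := @ge0_integral_shift_itv f 0 t T mf f0.
by rewrite add0r => <-; apply: eq_integral => x _; rewrite fT.
Qed.

(** With [t = w.2 / hh] and [s = w.1 - w.2 / s3], every horizontal slice is an interval of length 1.
    This is the form that Fubini needs. *)
Lemma fundamental_domainE : fundamental_domain (rho R) =
  [set w : R * R | 0 <= w.2 < hh /\ w.2 / s3 <= w.1 < w.2 / s3 + 1].
Proof.
have s0 := s3_gt0; have sn : s3 != 0 by rewrite gt_eqF.
have h0 := hh_gt0.
apply/seteqP; split.
  move=> w [s [t [/andP[s1 s2] /andP[t1 t2] ->]]] /=.
  change (0 <= s * 0 + t * hh < hh /\ (s * 0 + t * hh) / s3 <= s * 1 + t * 2^-1 < (s * 0 + t * hh) / s3 + 1).
  rewrite mulr1 mulr0 add0r; split.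
    apply/andP; split; first by rewrite mulr_ge0 // ltW.
    by rewrite -[ltRHS]mul1r ltr_pM2r.
  have -> : t * hh / s3 = t / 2 by field.
  by apply/andP; split; lra.
move=> [x y] /= [/andP[y1 y2] /andP[x1 x2]].
exists (x - y / s3), (y / hh); split.
- by apply/andP; split; lra.
- apply/andP; split; first by apply: divr_ge0 => //; exact: ltW.
  by rewrite ltr_pdivrMr // mul1r.
- rewrite /rho; congr pair.
    by rewrite -[RHS]/((x - y / s3) * 1 + (y / hh) * 2^-1); field.
  by rewrite -[RHS]/((x - y / s3) * 0 + (y / hh) * hh); field.
Qed.

Lemma measurable_fd : measurable (fundamental_domain (rho R)).
Proof.
rewrite fundamental_domainE.
have m1 : measurable_fun [set: R * R] (fun w : R * R => w.1 - w.2 / s3).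
  by apply: measurable_funB => //; apply: measurable_funM.
have -> : [set w : R * R | 0 <= w.2 < hh /\ w.2 / s3 <= w.1 < w.2 / s3 + 1] =
  (snd @^-1` `[0, hh[) `&` ((fun w : R * R => w.1 - w.2 / s3) @^-1` `[0, 1[).
  by apply/seteqP; split => -[x y] /=; rewrite !in_itv /= subr_ge0 ltrBlDl.
apply: measurableI.
  by rewrite -[X in measurable X]setTI; exact: measurable_snd.
by rewrite -[X in measurable X]setTI; exact: m1.
Qed.

(** By Tonelli and the horizontal period, each slanted slice can be slid back to [[0, 1[], which
    turns the parallelogram into a rectangle. *)
Lemma integral_fd (F : R * R -> \bar R) : measurable_fun [set: R * R] F ->
  (forall w, 0 <= F w)%E -> (forall w, F (w + (1, 0)) = F w) ->
  (\int[mu]_(w in fundamental_domain (rho R)) F w =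
   \int[leb]_(y in `[0%R, hh[) \int[leb]_(x in `[0%R, 1%R[) F (x, y))%E.
Proof.
move=> mF F0 F1.
rewrite integral_mkcond fubini_tonelli2; last 2 first.
- by apply/(measurable_restrictT _ _).1; [exact: measurable_fd|exact: measurable_funTS].
- by move=> w; apply: erestrict_ge0.
rewrite [RHS]integral_mkcond; apply: eq_integral => y _.
rewrite /fubini_G /patch.
case: ifPn => [|/negP hy]; last first.
  rewrite -[RHS](integral0 leb setT); apply: eq_integral => x _.
  case: ifPn => //; rewrite inE fundamental_domainE => -[/= hy' _].
  by exfalso; apply: hy; rewrite inE /= in_itv.
rewrite inE /= in_itv /= => yh.
rewrite -(@integral_period (fun x => F (x, y)) 1 (y / s3)) //; first last.
- by move=> x; rewrite -(F1 (x, y)) -[(x, y) + _]/(x + 1, y + 0) addr0.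
- exact: measurable_fun_pair1.
rewrite [RHS]integral_mkcond; apply: eq_integral => x _; rewrite /patch.
congr (if _ then _ else _).
apply/idP/idP; rewrite !inE fundamental_domainE /= in_itv /=; first by case.
by [].
Qed.

(** Raising the height by [hh] is translation by [rho] up to a horizontal shift by 1/2, to which the
    inner integral is blind. So the inner integral [g] is [hh]-periodic, and one-dimensional
    invariance applies twice. *)
Lemma integral_fd_shift (F : R * R -> \bar R) (c : R * R) : measurable_fun [set: R * R] F ->
  (forall w, 0 <= F w)%E -> (forall w, F (w + (1, 0)) = F w) ->
  (forall w, F (w + rho R) = F w) ->
  (\int[mu]_(w in fundamental_domain (rho R)) F (w + c)%R =
   \int[mu]_(w in fundamental_domain (rho R)) F w)%E.
Proof.
move=> mF F0 F1 Frho.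
have mshift : measurable_fun [set: R * R] (fun w : R * R => w + c).
  have -> : (fun w : R * R => w + c) = (fun w => (w.1 + c.1, w.2 + c.2)) by apply/funext => -[].
  by apply: measurable_fun_pair; apply: measurable_funD.
rewrite integral_fd //; last 2 first.
- exact: measurableT_comp.
- by move=> w; rewrite addrAC F1.
rewrite integral_fd //.
have mFy y : measurable_fun [set: R] (fun x => F (x, y)) by exact: measurable_fun_pair1.
have inner y a : (\int[leb]_(x in `[0%R, 1%R[) F (x + a, y)%R = \int[leb]_(x in `[0%R, 1%R[) F (x, y))%E.
  rewrite (@ge0_integral_shift_itv (fun x => F (x, y)) 0 1 a) // add0r addrC.
  rewrite integral_period // => x.
  by rewrite -(F1 (x, y)) -[(x, y) + _]/(x + 1, y + 0) addr0.
pose g y := (\int[leb]_(x in `[0%R, 1%R[) F (x, y))%E.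
have mg : measurable_fun [set: R] g.
  have -> : g = fubini_G leb (F \_ (`[0, 1[ `*` setT)).
    apply/funext => y; rewrite /g /fubini_G [LHS]integral_mkcond; apply: eq_integral => x _.
    rewrite /patch; congr (if _ then _ else _).
    by apply/idP/idP; rewrite !inE /=; [split|case].
  apply: measurable_fun_fubini_tonelli_G.
    apply/(measurable_restrictT _ _).1; first exact: measurableX.
    exact: measurable_funTS.
  by move=> w; apply: erestrict_ge0.
have g0 y : (0 <= g y)%E by apply: integral_ge0.
have gh y : g (y + hh) = g y.
  rewrite /g -(inner y (- 2^-1)); apply: eq_integral => x _.
  by rewrite -(Frho (x - 2^-1, y)%R) -[(_, y) + rho R]/(x - 2^-1 + 2^-1, y + hh) subrK.
transitivity (\int[leb]_(y in `[0%R, hh[) g (y + c.2)%R)%E.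
  apply: eq_integral => y _; rewrite /g -(inner (y + c.2) c.1).
  by apply: eq_integral.
rewrite (@ge0_integral_shift_itv g 0 hh c.2) // add0r addrC integral_period //.
Qed.

End measure.

Local Open Scope complex_scope.
Local Notation Re := (@complex.Re _).
Local Notation Im := (@complex.Im _).

(** * Polynomial bounds for sine and cosine *)

Section cosine.
Context {R : realType}.

Lemma ge0_of_derive (f f' : R -> R) : (forall x, is_derive (x : R) (1 : R) f (f' x)) ->
  f 0 = 0 -> (forall x, 0 <= x -> 0 <= f' x) -> forall x, 0 <= x -> 0 <= f x.
Proof.
move=> df f0 f'0 x; rewrite le_eqVlt => /orP[/eqP <-|x0]; first by rewrite f0.
have fc : {within `[0, x], continuous f}.
  by apply: derivable_within_continuous => t _; case: (df t).
have [c] := MVT x0 (fun t _ => df t) fc.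
rewrite in_itv /= => /andP[c0 _]; rewrite f0 !subr0 => ->.
by rewrite mulr_ge0 ?f'0 // ltW.
Qed.

Lemma sin_le_id (x : R) : 0 <= x -> sin x <= x.
Proof.
move=> x0; rewrite -subr_ge0.
apply: (@ge0_of_derive (fun x => x - sin x) (fun x => 1 - cos x)) => //.
by rewrite sin0 subrr.
Qed.

Lemma is_derive_poly_frac (n : nat) (c : R) (t : R) :
  is_derive t 1 (fun x : R => x ^+ n.+1 / c) (n.+1%:R * t ^+ n / c).
Proof.
have h := is_deriveM (is_deriveX n.+1 (is_derive_id t (1 : R))) (is_derive_cst (c^-1 : R) t (1 : R)).
have -> : (fun x : R => x ^+ n.+1 / c) = id ^+ n.+1 * cst c^-1 by apply/funext => x; rewrite !fctE.
by apply: (is_derive_eq h); rewrite /GRing.scale /= /cst; ring.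
Qed.

Lemma cos_ge_quad (x : R) : 1 - x ^+ 2 / 2 <= cos x.
Proof.
wlog x0 : x / 0 <= x.
  move=> h; have [/h//|x0] := leP 0 x.
  by rewrite -cosN -[x ^+ 2]sqrrN; apply: h; rewrite oppr_ge0 ltW.
rewrite -subr_ge0.
have -> : cos x - (1 - x ^+ 2 / 2) = x ^+ 2 / 2 - (1 - cos x) by ring.
apply: (@ge0_of_derive (fun x => x ^+ 2 / 2 - (1 - cos x)) (fun x => x - sin x)) => //.
- move=> t.
  have h1 : is_derive t 1 (fun x : R => 1 - cos x) (sin t).
    have h := is_deriveB (is_derive_cst (1 : R) t (1 : R)) (is_derive_cos t).
    by apply: (is_derive_eq h); rewrite sub0r opprK.
  have h2 : is_derive t 1 (fun x : R => x ^+ 2 / 2) t.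
    by apply: (is_derive_eq (is_derive_poly_frac 1 2 t)); field.
  exact: is_deriveB.
- by rewrite cos0 expr0n /= mul0r !subrr.
- by move=> t t0; rewrite subr_ge0 sin_le_id.
Qed.

Lemma sin_ge_cubic (x : R) : 0 <= x -> x - x ^+ 3 / 6 <= sin x.
Proof.
move=> x0; rewrite -subr_ge0.
apply: (@ge0_of_derive (fun x => sin x - (x - x ^+ 3 / 6)) (fun x => cos x - (1 - x ^+ 2 / 2))) => //.
- move=> t; apply: is_deriveB; apply: is_deriveB.
  by apply: (is_derive_eq (is_derive_poly_frac 2 6 t)); field.
- by rewrite sin0 expr0n /= mul0r !subrr.
- by move=> t _; rewrite subr_ge0 cos_ge_quad.
Qed.

Lemma cos_le_quartic (x : R) : cos x <= 1 - x ^+ 2 / 2 + x ^+ 4 / 24.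
Proof.
wlog x0 : x / 0 <= x.
  move=> h; have [/h//|x0] := leP 0 x.
  have := h (- x); rewrite cosN.
  have -> : (- x) ^+ 2 = x ^+ 2 by ring.
  by have -> : (- x) ^+ 4 = x ^+ 4; [ring|apply; lra].
rewrite -subr_ge0.
have -> : 1 - x ^+ 2 / 2 + x ^+ 4 / 24 - cos x = x ^+ 4 / 24 - (x ^+ 2 / 2 - (1 - cos x)) by ring.
apply: (@ge0_of_derive (fun x => x ^+ 4 / 24 - (x ^+ 2 / 2 - (1 - cos x)))
   (fun x => sin x - (x - x ^+ 3 / 6))) => //.
- move=> t.
  have h1 : is_derive t 1 (fun x : R => 1 - cos x) (sin t).
    have h := is_deriveB (is_derive_cst (1 : R) t (1 : R)) (is_derive_cos t).
    by apply: (is_derive_eq h); rewrite sub0r opprK.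
  have h := is_deriveB (is_derive_poly_frac 3 24 t) (is_deriveB (is_derive_poly_frac 1 2 t) h1).
  by apply: (is_derive_eq h); field.
- by rewrite cos0 !expr0n /= !mul0r !subrr.
- by move=> t t0; rewrite subr_ge0 sin_ge_cubic.
Qed.

(** [1 - cos x] is [2 sin^2 (x / 2)], and the cubic bound yields [sin (x / 2) >= x / 6] as long as
    [x <= 4], a range that covers [[0, pi]]. Only positivity of the constant matters. *)
Lemma one_sub_cos_ge (x : R) : `|x| <= pi -> x ^+ 2 / 18 <= 1 - cos x.
Proof.
move=> xpi.
wlog x0 : x xpi / 0 <= x.
  move=> h; have [/(h x xpi)//|x0] := leP 0 x.
  by rewrite -cosN -[x ^+ 2]sqrrN; apply: h; rewrite ?normrN // oppr_ge0 ltW.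
have x4 : x <= 4.
  by move: xpi; rewrite ger0_norm //; have := pihalf_lt2 R; lra.
have -> : cos x = 1 - sin (x / 2) ^+ 2 *+ 2.
  have -> : x = (x / 2) *+ 2 by rewrite mulr2n; field.
  by rewrite cos_mulr2n [in LHS]cos2sin2 mulr2n [in RHS](_ : (x / 2) *+ 2 / 2 = x / 2); [ring|rewrite mulr2n; field].
have h := @sin_ge_cubic (x / 2) ltac:(lra).
have h1 : x / 6 <= sin (x / 2).
  apply: le_trans h.
  have : 0 <= x * (16 - x ^+ 2) by rewrite mulr_ge0 // subr_ge0; nra.
  have -> : (x / 2) ^+ 3 = x ^+ 3 / 8 by field.
  by rewrite exprS; lra.
have : (x / 6) ^+ 2 <= sin (x / 2) ^+ 2 by rewrite ler_pXn2r ?nnegrE //; lra.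
by rewrite mulr2n; lra.
Qed.

End cosine.

(** * A trigonometric model of the squared distance to the lattice *)

Section torusT.
Context {R : realType}.
Local Notation s3 := (Num.sqrt (3 : R)).
Local Notation hh := (s3 / 2).
Implicit Types w z : R * R.

(** For [w = s + t rho] the phases [ta1 w] and [ta2 w] are [2 pi s] and [2 pi t]. With their sum
    they give, up to sign, the six shortest frequencies of the hexagonal torus; hence the isotropy
    in [TT_quad_sum]. *)
Definition ta1 w : R := 2 * pi * (w.1 - w.2 / s3).
Definition ta2 w : R := 4 * pi * (w.2 / s3).
(* A trigonometric polynomial on the hexagonal torus with T(w) ~ 4 pi^2 |w|^2 at
   the lattice points, positive elsewhere; log T serves as Green's function. *)
Definition TT w : R := (1 - cos (ta1 w)) + (1 - cos (ta2 w)) + (1 - cos (ta1 w + ta2 w)).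
Definition Tsig3 w : R := (1 - cos (ta1 w)) * (1 - cos (ta2 w)) * (1 - cos (ta1 w + ta2 w)).

Lemma s3n0 : s3 != 0. Proof. by rewrite gt_eqF // s3_gt0. Qed.
Lemma TT_ge0 w : 0 <= TT w.
Proof. by rewrite /TT; have := cos_le1 (ta1 w); have := cos_le1 (ta2 w); have := cos_le1 (ta1 w + ta2 w); lra. Qed.
Lemma TT_le6 w : TT w <= 6.
Proof. by rewrite /TT; have := cos_geN1 (ta1 w); have := cos_geN1 (ta2 w); have := cos_geN1 (ta1 w + ta2 w); lra. Qed.
Lemma cosD2pi' (x : R) : cos (x + 2 * pi) = cos x.
Proof. by have -> : 2 * pi = pi *+ 2 :> R; [rewrite mulr2n; ring|rewrite cosD2pi]. Qed.

Lemma TT_per1 w : TT (w + (1, 0)) = TT w.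
Proof.
have e1 : ta1 (w + (1, 0)) = ta1 w + 2 * pi.
  rewrite /ta1 -[(w + _).1]/(w.1 + 1) -[(w + _).2]/(w.2 + 0); ring.
have e2 : ta2 (w + (1, 0)) = ta2 w.
  by rewrite /ta2 -[(w + _).2]/(w.2 + 0) addr0.
have e3 : ta1 w + 2 * pi + ta2 w = ta1 w + ta2 w + 2 * pi by ring.
by rewrite /TT e1 e2 e3 !cosD2pi'.
Qed.

Lemma TT_per2 w : TT (w + rho R) = TT w.
Proof.
have s := s3n0.
have e1 : ta1 (w + rho R) = ta1 w.
  by rewrite /ta1 -[(w + _).1]/(w.1 + 2^-1) -[(w + _).2]/(w.2 + hh); field.
have e2 : ta2 (w + rho R) = ta2 w + 2 * pi.
  by rewrite /ta2 -[(w + _).2]/(w.2 + hh); field.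
have e3 : ta1 w + (ta2 w + 2 * pi) = ta1 w + ta2 w + 2 * pi by ring.
by rewrite /TT e1 e2 e3 !cosD2pi'.
Qed.

Lemma TTN w : TT (- w) = TT w.
Proof.
have e1 : ta1 (- w) = - ta1 w by rewrite /ta1 -[(- w).1]/(- w.1) -[(- w).2]/(- w.2); ring.
have e2 : ta2 (- w) = - ta2 w by rewrite /ta2 -[(- w).2]/(- w.2); ring.
by rewrite /TT e1 e2 -opprD !cosN.
Qed.

Definition nr2 w : R := w.1 ^+ 2 + w.2 ^+ 2.

Lemma nr2_ge0 w : 0 <= nr2 w.
Proof. by rewrite /nr2 addr_ge0 // sqr_ge0. Qed.

Lemma TT_quad_sum w : ta1 w ^+ 2 + ta2 w ^+ 2 + (ta1 w + ta2 w) ^+ 2 = 8 * pi ^+ 2 * nr2 w.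
Proof.
have e : (w.2 / s3) ^+ 2 = w.2 ^+ 2 / 3 by rewrite exprMn exprVn s3_sqr.
have -> : ta1 w ^+ 2 + ta2 w ^+ 2 + (ta1 w + ta2 w) ^+ 2 =
  8 * pi ^+ 2 * (w.1 ^+ 2 + 3 * (w.2 / s3) ^+ 2) by rewrite /ta1 /ta2; ring.
by rewrite e /nr2; field.
Qed.

Lemma TT_le w : TT w <= 4 * pi ^+ 2 * nr2 w.
Proof.
have := TT_quad_sum w; have := cos_ge_quad (ta1 w); have := cos_ge_quad (ta2 w).
by have := cos_ge_quad (ta1 w + ta2 w); rewrite /TT; lra.
Qed.

Lemma TT_quartic w : `|TT w - 4 * pi ^+ 2 * nr2 w| <= 8 * pi ^+ 4 * nr2 w ^+ 2.
Proof.
rewrite ler_norml; apply/andP; split; last first.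
  apply: (@le_trans _ _ 0); first by rewrite subr_le0 TT_le.
  by have := exprn_ge0 4 (pi_ge0 R) => ?; rewrite mulr_ge0 ?sqr_ge0 // mulr_ge0.
have q := TT_quad_sum w.
have := cos_le_quartic (ta1 w); have := cos_le_quartic (ta2 w).
have := cos_le_quartic (ta1 w + ta2 w); rewrite /TT.
have : ta1 w ^+ 4 + ta2 w ^+ 4 + (ta1 w + ta2 w) ^+ 4 <= (8 * pi ^+ 2 * nr2 w) ^+ 2.
  rewrite -q.
  have := sqr_ge0 (ta1 w * ta2 w); have := sqr_ge0 (ta1 w * (ta1 w + ta2 w)).
  have := sqr_ge0 (ta2 w * (ta1 w + ta2 w)).
  move: (ta1 w) (ta2 w) => a b; rewrite !exprMn.
  have -> : a ^+ 4 = (a ^+ 2) ^+ 2 by rewrite -exprM.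
  have -> : b ^+ 4 = (b ^+ 2) ^+ 2 by rewrite -exprM.
  have -> : (a + b) ^+ 4 = ((a + b) ^+ 2) ^+ 2 by rewrite -exprM.
  move: (a ^+ 2) (b ^+ 2) ((a + b) ^+ 2) => x y t; rewrite !expr2; lra.
have -> : (8 * pi ^+ 2 * nr2 w) ^+ 2 = 64 * pi ^+ 4 * nr2 w ^+ 2 :> R.
  by ring.
have : 0 <= pi ^+ 4 * nr2 w ^+ 2 by rewrite mulr_ge0 // exprn_ge0 // ?pi_ge0 ?nr2_ge0.
lra.
Qed.

(** On the centred cell [ta1] and [ta1 + ta2] may leave [[- pi, pi]], so their cosines are not
    bounded one by one. They are paired as [cos (X - Y) + cos (X + Y) = 2 cos X cos Y], where
    [cos Y >= 0]. *)
Lemma TT_ge w : `|w.1| <= 2^-1 -> `|w.2| <= hh / 2 -> 4 / 9 * nr2 w <= TT w.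
Proof.
move=> w1 w2; have pi2 := pi_ge2 R; have pi0 := pi_gt0 R; have s0 := @s3_gt0 R.
have y2 : `|w.2 / s3| <= 4^-1.
  rewrite normrM normfV (gtr0_norm s0) ler_pdivrMr //; apply: le_trans w2 _; lra.
have a2 : `|ta2 w| <= pi.
  by rewrite /ta2 normrM (@gtr0_norm _ (4 * pi)) ?mulr_gt0 //; nra.
have h2 := one_sub_cos_ge a2.
pose X := 2 * pi * w.1; pose Y := 2 * pi * (w.2 / s3).
have e1 : ta1 w = X - Y by rewrite /ta1 /X /Y; ring.
have e3 : ta1 w + ta2 w = X + Y by rewrite /ta1 /ta2 /X /Y; ring.
have hX : X ^+ 2 / 18 <= 1 - cos X.
  by apply: one_sub_cos_ge; rewrite /X normrM (@gtr0_norm _ (2 * pi)) ?mulr_gt0 //; nra.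
have X2 : X ^+ 2 <= 16.
  have : `|X| <= 4.
    rewrite /X normrM (@gtr0_norm _ (2 * pi)) ?mulr_gt0 //; have := pihalf_lt2 R => ?; nra.
  by rewrite -(@ler_pXn2r _ 2) ?nnegrE // real_normK ?num_real //; lra.
have cY : 0 <= cos Y.
  apply: cos_ge0_pihalf; move: y2; rewrite ler_norml => /andP[? ?]; rewrite /Y; apply/andP; split; nra.
have c13 : 1 - cos (ta1 w) + (1 - cos (ta1 w + ta2 w)) = 2 - 2 * (cos X * cos Y).
  by rewrite e3 e1 cosB cosD; ring.
have h1 : X ^+ 2 / 18 <= 2 - 2 * (cos X * cos Y).
  have := cos_le1 Y; have := cos_le1 X => cX cY1.
  have [cY2|cY2] := leP (2^-1) (cos Y); first by nra.
  by have : cos X * cos Y <= 2^-1; [nra|lra].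
have q : X ^+ 2 / 18 <= TT w by rewrite /TT; have := cos_le1 (ta2 w); lra.
have q' : ta2 w ^+ 2 / 18 <= TT w.
  by rewrite /TT; have := cos_le1 (ta1 w); have := cos_le1 (ta1 w + ta2 w); lra.
have E2 : ta2 w ^+ 2 = 16 / 3 * pi ^+ 2 * w.2 ^+ 2.
  by rewrite /ta2 !exprMn exprVn s3_sqr; field.
have E1 : X ^+ 2 = 4 * pi ^+ 2 * w.1 ^+ 2 by rewrite /X !exprMn; ring.
have p4 : 4 <= (pi : R) ^+ 2 by nra.
have : 4 * w.1 ^+ 2 <= pi ^+ 2 * w.1 ^+ 2 by rewrite ler_wpM2r // sqr_ge0.
have : 4 * w.2 ^+ 2 <= pi ^+ 2 * w.2 ^+ 2 by rewrite ler_wpM2r // sqr_ge0.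
have := sqr_ge0 w.2; rewrite /nr2; rewrite E1 in q; rewrite E2 in q'; lra.
Qed.

Lemma trig12 w (S1 := sin (ta1 w)) (C1 := cos (ta1 w)) (S2 := sin (ta2 w)) (C2 := cos (ta2 w)) :
  [/\ S1 ^+ 2 + C1 ^+ 2 - 1 = 0, S2 ^+ 2 + C2 ^+ 2 - 1 = 0,
   cos (ta1 w + ta2 w) = C1 * C2 - S1 * S2 & sin (ta1 w + ta2 w) = S1 * C2 + C1 * S2].
Proof.
split; rewrite ?cosD ?sinD //.
  by have := cos2Dsin2 (ta1 w); rewrite -/S1 -/C1; lra.
by have := cos2Dsin2 (ta2 w); rewrite -/S2 -/C2; lra.
Qed.

Definition TTx w : R := 2 * pi * (sin (ta1 w) + sin (ta1 w + ta2 w)).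
Definition TTy w : R := 2 * pi / s3 * (2 * sin (ta2 w) + sin (ta1 w + ta2 w) - sin (ta1 w)).
(** All three phases have a gradient of squared length [LL], so each cosine is an eigenfunction of
    eigenvalue [- LL] and the Laplacian of [TT] is [LL * (3 - TT)]. *)
Definition LL : R := 16 * pi ^+ 2 / 3.
(** The left side is [T Delta T - |grad T|^2], the numerator of [Delta ln T]. The right side is of
    order [T^2], so that [Delta ln T] stays bounded off the lattice. *)
Lemma TT_identity w :
  LL * (3 - TT w) * TT w - (TTx w ^+ 2 + TTy w ^+ 2) = - LL * (TT w ^+ 2 / 4 + Tsig3 w / 2).
Proof.
have [e1 e2 e3 e4] := trig12 w.
have e5 : (2 * pi / s3) ^+ 2 = 4 * pi ^+ 2 / 3 by rewrite !exprMn exprVn s3_sqr; field.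
rewrite /TTx /TTy exprMn [X in _ - (_ + X)]exprMn e5 /TT /Tsig3 /LL e3 e4.
move: e1 e2; set S1 := sin _; set C1 := cos _; set S2 := sin (ta2 w); set C2 := cos (ta2 w).
move=> e1 e2; apply/eqP; rewrite -subr_eq0; apply/eqP.
(* The difference of the two sides lies in the ideal of the relations [S^2 + C^2 = 1]; these are its
   cofactors. *)
transitivity (16 * pi ^+ 2 / 3 *
  ((-(3 / 4) * S2 ^+ 2 - 1 - C2 ^+ 2 - C2) * (S1 ^+ 2 + C1 ^+ 2 - 1) +
   (-(7 / 4) - (1 / 4) * C1 ^+ 2 - C1) * (S2 ^+ 2 + C2 ^+ 2 - 1))); first by field.
by rewrite e1 e2 !mulr0 addr0 mulr0.
Qed.

Lemma Tsig3_ge0 w : 0 <= Tsig3 w.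
Proof. by rewrite !mulr_ge0 // subr_ge0 cos_le1. Qed.

Lemma Tsig3_le w : Tsig3 w <= TT w ^+ 2.
Proof.
have h1 := cos_le1 (ta1 w); have h2 := cos_le1 (ta2 w); have h3 := cos_le1 (ta1 w + ta2 w).
have g3 := cos_geN1 (ta1 w + ta2 w).
rewrite /Tsig3 /TT; move: h1 h2 h3 g3.
move: (cos _) (cos _) (cos _) => p q r h1 h2 h3 g3.
have ab : 0 <= (1 - r) * (1 - q) by rewrite mulr_ge0 // subr_ge0.
have : (1 - r) * (1 - q) * (1 - p) <= (1 - r) * (1 - q) * 2 by apply: ler_wpM2l => //; lra.
nra.
Qed.

Lemma rd_ta1 w : rd ta1 w (2 * pi) (- (2 * pi / s3)).
Proof.
have -> : ta1 = (fun w => 2 * pi * w.1 - 2 * pi / s3 * w.2).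
  by apply/funext => t; rewrite /ta1; ring.
by apply: rd_eq; [exact: (rdB (rdM (rd_cst _ _) (rd_fst _)) (rdM (rd_cst _ _) (rd_snd _)))|..]; cbv beta; ring.
Qed.

Lemma rd_ta2 w : rd ta2 w 0 (4 * pi / s3).
Proof.
have -> : ta2 = (fun w => 4 * pi / s3 * w.2) by apply/funext => t; rewrite /ta2; ring.
by apply: rd_eq; [exact: (rdM (rd_cst _ _) (rd_snd _))|..]; cbv beta; ring.
Qed.

Lemma rd_ta12 w : rd (fun w => ta1 w + ta2 w) w (2 * pi) (2 * pi / s3).
Proof. by apply: rd_eq; [exact: (rdD (rd_ta1 _) (rd_ta2 _))|..]; cbv beta; ring. Qed.

Lemma rd_TT w : rd TT w (TTx w) (TTy w).
Proof.
have c1 := rdB (rd_cst 1 w) (rd_comp (rd_ta1 w) (is_derive_cos (ta1 w))).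
have c2 := rdB (rd_cst 1 w) (rd_comp (rd_ta2 w) (is_derive_cos (ta2 w))).
have c3 := rdB (rd_cst 1 w) (rd_comp (rd_ta12 w) (is_derive_cos (ta1 w + ta2 w))).
by apply: rd_eq; [exact: (rdD (rdD c1 c2) c3)|..]; rewrite ?/TTx ?/TTy; cbv beta; ring.
Qed.

Lemma rd_TTx w : rd TTx w (4 * pi ^+ 2 * (cos (ta1 w) + cos (ta1 w + ta2 w)))
   (4 * pi ^+ 2 / s3 * (cos (ta1 w + ta2 w) - cos (ta1 w))).
Proof.
have c1 := rd_comp (rd_ta1 w) (is_derive_sin (ta1 w)).
have c3 := rd_comp (rd_ta12 w) (is_derive_sin (ta1 w + ta2 w)).
by apply: rd_eq; [exact: (rdM (rd_cst (2 * pi) w) (rdD c1 c3))|..]; cbv beta; ring.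
Qed.

Lemma rd_TTy w : rd TTy w (4 * pi ^+ 2 / s3 * (cos (ta1 w + ta2 w) - cos (ta1 w)))
  (4 * pi ^+ 2 / 3 * (4 * cos (ta2 w) + cos (ta1 w + ta2 w) + cos (ta1 w))).
Proof.
have s := s3n0.
have e5 : (2 * pi / s3) * (2 * pi / s3) = 4 * pi ^+ 2 / 3.
  by rewrite -expr2 !exprMn exprVn s3_sqr; field.
have c1 := rd_comp (rd_ta1 w) (is_derive_sin (ta1 w)).
have c2 := rd_comp (rd_ta2 w) (is_derive_sin (ta2 w)).
have c3 := rd_comp (rd_ta12 w) (is_derive_sin (ta1 w + ta2 w)).
apply: rd_eq; [exact: (rdM (rd_cst (2 * pi / s3) w) (rdB (rdD (rdM (rd_cst 2 w) c2) c3) c1))|..]; cbv beta; first by ring.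
by rewrite -e5; ring.
Qed.

End torusT.

(** * A class of test functions, and equality of mixed partials *)

Section smooth_class.
Context {R : realType}.

(** The index makes the span of [exp (- 1 / x)] and its derivatives closed under differentiation,
    see [is_derive_flat]; [flat 0] serves as the profile of cutoffs. *)
Definition flat (n : nat) (x : R) : R := if 0 < x then x ^- n * expR (- x^-1) else 0.

Lemma flat_quad n : exists2 C, 0 <= C & forall x, `|flat n x| <= C * x ^+ 2.
Proof.
exists (n.+2)`!%:R => // x; rewrite /flat; case: ifPn => [x0|_]; last by rewrite normr0 mulr_ge0 ?sqr_ge0.
have xi : 0 < x^-1 by rewrite invr_gt0.
have E : 0 < expR x^-1 := expR_gt0 _.
have f0 : 0 < (n.+2)`!%:R :> R by rewrite ltr0n fact_gt0.
have h := @expR_ge1Dxn R x^-1 n.+1 (ltW xi).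
have xn : 0 <= x ^- n by rewrite invr_ge0 exprn_ge0 // ltW.
rewrite expRN ger0_norm; last by rewrite mulr_ge0 // invr_ge0 ltW.
rewrite ler_pdivrMr // -mulrA.
have : x^-1 ^+ n.+2 / n.+2`!%:R <= expR x^-1 by lra.
rewrite ler_pdivrMr // => h2.
have -> : x ^- n = x ^+ 2 * x^-1 ^+ n.+2.
  have x0' : x != 0 by rewrite gt_eqF.
  by rewrite -exprVn !exprS expr0 mulr1; field.
by rewrite [leRHS]mulrCA; apply: ler_wpM2l; [exact: sqr_ge0|rewrite mulrC].
Qed.

Lemma is_derive_quad (f : R -> R) (C : R) : (forall x, `|f x| <= C * x ^+ 2) -> is_derive (0 : R) (1 : R) f 0.
Proof.
move=> fC.
have f0 : f 0 = 0 by apply/normr0_eq0/eqP; rewrite eq_le normr_ge0 andbT; have := fC 0; rewrite expr0n /= mulr0.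
have cn : (fun h : R => C * `|h|) @ 0^' --> (0 : R).
  have h : (fun h : R => C * `|h|) @ 0 --> C * `|0 : R|.
    by apply: cvgMr; apply: cvg_norm; exact: cvg_id.
  by rewrite normr0 mulr0 in h; exact: cvg_within_filter h.
have lim : (fun h => h^-1 *: (f (h *: 1 + 0) - f 0)) @ 0^' --> (0 : R).
  apply: (@squeeze_cvgr _ _ _ _ (fun h => - (C * `|h|)) (fun h => C * `|h|)).
  - near=> h; have h0 : h != 0 by near: h; exact: nbhs_dnbhs_neq.
    rewrite -ler_norml f0 subr0 addr0 /GRing.scale /= mulr1 normrM normfV.
    rewrite ler_pdivrMl ?normr_gt0 //; apply: le_trans (fC _) _.
    by rewrite -(real_normK (num_real h)) expr2 mulrCA.
  - by have h := cvgN cn; rewrite oppr0 in h; exact: h.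
  - exact: cn.
apply: DeriveDef; first by apply/cvg_ex; exists 0.
by apply: cvg_lim.
Unshelve. all: by end_near.
Qed.

Lemma is_derive_flat n (x : R) : is_derive x 1 (flat n) (flat n.+2 x - n%:R * flat n.+1 x).
Proof.
have [x0|x0|x0] := ltgtP 0 x.
- have xn0 : x != 0 by rewrite gt_eqF.
  have di := is_deriveV xn0 (is_derive_id x (1 : R)).
  have de := @is_derive1_comp _ expR (- (fun y : R => y^-1)) x _ _ (is_derive_expR (- x^-1)) (is_deriveN di).
  have h := is_deriveM (is_deriveX n di) de.
  have : is_derive x 1 (fun y : R => y^-1 ^+ n * expR (- y^-1)) (flat n.+2 x - n%:R * flat n.+1 x).
    have -> : (fun y : R => y^-1 ^+ n * expR (- y^-1)) = (fun y => y^-1) ^+ n * (expR \o (- (fun y => y^-1))).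
      by apply/funext => y; rewrite !fctE.
    apply: (is_derive_eq h); rewrite /flat x0 /GRing.scale /= !fctE.
    rewrite -!exprVn; case: n {h} => [|n]; rewrite ?mul0r /= !exprS ?expr0; ring.
  apply: near_eq_is_derive.
  near=> y; have y0 : 0 < y by near: y; exact: lt_nbhsr.
  by rewrite /flat y0 exprVn.
- have : is_derive x 1 (fun _ : R => 0 : R) (flat n.+2 x - n%:R * flat n.+1 x).
    have e : 0 = flat n.+2 x - n%:R * flat n.+1 x by rewrite /flat ltNge ltW //= mulr0 subr0.
    by rewrite -e; exact: is_derive_cst.
  apply: near_eq_is_derive; near=> y.
  have y0 : y < 0 by near: y; exact: lt_nbhsl.
  by rewrite /flat ltNge ltW.
- rewrite -x0 {2 3}/flat ltxx mulr0 subr0.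
  by have [C _ hC] := flat_quad n; apply: is_derive_quad hC.
Unshelve. all: by end_near.
Qed.

Lemma flat_ge0 n x : 0 <= flat n x.
Proof. by rewrite /flat; case: ifP => // x0; rewrite mulr_ge0 ?expR_ge0 // invr_ge0 exprn_ge0 ?ltW. Qed.
Lemma flat0_gt0 x : (0 < flat 0 x) = (0 < x).
Proof. by rewrite /flat; case: ifP => //; rewrite ?ltxx // expr0 invr1 mul1r expR_gt0. Qed.

(** Smoothness as membership in a syntactic class stable under partial derivatives ([smf_rd]): one
    induction then yields all iterated derivatives. The side conditions of [smf_inv] and [smf_ln]
    are required on the whole plane, which is one reason for adding a positive [e] to [TT] below. *)
Inductive smf : (R * R -> R) -> Prop :=
| smf_cst c : smf (fun _ => c)
| smf_fst : smf fst
| smf_snd : smf snd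
| smf_add f g : smf f -> smf g -> smf (fun z => f z + g z)
| smf_mul f g : smf f -> smf g -> smf (fun z => f z * g z)
| smf_inv f : smf f -> (forall z, f z != 0) -> smf (fun z => (f z)^-1)
| smf_ln f : smf f -> (forall z, 0 < f z) -> smf (fun z => ln (f z))
| smf_exp f : smf f -> smf (fun z => expR (f z))
| smf_cos f : smf f -> smf (fun z => cos (f z))
| smf_sin f : smf f -> smf (fun z => sin (f z))
| smf_flat n f : smf f -> smf (fun z => flat n (f z)).

Lemma smfN f : smf f -> smf (fun z => - f z).
Proof.
move=> sf; have -> : (fun z => - f z) = (fun z => -1 * f z) by apply/funext => z; rewrite mulN1r.
by apply: smf_mul => //; exact: smf_cst.
Qed.

Lemma smfB f g : smf f -> smf g -> smf (fun z => f z - g z).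
Proof. by move=> sf sg; apply: smf_add => //; exact: smfN. Qed.

Lemma smf_rd f : smf f -> exists fx fy, [/\ smf fx, smf fy & forall z, rd f z (fx z) (fy z)].
Proof.
elim=> {f} [c|||f g sf [fx [fy [sx sy rf]]] sg [gx [gy [tx ty rg]]]
  |f g sf [fx [fy [sx sy rf]]] sg [gx [gy [tx ty rg]]]
  |f sf [fx [fy [sx sy rf]]] f0|f sf [fx [fy [sx sy rf]]] f0
  |f sf [fx [fy [sx sy rf]]]|f sf [fx [fy [sx sy rf]]]|f sf [fx [fy [sx sy rf]]]
  |n f sf [fx [fy [sx sy rf]]]].
- by exists (fun _ => 0), (fun _ => 0); split; [exact: smf_cst..|move=> z; exact: rd_cst].
- by exists (fun _ => 1), (fun _ => 0); split; [exact: smf_cst..|move=> z; exact: rd_fst].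
- by exists (fun _ => 0), (fun _ => 1); split; [exact: smf_cst..|move=> z; exact: rd_snd].
- by eexists; eexists; split; last (by move=> z; exact: rdD (rf z) (rg z)); exact: smf_add.
- exists (fun z => f z * gx z + fx z * g z), (fun z => f z * gy z + fy z * g z).
  split; [by apply: smf_add; apply: smf_mul..|].
  by move=> z; apply: rd_eq; [exact: rdM (rf z) (rg z)|..]; ring.
- exists (fun z => - fx z * ((f z)^-1 * (f z)^-1)), (fun z => - fy z * ((f z)^-1 * (f z)^-1)).
  split; [by do 2?[apply: smf_mul]; [exact: smfN|exact: smf_inv..]..|].
  by move=> z; apply: rd_eq; [exact: rdV (f0 z) (rf z)|..]; rewrite expr2 invfM; ring.
- exists (fun z => (f z)^-1 * fx z), (fun z => (f z)^-1 * fy z).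
  split; [by apply: smf_mul => //; apply: smf_inv => // z; rewrite gt_eqF..|].
  by move=> z; apply: rd_eq; [exact: rd_comp (rf z) (is_derive1_ln (f0 z))|..]; ring.
- exists (fun z => expR (f z) * fx z), (fun z => expR (f z) * fy z).
  split; [by apply: smf_mul => //; exact: smf_exp..|].
  by move=> z; apply: rd_eq; [exact: rd_comp (rf z) (is_derive_expR (f z))|..]; ring.
- exists (fun z => - sin (f z) * fx z), (fun z => - sin (f z) * fy z).
  split; [by apply: smf_mul => //; apply: smfN; exact: smf_sin..|].
  by move=> z; apply: rd_eq; [exact: rd_comp (rf z) (is_derive_cos (f z))|..]; ring.
- exists (fun z => cos (f z) * fx z), (fun z => cos (f z) * fy z).
  split; [by apply: smf_mul => //; exact: smf_cos..|].
  by move=> z; apply: rd_eq; [exact: rd_comp (rf z) (is_derive_sin (f z))|..]; ring.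
- exists (fun z => (flat n.+2 (f z) - n%:R * flat n.+1 (f z)) * fx z),
    (fun z => (flat n.+2 (f z) - n%:R * flat n.+1 (f z)) * fy z).
  split; [by apply: smf_mul => //; apply: smfB; [exact: smf_flat|apply: smf_mul; [exact: smf_cst|exact: smf_flat]]..|].
  by move=> z; apply: rd_eq; [exact: rd_comp (rf z) (is_derive_flat n (f z))|..]; ring.
Qed.

Lemma smf_smooth f : smf f -> smooth_on setT f.
Proof.
move=> sf vs z _.
have : smf (foldr (fun v g => 'D_v g) f vs).
  elim: vs => [//|v vs /= /smf_rd[fx [fy [sx sy r]]]].
  have -> : 'D_v (foldr (fun v g => 'D_v g) f vs) = (fun z => fx z * v.1 + fy z * v.2).
    by apply/funext => w; rewrite (rd_derive v (r w)).
  by apply: smf_add; apply: smf_mul => //; exact: smf_cst.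
by move=> /smf_rd[fx [fy [_ _ r]]]; exact: rd_diff (r z).
Qed.

Lemma smf_ta1 : smf ta1.
Proof.
rewrite /ta1; apply: smf_mul; first exact: smf_cst.
by apply: smfB; [exact: smf_fst|apply: smf_mul; [exact: smf_snd|exact: smf_cst]].
Qed.

Lemma smf_ta2 : smf ta2.
Proof.
rewrite /ta2; apply: smf_mul; first exact: smf_cst.
by apply: smf_mul; [exact: smf_snd|exact: smf_cst].
Qed.

Lemma smf_TT : smf TT.
Proof.
rewrite /TT; apply: smf_add; [apply: smf_add|]; apply: smfB; try exact: smf_cst; apply: smf_cos.
- exact: smf_ta1.
- exact: smf_ta2.
- by apply: smf_add; [exact: smf_ta1|exact: smf_ta2].
Qed.

Lemma smf_shift f (c : R * R) : smf f -> smf (fun z => f (z + c)).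
Proof.
elim=> {f}; intros; try by [apply: smf_add|apply: smf_mul|apply: smf_inv|apply: smf_ln|apply: smf_exp|
  apply: smf_cos|apply: smf_sin|apply: smf_flat].
- exact: smf_cst.
- by apply: (@smf_add fst (fun _ => c.1)); [exact: smf_fst|exact: smf_cst].
- by apply: (@smf_add snd (fun _ => c.2)); [exact: smf_snd|exact: smf_cst].
Qed.

Lemma mixed_difference (f fx fy fxy : R * R -> R) (z : R * R) (s : R) : 0 < s ->
  (forall w, z.1 <= w.1 <= z.1 + s -> z.2 <= w.2 <= z.2 + s -> rd f w (fx w) (fy w)) ->
  (forall w, z.1 <= w.1 <= z.1 + s -> z.2 <= w.2 <= z.2 + s -> exists a, rd fx w a (fxy w)) ->
  exists2 w, z.1 <= w.1 <= z.1 + s /\ z.2 <= w.2 <= z.2 + s &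
   f (z.1 + s, z.2 + s) - f (z.1 + s, z.2) - f (z.1, z.2 + s) + f z = s ^+ 2 * fxy w.
Proof.
move=> s0 df dfx.
have mvt (g g' : R -> R) a : (forall t, a <= t <= a + s -> is_derive t 1 g (g' t)) ->
    exists2 c, a <= c <= a + s & g (a + s) - g a = s * g' c.
  move=> dg; have as_ : a < a + s by rewrite ltrDl.
  have cg : {within `[a, a + s], continuous g}.
    by apply: derivable_within_continuous => t; rewrite in_itv /= => /dg [].
  have dg' t : t \in `]a, a + s[ -> is_derive t 1 g (g' t).
    by rewrite in_itv /= => /andP[? ?]; apply: dg; rewrite !ltW.
  have [c cI e] := MVT as_ dg' cg; exists c.
    by move: cI; rewrite in_itv /= => /andP[? ?]; rewrite !ltW.
  by rewrite e addrAC subrr add0r mulrC.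
have lx (g : R * R -> R) (x y a b : R) : rd g (x, y) a b -> is_derive x 1 (fun t => g (t, y)) a.
  move=> h; have := @rd_line _ g (0, y) (1, 0) x a b.
  rewrite /= add0r mulr1 mulr0 addr0 => /(_ h) h'; move: (is_derive_eq h' (erefl _)).
  have -> : (fun t : R => g (0 + t * 1, y + t * 0)) = (fun t => g (t, y)).
    by apply/funext => t; rewrite mulr1 mulr0 add0r addr0.
  by rewrite mulr1 mulr0 addr0.
have ly (g : R * R -> R) (x y a b : R) : rd g (x, y) a b -> is_derive y 1 (fun t => g (x, t)) b.
  move=> h; have := @rd_line _ g (x, 0) (0, 1) y a b.
  rewrite /= add0r mulr1 mulr0 addr0 => /(_ h) h'; move: (is_derive_eq h' (erefl _)).
  have -> : (fun t : R => g (x + t * 0, 0 + t * 1)) = (fun t => g (x, t)).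
    by apply/funext => t; rewrite mulr1 mulr0 add0r addr0.
  by rewrite mulr1 mulr0 add0r.
have zs : z.2 <= z.2 <= z.2 + s by rewrite lexx lerDl ltW.
have zs' : z.2 <= z.2 + s <= z.2 + s by rewrite lexx lerDl ltW.
have [c cI e1] := mvt (fun t => f (t, z.2 + s) - f (t, z.2)) (fun t => fx (t, z.2 + s) - fx (t, z.2)) z.1
  (fun t tI => is_deriveB (lx _ _ _ _ _ (df (t, z.2 + s) tI zs')) (lx _ _ _ _ _ (df (t, z.2) tI zs))).
have [d dI e2] : exists2 d, z.2 <= d <= z.2 + s & fx (c, z.2 + s) - fx (c, z.2) = s * fxy (c, d).
  apply: (mvt (fun t => fx (c, t)) (fun t => fxy (c, t))) => t tI.
  by have [a] := dfx (c, t) cI tI; exact: ly.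
exists (c, d) => //; move: e1; rewrite e2 /= => e1.
have -> : f z = f (z.1, z.2) by case: (z).
by rewrite expr2 -mulrA -e1; ring.
Qed.

Lemma rd_swap (f : R * R -> R) z a b : rd f (z.2, z.1) a b -> rd (fun w => f (w.2, w.1)) z b a.
Proof.
move=> hf; have h := @rd_affine R f z a b 0 1 1 0 0 0.
have -> : (fun w => f (w.2, w.1)) = (fun w => f (0 * w.1 + 1 * w.2 + 0, 1 * w.1 + 0 * w.2 + 0)).
  by apply/funext => w; rewrite !mul0r !mul1r !addr0 add0r.
by apply: rd_eq; [apply: h; rewrite !mul0r !mul1r !addr0 add0r; exact: hf|..]; ring.
Qed.

(** The second difference over a square of side [s] is [s^2] times a value of either mixed
    derivative, by [mixed_difference] applied to [f] and to [f] with exchanged variables. If the two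
    differed at [z], continuity would keep their values apart on a small square. *)
Lemma mixed_partials (f fx fy fxy fyx : R * R -> R) (z : R * R) :
  (\forall w \near z, rd f w (fx w) (fy w)) ->
  (\forall w \near z, exists a, rd fx w a (fxy w)) ->
  (\forall w \near z, exists b, rd fy w (fyx w) b) ->
  {for z, continuous fxy} -> {for z, continuous fyx} -> fxy z = fyx z.
Proof.
move=> df dfx dfy cxy cyx; apply/eqP; apply: contrapT => /negP ne.
pose e := `|fxy z - fyx z| / 2.
have e0 : 0 < e by rewrite divr_gt0 // normr_gt0 subr_eq0.
move/cvgrPdist_lt : (cxy) => /(_ e e0) n1.
move/cvgrPdist_lt : (cyx) => /(_ e e0) n2.
have : \forall w \near z, [/\ rd f w (fx w) (fy w), exists a, rd fx w a (fxy w),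
   exists b, rd fy w (fyx w) b, `|fxy z - fxy w| < e & `|fyx z - fyx w| < e].
  by near=> w; split; near: w.
move=> /nbhs_ballP[r /= r0 hr].
pose s := r / 2.
have s0 : 0 < s by rewrite divr_gt0.
have inb (w : R * R) : z.1 <= w.1 <= z.1 + s -> z.2 <= w.2 <= z.2 + s -> ball z r w.
  move=> /andP[a1 a2] /andP[b1 b2]; split; rewrite /ball /= distrC ger0_norm ?subr_ge0 //; rewrite /s in a2 b2 *; lra.
have [p [p1 p2] ep] := @mixed_difference f fx fy fxy z s s0
  (fun w a b => let: And5 h _ _ _ _ := hr w (inb w a b) in h)
  (fun w a b => let: And5 _ h _ _ _ := hr w (inb w a b) in h).
have [q [q1 q2] eq] := @mixed_difference (fun w => f (w.2, w.1)) (fun w => fy (w.2, w.1))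
  (fun w => fx (w.2, w.1)) (fun w => fyx (w.2, w.1)) (z.2, z.1) s s0
  (fun w a b => let: And5 h _ _ _ _ := hr (w.2, w.1) (inb (w.2, w.1) b a) in rd_swap h)
  (fun w a b => let: And5 _ _ (ex_intro c h) _ _ := hr (w.2, w.1) (inb (w.2, w.1) b a) in
     ex_intro _ c (rd_swap h)).
have epq : fxy p = fyx (q.2, q.1).
  have s2 : s ^+ 2 != 0 by rewrite gt_eqF // exprn_gt0.
  apply: (mulfI s2); rewrite -ep -eq /=.
  have -> : f (z.1, z.2) = f z by case: (z).
  by ring.
have [_ _ _ hp _] := hr p (inb p p1 p2).
have [_ _ _ _ hq] := hr (q.2, q.1) (inb (q.2, q.1) q2 q1).
have : `|fxy z - fyx z| < e + e.
  have -> : fxy z - fyx z = (fxy z - fxy p) - (fyx z - fyx (q.2, q.1)) by rewrite epq; ring.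
  by apply: le_lt_trans (ler_normB _ _) _; apply: ltrD.
by rewrite /e -splitr ltxx.
Unshelve. all: by end_near.
Qed.

End smooth_class.

(** * Periodic functions and their integrals over the torus *)

Section periodic.
Context {R : realType}.
Local Notation leb := (@lebesgue_measure R).
Local Notation mu := (lebesgue2 R).
Local Notation s3 := (Num.sqrt (3 : R)).
Local Notation hh := (s3 / 2).
Local Notation P := (fundamental_domain (rho R)).
Local Notation Lam := (lattice (rho R)).
Implicit Types w z c : R * R.

Local Notation PT := (measurableTypeR R * measurableTypeR R)%type.
Local Notation mf f := (measurable_fun [set: PT] (f : PT -> R)).
Local Notation mfp f := (measurable_fun (P : set PT) (f : PT -> R)).

Definition per (f : R * R -> R) :=
  (forall w, f (w + (1, 0)) = f w) /\ (forall w, f (w + rho R) = f w).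

Lemma int_period (T : Type) (f : R * R -> T) v : (forall w, f (w + v) = f w) ->
  forall (m : int) w, f (w + v *~ m) = f w.
Proof.
move=> fv; have H : forall (n : nat) w, f (w + v *+ n) = f w.
  by elim=> [|n IH] w; rewrite ?mulr0n ?addr0 // mulrSr addrA fv IH.
move=> [n|n] w; first exact: H.
by rewrite NegzE mulrNz -(H n.+1 (w - _)) subrK.
Qed.

Lemma latticeP c : Lam c <-> exists m n : int, c = (m%:~R + n%:~R / 2, n%:~R * hh).
Proof.
have fe1 (m : int) : ((1, 0) : R * R) *~ m = (m%:~R, 0).
  rewrite [LHS]surjective_pairing; congr pair.
    by rewrite (raddfMz fst).
  by rewrite (raddfMz snd) /= mul0rz.
have fe2 (n : int) : rho R *~ n = (n%:~R / 2, n%:~R * hh).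
  rewrite [LHS]surjective_pairing; congr pair.
    by rewrite (raddfMz fst) /= mulrzl.
  by rewrite (raddfMz snd) /= mulrzl.
split => -[m [n ->]]; exists m, n; rewrite fe1 fe2.
  by rewrite -[LHS]/(m%:~R + n%:~R / 2, 0 + n%:~R * hh) add0r.
by rewrite -[RHS]/(m%:~R + n%:~R / 2, 0 + n%:~R * hh) add0r.
Qed.

Lemma lattice_period (T : Type) (f : R * R -> T) c : (forall w, f (w + (1, 0)) = f w) ->
  (forall w, f (w + rho R) = f w) -> Lam c -> forall w, f (w + c) = f w.
Proof. by move=> f1 f2 [m [n ->]] w; rewrite addrA !int_period. Qed.
Lemma lattice0 : Lam 0.
Proof. by exists 0, 0; rewrite !mulr0z addr0. Qed.
Lemma latticeN c : Lam c -> Lam (- c).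
Proof. by move=> [m [n ->]]; exists (- m), (- n); rewrite !mulrNz opprD. Qed.
Lemma latticeD c d : Lam c -> Lam d -> Lam (c + d).
Proof. by move=> [m [n ->]] [p [q ->]]; exists (m + p), (n + q); rewrite !mulrzDr addrACA. Qed.
Lemma lattice_1 : Lam (1, 0). Proof. by exists 1, 0; rewrite mulr1z mulr0z addr0. Qed.
Lemma lattice_rho : Lam (rho R). Proof. by exists 0, 1; rewrite mulr1z mulr0z add0r. Qed.

Lemma cell_reduce w : exists2 c, Lam c & 0 <= (w + c).1 < 1 /\ 0 <= (w + c).2 < hh.
Proof.
have h0 := @hh_gt0 R.
pose n := - Num.floor (w.2 / hh); pose m := - Num.floor (w.1 + n%:~R / 2).
exists (m%:~R + n%:~R / 2, n%:~R * hh); first by apply/latticeP; exists m, n.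
rewrite -[(w + _).1]/(w.1 + (m%:~R + n%:~R / 2)) -[(w + _).2]/(w.2 + n%:~R * hh).
have fl (x : R) : 0 <= x + (- Num.floor x)%:~R < 1.
  rewrite rmorphN /= subr_ge0 floor_le_tmp /= ltrBlDl addrC.
  by have := floorD1_gt x; rewrite rmorphD /= addrC.
split.
  have -> : w.1 + (m%:~R + n%:~R / 2) = w.1 + n%:~R / 2 + m%:~R by ring.
  exact: fl.
have -> : w.2 + n%:~R * hh = (w.2 / hh + n%:~R) * hh by rewrite mulrDl divfK // gt_eqF.
have /andP[a b] := fl (w.2 / hh).
apply/andP; split; first by rewrite mulr_ge0 // ltW.
by rewrite -[ltRHS]mul1r ltr_pM2r.
Qed.

Lemma centred_reduce w : exists2 c, Lam c & `|(w + c).1| <= 2^-1 /\ `|(w + c).2| <= hh / 2.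
Proof.
have h0 := @hh_gt0 R.
have [c cL [/andP[a b] /andP[d e]]] := cell_reduce (w + (2^-1, hh / 2)); exists c => //.
move: a b d e; rewrite -[(_ + c).1]/(w.1 + 2^-1 + c.1) -[(_ + c).2]/(w.2 + hh / 2 + c.2).
move=> a b d e; rewrite -[(w + c).1]/(w.1 + c.1) -[(w + c).2]/(w.2 + c.2).
by split; rewrite ler_norml; apply/andP; split; lra.
Qed.

Lemma TT_lattice w c : Lam c -> TT (w + c) = TT w.
Proof. by move=> cL; apply: lattice_period => //; [exact: TT_per1|exact: TT_per2]. Qed.

Lemma TT_0 : TT (0 : R * R) = 0.
Proof.
apply/eqP; rewrite eq_le TT_ge0 andbT; apply: le_trans (TT_le _) _.
by rewrite /nr2 /= expr0n /= addr0 mulr0.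
Qed.

Lemma TT_eq0 w : (TT w = 0) <-> Lam w.
Proof.
split=> [Tw|wL]; last by rewrite -[w]add0r TT_lattice // TT_0.
have [c cL [c1 c2]] := centred_reduce w.
have := TT_ge c1 c2; rewrite TT_lattice // Tw => h.
have : nr2 (w + c) <= 0 by lra.
have q1 := sqr_ge0 (w + c).1; have q2 := sqr_ge0 (w + c).2; rewrite /nr2 => h2.
have /eqP : (w + c).1 ^+ 2 = 0 by lra.
have /eqP : (w + c).2 ^+ 2 = 0 by lra.
rewrite !sqrf_eq0 => /eqP e2 /eqP e1.
have : w + c = 0 by rewrite [LHS]surjective_pairing e1 e2.
by move/eqP; rewrite addr_eq0 => /eqP ->; exact: latticeN.
Qed.

Lemma TT_gt0 w : ~ Lam w -> 0 < TT w.
Proof. by move=> wL; rewrite lt_neqAle TT_ge0 andbT eq_sym; apply/negP => /eqP /TT_eq0. Qed.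
Lemma smf_cts f z : smf f -> {for z, continuous f}.
Proof. by move=> /smf_rd[fx [fy [_ _ r]]]; exact: rd_cts (r z). Qed.
Lemma continuous_TT : continuous (@TT R).
Proof. by move=> z; apply: smf_cts; exact: smf_TT. Qed.

Lemma open_notlattice : open (~` Lam).
Proof.
have -> : ~` Lam = TT @^-1` [set x | 0 < x].
  by apply/seteqP; split=> w /=; [exact: TT_gt0|move=> T0 /TT_eq0 e; rewrite e ltxx in T0].
by apply: open_comp; [move=> w _; exact: continuous_TT|exact: open_gt].
Qed.

Lemma cts_measurable (f : R * R -> R) : continuous f -> measurable_fun [set: R * R] f.
Proof. by move=> fc; apply: cts_measurable2 => [|z _]; [exact: openT|exact: fc]. Qed.

Lemma per_bounded f : per f -> continuous f -> exists M, forall w, `|f w| <= M.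
Proof.
move=> [f1 f2] fc; have h0 := @hh_gt0 R.
pose K : set (R * R) := `[0, 1] `*` `[0, hh].
have Kc : compact K by apply: compact_setX; exact: segment_compact.
have K0 : K !=set0 by exists (0, 0); split; rewrite /= in_itv /= lexx ?ler01 // ltW.
have fKc : {within K, continuous (fun w => `|f w|)}.
  by apply: continuous_subspaceT => w; apply: continuous_comp (fc w) _; exact: norm_continuous.
have [z _ hz] := compact_EVT_max K0 Kc fKc.
exists `|f z| => w; have [c cL [/andP[a b] /andP[d e]]] := cell_reduce w.
rewrite -(lattice_period f1 f2 cL w); apply: hz; rewrite inE.
by split; rewrite /= in_itv /= ?a ?d ltW.
Qed.

Lemma lebesgue_measure_0a (a : R) : 0 < a -> leb `[0, a[%classic = a%:E.
Proof. by move=> a0; have := lebesgue_measure_itv `[0, a[; rewrite /= lte_fin a0 sube0. Qed.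
Lemma measP : measurable (P : set PT). Proof. exact: measurable_fd. Qed.

Lemma muP : mu P = hh%:E.
Proof.
have h0 := @hh_gt0 R.
transitivity (\int[mu]_(w in P) (1 : \bar R))%E.
  by rewrite integral_cst ?mul1e //; exact: measurable_fd.
rewrite (integral_fd (F := fun => 1%E)) //.
rewrite (eq_integral (fun=> 1%E)) => [|y _].
  by rewrite integral_cst // mul1e; exact: lebesgue_measure_0a.
by rewrite integral_cst // mul1e; exact: lebesgue_measure_0a.
Qed.

Definition ip (f : R * R -> R) : R := \int[mu]_(w in P) f w.
Definition itg (f : R * R -> R) := mu.-integrable P (EFin \o f).
Implicit Types (f g : R * R -> R) (M k : R).

Lemma mfP f : mf f -> mfp f. Proof. exact: measurable_funTS. Qed.

Lemma itg_bounded f M : mf f -> (forall w, `|f w| <= M) -> itg f.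
Proof.
move=> fm fM; apply: measurable_bounded_integrable.
- exact: measP.
- by have : (mu P < +oo)%E by rewrite muP ltry.
- exact: mfP.
- exists M; split; rewrite ?num_real // => x Mx w _ /=.
  by rewrite (le_trans (fM w)) // ltW.
Qed.

Lemma itg_cst k : itg (fun=> k).
Proof. by apply: (@itg_bounded _ `|k|). Qed.

Lemma itgD f g : itg f -> itg g -> itg (fun w => f w + g w).
Proof.
move=> hf hg; exact: (integrableD measP hf hg).
Qed.

Lemma itgZ k f : itg f -> itg (fun w => k * f w).
Proof. by move=> hf; have := integrableZl measP k hf. Qed.
Lemma itgB f g : itg f -> itg g -> itg (fun w => f w - g w).
Proof. by move=> hf hg; have := integrableB measP hf hg. Qed.
Lemma itg_norm f : itg f -> itg (fun w => `|f w|).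
Proof. exact: integrable_norm. Qed.

Lemma itg_le f g : mfp f -> (forall w, P w -> `|f w| <= g w) -> itg g -> itg f.
Proof.
move=> fm fg; apply: le_integrable; first exact: measP.
  exact/measurable_EFinP.
by move=> w Pw /=; rewrite lee_fin (le_trans (fg _ Pw)) // ler_norm.
Qed.

Lemma itgM f g M : itg f -> mf g -> (forall w, `|g w| <= M) -> itg (fun w => f w * g w).
Proof.
move=> fi gm gM; have fm : mfp f by apply/measurable_EFinP; exact: measurable_int fi.
apply: (@itg_le _ (fun w => M * `|f w|)); last by apply: itgZ; exact: itg_norm.
  by apply: measurable_funM => //; exact: mfP.
by move=> w _; rewrite normrM mulrC ler_wpM2r.
Qed.

Lemma itg_mf f : itg f -> mfp f.
Proof. by move=> fi; apply/measurable_EFinP; exact: measurable_int fi. Qed.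
Lemma ipD f g : itg f -> itg g -> ip (fun w => f w + g w) = ip f + ip g.
Proof. by move=> hf hg; rewrite /ip RintegralD //; exact: measP. Qed.
Lemma ipB f g : itg f -> itg g -> ip (fun w => f w - g w) = ip f - ip g.
Proof. by move=> hf hg; rewrite /ip RintegralB //; exact: measP. Qed.
Lemma ipZ k f : itg f -> ip (fun w => k * f w) = k * ip f.
Proof. by move=> hf; rewrite /ip RintegralZl //; exact: measP. Qed.
Lemma ip_ge0 f : (forall w, P w -> 0 <= f w) -> 0 <= ip f.
Proof. exact: (@Rintegral_ge0 _ _ _ mu P f). Qed.
Lemma ip_le f g : itg f -> itg g -> (forall w, P w -> f w <= g w) -> ip f <= ip g.
Proof. by move=> hf hg h; exact: (@le_Rintegral _ _ _ mu P f g measP hf hg h). Qed.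

Lemma ip_cst k : ip (fun=> k) = k * hh.
Proof.
transitivity (k * fine (mu P)); first exact: (Rintegral_cst _ measP).
by rewrite muP.
Qed.

Lemma ip_norm f : itg f -> `|ip f| <= ip (fun w => `|f w|).
Proof. by move=> hf; apply: le_normr_Rintegral => //; exact: measP. Qed.
Lemma ip_eq f g : (forall w, P w -> f w = g w) -> ip f = ip g.
Proof. by move=> fg; apply: eq_Rintegral => w; rewrite inE => /fg. Qed.

(** Adding the constant [M] makes the function nonnegative, as [integral_fd_shift] requires. *)
Lemma ip_shift f M c : mf f -> (forall w, `|f w| <= M) -> per f -> ip (fun w => f (w + c)) = ip f.
Proof.
move=> fm fM [f1 f2].
have mshift : measurable_fun [set: R * R] (fun w : R * R => w + c).
  have -> : (fun w : R * R => w + c) = (fun w => (w.1 + c.1, w.2 + c.2)) by apply/funext => -[].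
  by apply: measurable_fun_pair; apply: measurable_funD.
have fcm : mf (fun w => f (w + c)) by exact: measurableT_comp.
apply: (@addIr _ (ip (fun=> M))).
rewrite -!ipD; try by [exact: itg_cst|apply: itg_bounded fM|apply: (@itg_bounded _ M) => // w; exact: fM].
rewrite /ip /Rintegral; congr fine.
rewrite -[RHS](@integral_fd_shift _ (fun w => (f w + M)%:E) c) //.
- by apply/measurable_EFinP; apply: measurable_funD.
- by move=> w; rewrite lee_fin; have := fM w; rewrite ler_norml => /andP[+ _]; lra.
- by move=> w; rewrite f1.
- by move=> w; rewrite f2.
Qed.

Lemma ip_dct_ae (f_ : nat -> R * R -> R) (f g : R * R -> R) (N : set (R * R)) :
  (forall n, mfp (f_ n)) -> mfp f -> mu.-negligible N ->
  (forall w, P w -> ~ N w -> f_ n w @[n --> \oo] --> f w) ->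
  (forall n w, P w -> ~ N w -> `|f_ n w| <= g w) -> itg g ->
  itg f /\ ip (f_ n) @[n --> \oo] --> ip f.
Proof.
move=> fm_ fm N0 f_f f_g gi.
have [] := @dominated_convergence _ _ _ mu P measP (fun n => EFin \o f_ n) (EFin \o f) (EFin \o g).
- by move=> n; exact/measurable_EFinP.
- exact/measurable_EFinP.
- apply: negligibleS N0 => w /= h; apply: contrapT => Nw; apply: h => Pw.
  by apply: cvg_EFin; [exact: nearW|exact: f_f].
- exact: gi.
- apply: negligibleS N0 => w /= h; apply: contrapT => Nw; apply: h => n Pw.
  by rewrite lee_fin f_g.
move=> fi _ lim; split => //; rewrite /ip /Rintegral.
have ff : (\int[mu]_(x in P) (EFin \o f) x)%E \is a fin_num by apply: integrable_fin_num => //; exact: measP.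
by apply: fine_cvg; rewrite fineK.
Qed.

Lemma ip_dct (f_ : nat -> R * R -> R) (f g : R * R -> R) (N : set (R * R)) :
  (forall n, mfp (f_ n)) -> mfp f -> mu.-negligible N ->
  (forall w, P w -> ~ N w -> f_ n w @[n --> \oo] --> f w) ->
  (forall n w, P w -> `|f_ n w| <= g w) -> itg g ->
  itg f /\ ip (f_ n) @[n --> \oo] --> ip f.
Proof.
move=> fm_ fm N0 f_f f_g; apply: (ip_dct_ae fm_ fm N0 f_f) => n w Pw _.
exact: f_g.
Qed.

Lemma P_lattice w : P w -> Lam w -> w = 0.
Proof.
have h0 := @hh_gt0 R.
have int0 (k : int) : 0 <= k -> k < 1 -> k = 0 by case: k => [[|k]|k].
move=> [s [t [/andP[s0 s1] /andP[t0 t1] e]]] /latticeP[m [n wE]].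
have e2 : w.2 = t * hh by rewrite e -[LHS]/(s * 0 + t * hh) mulr0 add0r.
have e1 : w.1 = s + t / 2 by rewrite e -[LHS]/(s * 1 + t * 2^-1) mulr1.
have /eqP : (t - n%:~R) * hh = 0 by move: e2; rewrite wE /= mulrBl => ->; rewrite subrr.
rewrite mulf_eq0 (gt_eqF h0) orbF subr_eq0 => /eqP tn.
have n0 : n = 0.
  by move: t0 t1; rewrite tn ler0z ltrz1; exact: int0.
rewrite n0 in tn wE; rewrite tn mul0r addr0 in e1; rewrite wE !mul0r addr0 /= in e1 *.
have m0 : m = 0.
  by move: s0 s1; rewrite -e1 ler0z ltrz1; exact: int0.
by rewrite m0.
Qed.

Lemma mf_shift f c : mf f -> mf (fun w => f (w + c)).
Proof.
move=> fm; apply: measurableT_comp => //.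
have -> : (fun w : R * R => w + c) = (fun w => (w.1 + c.1, w.2 + c.2)) by apply/funext => -[].
by apply: measurable_fun_pair; apply: measurable_funD.
Qed.

Lemma mf_TT : mf (@TT R).
Proof. by apply: cts_measurable; exact: continuous_TT. Qed.

(** The measure is the integral of a periodic indicator, so translation reduces the claim to
    [z = 0], where the parallelogram contains the single lattice point 0. *)
Lemma negligible_lattice z : mu.-negligible [set w | P w /\ TT (w - z) = 0].
Proof.
pose A z : set PT := [set w | TT (w - z) = 0].
have mA y : measurable (A y).
  have := mf_shift (- y) mf_TT measurableT (measurable_set1 (0 : R)); rewrite setTI.
  exact.
have -> : [set w | P w /\ TT (w - z) = 0] = A z `&` P by apply/seteqP; split => w [].
apply/negligibleP; first by apply: measurableI => //; exact: measP.
transitivity (\int[mu]_(w in P) (\1_(A z) w)%:E)%E; first exact/esym/(integral_indic mu measP (mA z)).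
transitivity (\int[mu]_(w in P) (\1_(A 0) w)%:E)%E.
  rewrite -[RHS](@integral_fd_shift _ (fun w => (\1_(A 0) w)%:E) (- z)).
  - by apply: eq_integral => w _; rewrite !indicE; congr ((nat_of_bool _)%:R%:E); apply/idP/idP; rewrite !inE /A /= subr0.
  - by have : measurable_fun [set: PT] (fun w : PT => (\1_(A 0) w : R)%:E) by apply/measurable_EFinP; exact: measurable_indic.
  - by move=> w; rewrite lee_fin.
  - by move=> w; rewrite !indicE; congr ((nat_of_bool _)%:R%:E); apply/idP/idP; rewrite !inE /A /= !subr0 TT_per1.
  - by move=> w; rewrite !indicE; congr ((nat_of_bool _)%:R%:E); apply/idP/idP; rewrite !inE /A /= !subr0 TT_per2.
transitivity (mu (A 0 `&` P)); first exact: (integral_indic mu measP (mA 0)).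
have -> : A 0 `&` P = [set 0] `*` [set 0].
  apply/seteqP; split => [w [/= + Pw]|w [/= e1 e2]].
    by rewrite /A /= subr0 => /TT_eq0 /(P_lattice Pw) ->.
  have -> : w = 0 by rewrite [LHS]surjective_pairing e1 e2.
  split; first by rewrite /A /= subr0 TT_0.
  by exists 0, 0; rewrite !lexx ltr01; split=> //; rewrite !scale0r addr0.
transitivity (leb [set 0%R] * leb [set 0%R])%E.
  exact: (product_measure1E leb leb (measurable_set1 0) (measurable_set1 0)).
have -> : leb [set 0%R] = 0%E by exact: lebesgue_measure_set1.
by rewrite mul0e.
Qed.

Lemma rd_shift f c w (a b : R) : rd f (w + c) a b -> rd (fun w => f (w + c)) w a b.
Proof.
move=> hf; have h := @rd_affine R f w a b 1 0 0 1 c.1 c.2.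
have -> : (fun w => f (w + c)) = (fun w => f (1 * w.1 + 0 * w.2 + c.1, 0 * w.1 + 1 * w.2 + c.2)).
  by apply/funext => -[x y]; rewrite /= !mul0r !mul1r addr0 add0r.
apply: rd_eq; [apply: h; rewrite !mul0r !mul1r addr0 add0r; exact: hf|..]; ring.
Qed.

Lemma per_rd f gx gy : per f -> (forall w, rd f w (gx w) (gy w)) -> per gx /\ per gy.
Proof.
move=> [f1 f2] df.
have H c : (forall w, f (w + c) = f w) -> forall w, gx (w + c) = gx w /\ gy (w + c) = gy w.
  move=> fc w; apply: (rd_inj (f := f) (z := w)) => //.
  have := rd_shift (df (w + c)).
  by have -> : (fun w => f (w + c)) = f by apply/funext.
by split; split => w; have [] := H _ f1 w; have [] := H _ f2 w.
Qed.

(** Difference quotients of [G] have integral 0 by translation invariance. By the mean value theorem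
    they are values of the derivative nearby, hence uniformly bounded and convergent. *)
Lemma ip_derive0 (G gx gy : R * R -> R) (v : R * R) : per G -> (forall w, rd G w (gx w) (gy w)) ->
  continuous gx -> continuous gy -> ip (fun w => gx w * v.1 + gy w * v.2) = 0.
Proof.
move=> pG dG cx' cy'.
pose g w := gx w * v.1 + gy w * v.2.
have [[px1 px2] [py1 py2]] := per_rd pG dG.
have cg : continuous g by move=> w; apply: cvgD; apply: cvgMl; [exact: cx'|exact: cy'].
have [M gM] : exists M, forall w, `|g w| <= M.
  by apply: per_bounded cg; split => w; rewrite /g ?px1 ?py1 ?px2 ?py2.
have cG : continuous G by move=> w; exact: rd_cts (dG w).
have [K GK] := per_bounded pG cG.
pose s (n : nat) : R := n.+1%:R^-1.
have s0 n : 0 < s n by rewrite invr_gt0.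
pose q n w := (s n)^-1 * (G (w + s n *: v) - G w).
have mvt n w : exists2 c, 0 < c < s n & q n w = g (w + c *: v).
  pose phi t := G (w.1 + t * v.1, w.2 + t * v.2).
  have dphi (t : R) : is_derive (t : R) (1 : R) phi (g (w + t *: v)) by exact: rd_line (dG _).
  have cphi : {within `[0, s n], continuous phi}.
    by apply: derivable_within_continuous => t _; case: (dphi t).
  have [c cI e] := MVT (s0 n) (fun t _ => dphi t) cphi.
  exists c; first by move: cI; rewrite in_itv.
  have p0 : phi 0 = G w by rewrite /phi !mul0r !addr0; case: (w).
  rewrite /q -[G (w + s n *: v)]/(phi (s n)) -p0 e subr0 mulrCA mulVf ?mulr1 // gt_eqF //.
have mG : mf G by exact: cts_measurable.
have bGs n w : `|G (w + s n *: v)| <= K by [].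
have ipq n : ip (q n) = 0.
  rewrite /q ipZ ?ipB ?(@ip_shift _ K) ?subrr ?mulr0 //; last apply: itgB;
    by [apply: (@itg_bounded _ K) => //; exact: mf_shift|apply: (@itg_bounded _ K)].
have mq n : mf (q n) by apply: measurable_funM => //; apply: measurable_funB => //; exact: mf_shift.
have mg : mf g by exact: cts_measurable.
have [] := @ip_dct q g (fun=> M) set0.
- by move=> n; exact: mfP.
- exact: mfP.
- exact: negligible_set0.
- move=> w _ _; apply/cvgrPdist_lt => e e0.
  have /cvgrPdist_lt/(_ e e0)/nbhs_ballP[d /= d0 hd] := cg w.
  have nv : 0 < `|v.1| + `|v.2| + 1 by rewrite ltr_wpDl // addr_ge0.
  near=> n.
  have [c /andP[c0 cs] ->] := mvt n w; apply: hd.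
  have cd : c * (`|v.1| + `|v.2| + 1) < d.
    rewrite -ltr_pdivlMr //; apply: lt_trans cs _.
    by near: n; apply: (cvgr_lt _ (@cvg_harmonic R)); rewrite divr_gt0.
  have c1 := mulr_ge0 (ltW c0) (normr_ge0 v.1); have c2 := mulr_ge0 (ltW c0) (normr_ge0 v.2).
  split; rewrite /ball /= opprD addrA subrr sub0r normrN normrM (gtr0_norm c0); nra.
- by move=> n w _; have [c _ ->] := mvt n w.
- exact: itg_cst.
move=> _ lim; have lim0 : ip (q n) @[n --> \oo] --> (0 : R).
  by under eq_cvg do rewrite ipq; exact: cvg_cst.
exact: (cvg_unique _ lim lim0).
Unshelve. all: by end_near.
Qed.

End periodic.

(** * Regularised logarithmic kernels *)

Section kernels.
Context {R : realType}.
Local Notation leb := (@lebesgue_measure R).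
Local Notation mu := (lebesgue2 R).
Local Notation s3 := (Num.sqrt (3 : R)).
Local Notation hh := (s3 / 2).
Local Notation P := (fundamental_domain (rho R)).
Local Notation PT := (measurableTypeR R * measurableTypeR R)%type.
Local Notation mf f := (measurable_fun [set: PT] (f : PT -> R)).
Local Notation mfp f := (measurable_fun (P : set PT) (f : PT -> R)).
Implicit Types (w z c : R * R) (f g : R * R -> R) (M k : R).

Lemma smf_continuous f : smf f -> continuous f.
Proof. by move=> sf w; exact: smf_cts. Qed.
Lemma smf_mf f : smf f -> mf f.
Proof. by move=> sf; apply: cts_measurable; exact: smf_continuous. Qed.

Lemma laplacianE f fx fy fxx fxy fyx fyy :
  (forall w, rd f w (fx w) (fy w)) -> (forall w, rd fx w (fxx w) (fxy w)) ->
  (forall w, rd fy w (fyx w) (fyy w)) -> laplacian f = (fun w => fxx w + fyy w).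
Proof.
move=> df dfx dfy; apply/funext => w; rewrite /laplacian.
have -> : 'D_(1, 0) f = fx by apply/funext => t; rewrite (rd_derive _ (df t)) /= mulr1 mulr0 addr0.
have -> : 'D_(0, 1) f = fy by apply/funext => t; rewrite (rd_derive _ (df t)) /= mulr1 mulr0 add0r.
by rewrite (rd_derive _ (dfx w)) (rd_derive _ (dfy w)) /= !mulr1 !mulr0 addr0 add0r.
Qed.

Lemma smf_rd2 f : smf f -> exists fx fy fxx fxy fyx fyy,
  [/\ smf fx, smf fy, smf fxx & smf fyy] /\
  [/\ forall w, rd f w (fx w) (fy w), forall w, rd fx w (fxx w) (fxy w),
   forall w, rd fy w (fyx w) (fyy w) & laplacian f = (fun w => fxx w + fyy w)].
Proof.
move=> /smf_rd[fx [fy [sx sy df]]].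
have [fxx [fxy [sxx sxy dfx]]] := smf_rd sx; have [fyx [fyy [syx syy dfy]]] := smf_rd sy.
exists fx, fy, fxx, fxy, fyx, fyy; do 2!split => //.
exact: laplacianE df dfx dfy.
Qed.

Lemma ip_laplacian f : per f -> smf f -> ip (laplacian f) = 0.
Proof.
move=> pf /smf_rd2[fx [fy [fxx [fxy [fyx [fyy [[sx sy sxx syy] [df dfx dfy ->]]]]]]]].
have [px py] := per_rd pf df.
have [pxx pxy] := per_rd px dfx; have [pyx pyy] := per_rd py dfy.
have sxy : continuous fxy.
  by move=> w; have [a [b [_ sb r]]] := smf_rd sx; have -> : fxy = b;
   [apply/funext => t; have [] := rd_inj (dfx t) (r t)|exact: smf_cts].
have syx : continuous fyx.
  by move=> w; have [a [b [sa _ r]]] := smf_rd sy; have -> : fyx = a;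
   [apply/funext => t; have [] := rd_inj (dfy t) (r t)|exact: smf_cts].
have h1 := ip_derive0 (1, 0) px dfx (smf_continuous sxx) sxy.
have h2 := ip_derive0 (0, 1) py dfy syx (smf_continuous syy).
have [M1 b1] := per_bounded pxx (smf_continuous sxx).
have [M2 b2] := per_bounded pyy (smf_continuous syy).
rewrite ipD; [|exact: (itg_bounded (smf_mf sxx) b1)|exact: (itg_bounded (smf_mf syy) b2)].
have -> : ip fxx = 0 by rewrite -h1; apply: ip_eq => w _ /=; rewrite mulr1 mulr0 addr0.
have -> : ip fyy = 0 by rewrite -h2; apply: ip_eq => w _ /=; rewrite mulr1 mulr0 add0r.
by rewrite addr0.
Qed.

Lemma lap_comp (F F1 F2 : R -> R) z : (forall t : R, 0 <= t -> is_derive (t : R) (1 : R) F (F1 t)) ->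
  (forall t : R, 0 <= t -> is_derive (t : R) (1 : R) F1 (F2 t)) ->
  laplacian (fun w => F (TT (w - z))) = (fun w => F2 (TT (w - z)) * (TTx (w - z) ^+ 2 + TTy (w - z) ^+ 2)
    + F1 (TT (w - z)) * (LL * (3 - TT (w - z)))).
Proof.
move=> dF dF1.
pose fx w := F1 (TT (w - z)) * TTx (w - z); pose fy w := F1 (TT (w - z)) * TTy (w - z).
have c1 w : rd (fun w => F1 (TT (w - z))) w (F2 (TT (w - z)) * TTx (w - z)) (F2 (TT (w - z)) * TTy (w - z)).
  by apply: rd_eq; [exact: (rd_comp (rd_shift (rd_TT (w - z))) (dF1 _ (TT_ge0 _)))|..]; cbv beta; ring.
rewrite (@laplacianE _ fx fy
  (fun w => F2 (TT (w - z)) * TTx (w - z) ^+ 2 + F1 (TT (w - z)) * (4 * pi ^+ 2 * (cos (ta1 (w - z)) + cos (ta1 (w - z) + ta2 (w - z)))))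
  (fun w => F2 (TT (w - z)) * TTx (w - z) * TTy (w - z) + F1 (TT (w - z)) * (4 * pi ^+ 2 / s3 * (cos (ta1 (w - z) + ta2 (w - z)) - cos (ta1 (w - z)))))
  (fun w => F2 (TT (w - z)) * TTx (w - z) * TTy (w - z) + F1 (TT (w - z)) * (4 * pi ^+ 2 / s3 * (cos (ta1 (w - z) + ta2 (w - z)) - cos (ta1 (w - z)))))
  (fun w => F2 (TT (w - z)) * TTy (w - z) ^+ 2 + F1 (TT (w - z)) * (4 * pi ^+ 2 / 3 * (4 * cos (ta2 (w - z)) + cos (ta1 (w - z) + ta2 (w - z)) + cos (ta1 (w - z)))))).
- apply/funext => w.
  have -> : LL * (3 - TT (w - z)) = 4 * pi ^+ 2 * (cos (ta1 (w - z)) + cos (ta1 (w - z) + ta2 (w - z))) +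
    4 * pi ^+ 2 / 3 * (4 * cos (ta2 (w - z)) + cos (ta1 (w - z) + ta2 (w - z)) + cos (ta1 (w - z))).
    by rewrite /LL /TT; field.
  by ring.
- by move=> w; apply: rd_eq; [exact: (rd_comp (rd_shift (rd_TT (w - z))) (dF _ (TT_ge0 _)))|..]; rewrite /fx /fy; cbv beta; ring.
- by move=> w; apply: rd_eq; [exact: (rdM (c1 w) (rd_shift (rd_TTx (w - z))))|..]; cbv beta; ring.
- by move=> w; apply: rd_eq; [exact: (rdM (c1 w) (rd_shift (rd_TTy (w - z))))|..]; cbv beta; ring.
Qed.

(** This is [T Delta T - |grad T|^2], that is [T^2 Delta ln T], in the form of [TT_identity] where
    sign and size can be read off. *)
Definition WW w : R := - LL * (TT w ^+ 2 / 4 + Tsig3 w / 2).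

Lemma LL_gt0 : 0 < LL :> R.
Proof. by rewrite /LL; have := exprn_gt0 2 (pi_gt0 R); lra. Qed.

Lemma WW_bound w : - (LL * TT w ^+ 2) <= WW w <= 0.
Proof.
have L0 := LL_gt0; have s0 := Tsig3_ge0 w; have s1 := Tsig3_le w; have T2 := sqr_ge0 (TT w).
rewrite /WW mulNr lerN2 oppr_le0; apply/andP; split.
  by apply: ler_wpM2l; [exact: ltW|lra].
by apply: mulr_ge0; [exact: ltW|lra].
Qed.

Lemma gradT2 w : TTx w ^+ 2 + TTy w ^+ 2 = LL * (3 - TT w) * TT w - WW w.
Proof. by have := TT_identity w; rewrite -/(WW w); lra. Qed.

Lemma is_derive_inv (x : R) : x != 0 -> is_derive (x : R) (1 : R) (@GRing.inv R) (- x ^- 2).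
Proof.
by move=> x0; apply: (is_derive_eq (is_deriveV x0 (is_derive_id x (1 : R)))); rewrite /GRing.scale /= mulr1.
Qed.

(** A smooth stand-in for the Green's function [ln T (w - z)], admissible as a test function for
    every [e > 0]. *)
Definition gl (e : R) z w : R := ln (TT (w - z) + e).

Lemma TTe_gt0 (e : R) w : 0 < e -> 0 < TT w + e.
Proof. by move=> e0; rewrite ltr_wpDl // TT_ge0. Qed.

Lemma smf_gl e z : 0 < e -> smf (gl e z).
Proof.
move=> e0; apply: smf_ln => [|w]; last exact: TTe_gt0.
by apply: smf_add; [exact: (smf_shift (- z) smf_TT)|exact: smf_cst].
Qed.

Lemma per_TTz (F : R -> R) z : per (fun w => F (TT (w - z))).
Proof. by split => w; rewrite addrAC ?TT_per1 ?TT_per2. Qed.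

Lemma lap_gl e z : 0 < e -> laplacian (gl e z) =
  fun w => (WW (w - z) + e * LL * (3 - TT (w - z))) / (TT (w - z) + e) ^+ 2.
Proof.
move=> e0; have te (t : R) : 0 <= t -> 0 < t + e by move=> t0; rewrite ltr_wpDl.
have dt (t : R) : is_derive (t : R) (1 : R) (fun t => t + e) 1.
  by have h := is_deriveD (is_derive_id t (1 : R)) (is_derive_cst e t (1 : R)); apply: (is_derive_eq h); rewrite addr0.
have h1 (t : R) : 0 <= t -> is_derive (t : R) (1 : R) (fun t => ln (t + e)) (t + e)^-1.
  move=> t0; have h := @is_derive1_comp _ (@ln R) (fun t => t + e) t _ _ (is_derive1_ln (te _ t0)) (dt t).
  by apply: (is_derive_eq h); rewrite mulr1.
have h2 (t : R) : 0 <= t -> is_derive (t : R) (1 : R) (fun t => (t + e)^-1) (- (t + e) ^- 2).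
  move=> t0; have tn : t + e != 0 by rewrite gt_eqF // te.
  have h := @is_derive1_comp _ (@GRing.inv R) (fun t => t + e) t _ _ (is_derive_inv tn) (dt t).
  by apply: (is_derive_eq h); rewrite /GRing.scale /= !mulr1.
rewrite /gl (lap_comp z h1 h2); apply/funext => w; rewrite gradT2; have := te _ (TT_ge0 (w - z)).
by move: (TT _) (WW _) => T W T0; field; rewrite gt_eqF.
Qed.

Definition sq (e : R) z w : R := expR (2^-1 * ln (TT (w - z) + e)).

Lemma smf_sq e z : 0 < e -> smf (sq e z).
Proof. by move=> e0; apply: smf_exp; apply: smf_mul; [exact: smf_cst|exact: smf_gl]. Qed.

Lemma lap_sq e z : 0 < e -> laplacian (sq e z) =
  fun w => sq e z w / (TT (w - z) + e) ^+ 2 *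
   (WW (w - z) / 4 + LL * (3 - TT (w - z)) * (TT (w - z) / 4 + e / 2)).
Proof.
move=> e0; have te (t : R) : 0 <= t -> 0 < t + e by move=> t0; rewrite ltr_wpDl.
have dt (t : R) : is_derive (t : R) (1 : R) (fun t => t + e) 1.
  by have h := is_deriveD (is_derive_id t (1 : R)) (is_derive_cst e t (1 : R)); apply: (is_derive_eq h); rewrite addr0.
pose F (t : R) := expR (2^-1 * ln (t + e)).
have dF (t : R) : 0 <= t -> is_derive (t : R) (1 : R) F (F t / (2 * (t + e))).
  move=> t0; have h1 := @is_derive1_comp _ (@ln R) (fun t => t + e) t _ _ (is_derive1_ln (te _ t0)) (dt t).
  have h2 := is_deriveZ (2^-1 : R) h1.
  have h := @is_derive1_comp _ (@expR R) (2^-1 \*: (@ln R \o (fun t => t + e))) t _ _ (is_derive_expR _) h2.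
  apply: (is_derive_eq h); rewrite /F /GRing.scale /= mulr1.
  by field; rewrite gt_eqF // te.
have dF1 (t : R) : 0 <= t -> is_derive (t : R) (1 : R) (fun t => F t / (2 * (t + e))) (- F t / (4 * (t + e) ^+ 2)).
  move=> t0; have tn : 2 * (t + e) != 0 by rewrite mulf_neq0 // gt_eqF // te.
  have h1 := is_deriveZ (2 : R) (dt t).
  have h2 := @is_derive1_comp _ (@GRing.inv R) (2 \*: (fun t => t + e)) t _ _ (is_derive_inv tn) h1.
  have h := is_deriveM (dF t t0) h2.
  apply: (is_derive_eq h).
  rewrite -[((@GRing.inv R) \o _) t]/((2 * (t + e))^-1); move: (F t) => X.
  by rewrite /GRing.scale /=; field; rewrite gt_eqF // te.
rewrite /sq (lap_comp z dF dF1); apply/funext => w; rewrite gradT2 -/(F (TT (w - z))); have := te _ (TT_ge0 (w - z)).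
by move: (TT _) (WW _) (F _) => T W X T0; field; rewrite gt_eqF.
Qed.

(** For each level [k] the truncations [min (f_ n) k], written [tr k] below, are bounded, and
    dominated convergence keeps the bound [B]; monotone convergence then removes the truncation. *)
Lemma ip_fatou (f_ : nat -> R * R -> R) (f : R * R -> R) (N : set (R * R)) (B : R) :
  (forall n, mfp (f_ n)) -> mfp f -> mu.-negligible N ->
  (forall n w, P w -> 0 <= f_ n w) -> (forall w, P w -> 0 <= f w) ->
  (forall w, P w -> ~ N w -> f_ n w @[n --> \oo] --> f w) ->
  (forall n, itg (f_ n)) -> (forall n, ip (f_ n) <= B) ->
  itg f /\ ip f <= B.
Proof.
move=> fm_ fm N0 f0_ f0 f_f fi_ fB.
pose tr (k x : R) := (x + k - `|x - k|) / 2.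
have trP (k x : R) : 0 <= k -> [/\ tr k x <= x, tr k x <= k & 0 <= x -> 0 <= tr k x].
  by move=> k0; rewrite /tr; have [h|h] := ler0P (x - k); split; lra.
have trm (k : R) g : mfp g -> mfp (fun w => tr k (g w)).
  move=> gm; apply: measurable_funM => //; apply: measurable_funB; first exact: measurable_funD.
  by apply: measurableT_comp => //; exact: measurable_funB.
have trB (n : nat) : (\int[mu]_(w in P) (tr n%:R (f w))%:E <= B%:E)%E.
  have n0 : 0 <= n%:R :> R by [].
  have [] := @ip_dct _ (fun m w => tr n%:R (f_ m w)) (fun w => tr n%:R (f w)) (fun=> n%:R) N.
  - by move=> m; exact: trm.
  - exact: trm.
  - exact: N0.
  - move=> w Pw Nw; apply: cvgMl; apply: cvgB; first by apply: cvgD; [exact: f_f|exact: cvg_cst].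
    by apply: cvg_norm; apply: cvgB; [exact: f_f|exact: cvg_cst].
  - move=> m w Pw; have [_ h1 h2] := trP _ (f_ m w) n0.
    by rewrite ger0_norm // h2 // f0_.
  - exact: itg_cst.
  move=> gi lim.
  have le : ip (fun w => tr n%:R (f w)) <= B.
    apply: (ler_cvg_to lim (cvg_cst B)); apply: nearW => m.
    apply: le_trans (fB m); apply: ip_le => //; last by move=> w _; have [] := trP _ (f_ m w) n0.
    apply: (@itg_le _ _ (f_ m)) => //; first exact: trm.
    by move=> w Pw; have [h1 _ h2] := trP _ (f_ m w) n0; rewrite ger0_norm // h2 // f0_.
  have := le; rewrite -lee_fin /ip /Rintegral fineK //; apply: integrable_fin_num => //; exact: measP.
have main : (\int[mu]_(w in P) (f w)%:E <= B%:E)%E.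
  pose g (n : nat) (w : PT) := (tr n%:R (f w))%:E.
  have mg n : measurable_fun (P : set PT) (g n) by apply/measurable_EFinP; exact: trm.
  have g0 n w : P w -> (0 <= g n w)%E.
    by move=> Pw; rewrite lee_fin; have [_ _ h] := trP _ (f w) (ler0n R n); exact: h (f0 _ Pw).
  have gnd w : P w -> {homo g^~ w : n m / (n <= m)%N >-> (n <= m)%E}.
    move=> Pw n m nm; rewrite lee_fin /tr; have : n%:R <= m%:R :> R by rewrite ler_nat.
    by have [h|h] := ler0P (f w - n%:R); have [h'|h'] := ler0P (f w - m%:R); lra.
  have -> : (\int[mu]_(w in P) (f w)%:E = \int[mu]_(w in P) limn (g^~ w))%E.
    apply: eq_integral => w; rewrite inE => Pw; apply/esym/cvg_lim => //.
    apply: cvg_near_cst; exists (Num.bound (f w)) => // n /= bn.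
    have : f w <= n%:R.
      apply: le_trans (ltW (archi_boundP (f0 _ Pw))) _; by rewrite ler_nat.
    by move=> fn; rewrite /g /tr ler0_norm ?subr_le0 //; congr EFin; lra.
  rewrite (monotone_convergence mu measP mg g0 gnd).
  apply: lime_le; last by apply: nearW => n; exact: trB.
  apply: ereal_nondecreasing_is_cvgn => m n mn; apply: ge0_le_integral => //.
  - exact: measP.
  - by move=> w; exact: g0.
  - by move=> w Pw; exact: gnd.
have fi : itg f.
  apply/integrableP; split; first exact/measurable_EFinP.
  have -> : (\int[mu]_(w in P) `|(EFin \o f) w| = \int[mu]_(w in P) (f w)%:E)%E.
    by apply: eq_integral => w; rewrite inE => Pw /=; rewrite ger0_norm // f0.
  exact: le_lt_trans main (ltry _).
split => //; rewrite -lee_fin /ip /Rintegral fineK //; apply: integrable_fin_num => //; exact: measP.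
Qed.

Lemma smf_lap f : smf f -> smf (laplacian f).
Proof. by move=> /smf_rd2[? [? [? [? [? [? [[_ _ sxx syy] [_ _ _ ->]]]]]]]]; exact: smf_add. Qed.

Lemma per_lap f : per f -> smf f -> per (laplacian f).
Proof.
move=> pf /smf_rd2[fx [fy [fxx [fxy [fyx [fyy [_ [df dfx dfy ->]]]]]]]].
have [px py] := per_rd pf df; have [[p1 p2] _] := per_rd px dfx; have [_ [p3 p4]] := per_rd py dfy.
by split => w; rewrite ?p1 ?p2 ?p3 ?p4.
Qed.

Lemma smf_bounded f : per f -> smf f -> exists M, forall w, `|f w| <= M.
Proof. by move=> pf sf; apply: per_bounded => //; exact: smf_continuous. Qed.
Lemma smf_itg f : per f -> smf f -> itg f.
Proof. by move=> pf sf; have [M b] := smf_bounded pf sf; exact: itg_bounded (smf_mf sf) b. Qed.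

(** The power [T^(-1/2)], singular like [1 / |w|]. On the lattice it takes the value 1, because
    [ln 0 = 0]. *)
Definition sT w : R := expR (- 2^-1 * ln (TT w)).

Lemma mf_sT : mf sT.
Proof.
apply: measurableT_comp => //; apply: measurable_funM => //; apply: measurableT_comp => //; exact: mf_TT.
Qed.

(** Integrability without polar coordinates: [sqrt (T + e)] is periodic, so its Laplacian has
    integral 0, while [(T + e)^(-1/2)] is at most [2 / LL] times that Laplacian plus 20. The
    resulting bound does not depend on [e], and [ip_fatou] passes to the limit. *)
Lemma ip_sT : itg sT.
Proof.
pose e (n : nat) : R := n.+1%:R^-1.
have e0 n : 0 < e n by rewrite invr_gt0.
have e1 n : e n <= 1 by rewrite invf_le1 // ler1n.
pose f n w := expR (- 2^-1 * ln (TT w + e n)).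
have sf n : smf (f n).
  apply: smf_exp; apply: smf_mul; first exact: smf_cst.
  by have := smf_gl (0 : R * R) (e0 n); rewrite /gl; under eq_fun do rewrite subr0.
have fE n w : f n w = sq (e n) 0 w / (TT w + e n).
  rewrite /f /sq subr0 -[in X in _ / X](@lnK _ (TT w + e n)) ?posrE ?TTe_gt0 // -expRN -expRD.
  by congr expR; field.
have sq3 n w : sq (e n) 0 w <= 3.
  rewrite /sq subr0 -[leRHS](@lnK _ 3) ?posrE // ler_expR.
  have : ln (TT w + e n) <= ln (3 * 3).
    by rewrite ler_ln ?posrE ?TTe_gt0 //; have := TT_le6 w; have := e1 n; lra.
  by rewrite lnM ?posrE //; lra.
have pf n : per (f n) by rewrite /f; split => w; rewrite ?TT_per1 ?TT_per2.
have [||||||||//] := @ip_fatou f sT (fun w => P w /\ TT (w - 0) = 0) (20 * hh).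
- by move=> n; apply: mfP; exact: smf_mf.
- by apply: mfP; exact: mf_sT.
- exact: negligible_lattice.
- by move=> n w _; exact: expR_ge0.
- by move=> w _; exact: expR_ge0.
- move=> w Pw nT; have T0 : 0 < TT w.
    by rewrite lt_neqAle TT_ge0 andbT eq_sym; apply/negP => /eqP T0; apply: nT; rewrite subr0.
  apply: continuous_cvg; first exact: continuous_expR.
  apply: cvgMr; apply: continuous_cvg.
    by apply: continuous_ln.
  rewrite -[X in _ --> X]addr0; apply: cvgD; [exact: cvg_cst|exact: cvg_harmonic].
- by move=> n; exact: smf_itg.
- move=> n; have psq : per (sq (e n) 0) by exact: (per_TTz (fun t => expR (2^-1 * ln (t + e n))) 0).
  have ssq := smf_sq (0 : R * R) (e0 n).
  have il := smf_itg (per_lap psq ssq) (smf_lap ssq).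
  have -> : 20 * hh = ip (fun w => 2 / LL * laplacian (sq (e n) 0) w + 20).
    by rewrite ipD ?ipZ ?ip_laplacian ?ip_cst ?mulr0 ?add0r //; [exact: itgZ|exact: itg_cst].
  apply: ip_le; [exact: smf_itg|by apply: itgD; [exact: itgZ|exact: itg_cst]|move=> w _].
  rewrite fE lap_sq // subr0.
  have L0 := LL_gt0; have s0 := TTe_gt0 w (e0 n); have T0 := TT_ge0 w; have T6 := TT_le6 w.
  have /andP[W1 W2] := WW_bound w; have X3 := sq3 n w; have X0 : 0 <= sq (e n) 0 w by exact: expR_ge0.
  have [a0 a1] := (ltW (e0 n), e1 n).
  move: (sq _ _ _) X0 X3 => X X0 X3; move: (e n) s0 a0 a1 => a s0 a0 a1.
  pose q := - WW w / LL.
  have WE : WW w = - (LL * q) by rewrite /q; field; rewrite gt_eqF.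
  have q0 : 0 <= q by rewrite /q; apply: divr_ge0; [rewrite oppr_ge0|exact: ltW].
  have qT : q <= TT w ^+ 2 by rewrite /q ler_pdivrMr // mulrC; lra.
  rewrite WE; move: (TT w) T0 T6 s0 qT => T T0 T6 s0 qT.
  pose Y := X / (T + a) ^+ 2.
  have Y0 : 0 <= Y by rewrite /Y divr_ge0 // sqr_ge0.
  have sn : T + a != 0 by rewrite gt_eqF.
  have XY : X = Y * (T + a) ^+ 2 by rewrite /Y divfK // expf_neq0.
  rewrite -subr_ge0.
  have -> : 2 / LL * (X / (T + a) ^+ 2 * (- (LL * q) / 4 + LL * (3 - T) * (T / 4 + a / 2))) + 20 - X / (T + a) =
    20 - Y * (T + a + q / 2 - (3 - T) * (T / 2 + a)).
    by rewrite /Y; field; rewrite sn gt_eqF.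
  rewrite subr_ge0; apply: (@le_trans _ _ (Y * (5 * (T + a) ^+ 2))); last by rewrite mulrCA -XY; lra.
  apply: ler_wpM2l => //.
  have [T1|T1] := leP T 1.
    have h1 : 2 * (T / 2 + a) <= (3 - T) * (T / 2 + a) by apply: ler_wpM2r; lra.
    have h2 : T ^+ 2 <= (T + a) ^+ 2.
      have m1 := mulr_ge0 T0 a0; have m2 := sqr_ge0 a; lra.
    lra.
  have h1 : - (3 - T) * (T / 2 + a) <= 3 * (T + a).
    apply: (@le_trans _ _ (3 * (T / 2 + a))); last by lra.
    by apply: ler_wpM2r; lra.
  have h2 : T ^+ 2 <= (T + a) ^+ 2.
      have m1 := mulr_ge0 T0 a0; have m2 := sqr_ge0 a; lra.
  have h3 : 1 * (T + a) <= (T + a) * (T + a) by apply: ler_wpM2r; lra.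
  by rewrite expr2 in h2 *; lra.
Qed.

Lemma box_ip_gt0 f : continuous f -> per f -> (forall w, 0 <= f w) -> 0 < f 0 -> 0 < ip f.
Proof.
move=> fc pf f0 f00; have h0 := @hh_gt0 R; have s0 := @s3_gt0 R.
have /cvgrPdist_lt/(_ (f 0 / 2)) := fc 0; rewrite divr_gt0 // => /(_ isT)/nbhs_ballP[d /= d0 hd].
pose t : R := Num.min (d / 2) 4^-1.
have t0 : 0 < t by rewrite lt_min !divr_gt0 //= invr_gt0.
have td : t < d by rewrite (@le_lt_trans _ _ (d / 2)) ?ge_min ?lexx //; lra.
have t4 : t <= 4^-1 by rewrite ge_min lexx orbT.
(* A box to the right of the origin, low enough to stay below the slanted side of the
   parallelogram. *)
pose B : set PT := `[t / 2, t] `*` `[0, t / 4].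
have s1 : 1 <= s3 by rewrite -[leLHS](@sqrtr1 R) ler_wsqrtr //; lra.
have BP : B `<=` P.
  move=> w [/=]; rewrite !in_itv /= => /andP[x1 x2] /andP[y1 y2].
  have q0 : 0 <= w.2 / s3 <= t / 4.
    apply/andP; split; first by apply: divr_ge0 => //; exact: ltW.
    by rewrite ler_pdivrMr //; apply: le_trans y2 _; apply: ler_peMr => //; lra.
  have /andP[q1 q2] := q0.
  exists (w.1 - w.2 / s3), (2 * (w.2 / s3)); split; [lra|lra|].
  rewrite [LHS]surjective_pairing.
  rewrite -[RHS]/((w.1 - w.2 / s3) * 1 + 2 * (w.2 / s3) * 2^-1, (w.1 - w.2 / s3) * 0 + 2 * (w.2 / s3) * hh).
  by congr pair; field; rewrite gt_eqF.
have mB : measurable B by apply: measurableX; exact: measurable_itv.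
have fB w : B w -> f 0 / 2 <= f w.
  move=> [/=]; rewrite !in_itv /= => /andP[x1 x2] /andP[y1 y2].
  have : `|f 0 - f w| < f 0 / 2.
    by apply: hd; split; rewrite /ball /= sub0r normrN ger0_norm; lra.
  by rewrite ltr_norml => /andP[_]; lra.
have [M bM] := per_bounded pf fc.
have fi : itg f by exact: itg_bounded (cts_measurable fc) bM.
have ii : itg (fun w => (\1_B w : R)).
  by apply: (@itg_bounded _ _ 1) => [|w]; [exact: measurable_indic|rewrite indicE ger0_norm // lern1 leq_b1].
have : f 0 / 2 * ip (fun w => \1_B w) <= ip f.
  rewrite -ipZ //; apply: ip_le => //; first exact: itgZ.
  move=> w _; rewrite indicE; case: (boolP (w \in B)) => h /=; last by rewrite mulr0.
  by rewrite mulr1; apply: fB; rewrite inE in h.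
apply: lt_le_trans; rewrite mulr_gt0 ?divr_gt0 //.
have -> : ip (fun w => \1_B w) = t / 2 * (t / 4).
  rewrite /ip /Rintegral.
  transitivity (fine (mu (B `&` P))); first by congr fine; exact: (integral_indic mu measP mB).
  rewrite (_ : B `&` P = B); last by apply/seteqP; split => [w []|w Bw] //; split => //; exact: BP.
  transitivity (fine (leb `[(t / 2)%R, t]%classic * leb `[0%R, (t / 4)%R]%classic)%E).
    congr fine; exact: (product_measure1E leb leb (measurable_itv _) (measurable_itv _)).
  have -> : (leb `[(t / 2)%R, t]%classic = (t / 2)%:E).
    have := lebesgue_measure_itv `[t / 2, t]; rewrite /= lte_fin (_ : t / 2 < t = true); last by lra.
    by move=> ->; rewrite -EFinB; congr EFin; lra.
  have -> : (leb `[0%R, (t / 4)%R]%classic = (t / 4)%:E).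
    have := lebesgue_measure_itv `[0%R, t / 4]; rewrite /= lte_fin (_ : 0 < t / 4 = true); last by rewrite divr_gt0.
    by move=> ->; rewrite -EFinB; congr EFin; lra.
  by [].
by rewrite mulr_gt0 ?divr_gt0.
Qed.

End kernels.

(** * The pointwise Liouville equation off the lattice *)

Section pde.
Context {R : realType}.
Local Notation mu := (lebesgue2 R).
Local Notation P := (fundamental_domain (rho R)).
Local Notation Lam := (lattice (rho R)).
Implicit Types (w z c : R * R) (f g : R * R -> R) (M k : R).

Lemma TT_near0 (r : R) : 0 < r -> exists2 d, 0 < d &
  forall w, TT w < d -> exists2 c, Lam c & ball (0 : R * R) r (w + c).
Proof.
move=> r0; exists (4 / 9 * r ^+ 2) => [|w Tw]; first by rewrite mulr_gt0 // exprn_gt0.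
have [c cL [c1 c2]] := centred_reduce w; exists c => //.
have h := TT_ge c1 c2; rewrite TT_lattice // in h.
have : nr2 (w + c) < r ^+ 2 by have := le_lt_trans h Tw; rewrite ltr_pM2l.
have q1 := sqr_ge0 (w + c).1; have q2 := sqr_ge0 (w + c).2; rewrite /nr2 => h2.
split; rewrite /ball /= sub0r normrN -(@ltr_pXn2r _ 2) ?nnegrE ?(ltW r0) //.
  by rewrite real_normK ?num_real //; move: h2 q1 q2; rewrite -[(w + c).1]/(w.1 + c.1) -[(w + c).2]/(w.2 + c.2); lra.
by rewrite real_normK ?num_real //; move: h2 q1 q2; rewrite -[(w + c).1]/(w.1 + c.1) -[(w + c).2]/(w.2 + c.2); lra.
Qed.

Lemma perZ k f : per f -> per (fun w => k * f w).
Proof. by move=> [f1 f2]; split => w; rewrite ?f1 ?f2. Qed.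

Section smooth_off_lattice.
Variable u : R * R -> R.
Hypothesis pu : doubly_periodic_on (rho R) (~` Lam) u.
Hypothesis su : smooth_on (~` Lam) u.
Local Notation it vs := (foldr (fun v g => 'D_v g) u vs).

Lemma smooth_rd vs z : ~ Lam z -> rd (it vs) z (it ((1, 0) :: vs) z) (it ((0, 1) :: vs) z).
Proof. by move=> zL; apply: rdP; exact: su. Qed.
Lemma smooth_cts vs z : ~ Lam z -> {for z, continuous (it vs)}.
Proof. by move=> zL; exact: rd_cts (smooth_rd vs zL). Qed.
Lemma near_off z : ~ Lam z -> \forall w \near z, ~ Lam w.
Proof. by move=> zL; apply: open_nbhs_nbhs; split; [exact: open_notlattice|]. Qed.

Lemma smooth_swap vs z : ~ Lam z -> it [:: (1, 0), (0, 1) & vs] z = it [:: (0, 1), (1, 0) & vs] z.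
Proof.
move=> zL; apply/esym; apply: (@mixed_partials _ (it vs) (it ((1, 0) :: vs)) (it ((0, 1) :: vs))).
- by apply: filterS (near_off zL) => w wL; exact: smooth_rd.
- by apply: filterS (near_off zL) => w wL; eexists; exact: smooth_rd.
- by apply: filterS (near_off zL) => w wL; eexists; exact: smooth_rd.
- exact: (@smooth_cts [:: (0, 1), (1, 0) & vs] z zL).
- exact: (@smooth_cts [:: (1, 0), (0, 1) & vs] z zL).
Qed.

(** The two generating periods are known off the lattice only. Replacing [u] by 0 on the lattice
    gives a function periodic everywhere, hence invariant under every lattice vector; derivatives
    inherit the invariance by locality. *)
Lemma smooth_period vs c z : Lam c -> ~ Lam z -> it vs (z + c) = it vs z.
Proof.
have lat d w : Lam d -> ~ Lam w -> ~ Lam (w + d).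
  by move=> dL wL h; apply: wL; rewrite -[w](addrK d); apply: latticeD => //; exact: latticeN.
have base d w : Lam d -> ~ Lam w -> u (w + d) = u w.
  move=> dL wL; pose f w := if `[< Lam w >] then 0 else u w.
  have fE v : ~ Lam v -> f v = u v by move=> vL; rewrite /f; case: asboolP.
  have fper v e : Lam e -> (forall t, ~ Lam t -> u (t + e) = u t) -> f (v + e) = f v.
    move=> eL ue; rewrite /f; case: asboolP => h1; case: asboolP => h2 //.
    - by case: h2; rewrite -[v](addrK e); apply: latticeD => //; exact: latticeN.
    - by case: h1; exact: latticeD.
    - exact: ue.
  rewrite -!fE //; last exact: lat.
  apply: (lattice_period (f := f)) => // v; apply: fper; try exact: lattice_1; try exact: lattice_rho.
    by move=> t /pu [].
  by move=> t /pu [].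
move=> cL; elim: vs z => [|v vs IH] z zL; first exact: base.
have h : rd (it vs) z (it ((1, 0) :: vs) (z + c)) (it ((0, 1) :: vs) (z + c)).
  apply: rd_near (rd_shift (smooth_rd vs (lat _ _ cL zL))).
  by apply: filterS (near_off zL) => w wL; exact: IH.
have [e1 e2] := rd_inj (smooth_rd vs zL) h.
rewrite /= (rd_derive v (smooth_rd vs zL)) (rd_derive v (smooth_rd vs (lat _ _ cL zL))).
by rewrite e1 e2.
Qed.

Section cutoff.
Variables (phi : R * R -> R) (d : R).
Hypotheses (d0 : 0 < d) (pphi : per phi) (sphi : smf phi) (zphi : forall w, TT w < d -> phi w = 0).

Lemma zero_near z (f : R * R -> R) : (forall w, TT w < d -> f w = 0) -> Lam z -> \forall w \near z, f w = 0.
Proof.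
move=> f0 /TT_eq0 zL; have : \forall w \near z, TT w < d.
  by apply: (cvgr_lt _ (@continuous_TT R z)); rewrite zL.
by apply: filterS => w; exact: f0.
Qed.

Lemma zero_rd (f fx fy : R * R -> R) : (forall w, TT w < d -> f w = 0) ->
  (forall w, rd f w (fx w) (fy w)) -> forall w, TT w < d -> fx w = 0 /\ fy w = 0.
Proof.
move=> f0 df w Tw; apply: rd_inj (df w) _.
apply: (@rd_near _ (fun=> 0)); last exact: rd_cst.
have : \forall v \near w, TT v < d by apply: (cvgr_lt _ (@continuous_TT R w)).
by apply: filterS => v Tv; rewrite f0.
Qed.

Lemma cutoff_cts (f g : R * R -> R) : continuous f -> (forall w, TT w < d -> f w = 0) ->
  (forall z, ~ Lam z -> {for z, continuous g}) -> continuous (fun w => f w * g w).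
Proof.
move=> cf f0 cg z; have [zL|zL] := pselect (Lam z); last by apply: cvgM; [exact: cf|exact: cg].
have n0 := zero_near f0 zL.
have fz : f z * g z = 0 by rewrite (nbhs_singleton n0) mul0r.
rewrite /continuous_at fz; apply: cvg_near_cst; apply: filterS n0 => w ->.
by rewrite mul0r.
Qed.

Lemma cutoff_per (f g : R * R -> R) : per f -> (forall w, TT w < d -> f w = 0) ->
  (forall c z, Lam c -> ~ Lam z -> g (z + c) = g z) -> per (fun w => f w * g w).
Proof.
move=> [f1 f2] f0 gp.
have H c : Lam c -> (forall w, f (w + c) = f w) -> forall w, f (w + c) * g (w + c) = f w * g w.
  move=> cL fc w; rewrite fc; have [/TT_eq0 wL|wL] := pselect (Lam w); last by rewrite gp.
  by rewrite f0 ?mul0r // wL.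
by split; [exact: (H _ lattice_1 f1)|exact: (H _ lattice_rho f2)].
Qed.

Lemma perB f g : per f -> per g -> per (fun w => f w - g w).
Proof. by move=> [f1 f2] [g1 g2]; split => w; rewrite ?f1 ?f2 ?g1 ?g2. Qed.

Lemma cutoff_itg f g : smf f -> per f -> (forall w, TT w < d -> f w = 0) ->
  (forall z, ~ Lam z -> {for z, continuous g}) ->
  (forall c z, Lam c -> ~ Lam z -> g (z + c) = g z) -> itg (fun w => f w * g w).
Proof.
move=> sf pf f0 cg pg; have c := cutoff_cts (smf_continuous sf) f0 cg.
have [M b] := per_bounded (cutoff_per pf f0 pg) c.
exact: itg_bounded (cts_measurable c) b.
Qed.

(** [phi_x u - phi u_x] and its analogue in the other variable extend by 0 across the lattice, since
    [phi] vanishes where [T < d]. They are periodic with continuous derivatives, so [ip_derive0]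
    applies to both. *)
Lemma ip_green : ip (fun w => laplacian phi w * u w) = ip (fun w => phi w * laplacian u w).
Proof.
have [fx [fy [fxx [fxy [fyx [fyy [[sx sy sxx syy] [df dfx dfy ->]]]]]]]] := smf_rd2 sphi.
have [px py] := per_rd pphi df.
have [pxx pxy] := per_rd px dfx; have [pyx pyy] := per_rd py dfy.
have zx := zero_rd zphi df.
have zxx := zero_rd (fun w Tw => (zx w Tw).1) dfx.
have zyy := zero_rd (fun w Tw => (zx w Tw).2) dfy.
have cxy : continuous fxy.
  by move=> w; have [a [b [_ sb r]]] := smf_rd sx; have -> : fxy = b;
   [apply/funext => t; have [] := rd_inj (dfx t) (r t)|exact: smf_cts].
have cyx : continuous fyx.
  by move=> w; have [a [b [sa _ r]]] := smf_rd sy; have -> : fyx = a;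
   [apply/funext => t; have [] := rd_inj (dfy t) (r t)|exact: smf_cts].
have cphi := smf_continuous sphi; have cx' := smf_continuous sx; have cy' := smf_continuous sy.
have cxx := smf_continuous sxx; have cyy := smf_continuous syy.
have z0 w : TT w < d -> phi w = 0 by exact: zphi.
have z1 w (h : TT w < d) := (zx w h).1; have z2 w (h : TT w < d) := (zx w h).2.
have z11 w (h : TT w < d) := (zxx w h).1; have z12 w (h : TT w < d) := (zxx w h).2.
have z21 w (h : TT w < d) := (zyy w h).1; have z22 w (h : TT w < d) := (zyy w h).2.
pose e1 : R * R := (1, 0); pose e2 : R * R := (0, 1).
have cu vs z (zL : ~ Lam z) : {for z, continuous (it vs)} := @smooth_cts vs z zL.
have pu' vs := @smooth_period vs.
have zero_case (X : R * R -> R) : (forall w, TT w < d -> X w = 0) -> forall w, Lam w -> rd X w 0 0.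
  move=> X0 w wL; apply: (@rd_near _ (fun=> 0)); last exact: rd_cst.
  by apply: filterS (zero_near X0 wL) => v ->.
have TL w : Lam w -> TT w < d by move=> /TT_eq0 ->.
have h1 : ip (fun w => fxx w * u w - phi w * it [:: e1; e1] w) = 0.
  pose Xy w := (fx w * it [:: e2] w + fxy w * u w) - (phi w * it [:: e2; e1] w + fy w * it [:: e1] w).
  transitivity (ip (fun w => (fxx w * u w - phi w * it [:: e1; e1] w) * ((1, 0) : R * R).1 + Xy w * ((1, 0) : R * R).2)).
    by apply: ip_eq => w _; rewrite /= mulr1 mulr0 addr0.
  apply: (@ip_derive0 _ (fun w => fx w * u w - phi w * it [:: e1] w)).
  - apply: perB; apply: cutoff_per => //; [exact: (pu' [::])|exact: (pu' [:: e1])].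
  - move=> w; have [wL|wL] := pselect (Lam w).
      have Tw := TL _ wL; apply: rd_eq; first apply: (zero_case _ _ w wL).
      - by move=> v Tv; rewrite (z1 _ Tv) (z0 _ Tv) !mul0r subrr.
      - by rewrite (z11 _ Tw) (z0 _ Tw) !mul0r subrr.
      - by rewrite /Xy (z1 _ Tw) (z0 _ Tw) (z12 _ Tw) (z2 _ Tw) !mul0r !addr0 subrr.
    by apply: rd_eq; [exact: (rdB (rdM (dfx w) (smooth_rd [::] wL)) (rdM (df w) (smooth_rd [:: e1] wL)))|..]; rewrite /Xy /e1 /e2 /=; ring.
  - move=> w; apply: cvgB; apply: cutoff_cts => //; [exact: (cu [::])|exact: (cu [:: e1; e1])].
  - move=> w; apply: cvgB; apply: cvgD; apply: cutoff_cts => //;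
      [exact: (cu [:: e2])|exact: (cu [::])|exact: (cu [:: e2; e1])|exact: (cu [:: e1])].
have h2 : ip (fun w => fyy w * u w - phi w * it [:: e2; e2] w) = 0.
  pose Xy w := (fy w * it [:: e1] w + fyx w * u w) - (phi w * it [:: e1; e2] w + fx w * it [:: e2] w).
  transitivity (ip (fun w => Xy w * ((0, 1) : R * R).1 + (fyy w * u w - phi w * it [:: e2; e2] w) * ((0, 1) : R * R).2)).
    by apply: ip_eq => w _; rewrite /= mulr1 mulr0 add0r.
  apply: (@ip_derive0 _ (fun w => fy w * u w - phi w * it [:: e2] w)).
  - apply: perB; apply: cutoff_per => //; [exact: (pu' [::])|exact: (pu' [:: e2])].
  - move=> w; have [wL|wL] := pselect (Lam w).
      have Tw := TL _ wL; apply: rd_eq; first apply: (zero_case _ _ w wL).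
      - by move=> v Tv; rewrite (z2 _ Tv) (z0 _ Tv) !mul0r subrr.
      - by rewrite /Xy (z1 _ Tw) (z0 _ Tw) (z21 _ Tw) (z2 _ Tw) !mul0r !addr0 subrr.
      - by rewrite (z22 _ Tw) (z0 _ Tw) !mul0r subrr.
    by apply: rd_eq; [exact: (rdB (rdM (dfy w) (smooth_rd [::] wL)) (rdM (df w) (smooth_rd [:: e2] wL)))|..]; rewrite /Xy /e1 /e2 /=; ring.
  - move=> w; apply: cvgB; apply: cvgD; apply: cutoff_cts => //;
      [exact: (cu [:: e1])|exact: (cu [::])|exact: (cu [:: e1; e2])|exact: (cu [:: e2])].
  - move=> w; apply: cvgB; apply: cutoff_cts => //; [exact: (cu [::])|exact: (cu [:: e2; e2])].
have i1 : itg (fun w => fxx w * u w) by exact: (cutoff_itg sxx pxx z11 (cu [::]) (pu' [::])).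
have i2 : itg (fun w => fyy w * u w) by exact: (cutoff_itg syy pyy z22 (cu [::]) (pu' [::])).
have j1 : itg (fun w => phi w * it [:: e1; e1] w) by exact: (cutoff_itg sphi pphi zphi (cu [:: e1; e1]) (pu' [:: e1; e1])).
have j2 : itg (fun w => phi w * it [:: e2; e2] w) by exact: (cutoff_itg sphi pphi zphi (cu [:: e2; e2]) (pu' [:: e2; e2])).
rewrite ipB // in h1; rewrite ipB // in h2.
rewrite (ip_eq (g := fun w => fxx w * u w + fyy w * u w)); last by move=> w _; rewrite mulrDl.
rewrite [RHS](ip_eq (g := fun w => phi w * it [:: e1; e1] w + phi w * it [:: e2; e2] w)); last by move=> w _; rewrite /laplacian mulrDr.
by rewrite (ipD i1 i2) (ipD j1 j2) (subr0_eq h1) (subr0_eq h2).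
Qed.

End cutoff.

(** If [E = Delta u + e^u] were nonzero at [z0], the equation could be tested with a bump in
    [T (w - z0)], supported near the lattice translates of [z0], where [E] keeps its sign. The
    integral of bump times [E] would be both 0 and nonzero. *)
Lemma liouville (c : R) z0 : distributional_equation (rho R) c u -> ~ Lam z0 ->
  laplacian u z0 + expR (u z0) = 0.
Proof.
move=> eqn z0L.
pose E w := laplacian u w + expR (u w).
have cl w : ~ Lam w -> {for w, continuous (laplacian u)}.
  move=> wL; have c1 : {for w, continuous ('D_(1, 0) ('D_(1, 0) u))} := @smooth_cts [:: (1, 0); (1, 0)] w wL.
  have c2 : {for w, continuous ('D_(0, 1) ('D_(0, 1) u))} := @smooth_cts [:: (0, 1); (0, 1)] w wL.
  exact: cvgD c1 c2.
have cE w : ~ Lam w -> {for w, continuous E}.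
  move=> wL; apply: cvgD; last exact: rd_cts (rd_comp (smooth_rd [::] wL) (is_derive_expR (u w))).
  exact: cl.
have pl b w : Lam b -> ~ Lam w -> laplacian u (w + b) = laplacian u w.
  move=> bL wL.
  have q1 : 'D_(1, 0) ('D_(1, 0) u) (w + b) = 'D_(1, 0) ('D_(1, 0) u) w := @smooth_period [:: (1, 0); (1, 0)] b w bL wL.
  have q2 : 'D_(0, 1) ('D_(0, 1) u) (w + b) = 'D_(0, 1) ('D_(0, 1) u) w := @smooth_period [:: (0, 1); (0, 1)] b w bL wL.
  by rewrite /laplacian q1 q2.
have pE b w : Lam b -> ~ Lam w -> E (w + b) = E w.
  move=> bL wL; have q : u (w + b) = u w := @smooth_period [::] b w bL wL.
  by rewrite /E q pl.
apply: contrapT => /eqP Ez.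
pose s : R := Num.sg (E z0).
have sE0 : 0 < s * E z0 by rewrite /s -normrEsg normr_gt0.
have T0 := TT_gt0 z0L; pose d := TT z0 / 2.
have d0 : 0 < d by rewrite divr_gt0.
have n1 : \forall w \near z0, d < TT w.
  by apply: (cvgr_gt _ (@continuous_TT R z0)); rewrite /d; lra.
have csE : {for z0, continuous (fun w => s * E w)} by apply: cvgMr; exact: cE.
have n2 : \forall w \near z0, 0 < s * E w by apply: (cvgr_gt _ csE).
have /nbhs_ballP[r /= r0 hr] : \forall w \near z0, d < TT w /\ 0 < s * E w by near=> w; split; near: w.
have [dl dl0 hdl] := TT_near0 r0.
pose dd := Num.min dl (TT z0).
have dd0 : 0 < dd by rewrite lt_min dl0.
pose phi w := flat 0 (dd - TT (w - z0)).
have pphi : per phi by exact: (per_TTz (fun t => flat 0 (dd - t)) z0).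
have sphi : smf phi.
  by apply: smf_flat; apply: smfB; [exact: smf_cst|exact: (smf_shift (- z0) smf_TT)].
have supp w : 0 < phi w -> ~ Lam w /\ (d < TT w /\ 0 < s * E w).
  rewrite flat0_gt0 subr_gt0 lt_min => /andP[/hdl [b bL hb] _].
  have [a1 a2] : d < TT (w + b) /\ 0 < s * E (w + b).
    apply: hr; move: hb => [/= h1 h2]; split; rewrite /ball /=.
      have : `|0 - (w.1 - z0.1 + b.1)| < r by exact: h1.
      by have -> : z0.1 - (w.1 + b.1) = 0 - (w.1 - z0.1 + b.1) by ring.
    have : `|0 - (w.2 - z0.2 + b.2)| < r by exact: h2.
      by have -> : z0.2 - (w.2 + b.2) = 0 - (w.2 - z0.2 + b.2) by ring.
  rewrite TT_lattice // in a1.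
  have wL : ~ Lam w by move=> /TT_eq0 e; rewrite e in a1; have := lt_trans d0 a1; rewrite ltxx.
  by rewrite pE // in a2.
have zphi w : TT w < d -> phi w = 0.
  move=> Tw; apply/eqP; rewrite eq_le flat_ge0 andbT leNgt; apply/negP => /supp[_ [h _]].
  by have := lt_trans Tw h; rewrite ltxx.
have phi0 : phi 0 = 0 by apply: zphi; rewrite TT_0.
have tphi : torus_test_function (rho R) phi by split; [move=> w _; split; [exact: pphi.1|exact: pphi.2]|exact: smf_smooth].
have := eqn phi tphi; rewrite phi0 mulr0.
have cu vs z (zL : ~ Lam z) : {for z, continuous (it vs)} := @smooth_cts vs z zL.
have ptf : forall b w, Lam b -> ~ Lam w -> expR (u (w + b)) = expR (u w).
  by move=> b w bL wL; have -> : u (w + b) = u w := @smooth_period [::] b w bL wL.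
have ce w : ~ Lam w -> {for w, continuous (fun w => expR (u w))}.
  by move=> wL; exact: rd_cts (rd_comp (smooth_rd [::] wL) (is_derive_expR (u w))).
have il : itg (fun w => phi w * laplacian u w) := cutoff_itg d0 sphi pphi zphi cl pl.
have ie : itg (fun w => phi w * expR (u w)) := cutoff_itg d0 sphi pphi zphi ce ptf.
have -> : \int[mu]_(z in P) (u z * laplacian phi z) = ip (fun w => phi w * laplacian u w).
  by rewrite -(ip_green d0 pphi sphi zphi); apply: ip_eq => w _; rewrite mulrC.
have -> : \int[mu]_(z in P) (expR (u z) * phi z) = ip (fun w => phi w * expR (u w)).
  by apply: ip_eq => w _; rewrite mulrC.
rewrite -ipD // => ip0.
pose f w := s * (phi w * E w).
have cf : continuous f by move=> w; apply: cvgMr; exact: (cutoff_cts d0 (smf_continuous sphi) zphi cE).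
have pf : per f := perZ s (cutoff_per d0 pphi zphi pE).
have f0 w : 0 <= f w.
  rewrite /f mulrCA; have [/supp[_ [_ h]]|h] := ltP 0 (phi w); first by rewrite mulr_ge0 ?flat_ge0 // ltW.
  have -> : phi w = 0 by apply/eqP; rewrite eq_le h flat_ge0.
  by rewrite mul0r.
have ipf : ip f = 0.
  rewrite /f ipZ; last exact: (cutoff_itg d0 sphi pphi zphi cE pE).
  by rewrite (ip_eq (g := fun w => phi w * laplacian u w + phi w * expR (u w))) ?ip0 ?mulr0 // => w _; rewrite mulrDr.
have [M bM] := per_bounded pf cf.
have : 0 < ip (fun w => f (w + z0)).
  apply: box_ip_gt0.
  - move=> w; apply: (@continuous_comp _ _ _ (fun w => w + z0) f); last exact: cf.
    by apply: cvgD; [exact: cvg_id|exact: cvg_cst].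
  - by split => w; rewrite addrAC; [exact: pf.1|exact: pf.2].
  - by move=> w; exact: f0.
  - rewrite add0r /f mulrCA mulr_gt0 //.
    by rewrite flat0_gt0 subr_gt0 subrr TT_0.
rewrite (ip_shift z0 (cts_measurable cf) bM pf) ipf ltxx //.
Unshelve. all: by end_near.
Qed.

End smooth_off_lattice.
End pde.

(** * Calculus of one real variable *)

Section derive1d.
Context {R : realType}.
Implicit Types (f g : R -> R) (x a b c : R).
Local Notation dv f x a := (is_derive (x : R) (1 : R) f a).

Lemma dv_eq f x a b : dv f x a -> a = b -> dv f x b.
Proof. by move=> h <-. Qed.
Lemma dv_cst c x : dv (fun=> c) x 0.
Proof. exact: is_derive_cst. Qed.
Lemma dv_id x : dv (fun t => t) x 1.
Proof. exact: is_derive_id. Qed.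
Lemma dvD f g x a b : dv f x a -> dv g x b -> dv (fun t => f t + g t) x (a + b).
Proof. by move=> hf hg; exact: is_deriveD. Qed.
Lemma dvN f x a : dv f x a -> dv (fun t => - f t) x (- a).
Proof. by move=> hf; exact: is_deriveN. Qed.
Lemma dvB f g x a b : dv f x a -> dv g x b -> dv (fun t => f t - g t) x (a - b).
Proof. by move=> hf hg; exact: is_deriveB. Qed.

Lemma dvM f g x a b : dv f x a -> dv g x b -> dv (fun t => f t * g t) x (a * g x + f x * b).
Proof.
by move=> hf hg; apply: (dv_eq (is_deriveM hf hg)); rewrite /GRing.scale /= addrC [g x * a]mulrC.
Qed.

Lemma dv_sqr f x a : dv f x a -> dv (fun t => f t ^+ 2) x (2 * f x * a).
Proof.
move=> hf; have -> : (fun t => f t ^+ 2) = (fun t => f t * f t) by apply/funext => t; rewrite expr2.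
by apply: (dv_eq (dvM hf hf)); ring.
Qed.

Lemma cvg_sqr (T : Type) (F : set_system T) {FF : Filter F} (h : T -> R) (l : R) :
  h @ F --> l -> (fun t => h t ^+ 2) @ F --> l ^+ 2.
Proof.
move=> hl; have -> : (fun t => h t ^+ 2) = (fun t => h t * h t) by apply/funext => t; rewrite expr2.
by rewrite expr2; exact: cvgM.
Qed.

Lemma cvg_cont (T : Type) (F : set_system T) {FF : Filter F} (h : R -> R) (u : T -> R) (l : R) :
  {for l, continuous h} -> u @ F --> l -> (fun t => h (u t)) @ F --> h l.
Proof. by move=> ch ul; apply: (@cvg_comp _ _ _ u h _ (nbhs l)). Qed.
Lemma dvC f g x a b : dv f x a -> dv g (f x) b -> dv (fun t => g (f t)) x (b * a).
Proof. by move=> hf hg; exact: is_derive1_comp. Qed.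

Lemma dvV f x a : f x != 0 -> dv f x a -> dv (fun t => (f t)^-1) x (- a / f x ^+ 2).
Proof.
move=> f0 hf; have h := dvC hf (is_deriveV f0 (is_derive_id (f x) (1 : R))).
by apply: (dv_eq h); rewrite /GRing.scale /= mulr1; ring.
Qed.

Lemma dv_mvt f (f' : R -> R) a b : a < b -> (forall x, a <= x <= b -> dv f x (f' x)) ->
  exists2 c, a < c < b & f b - f a = f' c * (b - a).
Proof.
move=> ab df.
have fc : {within `[a, b], continuous f}.
  by apply: derivable_within_continuous => t; rewrite in_itv /= => /df [].
have df' t : t \in `]a, b[ -> dv f t (f' t).
  by rewrite in_itv /= => /andP[h1 h2]; apply: df; rewrite !ltW.
have [c] := MVT ab df' fc.
by rewrite in_itv /= => cI e; exists c.
Qed.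

End derive1d.

(** * The mass of the logarithmic singularity *)

Section mass.
Context {R : realType}.
Local Notation leb := (@lebesgue_measure R).
Local Notation mu := (lebesgue2 R).
Local Notation s3 := (Num.sqrt (3 : R)).
Local Notation hh := (s3 / 2).
Local Notation PT := (measurableTypeR R * measurableTypeR R)%type.
Local Notation mf f := (measurable_fun [set: PT] (f : PT -> R)).
Implicit Types (w z c : R * R) (f g : R * R -> R) (M k : R).

Lemma integral_deriv (F f : R -> R) (a b : R) : a < b ->
  (forall x : R, is_derive (x : R) (1 : R) F (f x)) -> continuous f ->
  (\int[leb]_(x in `[a, b]) (f x)%:E = (F b - F a)%:E)%E.
Proof.
move=> ab dF cf; rewrite EFinB; apply: continuous_FTC2 => //.
- exact: continuous_subspaceT.
- have cF x : {for x, continuous F}.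
    by apply: differentiable_continuous; apply/derivable1_diffP; case: (dF x).
  split; first by move=> x _; case: (dF x).
    by apply: cvg_at_right_filter; exact: cF.
  by apply: cvg_at_left_filter; exact: cF.
- by move=> x _; rewrite derive1E; case: (dF x) => _ ->.
Qed.

Section rectangle.
Variables (a b c d : R).
Let B : set PT := `[a, b] `*` `[c, d].

Lemma measurable_box : measurable B.
Proof. by apply: measurableX; exact: measurable_itv. Qed.

Lemma box_finite : (mu B < +oo)%E.
Proof.
have -> : mu B = (leb `[a, b]%classic * leb `[c, d]%classic)%E.
  exact: (product_measure1E leb leb (measurable_itv _) (measurable_itv _)).
have h (x y : R) : (leb `[x, y]%classic < +oo)%E.
  have := lebesgue_measure_itv `[x, y]; rewrite /= => ->; case: ifP => _; last exact: ltry.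
  by rewrite -EFinB ltry.
have f (x y : R) : leb `[x, y]%classic \is a fin_num by rewrite ge0_fin_numE.
by rewrite -(fineK (f a b)) -(fineK (f c d)) -EFinM ltry.
Qed.

Variable g : R * R -> R.
Hypothesis cg : continuous g.

Lemma box_bounded : exists M, forall w, B w -> `|g w| <= M.
Proof.
have [ab|ab] := leP a b; last by exists 0 => w [/=]; rewrite in_itv /= => /andP[h1 h2]; have := le_lt_trans (le_trans h1 h2) ab; rewrite ltxx.
have [cd|cd] := leP c d; last by exists 0 => w [_ /=]; rewrite in_itv /= => /andP[h1 h2]; have := le_lt_trans (le_trans h1 h2) cd; rewrite ltxx.
have Kc : compact (`[a, b] `*` `[c, d] : set (R * R)) by apply: compact_setX; exact: segment_compact.
have K0 : (`[a, b] `*` `[c, d] : set (R * R)) !=set0 by exists (a, c); split; rewrite /= in_itv /= lexx.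
have gc : {within (`[a, b] `*` `[c, d] : set (R * R)), continuous (fun w => `|g w|)}.
  by apply: continuous_subspaceT => w; apply: (@continuous_comp _ _ _ g (fun x : R => `|x|)); [exact: cg|exact: norm_continuous].
have [z _ hz] := compact_EVT_max K0 Kc gc.
by exists `|g z| => w Bw; apply: hz; rewrite inE.
Qed.

Lemma box_integrable : mu.-integrable B (EFin \o g).
Proof.
have [M hM] := box_bounded.
apply: measurable_bounded_integrable; [exact: measurable_box|exact: box_finite| |].
  by apply: measurable_funTS; exact: cts_measurable.
exists M; split; rewrite ?num_real // => x Mx w Bw /=.
by rewrite (le_trans (hM _ Bw)) // ltW.
Qed.

Lemma restr_integrable : mu.-integrable [set: PT] ((fun w : PT => (g w)%:E) \_ B).
Proof.
have := box_integrable; move/(integrable_mkcond (fun w : PT => (g w)%:E) measurable_box); exact.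
Qed.

Lemma fubini_xy : (\int[mu]_(w in B) (g w)%:E =
  \int[leb]_(y in `[c, d]) \int[leb]_(x in `[a, b]) (g (x, y))%:E)%E.
Proof.
rewrite integral_mkcond -(integral21_prod_meas1 restr_integrable).
rewrite [RHS]integral_mkcond; apply: eq_integral => y _; rewrite /fubini_G /patch.
case: ifPn => [|/negP hy]; last first.
  rewrite -[RHS](integral0 leb setT); apply: eq_integral => x _.
  by case: ifPn => //; rewrite inE => -[/= _ h]; exfalso; apply: hy; rewrite inE.
rewrite inE /= => yh; rewrite [RHS]integral_mkcond; apply: eq_integral => x _; rewrite /patch.
by congr (if _ then _ else _); apply/idP/idP; rewrite !inE /=; [case|move=> xh; split].
Qed.

Lemma fubini_yx : (\int[mu]_(w in B) (g w)%:E =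
  \int[leb]_(x in `[a, b]) \int[leb]_(y in `[c, d]) (g (x, y))%:E)%E.
Proof.
rewrite integral_mkcond -(integral12_prod_meas1 restr_integrable).
rewrite [RHS]integral_mkcond; apply: eq_integral => x _; rewrite /fubini_F /patch.
case: ifPn => [|/negP hx]; last first.
  rewrite -[RHS](integral0 leb setT); apply: eq_integral => y _.
  by case: ifPn => //; rewrite inE => -[/= h _]; exfalso; apply: hx; rewrite inE.
rewrite inE /= => xh; rewrite [RHS]integral_mkcond; apply: eq_integral => y _; rewrite /patch.
by congr (if _ then _ else _); apply/idP/idP; rewrite !inE /=; [case|move=> yh; split].
Qed.

End rectangle.

Let Q0 : set PT := `[0, 1[ `*` `[0, hh[.

Lemma ip_Q0 f : continuous f -> per f -> (forall w, 0 <= f w) ->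
  ip f = \int[mu]_(w in Q0) f w.
Proof.
move=> cf [f1 f2] f0; have mff := cts_measurable cf.
rewrite /ip /Rintegral; congr fine.
rewrite (integral_fd (F := fun w => (f w)%:E)); first last.
- by move=> w; rewrite f1.
- by move=> w; rewrite lee_fin.
- by have : measurable_fun [set: PT] (fun w : PT => (f w)%:E) by apply/measurable_EFinP.
have mQ : measurable Q0 by apply: measurableX; exact: measurable_itv.
rewrite [RHS]integral_mkcond fubini_tonelli2; first last.
- by move=> w; apply: erestrict_ge0 => v _; rewrite lee_fin.
- by apply/(measurable_restrictT _ _).1 => //; apply: measurable_funTS; apply/measurable_EFinP.
rewrite [LHS]integral_mkcond; apply: eq_integral => y _; rewrite /fubini_G /patch.
case: ifPn => [|/negP hy]; last first.
  rewrite -[LHS](integral0 leb setT); apply: eq_integral => x _.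
  by case: ifPn => //; rewrite inE => -[/= _ h]; exfalso; apply: hy; rewrite inE.
rewrite inE /= => yh; rewrite [LHS]integral_mkcond; apply: eq_integral => x _; rewrite /patch.
by congr (if _ then _ else _); apply/idP/idP; rewrite !inE /=; [move=> xh; split|case].
Qed.

Lemma dct_bounded (D : set PT) (f_ : nat -> R * R -> R) (f : R * R -> R) (N : set (R * R)) M :
  measurable D -> (mu D < +oo)%E ->
  (forall n, measurable_fun D (f_ n : PT -> R)) -> measurable_fun D (f : PT -> R) -> mu.-negligible N ->
  (forall w, D w -> ~ N w -> f_ n w @[n --> \oo] --> f w) ->
  (forall n w, D w -> `|f_ n w| <= M) ->
  \int[mu]_(w in D) (f_ n w) @[n --> \oo] --> \int[mu]_(w in D) f w.
Proof.
move=> mD fD fm_ fm N0 f_f f_M.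
have gi : mu.-integrable D (EFin \o (fun=> M)).
  apply: measurable_bounded_integrable => //.
  by exists `|M|; split; rewrite ?num_real // => x Mx w _ /=; exact: ltW.
have [] := @dominated_convergence _ _ _ mu D mD (fun n => EFin \o f_ n) (EFin \o f) (EFin \o (fun=> M)).
- by move=> n; exact/measurable_EFinP.
- exact/measurable_EFinP.
- apply: negligibleS N0 => w /= h; apply: contrapT => Nw; apply: h => Dw.
  by apply: cvg_EFin; [exact: nearW|exact: f_f].
- exact: gi.
- by apply: aeW => w n Dw; rewrite lee_fin f_M.
move=> fi _ lim; rewrite /Rintegral.
have ff : (\int[mu]_(x in D) (EFin \o f) x)%E \is a fin_num by apply: integrable_fin_num.
by apply: fine_cvg; rewrite fineK.
Qed.
Let K2 : R := 4 * pi ^+ 2.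
Let K2_gt0 : 0 < K2. Proof. by rewrite /K2; have := exprn_gt0 2 (pi_gt0 R); lra. Qed.
Definition Dq (e x y : R) : R := K2 * (x ^+ 2 + y ^+ 2) + e.

Lemma Dq_gt0 e x y : 0 < e -> 0 < Dq e x y.
Proof. by move=> e0; rewrite /Dq ltr_wpDl // mulr_ge0 ?(ltW K2_gt0) // addr_ge0 // sqr_ge0. Qed.

(** The model of [Kq]: [T] is replaced by its quadratic part, for which explicit primitives
    exist. *)
Definition kq (e : R) w : R := e / Dq e w.1 w.2 ^+ 2.
(** The derivative of [x / (2 Dq)] in [x], see [gq_deriv]. Together with the exchanged copy it
    writes [kq] as the divergence of [w / (2 Dq)]. *)
Definition gq (e x y : R) : R := (2 * Dq e x y)^-1 - K2 * x ^+ 2 / Dq e x y ^+ 2.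

Lemma kq_split e w : 0 < e -> kq e w = gq e w.1 w.2 + gq e w.2 w.1.
Proof.
move=> e0; have D0 := Dq_gt0 w.1 w.2 e0.
have -> : gq e w.2 w.1 = (2 * Dq e w.1 w.2)^-1 - K2 * w.2 ^+ 2 / Dq e w.1 w.2 ^+ 2.
  by rewrite /gq /Dq [w.2 ^+ 2 + _]addrC.
rewrite /kq /gq; have : e = Dq e w.1 w.2 - K2 * (w.1 ^+ 2 + w.2 ^+ 2) by rewrite /Dq; ring.
move: (Dq _ _ _) D0 => D D0 ->; field; by rewrite gt_eqF.
Qed.

Lemma gq_deriv e y (s x : R) : 0 < e ->
  is_derive (x : R) (1 : R) (fun x => (x - s) / (2 * Dq e (x - s) y)) (gq e (x - s) y).
Proof.
move=> e0; have Dn : Dq e (x - s) y != 0 by rewrite gt_eqF // Dq_gt0.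
have dX := dvB (dv_id x) (dv_cst s x).
have dD : is_derive (x : R) (1 : R) (fun t => Dq e (t - s) y) (2 * K2 * (x - s)).
  apply: (dv_eq (dvD (dvM (dv_cst K2 x) (dvD (dv_sqr dX) (dv_cst (y ^+ 2) x))) (dv_cst e x))).
  by cbv beta; ring.
have nz : 2 * Dq e (x - s) y != 0 by rewrite mulf_neq0.
have h := dvM dX (@dvV R (fun t => 2 * Dq e (t - s) y) x _ nz (dvM (dv_cst (2 : R) x) dD)).
apply: (dv_eq h); rewrite /gq; cbv beta.
by move: (Dq _ _ _) Dn {nz dD} => D Dn; field.
Qed.

Lemma continuous_Dq e (f g : R * R -> R) : continuous f -> continuous g ->
  continuous (fun w => Dq e (f w) (g w)).
Proof.
move=> cf cg w; apply: cvgD; last exact: cvg_cst.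
by apply: cvgMr; apply: cvgD; apply: cvg_sqr; [exact: cf|exact: cg].
Qed.

Lemma continuous_gq e (f g : R * R -> R) : 0 < e -> continuous f -> continuous g ->
  continuous (fun w => gq e (f w) (g w)).
Proof.
move=> e0 cf cg w; have cD := @continuous_Dq e _ _ cf cg.
have Dn : Dq e (f w) (g w) != 0 by rewrite gt_eqF // Dq_gt0.
apply: cvgB; first by apply: cvgV; [rewrite mulf_neq0|apply: cvgMr; exact: cD].
apply: cvgM; first by apply: cvgMr; apply: cvg_sqr; exact: cf.
by apply: cvgV; [rewrite expf_neq0|apply: cvg_sqr; exact: cD].
Qed.
Let a : R := 4^-1.
Let s1 : R := 2^-1.
Let s2 : R := hh / 2.
Let S : set PT := `[s1 - a, s1 + a] `*` `[s2 - a, s2 + a].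

Let ae : 0 < a. Proof. by rewrite invr_gt0. Qed.

(** The flux of [w / (2 Dq)] through a pair of opposite sides of the square of half-side [a]; the
    integral along a side is an arctangent. *)
Definition Jq (e : R) : R := a / (pi * Num.sqrt (K2 * a ^+ 2 + e)) * atan (2 * pi * a / Num.sqrt (K2 * a ^+ 2 + e)).

Lemma integral_outer e s : 0 < e ->
  (\int[leb]_(y in `[(s - a)%R, (s + a)%R]) (a / Dq e a (y - s))%:E = (Jq e)%:E)%E.
Proof.
move=> e0; pose c := Num.sqrt (K2 * a ^+ 2 + e).
have p0 : 0 < K2 * a ^+ 2 + e by rewrite ltr_wpDl // mulr_ge0 ?(ltW K2_gt0) // sqr_ge0.
have c0 : 0 < c by rewrite sqrtr_gt0.
have c2 : c ^+ 2 = K2 * a ^+ 2 + e by rewrite sqr_sqrtr // ltW.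
pose F (y : R) := a / (2 * pi * c) * atan (2 * pi / c * (y - s)).
have dF (y : R) : is_derive (y : R) (1 : R) F (a / Dq e a (y - s)).
  have dX := dvM (dv_cst (2 * pi / c) y) (dvB (dv_id y) (dv_cst s y)).
  have h := dvM (dv_cst (a / (2 * pi * c)) y) (dvC dX (is_derive1_atan (2 * pi / c * (y - s)))).
  apply: (dv_eq h).
  have Dn := Dq_gt0 a (y - s) e0; have pi0 := pi_gt0 R.
  have E : Dq e a (y - s) = c ^+ 2 + 4 * pi ^+ 2 * (y - s) ^+ 2 by rewrite c2 /Dq /K2; ring.
  have q0 : c ^+ 2 + 4 * pi ^+ 2 * (y - s) ^+ 2 != 0 by rewrite -E gt_eqF.
  rewrite E; move: (y - s) q0 => t q0.
  have -> : 1 + (2 * pi / c * t) ^+ 2 = (c ^+ 2 + 4 * pi ^+ 2 * t ^+ 2) / c ^+ 2 by field; rewrite gt_eqF.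
  have cn : c != 0 by rewrite gt_eqF.
  have pn : (pi : R) != 0 by rewrite gt_eqF.
  move: (pi : R) pn q0 {E h dX Dn pi0 F} => p pn q0.
  rewrite mul0r add0r mul0r add0r subr0 mulr1 invf_div.
  field.
  by rewrite ?cn ?pn ?q0.
have ab : s - a < s + a by rewrite ltrD2l -subr_gt0 opprK addr_gt0.
have cf : continuous (fun y => a / Dq e a (y - s)).
  move=> y; apply: cvgMr; apply: cvgV; first by rewrite gt_eqF // Dq_gt0.
  apply: cvgD; last exact: cvg_cst.
  apply: cvgMr; apply: cvgD; first exact: cvg_cst.
  by apply: cvg_sqr; apply: cvgB; [exact: cvg_id|exact: cvg_cst].
rewrite (integral_deriv ab dF cf) /F /Jq -/c; congr EFin.
have -> : 2 * pi / c * (s + a - s) = 2 * pi * a / c by ring.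
have -> : 2 * pi / c * (s - a - s) = - (2 * pi * a / c) by ring.
have cn : c != 0 by rewrite gt_eqF.
have pn : (pi : R) != 0 by rewrite gt_eqF // pi_gt0.
rewrite atanN; move: (atan _) => A; move: (pi : R) pn => p pn.
field.
by rewrite ?cn ?pn.
Qed.

Lemma integral_gq e s y : 0 < e ->
  (\int[leb]_(x in `[(s - a)%R, (s + a)%R]) (gq e (x - s) y)%:E = (a / Dq e a y)%:E)%E.
Proof.
move=> e0; pose F x := (x - s) / (2 * Dq e (x - s) y).
have ab : s - a < s + a by rewrite ltrD2l -subr_gt0 opprK addr_gt0.
have dF (x : R) : is_derive (x : R) (1 : R) F (gq e (x - s) y) by exact: gq_deriv.
have cf : continuous (fun x => gq e (x - s) y).
  move=> x; have cs : (fun x => x - s) @ x --> x - s by apply: cvgB; [exact: cvg_id|exact: cvg_cst].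
  have cD : (fun x => Dq e (x - s) y) @ x --> Dq e (x - s) y.
    by apply: cvgD; [apply: cvgMr; apply: cvgD; [exact: cvg_sqr|exact: cvg_cst]|exact: cvg_cst].
  have Dn : Dq e (x - s) y != 0 by rewrite gt_eqF // Dq_gt0.
  apply: cvgB; first by apply: cvgV; [rewrite mulf_neq0|apply: cvgMr; exact: cD].
  apply: cvgM; first by apply: cvgMr; exact: cvg_sqr.
  by apply: cvgV; [rewrite expf_neq0|exact: cvg_sqr].
rewrite (integral_deriv ab dF cf) /F; congr EFin.
have -> : s + a - s = a by ring.
have -> : s - a - s = - a by ring.
have -> : Dq e (- a) y = Dq e a y by rewrite /Dq sqrrN.
by field; rewrite gt_eqF // Dq_gt0.
Qed.

Lemma integral_kq e : 0 < e -> \int[mu]_(w in S) kq e (w - (s1, s2)) = 2 * Jq e.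
Proof.
move=> e0.
have c1 : continuous (fun w : R * R => w.1 - s1) by move=> w; apply: cvgB; [exact: cvg_fst|exact: cvg_cst].
have c2 : continuous (fun w : R * R => w.2 - s2) by move=> w; apply: cvgB; [exact: cvg_snd|exact: cvg_cst].
have g1 := continuous_gq e0 c1 c2; have g2 := continuous_gq e0 c2 c1.
transitivity (\int[mu]_(w in S) gq e (w.1 - s1) (w.2 - s2) + \int[mu]_(w in S) gq e (w.2 - s2) (w.1 - s1)).
  rewrite -RintegralD; [|exact: measurable_box|exact: box_integrable|exact: box_integrable].
  by apply: eq_Rintegral => w _; rewrite kq_split.
have -> : \int[mu]_(w in S) gq e (w.1 - s1) (w.2 - s2) = Jq e.
  rewrite /Rintegral fubini_xy //= -[RHS]/(fine (Jq e)%:E) -(integral_outer s2 e0); congr fine.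
  by apply: eq_integral => y _; exact: integral_gq.
have -> : \int[mu]_(w in S) gq e (w.2 - s2) (w.1 - s1) = Jq e.
  rewrite /Rintegral fubini_yx //= -[RHS]/(fine (Jq e)%:E) -(integral_outer s1 e0); congr fine.
  by apply: eq_integral => x _; exact: integral_gq.
by ring.
Qed.
Let ee (n : nat) : R := n.+1%:R^-1.
Let ee0 n : 0 < ee n. Proof. by rewrite invr_gt0. Qed.
Let ee_lim : ee n @[n --> \oo] --> (0 : R). Proof. exact: cvg_harmonic. Qed.

(** In the limit the arctangent is taken at 1 and equals [pi / 4], while its prefactor tends to
    [1 / (2 pi^2)]. *)
Lemma Jq_lim : Jq (ee n) @[n --> \oo] --> (8 * pi)^-1.
Proof.
have pi0 := pi_gt0 R.
have c0 : Num.sqrt (K2 * a ^+ 2) = 2 * pi * a.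
  have -> : K2 * a ^+ 2 = (2 * pi * a) ^+ 2 by rewrite /K2; ring.
  by rewrite sqrtr_sqr ger0_norm // !mulr_ge0 // ltW.
have cn : 2 * pi * a != 0 by rewrite gt_eqF // !mulr_gt0.
have cl : Num.sqrt (K2 * a ^+ 2 + ee n) @[n --> \oo] --> 2 * pi * a.
  rewrite -c0 -[X in _ --> Num.sqrt X]addr0.
  apply: (@cvg_comp _ _ _ (fun n => K2 * a ^+ 2 + ee n) (@Num.sqrt R) _ (nbhs (K2 * a ^+ 2 + 0))); last exact: sqrt_continuous.
  by apply: cvgD; [exact: cvg_cst|exact: ee_lim].
have -> : (8 * pi)^-1 = a / (pi * (2 * pi * a)) * atan (2 * pi * a / (2 * pi * a)).
  rewrite divff // atan1 /a.
  have pn : (pi : R) != 0 by rewrite gt_eqF.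
  move: (pi : R) pn => p pn; field.
  by rewrite ?pn.
apply: cvgM.
  by apply: cvgMr; apply: cvgV; [rewrite mulf_neq0 // gt_eqF|apply: cvgMr].
apply: cvg_cont; first exact: continuous_atan.
by apply: cvgMr; apply: cvgV.
Qed.

Definition Kq (e : R) w : R := e / (TT w + e) ^+ 2.

Lemma near_cell w : Q0 w -> `|(w - (s1, s2)).1| <= 2^-1 /\ `|(w - (s1, s2)).2| <= hh / 2.
Proof.
have h0 := @hh_gt0 R.
move=> [/=]; rewrite !in_itv /= => /andP[x1 x2] /andP[y1 y2].
rewrite !ler_norml /s1 /s2.
by split; apply/andP; split; lra.
Qed.

(* The difference of the two kernels stays bounded because T and its quadratic part
   are both comparable to |w|^2 and differ by O(|w|^4). *)
Lemma kernel_diff_bound (e T q : R) : 0 < e -> 4 / 9 * q <= T -> 0 <= q ->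
  `|T - K2 * q| <= 8 * pi ^+ 4 * q ^+ 2 ->
  `|e / (T + e) ^+ 2 - e / (K2 * q + e) ^+ 2| <= 16 * pi ^+ 4 * (9 / 4) ^+ 2.
Proof.
move=> e0 qT q0 TK; have pi2 := pi_ge2 R.
have K4 : 4 / 9 <= K2 by have h : 2 * 2 <= pi * pi :> R; [exact: ler_pM|rewrite /K2 expr2; lra].
pose b := 4 / 9 * q + e; pose A := T + e; pose B := K2 * q + e.
have b0 : 0 < b by rewrite /b; lra.
have bA : b <= A by rewrite /b /A; lra.
have bB : b <= B by rewrite /b /B lerD2r ler_wpM2r.
have A0 := lt_le_trans b0 bA; have B0 := lt_le_trans b0 bB.
have -> : e / A ^+ 2 - e / B ^+ 2 = - (T - K2 * q) * e * (A^-1 * B^-1 ^+ 2 + A^-1 ^+ 2 * B^-1).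
  have -> : T - K2 * q = A - B by rewrite /A /B; ring.
  by field; rewrite !gt_eqF.
have Ai : 0 <= A^-1 <= b^-1 by rewrite invr_ge0 (ltW A0) lef_pV2 ?posrE.
have Bi : 0 <= B^-1 <= b^-1 by rewrite invr_ge0 (ltW B0) lef_pV2 ?posrE.
have /andP[Ai0 Ai1] := Ai; have /andP[Bi0 Bi1] := Bi.
have bi0 : 0 <= b^-1 by rewrite invr_ge0 ltW.
have h1 : A^-1 * B^-1 ^+ 2 <= b^-1 * b^-1 ^+ 2 by apply: ler_pM => //; [exact: sqr_ge0|rewrite ler_pXn2r ?nnegrE].
have h2 : A^-1 ^+ 2 * B^-1 <= b^-1 ^+ 2 * b^-1 by apply: ler_pM => //; [exact: sqr_ge0|rewrite ler_pXn2r ?nnegrE].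
have h3 : 0 <= A^-1 * B^-1 ^+ 2 + A^-1 ^+ 2 * B^-1 by rewrite addr_ge0 // mulr_ge0 // sqr_ge0.
rewrite !normrM normrN (gtr0_norm e0) (ger0_norm h3).
apply: (@le_trans _ _ (8 * pi ^+ 4 * q ^+ 2 * e * (2 * b^-1 ^+ 3))).
  apply: ler_pM; [by apply: mulr_ge0; [|exact: ltW]|exact: h3|by rewrite ler_pM2r|].
  by apply: le_trans (lerD h1 h2) _; rewrite le_eqVlt; apply/orP; left; apply/eqP; ring.
have q2 : q ^+ 2 * b^-1 ^+ 2 <= (9 / 4) ^+ 2.
  have qb : 0 <= q * b^-1 by exact: mulr_ge0.
  rewrite -exprMn ler_pXn2r ?nnegrE //.
  by rewrite ler_pdivrMr // /b; lra.
have eb : e * b^-1 <= 1 by rewrite ler_pdivrMr // mul1r /b; lra.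
have -> : 8 * pi ^+ 4 * q ^+ 2 * e * (2 * b^-1 ^+ 3) = 16 * pi ^+ 4 * ((q ^+ 2 * b^-1 ^+ 2) * (e * b^-1)) by ring.
apply: ler_wpM2l; first by rewrite mulr_ge0 // exprn_ge0 // pi_ge0.
rewrite -[leRHS]mulr1; apply: ler_pM => //; first by rewrite mulr_ge0 // sqr_ge0.
by rewrite mulr_ge0 // ltW.
Qed.

Lemma smf_Kq e : 0 < e -> smf (Kq e).
Proof.
move=> e0; apply: smf_mul; first exact: smf_cst.
apply: smf_inv => [|w]; last by rewrite expf_neq0 // gt_eqF // TTe_gt0.
have -> : (fun w => (TT w + e) ^+ 2) = (fun w => (TT w + e) * (TT w + e)) by apply/funext => w; rewrite expr2.
by apply: smf_mul; apply: smf_add; [exact: smf_TT|exact: smf_cst|exact: smf_TT|exact: smf_cst].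
Qed.

Lemma per_Kq e : per (Kq e).
Proof. by split => w; rewrite /Kq ?TT_per1 ?TT_per2. Qed.

Lemma kernel_cvg0 (T : R) : 0 < T -> ee n / (T + ee n) ^+ 2 @[n --> \oo] --> (0 : R).
Proof.
move=> T0; rewrite -(mul0r ((T + 0) ^+ 2)^-1); apply: cvgM; first exact: ee_lim.
apply: cvgV; first by rewrite addr0 expf_neq0 // gt_eqF.
by apply: cvg_sqr; apply: cvgD; [exact: cvg_cst|exact: ee_lim].
Qed.

Lemma negligible_point z : mu.-negligible [set z].
Proof.
have -> : [set z] = [set z.1] `*` [set z.2].
  by apply/seteqP; split => [w -> //|[x y] [/= -> ->]]; rewrite -surjective_pairing.
apply/negligibleP; first exact: measurableX (measurable_set1 _) (measurable_set1 _).
transitivity (leb [set z.1] * leb [set z.2])%E.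
  exact: (product_measure1E leb leb (measurable_set1 _) (measurable_set1 _)).
have -> : leb [set z.1] = 0%E by exact: lebesgue_measure_set1.
by rewrite mul0e.
Qed.

(** The singularity is moved to the centre [c] of the rectangle [Q0], where [T] and its quadratic
    part are comparable on the whole rectangle. The difference between [Kq] and the model kernel cut
    to the square [S] is bounded and tends to 0 off [c]; so the limit is that of [2 Jq], namely
    [2 / (8 pi)]. *)
Lemma ip_Kq_lim : ip (Kq (ee n)) @[n --> \oo] --> (4 * pi)^-1.
Proof.
have pi0 := pi_gt0 R; have h0 := @hh_gt0 R.
pose c : R * R := (s1, s2).
have mQ : measurable Q0 by apply: measurableX; exact: measurable_itv.
have fQ : (mu Q0 < +oo)%E.
  apply: le_lt_trans (box_finite 0 1 0 hh); apply: le_measure; rewrite ?inE //; first exact: measurable_box.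
  by move=> w [/=]; rewrite !in_itv /= => /andP[x1 x2] /andP[y1 y2]; split; rewrite /= ?in_itv /= ?x1 ?y1 ltW.
have s31 : 1 < s3 by rewrite -[ltLHS](@sqrtr1 R) ltr_sqrt //; lra.
have SQ : S `<=` Q0.
  move=> w [/=]; rewrite !in_itv /= /s1 /s2 /a => /andP[x1 x2] /andP[y1 y2].
  by split; rewrite /= ?in_itv /=; apply/andP; split; lra.
have mS : measurable S by exact: measurable_box.
pose k n w := (kq (ee n) (w - c)) * \1_S w.
have cq n : continuous (fun w => kq (ee n) (w - c)).
  have c1 : continuous (fun w : R * R => w.1 - s1) by move=> w; apply: cvgB; [exact: cvg_fst|exact: cvg_cst].
  have c2 : continuous (fun w : R * R => w.2 - s2) by move=> w; apply: cvgB; [exact: cvg_snd|exact: cvg_cst].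
  have cD := @continuous_Dq (ee n) _ _ c1 c2.
  move=> w; apply: cvgMr; apply: cvgV; first by rewrite expf_neq0 // gt_eqF // Dq_gt0.
  by apply: cvg_sqr; exact: cD.
have mk n : mf (k n) by apply: measurable_funM; [exact: cts_measurable|exact: measurable_indic].
have mK n : mf (fun w => Kq (ee n) (w - c)) by apply: mf_shift; exact: smf_mf (smf_Kq _).
have e1 n : ee n <= 1 by rewrite invf_le1 // ler1n.
have TQ w : Q0 w -> w <> c -> 0 < nr2 (w - c).
  move=> Qw wc; rewrite lt_neqAle nr2_ge0 andbT eq_sym; apply/negP => /eqP.
  rewrite /nr2 => /eqP; rewrite paddr_eq0 ?sqr_ge0 // !sqrf_eq0 => /andP[/eqP h1 /eqP h2].
  apply: wc; apply/eqP; rewrite -subr_eq0; apply/eqP.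
  by rewrite [LHS]surjective_pairing h1 h2.
have bound n w : Q0 w -> `|Kq (ee n) (w - c) - k n w| <= 16 * pi ^+ 4 * (9 / 4) ^+ 2 + 36.
  move=> Qw; have [b1 b2] := near_cell Qw.
  have Tq := TT_ge b1 b2; have q4 := TT_quartic (w - c); have q0 := nr2_ge0 (w - c).
  have B0 : 0 <= 16 * pi ^+ 4 * (9 / 4) ^+ 2 :> R by have := exprn_ge0 4 (pi_ge0 R); lra.
  rewrite /k indicE; case: (boolP (w \in S)) => Sw /=.
    rewrite mulr1; apply: (@le_trans _ _ (16 * pi ^+ 4 * (9 / 4) ^+ 2)); last by lra.
    exact: kernel_diff_bound (ee0 n) Tq q0 q4.
  rewrite mulr0 subr0 /Kq.
  have q16 : 16^-1 <= nr2 (w - c).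
    rewrite leNgt; apply/negP => h; move/negP: Sw; apply; rewrite inE.
    have n1 := sqr_ge0 (w - c).1; have n2 := sqr_ge0 (w - c).2.
    have a2 : 16^-1 = a ^+ 2 by rewrite /a; field.
    rewrite a2 /nr2 in h.
    have l1 : `|(w - c).1| < a.
      by rewrite -(@ltr_pXn2r _ 2) ?nnegrE ?(ltW ae) // real_normK ?num_real //; apply: le_lt_trans h; rewrite lerDl.
    have l2 : `|(w - c).2| < a.
      by rewrite -(@ltr_pXn2r _ 2) ?nnegrE ?(ltW ae) // real_normK ?num_real //; apply: le_lt_trans h; rewrite lerDr.
    move: l1 l2; rewrite !ltr_norml -[(w - c).1]/(w.1 - s1) -[(w - c).2]/(w.2 - s2) => /andP[x1 x2] /andP[y1 y2].
    by split; rewrite /= ?in_itv /=; apply/andP; split; lra.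
  (* [36 = 16 * 9 / 4]: outside the square [|w - c|^2 >= 1/16], and [T >= 4/9 |w - c|^2]. *)
  have T36 : 36^-1 <= TT (w - c) by lra.
  have e0 := ee0 n; have T0 : 0 < TT (w - c) + ee n by rewrite addr_gt0 //; lra.
  rewrite ger0_norm; last by rewrite divr_ge0 ?sqr_ge0 // ltW.
  apply: (@le_trans _ _ 36); last by rewrite lerDr.
  rewrite ler_pdivrMr ?exprn_gt0 //.
  have : 36^-1 * (TT (w - c) + ee n) <= (TT (w - c) + ee n) ^+ 2.
    by rewrite expr2 ler_pM2r //; lra.
  lra.
have lim0 : \int[mu]_(w in Q0) (Kq (ee n) (w - c) - k n w) @[n --> \oo] --> (0 : R).
  have := @dct_bounded Q0 (fun n w => Kq (ee n) (w - c) - k n w) (fun=> 0) [set c]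
    (16 * pi ^+ 4 * (9 / 4) ^+ 2 + 36) mQ fQ.
  rewrite Rintegral_cst // mul0r; apply.
  - by move=> n; apply: measurable_funTS; exact: measurable_funB.
  - exact: measurable_cst.
  - exact: negligible_point.
  - move=> w Qw /(TQ w Qw) q0; have [b1 b2] := near_cell Qw.
    have T0 : 0 < TT (w - c) by apply: lt_le_trans (TT_ge b1 b2); rewrite mulr_gt0.
    rewrite -[X in _ --> X](subrr 0); apply: cvgB; first exact: kernel_cvg0.
    rewrite -[X in _ --> X](mul0r (\1_S w)); apply: cvgM; last exact: cvg_cst.
    by apply: (@kernel_cvg0 (K2 * nr2 (w - c))); rewrite mulr_gt0.
  - exact: bound.
have iK n : mu.-integrable Q0 (EFin \o (fun w => Kq (ee n) (w - c))).
  have [M bM] := smf_bounded (per_Kq (ee n)) (smf_Kq (ee0 n)).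
  apply: measurable_bounded_integrable => //; first exact: measurable_funTS.
  by exists M; split; rewrite ?num_real // => x Mx w _ /=; rewrite (le_trans (bM _)) // ltW.
have ik n : mu.-integrable Q0 (EFin \o k n).
  have iB : mu.-integrable Q0 (EFin \o (fun w => Kq (ee n) (w - c) - k n w)).
    apply: measurable_bounded_integrable => //; first by apply: measurable_funTS; exact: measurable_funB.
    by exists (16 * pi ^+ 4 * (9 / 4) ^+ 2 + 36); split; rewrite ?num_real // => x Mx w Qw /=; rewrite (le_trans (bound _ _ Qw)) // ltW.
  have := integrableB mQ (iK n) iB.
  by apply: eq_integrable => // w _ /=; rewrite -EFinB; congr EFin; ring.
have Ek n : \int[mu]_(w in Q0) k n w = 2 * Jq (ee n).
  rewrite -integral_kq //.
  have -> : \int[mu]_(w in S) kq (ee n) (w - c) = \int[mu]_(w in Q0 `&` S) kq (ee n) (w - c).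
    by rewrite (setIidr SQ).
  have E1 : k n = ((fun w : PT => kq (ee n) (w - c)) \_ S).
    by apply/funext => w; rewrite /k indicE /patch; case: (boolP (w \in S)) => _; rewrite ?mulr1 ?mulr0.
  by rewrite E1 [RHS]Rintegral_mkcondr.
have EK n : \int[mu]_(w in Q0) Kq (ee n) (w - c) = ip (Kq (ee n)).
  have [M bM] := smf_bounded (per_Kq (ee n)) (smf_Kq (ee0 n)).
  rewrite -(ip_shift (- c) (smf_mf (smf_Kq (ee0 n))) bM (per_Kq _)); apply/esym/ip_Q0.
  - exact: smf_continuous (smf_shift (- c) (smf_Kq (ee0 n))).
  - by have [p1 p2] := per_Kq (ee n); split => w; rewrite addrAC ?p1 ?p2.
  - by move=> w; rewrite /Kq divr_ge0 ?sqr_ge0 // ltW.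
have -> : (4 * pi)^-1 = 0 + 2 * (8 * pi)^-1 :> R.
  have pn : (pi : R) != 0 by rewrite gt_eqF.
  by move: (pi : R) pn => p pn; field; rewrite ?pn.
have -> : (fun n => ip (Kq (ee n))) = (fun n => \int[mu]_(w in Q0) (Kq (ee n) (w - c) - k n w) + 2 * Jq (ee n)).
  by apply/funext => n; rewrite RintegralB // EK Ek subrK.
by apply: cvgD => //; apply: cvgMr; exact: Jq_lim.
Qed.

(** The function part of the distribution [Delta ln T]; division by 0 gives it the value 0 on the
    lattice. *)
Definition RR w : R := WW w / TT w ^+ 2.

Lemma RR_bound w : `|RR w| <= LL.
Proof.
have L0 := @LL_gt0 R; have /andP[W1 W2] := WW_bound w.
rewrite /RR normrM (ler0_norm W2) normfV (@ger0_norm _ (TT w ^+ 2)) ?sqr_ge0 //.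
have [->|T0] := eqVneq (TT w) 0; first by rewrite expr0n invr0 mulr0 ltW.
by rewrite ler_pdivrMr ?exprn_even_gt0 //; lra.
Qed.
Let f n w := WW w / (TT w + ee n) ^+ 2.

Lemma smf_WW : smf (@WW R).
Proof.
rewrite /WW; apply: smf_mul; first exact: smf_cst.
apply: smf_add; apply: smf_mul; try exact: smf_cst.
  have -> : (fun w : R * R => TT w ^+ 2) = (fun w => TT w * TT w) by apply/funext => w; rewrite expr2.
  by apply: smf_mul; exact: smf_TT.
apply: smf_mul; [apply: smf_mul|]; apply: smfB; try exact: smf_cst; apply: smf_cos.
- exact: smf_ta1.
- exact: smf_ta2.
- by apply: smf_add; [exact: smf_ta1|exact: smf_ta2].
Qed.

Lemma per_WW : per (@WW R).
Proof.
have e w : WW w = LL * (3 - TT w) * TT w - (TTx w ^+ 2 + TTy w ^+ 2) by rewrite gradT2; ring.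
have [[x1 x2] [y1 y2]] := per_rd (conj (@TT_per1 R) (@TT_per2 R)) (@rd_TT R).
by split => w; rewrite !e ?TT_per1 ?TT_per2 ?x1 ?y1 // x2 y2.
Qed.
Let se n : smf (fun w => ((TT w + ee n) ^+ 2)^-1).
Proof.
apply: smf_inv => [|w]; last by rewrite expf_neq0 // gt_eqF // TTe_gt0.
have -> : (fun w => (TT w + ee n) ^+ 2) = (fun w => (TT w + ee n) * (TT w + ee n)) by apply/funext => w; rewrite expr2.
by apply: smf_mul; apply: smf_add; [exact: smf_TT|exact: smf_cst|exact: smf_TT|exact: smf_cst].
Qed.
Let sf n : smf (f n). Proof. by apply: smf_mul; [exact: smf_WW|exact: se]. Qed.
Let f_lim w : f n w @[n --> \oo] --> RR w.
Proof.
have [T0|T0] := eqVneq (TT w) 0.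
  have W0 : WW w = 0 by have := WW_bound w; rewrite T0 expr0n mulr0 oppr0 => h; apply/eqP; rewrite eq_le andbC.
  rewrite /RR /f W0 mul0r; under eq_fun do rewrite mul0r; exact: cvg_cst.
apply: cvgMr; apply: cvgV; first by rewrite expf_neq0.
have h : TT w + ee n @[n --> \oo] --> TT w + 0 by apply: cvgD; [exact: cvg_cst|exact: ee_lim].
by rewrite addr0 in h; exact: cvg_sqr h.
Qed.

Lemma mf_RR : mf RR.
Proof.
apply: (@measurable_fun_cvg _ _ _ _ (fun n => f n : PT -> R)) => [n|w _]; first exact: smf_mf (sf n).
exact: f_lim.
Qed.

(** The Laplacian of [ln (T + e)] has integral 0, and its part concentrating at the lattice
    contributes [3 LL / (4 pi) = 4 pi] in the limit. As distributions, [Delta ln T] is thus [RR]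
    plus [4 pi] times the Dirac mass. *)
Lemma ip_RR : ip RR = - (4 * pi).
Proof.
have pi0 := pi_gt0 R; have L0 := @LL_gt0 R.
have pT (F : R -> R) : per (fun w => F (TT w)) by split => w; rewrite ?TT_per1 ?TT_per2.
pose g n w := ee n * TT w / (TT w + ee n) ^+ 2.
have pf n : per (f n).
  by have [w1 w2] := per_WW; split => w; rewrite /f ?w1 ?w2 ?TT_per1 ?TT_per2.
have fb n w : `|f n w| <= LL.
  have /andP[W1 W2] := WW_bound w; have s0 := TTe_gt0 w (ee0 n).
  rewrite /f normrM (ler0_norm W2) normfV (@ger0_norm _ ((TT w + ee n) ^+ 2)) ?sqr_ge0 //.
  rewrite ler_pdivrMr ?exprn_gt0 //; apply: (@le_trans _ _ (LL * TT w ^+ 2)); first by lra.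
  have e0 := ltW (ee0 n); have t0 := TT_ge0 w.
  have h : TT w <= TT w + ee n by rewrite lerDl.
  by rewrite ler_pM2l // !expr2; apply: ler_pM.
have gb n w : `|g n w| <= 1.
  have s0 := TTe_gt0 w (ee0 n); have t0 := TT_ge0 w; have e0 := ltW (ee0 n).
  rewrite /g ger0_norm; last by rewrite divr_ge0 ?sqr_ge0 // mulr_ge0.
  rewrite ler_pdivrMr ?exprn_gt0 // mul1r.
  have := sqr_ge0 (TT w); have := sqr_ge0 (ee n); have := mulr_ge0 e0 t0; lra.
have sg n : smf (g n) by apply: smf_mul; [apply: smf_mul; [exact: smf_cst|exact: smf_TT]|exact: se].
have [_ fl] : itg RR /\ ip (f n) @[n --> \oo] --> ip RR.
  apply: (@ip_dct _ f _ (fun=> LL) _ _ _ (negligible_set0 _)) => //.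
  - by move=> n; apply: mfP; exact: smf_mf.
  - by apply: mfP; exact: mf_RR.
  - exact: itg_cst.
have [_ gl0] : itg (fun _ : R * R => 0 : R) /\ ip (g n) @[n --> \oo] --> ip (fun _ : R * R => 0 : R).
  apply: (@ip_dct _ g _ (fun=> 1) _ _ _ (negligible_set0 _)) => //.
  - by move=> n; apply: mfP; exact: smf_mf.
  - move=> w Pw _; have [T0|T0] := eqVneq (TT w) 0.
      by rewrite /g T0; under eq_fun do rewrite mulr0 mul0r; exact: cvg_cst.
    have t0 : 0 < TT w by rewrite lt_neqAle eq_sym T0 TT_ge0.
    have h : TT w * (ee n / (TT w + ee n) ^+ 2) @[n --> \oo] --> TT w * 0 by apply: cvgMr; exact: kernel_cvg0.
    rewrite mulr0 in h.
    have -> : g^~ w = (fun n => TT w * (ee n / (TT w + ee n) ^+ 2)) by apply/funext => n; rewrite /g; ring.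
    exact: h.
  - exact: itg_cst.
rewrite ip_cst mul0r in gl0.
have E n : ip (f n) = LL * ip (g n) - 3 * LL * ip (Kq (ee n)).
  have z : ip (laplacian (gl (ee n) 0)) = 0.
    by apply: ip_laplacian; [exact: (per_TTz (fun t => ln (t + ee n)) 0)|exact: smf_gl].
  have i1 : itg (f n) by exact: smf_itg.
  have i2 : itg (Kq (ee n)) by apply: smf_itg; [exact: per_Kq|exact: smf_Kq].
  have i3 : itg (g n) by apply: smf_itg (sg n); exact: (pT (fun t => ee n * t / (t + ee n) ^+ 2)).
  have : ip (laplacian (gl (ee n) 0)) = ip (fun w => f n w + (3 * LL * Kq (ee n) w - LL * g n w)).
    apply: ip_eq => w _; rewrite lap_gl // subr0 /f /Kq /g.
    by have := TTe_gt0 w (ee0 n); move: (WW w) (TT w) => W T T0; field; rewrite gt_eqF.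
  rewrite z ipD //; last by apply: itgB; exact: itgZ.
  by rewrite (ipB (itgZ _ i2) (itgZ _ i3)) (ipZ _ i2) (ipZ _ i3); lra.
have lim : ip (f n) @[n --> \oo] --> LL * 0 - 3 * LL * (4 * pi)^-1.
  have -> : (fun n => ip (f n)) = (fun n => LL * ip (g n) - 3 * LL * ip (Kq (ee n))) by apply/funext.
  by apply: cvgB; apply: cvgMr => //; exact: ip_Kq_lim.
rewrite (cvg_unique _ fl lim) // /LL.
have pn : (pi : R) != 0 by rewrite gt_eqF.
move: (pi : R) pn => p pn; field.
by rewrite ?pn.
Qed.

End mass.

(** * Green representation of the solution *)

Section representation.
Context {R : realType}.
Local Notation mu := (lebesgue2 R).
Local Notation P := (fundamental_domain (rho R)).
Local Notation Lam := (lattice (rho R)).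
Local Notation PT := (measurableTypeR R * measurableTypeR R)%type.
Local Notation mf f := (measurable_fun [set: PT] (f : PT -> R)).
Local Notation mfp f := (measurable_fun (P : set PT) (f : PT -> R)).
Implicit Types (w z c : R * R) (f g : R * R -> R) (M k : R).

Variable u : R * R -> R.
Hypothesis sol : mean_field_solution (rho R) (16 * pi) u.

Let pu := solution_periodic sol.
Let su := solution_smooth sol.
Let iu : itg u. Proof. exact: solution_integrable sol. Qed.
Let ieu : itg (fun w => expR (u w)). Proof. exact: solution_exp_integrable sol. Qed.
Let ee (n : nat) : R := n.+1%:R^-1.
Let ee0 n : 0 < ee n. Proof. by rewrite invr_gt0. Qed.
Let ee1 n : ee n <= 1. Proof. by rewrite invf_le1 // ler1n. Qed.
Let ee_lim : ee n @[n --> \oo] --> (0 : R). Proof. exact: cvg_harmonic. Qed.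
Let f n w := WW w / (TT w + ee n) ^+ 2.

Let sf n : smf (f n).
Proof.
apply: smf_mul; first exact: smf_WW.
apply: smf_inv => [|w]; last by rewrite expf_neq0 // gt_eqF // TTe_gt0.
have -> : (fun w => (TT w + ee n) ^+ 2) = (fun w => (TT w + ee n) * (TT w + ee n)) by apply/funext => w; rewrite expr2.
by apply: smf_mul; apply: smf_add; [exact: smf_TT|exact: smf_cst|exact: smf_TT|exact: smf_cst].
Qed.
Let pf n : per (f n).
Proof. by have [w1 w2] := @per_WW R; split => w; rewrite /f ?w1 ?w2 ?TT_per1 ?TT_per2. Qed.
Let f_lim w : f n w @[n --> \oo] --> RR w.
Proof.
have [T0|T0] := eqVneq (TT w) 0.
  have W0 : WW w = 0 by have := WW_bound w; rewrite T0 expr0n mulr0 oppr0 => h; apply/eqP; rewrite eq_le andbC.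
  rewrite /RR /f W0 mul0r; under eq_fun do rewrite mul0r; exact: cvg_cst.
apply: cvgMr; apply: cvgV; first by rewrite expf_neq0.
have h : TT w + ee n @[n --> \oo] --> TT w + 0 by apply: cvgD; [exact: cvg_cst|exact: ee_lim].
by rewrite addr0 in h; exact: cvg_sqr h.
Qed.
Let fb n w : `|f n w| <= LL.
Proof.
have /andP[W1 W2] := WW_bound w; have s0 := TTe_gt0 w (ee0 n); have L0 := @LL_gt0 R.
rewrite /f normrM (ler0_norm W2) normfV (@ger0_norm _ ((TT w + ee n) ^+ 2)) ?sqr_ge0 //.
rewrite ler_pdivrMr ?exprn_gt0 //; apply: (@le_trans _ _ (LL * TT w ^+ 2)); first by lra.
have t0 := TT_ge0 w; have h : TT w <= TT w + ee n by rewrite lerDl ltW.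
by rewrite ler_pM2l // !expr2; apply: ler_pM.
Qed.

(** The part of the Laplacian of [gl] that concentrates at the pole as [e] tends to 0, an
    approximation of [4 pi] times the Dirac mass. *)
Definition kap (e : R) w : R := e * LL * (3 - TT w) / (TT w + e) ^+ 2.

Let lapE n z w : laplacian (gl (ee n) z) w = f n (w - z) + kap (ee n) (w - z).
Proof. by rewrite lap_gl // mulrDl. Qed.
Let skap n : smf (kap (ee n)).
Proof.
have -> : kap (ee n) = (fun w => laplacian (gl (ee n) 0) w - f n w).
  by apply/funext => w; rewrite lapE !subr0; ring.
by apply: smfB => //; apply: smf_lap; exact: smf_gl.
Qed.
Let pkap n : per (kap (ee n)).
Proof. by split => w; rewrite /kap ?TT_per1 ?TT_per2. Qed.
Let kapK n w : `|kap (ee n) w| <= 3 * LL * Kq (ee n) w.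
Proof.
have L0 := @LL_gt0 R; have e0 := ee0 n; have T0 := TT_ge0 w; have T6 := TT_le6 w.
have -> : kap (ee n) w = (3 - TT w) * (LL * Kq (ee n) w) by rewrite /kap /Kq; ring.
have K0 : 0 <= LL * Kq (ee n) w by rewrite mulr_ge0 ?(ltW L0) // /Kq divr_ge0 ?sqr_ge0 // ltW.
rewrite normrM (ger0_norm K0) -mulrA; apply: ler_wpM2r => //.
by rewrite ler_norml; apply/andP; split; lra.
Qed.
Let perz (F : R * R -> R) z : per F -> per (fun w => F (w - z)).
Proof. by move=> [f1 f2]; split => w; rewrite addrAC ?f1 ?f2. Qed.
Let itg_u_smf (F : R * R -> R) z : smf F -> per F -> itg (fun w => u w * F (w - z)).
Proof.
move=> sf' pf'; have [M bM] := smf_bounded pf' sf'.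
apply: (@itgM _ _ _ M iu) => [|w]; last exact: bM.
exact: smf_mf (smf_shift (- z) sf').
Qed.

Lemma ip_u_lim z : ip (fun w => u w * f n (w - z)) @[n --> \oo] --> ip (fun w => u w * RR (w - z)).
Proof.
have [] // := @ip_dct _ (fun n w => u w * f n (w - z)) (fun w => u w * RR (w - z)) (fun w => LL * `|u w|) set0.
- by move=> n; exact: itg_mf (itg_u_smf z (sf n) (pf n)).
- apply: measurable_funM; first exact: itg_mf iu.
  by apply: mfP; apply: mf_shift; exact: mf_RR.
- exact: negligible_set0.
- by move=> w Pw _; apply: cvgMr; exact: f_lim.
- by move=> n w Pw; rewrite normrM mulrC ler_wpM2r.
- by apply: itgZ; exact: itg_norm.
Qed.

Lemma ip_kap_lim z : ip (fun w => kap (ee n) (w - z)) @[n --> \oo] --> 4 * pi.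
Proof.
have [_ fl] : itg (@RR R) /\ ip (f n) @[n --> \oo] --> ip (@RR R).
  apply: (@ip_dct _ f _ (fun=> LL) _ _ _ (negligible_set0 _)) => //.
  - by move=> n; apply: mfP; exact: smf_mf.
  - by apply: mfP; exact: mf_RR.
  - exact: itg_cst.
rewrite ip_RR in fl.
have -> : (fun n => ip (fun w => kap (ee n) (w - z))) = (fun n => - ip (f n)).
  apply/funext => n; have [M bM] := smf_bounded (pkap n) (skap n).
  rewrite (ip_shift (- z) (smf_mf (skap n)) bM (pkap n)).
  have : ip (laplacian (gl (ee n) 0)) = 0.
    by apply: ip_laplacian; [exact: (per_TTz (fun t => ln (t + ee n)) 0)|exact: smf_gl].
  have -> : ip (laplacian (gl (ee n) 0)) = ip (fun w => f n w + kap (ee n) w).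
    by apply: ip_eq => w _; rewrite lapE !subr0.
  by rewrite (ipD (smf_itg (pf n) (sf n)) (smf_itg (pkap n) (skap n))) => /eqP; rewrite addrC addr_eq0 => /eqP.
by rewrite -[4 * pi]opprK; exact: cvgN.
Qed.

(** Near the translates of [z], continuity makes [u w - u z] small against a kernel of bounded mass.
    Away from them the kernel is uniformly of order [ee n], and [u] is integrable. *)
Lemma ip_osc_lim z : ~ Lam z -> ip (fun w => (u w - u z) * kap (ee n) (w - z)) @[n --> \oo] --> (0 : R).
Proof.
move=> zL; have pi0 := pi_gt0 R; have L0 := @LL_gt0 R.
apply/cvgrPdist_lt => e e0.
(* Chosen so that [3 LL eta], times the limit mass [1 / (4 pi)] of [Kq], is [e / 2]. *)
pose eta := e * (4 * pi) / (6 * LL).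
have eta0 : 0 < eta by rewrite /eta divr_gt0 ?mulr_gt0.
have cu : {for z, continuous u} by exact: (@smooth_cts _ _ su [::] z zL).
move/cvgrPdist_lt : (cu) => /(_ eta eta0) n1.
have /nbhs_ballP[r /= r0 hr] : \forall t \near z, `|u z - u t| < eta /\ ~ Lam t.
  by near=> t; split; near: t => //; exact: near_off.
have [d1 d10 hd1] := TT_near0 r0.
pose D := ip (fun w => `|u w| + `|u z|).
have id : itg (fun w => `|u w| + `|u z|) by apply: itgD; [exact: itg_norm|exact: itg_cst].
pose b n := 3 * LL * eta * ip (Kq (ee n)) + 3 * LL / d1 ^+ 2 * D * ee n.
have bl : b n @[n --> \oo] --> e / 2.
  have -> : e / 2 = 3 * LL * eta * (4 * pi)^-1 + 3 * LL / d1 ^+ 2 * D * 0.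
    rewrite mulr0 addr0 /eta; have pn : (pi : R) != 0 by rewrite gt_eqF.
    have Ln : (LL : R) != 0 by rewrite gt_eqF.
    by move: (pi : R) (LL : R) pn Ln => p L pn Ln; field; rewrite ?pn ?Ln.
  by apply: cvgD; apply: cvgMr; [exact: ip_Kq_lim|exact: ee_lim].
have hb n : `|ip (fun w => (u w - u z) * kap (ee n) (w - z))| <= b n.
  have [M bM] := smf_bounded (pkap n) (skap n).
  have ii : itg (fun w => (u w - u z) * kap (ee n) (w - z)).
    apply: (@itgM _ _ _ M) => [||w]; [by apply: itgB => //; exact: itg_cst|exact: smf_mf (smf_shift (- z) (skap n))|exact: bM].
  apply: le_trans (ip_norm ii) _.
  have [M' bM'] := smf_bounded (per_Kq (ee n)) (smf_Kq (ee0 n)).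
  have iK : itg (fun w => Kq (ee n) (w - z)).
    by apply: smf_itg; [exact: perz (per_Kq _)|exact: smf_shift (- z) (smf_Kq (ee0 n))].
  have -> : b n = ip (fun w => 3 * LL * eta * Kq (ee n) (w - z) + 3 * LL / d1 ^+ 2 * ee n * (`|u w| + `|u z|)).
    rewrite (ipD (itgZ _ iK) (itgZ _ id)) (ipZ _ iK) (ipZ _ id) /b.
    by rewrite (ip_shift (- z) (smf_mf (smf_Kq (ee0 n))) bM' (per_Kq _)); congr (_ + _); rewrite -/D; ring.
  apply: ip_le => [||w Pw]; [exact: itg_norm|exact: itgD (itgZ _ iK) (itgZ _ id)|].
  have e0n := ee0 n; have T0 := TT_ge0 (w - z).
  have K0 : 0 <= Kq (ee n) (w - z) by rewrite /Kq divr_ge0 ?sqr_ge0 // ltW.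
  have u0 : 0 <= `|u w| + `|u z| by rewrite addr_ge0.
  have kb := kapK n (w - z).
  rewrite normrM; have [Td|Td] := ltP (TT (w - z)) d1.
    have [c cL hc] := hd1 _ Td.
    have wc : ball z r (w + c).
      move: hc => [/= h1 h2]; split; rewrite /ball /=.
        have : `|0 - (w.1 - z.1 + c.1)| < r by exact: h1.
        by have -> : z.1 - (w.1 + c.1) = 0 - (w.1 - z.1 + c.1) by ring.
      have : `|0 - (w.2 - z.2 + c.2)| < r by exact: h2.
      by have -> : z.2 - (w.2 + c.2) = 0 - (w.2 - z.2 + c.2) by ring.
    have uc : `|u w - u z| <= eta.
      have [h1 h2] := hr _ wc.
      have wL : ~ Lam w by move=> wL; apply: h2; exact: latticeD.
      have q : u (w + c) = u w := @smooth_period _ _ pu su [::] c w cL wL.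
      by rewrite q in h1; rewrite distrC ltW.
    apply: (@le_trans _ _ (eta * (3 * LL * Kq (ee n) (w - z)))); first by apply: ler_pM.
    have -> : eta * (3 * LL * Kq (ee n) (w - z)) = 3 * LL * eta * Kq (ee n) (w - z) by ring.
    by rewrite lerDl !mulr_ge0 ?invr_ge0 ?sqr_ge0 // ltW.
  apply: (@le_trans _ _ ((`|u w| + `|u z|) * (3 * LL * (ee n / d1 ^+ 2)))).
    apply: ler_pM => //; first exact: ler_normB.
    apply: le_trans kb _; apply: ler_wpM2l; first by lra.
    rewrite /Kq; apply: ler_wpM2l; first exact: ltW.
    rewrite lef_pV2 ?posrE ?exprn_gt0 //; last by rewrite ltr_wpDl.
    by rewrite !expr2; apply: ler_pM; rewrite ?(ltW d10) //; lra.
  have -> : (`|u w| + `|u z|) * (3 * LL * (ee n / d1 ^+ 2)) = 3 * LL / d1 ^+ 2 * ee n * (`|u w| + `|u z|) by ring.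
  have p1 := ltW eta0; have p2 := ltW L0.
  by rewrite lerDr; apply: mulr_ge0 => //; apply: mulr_ge0 => //; apply: mulr_ge0.
have be : \forall n \near \oo, b n < e.
  by apply: (cvgr_lt _ bl); lra.
by apply: filterS be => n bn; rewrite sub0r normrN; exact: le_lt_trans (hb n) bn.
Unshelve. all: by end_near.
Qed.

Definition GG w : R := - ln (TT w).

Lemma mf_GG : mf GG.
Proof. by apply: measurableT_comp => //; apply: measurableT_comp => //; exact: mf_TT. Qed.
Lemma TTNB w z : TT (w - z) = TT (z - w).
Proof. by rewrite -TTN opprB. Qed.

(** The equation tested with [gl (ee n) z] splits into a bounded kernel, an oscillation term and
    [u z] times the mass of [kap]. In the exponential term only [e^u] is known to be integrable, so
    Fatou is used first; it makes [e^u] times [GG] integrable and thereby provides the dominating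
    function for the limit. *)
Lemma representation z : ~ Lam z ->
  itg (fun w => expR (u w) * GG (w - z)) /\
  4 * pi * u z = 16 * pi * ln (TT z) + ip (fun w => expR (u w) * GG (w - z)) - ip (fun w => u w * RR (w - z)).
Proof.
move=> zL; have Tz := TT_gt0 zL.
have sg n := smf_gl z (ee0 n).
have pg n : per (gl (ee n) z) by exact: (per_TTz (fun t => ln (t + ee n)) z).
pose X n := ip (fun w => expR (u w) * gl (ee n) z w).
have iX n : itg (fun w => expR (u w) * gl (ee n) z w).
  by have [M bM] := smf_bounded (pg n) (sg n); exact: itgM ieu (smf_mf (sg n)) bM.
have eqX n : X n = 16 * pi * ln (TT z + ee n) - (ip (fun w => u w * f n (w - z)) +
   (ip (fun w => (u w - u z) * kap (ee n) (w - z)) + u z * ip (fun w => kap (ee n) (w - z)))).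
  have t : torus_test_function (rho R) (gl (ee n) z).
    by split; [move=> w _; split; [exact: (pg n).1|exact: (pg n).2]|exact: smf_smooth].
  have := solution_equation sol t; rewrite {3}/gl TTNB subr0 => <-.
  have i1 := itg_u_smf z (sf n) (pf n); have i2 := itg_u_smf z (skap n) (pkap n).
  have i3 : itg (fun w => kap (ee n) (w - z)).
    by apply: smf_itg; [exact: perz (pkap n)|exact: smf_shift (- z) (skap n)].
  have i4 : itg (fun w => (u w - u z) * kap (ee n) (w - z)).
    have -> : (fun w => (u w - u z) * kap (ee n) (w - z)) = (fun w => u w * kap (ee n) (w - z) - u z * kap (ee n) (w - z)).
      by apply/funext => w; rewrite mulrBl.
    by apply: itgB => //; exact: itgZ.
  have -> : \int[mu]_(w in P) (u w * laplacian (gl (ee n) z) w) = ip (fun w => u w * f n (w - z)) +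
     (ip (fun w => (u w - u z) * kap (ee n) (w - z)) + u z * ip (fun w => kap (ee n) (w - z))).
    rewrite -(ipZ _ i3) -(ipD i4 (itgZ _ i3)) -(ipD i1 (itgD i4 (itgZ _ i3))).
    by apply: ip_eq => w _; rewrite lapE; ring.
  by rewrite /X /ip; ring.
pose Xl := 16 * pi * ln (TT z) - (ip (fun w => u w * RR (w - z)) + (0 + u z * (4 * pi))).
have limX : X n @[n --> \oo] --> Xl.
  have -> : X = (fun n => 16 * pi * ln (TT z + ee n) - (ip (fun w => u w * f n (w - z)) +
   (ip (fun w => (u w - u z) * kap (ee n) (w - z)) + u z * ip (fun w => kap (ee n) (w - z))))) by apply/funext.
  apply: cvgB.
    apply: cvgMr; apply: cvg_cont; first exact: continuous_ln.
    by rewrite -[X in _ --> X]addr0; apply: cvgD; [exact: cvg_cst|exact: ee_lim].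
  apply: cvgD; first exact: ip_u_lim.
  by apply: cvgD; [exact: ip_osc_lim|apply: cvgMr; exact: ip_kap_lim].
(* [T + ee n] is at most 7, so [l7 - gl] is nonnegative, as Fatou requires. *)
pose l7 : R := ln 7.
pose h n w := expR (u w) * (l7 - gl (ee n) z w).
pose hl w := expR (u w) * (l7 + GG (w - z)).
have ih n : itg (h n).
  have -> : h n = (fun w => l7 * expR (u w) - expR (u w) * gl (ee n) z w) by apply/funext => w; rewrite /h; ring.
  by apply: itgB => //; exact: itgZ.
have iph n : ip (h n) = l7 * ip (fun w => expR (u w)) - X n.
  rewrite /X -(ipZ _ ieu) -(ipB (itgZ _ ieu) (iX n)); apply: ip_eq => w _; rewrite /h; ring.
have h0 n w : 0 <= h n w.
  apply: mulr_ge0; first exact: expR_ge0.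
  rewrite subr_ge0 /gl ler_ln ?posrE ?TTe_gt0 //.
  by have := TT_le6 (w - z); have := ee1 n; lra.
have hl0 w : 0 <= hl w.
  apply: mulr_ge0; first exact: expR_ge0.
  rewrite /GG subr_ge0; have [->|T0] := eqVneq (TT (w - z)) 0; first by rewrite ln0 // ln_ge0 //; lra.
  rewrite ler_ln ?posrE //; last by rewrite lt_neqAle eq_sym T0 TT_ge0.
  by have := TT_le6 (w - z); lra.
have mhl : mfp hl.
  apply: measurable_funM; first exact: itg_mf ieu.
  by apply: mfP; apply: measurable_funD => //; apply: mf_shift; exact: mf_GG.
have lim w : P w -> ~ (P w /\ TT (w - z) = 0) -> h n w @[n --> \oo] --> hl w.
  move=> Pw hN; have T0 : 0 < TT (w - z).
    by rewrite lt_neqAle TT_ge0 andbT eq_sym; apply/negP => /eqP T0; apply: hN.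
  apply: cvgMr; apply: cvgB; first exact: cvg_cst.
  apply: cvg_cont; first exact: continuous_ln.
  by rewrite -[X in _ --> X]addr0; apply: cvgD; [exact: cvg_cst|exact: ee_lim].
have [B hB] : exists B, forall n, ip (h n) <= B.
  move: (cvgP _ limX) => /cvg_seq_bounded/pinfty_ex_gt0[M M0 /= hM].
  exists (l7 * ip (fun w => expR (u w)) + M) => n; rewrite iph lerD2l.
  by have := hM n I; rewrite ler_norml => /andP[+ _]; lra.
have [ihl _] := ip_fatou (fun n => itg_mf (ih n)) mhl (negligible_lattice z) (fun n w _ => h0 n w) (fun w _ => hl0 w) lim ih hB.
have [_ lim2] : itg hl /\ ip (h n) @[n --> \oo] --> ip hl.
  apply: (@ip_dct_ae _ h hl (fun w => hl w + expR (u w) * l7) _ _ mhl (negligible_lattice z) lim) => [n|n w Pw hN|].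
  - exact: itg_mf (ih n).
  - have T0 : 0 < TT (w - z).
      by rewrite lt_neqAle TT_ge0 andbT eq_sym; apply/negP => /eqP T0; apply: hN.
    rewrite ger0_norm // /h /hl -mulrDr ler_wpM2l ?expR_ge0 //.
    have l70 : 0 <= l7 by rewrite ln_ge0 //; lra.
    have : ln (TT (w - z)) <= ln (TT (w - z) + ee n) by rewrite ler_ln ?posrE ?TTe_gt0 // lerDl ltW.
    by rewrite /GG /gl; lra.
  - apply: itgD => //; have -> : (fun w => expR (u w) * l7) = (fun w => l7 * expR (u w)) by apply/funext => w; rewrite mulrC.
    exact: itgZ.
have iG : itg (fun w => expR (u w) * GG (w - z)).
  have -> : (fun w => expR (u w) * GG (w - z)) = (fun w => hl w - l7 * expR (u w)) by apply/funext => w; rewrite /hl; ring.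
  by apply: itgB => //; exact: itgZ.
split => //.
have e1 : ip hl = l7 * ip (fun w => expR (u w)) + ip (fun w => expR (u w) * GG (w - z)).
  rewrite -(ipZ _ ieu) -(ipD (itgZ _ ieu) iG); apply: ip_eq => w _; rewrite /hl; ring.
have e2 : ip hl = l7 * ip (fun w => expR (u w)) - Xl.
  apply: (cvg_unique _ lim2) => //.
  have -> : (fun n => ip (h n)) = (fun n => l7 * ip (fun w => expR (u w)) - X n) by apply/funext.
  by apply: cvgB => //; exact: cvg_cst.
have : ip (fun w => expR (u w) * GG (w - z)) = - Xl by lra.
by move=> ->; rewrite /Xl; ring.
Qed.

End representation.

(** * The square root of [T] as a distance *)

Section triangle.
Context {R : realType}.
Implicit Types w z : R * R.

Lemma cos_half (x : R) : 1 - cos x = 2 * sin (x / 2) ^+ 2.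
Proof.
have {1}-> : x = (x / 2) *+ 2 by rewrite mulr2n; field.
by rewrite cos_mulr2n cos2sin2 mulr2n; ring.
Qed.

Lemma abs_sinD (x y : R) : `|sin ((x + y) / 2)| <= `|sin (x / 2)| + `|sin (y / 2)|.
Proof.
rewrite mulrDl sinD; apply: le_trans (ler_normD _ _) _; rewrite !normrM.
have c (t : R) : `|cos t| <= 1 by rewrite ler_norml cos_geN1 cos_le1.
apply: lerD; first by rewrite ler_piMr.
by rewrite ler_piMl.
Qed.

Definition sqT w : R := Num.sqrt (TT w).

Lemma sqT_ge0 w : 0 <= sqT w. Proof. exact: sqrtr_ge0. Qed.
Lemma sqT2 w : sqT w ^+ 2 = TT w. Proof. by rewrite sqr_sqrtr // TT_ge0. Qed.

Lemma sqTN w : sqT (- w) = sqT w. Proof. by rewrite /sqT TTN. Qed.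
Lemma TT_half w : TT w = 2 * (sin (ta1 w / 2) ^+ 2 + sin (ta2 w / 2) ^+ 2 + sin ((ta1 w + ta2 w) / 2) ^+ 2).
Proof. by rewrite /TT !cos_half; ring. Qed.

(* Minkowski's inequality, since T(w) = 2 sum_j sin^2(a_j / 2) with a_j linear in w. *)
Lemma sqT_triangle w z : sqT (w + z) <= sqT w + sqT z.
Proof.
have a1 : ta1 (w + z) = ta1 w + ta1 z.
  by rewrite /ta1 -[(w + z).1]/(w.1 + z.1) -[(w + z).2]/(w.2 + z.2); ring.
have a2 : ta2 (w + z) = ta2 w + ta2 z by rewrite /ta2 -[(w + z).2]/(w.2 + z.2); ring.
have Tw := TT_half w; have Tz := TT_half z.
have sw := sqT2 w; have sz := sqT2 z; have w0 := sqT_ge0 w; have z0 := sqT_ge0 z.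
rewrite -(@ler_pXn2r _ 2) ?nnegrE ?addr_ge0 ?sqT_ge0 // sqT2 TT_half a1 a2.
have h1 := abs_sinD (ta1 w) (ta1 z); have h2 := abs_sinD (ta2 w) (ta2 z).
have h3 := abs_sinD (ta1 w + ta2 w) (ta1 z + ta2 z).
have -> : ta1 w + ta1 z + (ta2 w + ta2 z) = ta1 w + ta2 w + (ta1 z + ta2 z) by ring.
move: Tw Tz h1 h2 h3 sw sz.
rewrite -!(real_normK (num_real (sin _))).
move: `|sin ((ta1 w + ta1 z) / 2)| (normr_ge0 (sin ((ta1 w + ta1 z) / 2))) => p1 p10.
move: `|sin ((ta2 w + ta2 z) / 2)| (normr_ge0 (sin ((ta2 w + ta2 z) / 2))) => p2 p20.
move: `|sin ((ta1 w + ta2 w + (ta1 z + ta2 z)) / 2)| (normr_ge0 (sin ((ta1 w + ta2 w + (ta1 z + ta2 z)) / 2))) => p3 p30.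
move: `|sin (ta1 w / 2)| (normr_ge0 (sin (ta1 w / 2))) => x1 x10.
move: `|sin (ta2 w / 2)| (normr_ge0 (sin (ta2 w / 2))) => x2 x20.
move: `|sin ((ta1 w + ta2 w) / 2)| (normr_ge0 (sin ((ta1 w + ta2 w) / 2))) => x3 x30.
move: `|sin (ta1 z / 2)| (normr_ge0 (sin (ta1 z / 2))) => y1 y10.
move: `|sin (ta2 z / 2)| (normr_ge0 (sin (ta2 z / 2))) => y2 y20.
move: `|sin ((ta1 z + ta2 z) / 2)| (normr_ge0 (sin ((ta1 z + ta2 z) / 2))) => y3 y30.
move=> -> -> h1 h2 h3 sw sz.
have q1 : p1 ^+ 2 <= (x1 + y1) ^+ 2 by rewrite ler_pXn2r ?nnegrE // addr_ge0.
have q2 : p2 ^+ 2 <= (x2 + y2) ^+ 2 by rewrite ler_pXn2r ?nnegrE // addr_ge0.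
have q3 : p3 ^+ 2 <= (x3 + y3) ^+ 2 by rewrite ler_pXn2r ?nnegrE // addr_ge0.
have cs : 2 * (x1 * y1 + x2 * y2 + x3 * y3) <= sqT w * sqT z.
  have n0 : 0 <= 2 * (x1 * y1 + x2 * y2 + x3 * y3) by rewrite mulr_ge0 // !addr_ge0 // mulr_ge0.
  have E2 : (sqT w * sqT z) ^+ 2 = 2 * (x1 ^+ 2 + x2 ^+ 2 + x3 ^+ 2) * (2 * (y1 ^+ 2 + y2 ^+ 2 + y3 ^+ 2)) by rewrite -sw -sz; ring.
  suff h : (2 * (x1 * y1 + x2 * y2 + x3 * y3)) ^+ 2 <= (sqT w * sqT z) ^+ 2.
    by rewrite -(@ler_pXn2r _ 2) ?nnegrE // mulr_ge0.
  rewrite E2.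
  have := sqr_ge0 (x1 * y2 - x2 * y1); have := sqr_ge0 (x1 * y3 - x3 * y1).
  have := sqr_ge0 (x2 * y3 - x3 * y2); nra.
have -> : (sqT w + sqT z) ^+ 2 = sqT w ^+ 2 + sqT z ^+ 2 + 2 * (sqT w * sqT z) by ring.
rewrite sw sz; lra.
Qed.

(** In the distance [sqT], a point at least [sqrt d] away from the lattice, moved by at most half of
    that, remains at least [sqrt d / 2] away. *)
Lemma TT_far w z (d : R) : 0 < d -> d <= TT w -> TT z <= d / 4 -> d / 4 <= TT (w - z).
Proof.
move=> d0 dw dz.
pose s := Num.sqrt d; have s0 : 0 < s by rewrite sqrtr_gt0.
have s2 : s ^+ 2 = d by rewrite sqr_sqrtr // ltW.
have h1 : s <= sqT w by rewrite ler_wsqrtr.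
have h2 : sqT z <= s / 2.
  rewrite -(@ler_pXn2r _ 2) ?nnegrE ?sqT_ge0 // ?divr_ge0 // ?(ltW s0) // sqT2.
  by have -> : (s / 2) ^+ 2 = d / 4; [rewrite -s2; field|].
have h3 : sqT w <= sqT (w - z) + sqT z by rewrite -{1}(subrK z w) sqT_triangle.
have h4 : s / 2 <= sqT (w - z) by lra.
rewrite -sqT2; have -> : d / 4 = (s / 2) ^+ 2 by rewrite -s2; field.
by rewrite ler_pXn2r ?nnegrE ?sqT_ge0 // divr_ge0 // ltW.
Qed.

End triangle.

(** * Exponential integrability of logarithmic potentials *)

Section bound.
Context {R : realType}.
Local Notation leb := (@lebesgue_measure R).
Local Notation mu := (lebesgue2 R).
Local Notation s3 := (Num.sqrt (3 : R)).
Local Notation hh := (s3 / 2).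
Local Notation P := (fundamental_domain (rho R)).
Local Notation PT := (measurableTypeR R * measurableTypeR R)%type.
Local Notation mf f := (measurable_fun [set: PT] (f : PT -> R)).
Implicit Types (w z c : R * R) (f g : R * R -> R) (M k : R).

Lemma expR_tangent (a x : R) : expR a * (1 + x - a) <= expR x.
Proof.
have -> : expR x = expR a * expR (x - a) by rewrite -expRD addrC subrK.
by rewrite ler_wpM2l ?expR_ge0 //; have := expR_ge1Dx (x - a); lra.
Qed.

(** Jensen for a mass at most [pi] instead of a probability. The tangent of the exponential at [a]
    is integrated against [f]; when [a > 1], the negative factor [1 - a] allows the mass to be
    replaced by [pi]. The case [a <= 1] is covered by the summand [expR 1]. *)
Lemma jensen_bound f g : (forall w, 0 <= f w) -> itg f -> ip f <= pi -> itg (fun w => f w * g w) ->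
  itg (fun w => f w * expR (g w / 4)) ->
  expR (ip (fun w => f w * g w) / (4 * pi)) <= expR 1 + ip (fun w => f w * expR (g w / 4)) / pi.
Proof.
move=> f0 fi fpi ifg ife; have pi0 := pi_gt0 R.
set a := _ / _; have [a1|a1] := leP a 1.
  rewrite -[leLHS]addr0; apply: lerD; first by rewrite ler_expR.
  by rewrite divr_ge0 ?(ltW pi0) // ip_ge0 // => w _; rewrite mulr_ge0 ?expR_ge0.
rewrite -[leLHS]add0r; apply: lerD; first exact: expR_ge0.
rewrite ler_pdivlMr //.
have e0 := expR_gt0 a.
have ga : ip (fun w => f w * g w) = 4 * pi * a by rewrite /a mulrC divfK // mulf_neq0 // gt_eqF.
have : ip (fun w => expR a * (1 - a) * f w + expR a / 4 * (f w * g w)) <= ip (fun w => f w * expR (g w / 4)).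
  apply: ip_le => //; first by apply: itgD; exact: itgZ.
  move=> w _; have h := expR_tangent a (g w / 4).
  have -> : expR a * (1 - a) * f w + expR a / 4 * (f w * g w) = f w * (expR a * (1 + g w / 4 - a)) by ring.
  by rewrite ler_wpM2l.
apply: le_trans; rewrite (ipD (itgZ _ fi) (itgZ _ ifg)) (ipZ _ fi) (ipZ _ ifg) ga.
have -> : expR a * (1 - a) * ip f + expR a / 4 * (4 * pi * a) = expR a * ((1 - a) * ip f + pi * a) by field.
rewrite ler_pM2l //.
have : (1 - a) * pi <= (1 - a) * ip f by rewrite ler_nM2l //; lra.
lra.
Qed.

(** This is [T^(-1/4)]. The exponent is the one produced by [jensen_bound]; its square [sT] is still
    integrable, which is what [double_potential] uses. *)
Definition qT w : R := expR (GG w / 4).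

Lemma qT2 w : qT w ^+ 2 = sT w.
Proof. by rewrite expr2 -expRD /sT; congr expR; rewrite /GG; field. Qed.
Lemma GG_le w : GG w <= 4 * qT w.
Proof. by have := expR_ge1Dx (GG w / 4); rewrite -/(qT w); lra. Qed.
Lemma qT_ge0 w : 0 <= qT w. Proof. exact: expR_ge0. Qed.

Lemma mf_qT : mf qT.
Proof. by apply: measurableT_comp => //; apply: measurable_funM => //; exact: mf_GG. Qed.

Lemma EFin_ip f : itg f -> (ip f)%:E = (\int[mu]_(w in P) (f w)%:E)%E.
Proof.
by move=> i; rewrite -[LHS]/((fine (\int[mu]_(w in P) (f w)%:E)%E)%:E) fineK //; apply: integrable_fin_num; [exact: measP|exact: i].
Qed.

Lemma sT_ge0 w : 0 <= sT w. Proof. exact: expR_ge0. Qed.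
Lemma sT_per : per (@sT R). Proof. by split => w; rewrite /sT ?TT_per1 ?TT_per2. Qed.

Lemma integral_sT z : (\int[mu]_(w in P) (sT (w + z)%R)%:E = (ip (@sT R))%:E)%E.
Proof.
have [p1 p2] := sT_per.
rewrite (@integral_fd_shift _ (fun w => (sT w)%:E) z).
- by rewrite EFin_ip //; exact: ip_sT.
- by have : measurable_fun [set: PT] (fun w : PT => (sT w)%:E) by apply/measurable_EFinP; exact: mf_sT.
- by move=> w; rewrite lee_fin sT_ge0.
- by move=> w; rewrite p1.
- by move=> w; rewrite p2.
Qed.

Lemma itg_sT_shift z : itg (fun w => sT (w + z)).
Proof.
apply/integrableP; split; first by apply/measurable_EFinP; apply: mfP; apply: mf_shift; exact: mf_sT.
have -> : (\int[mu]_(w in P) `|(sT (w + z)%R)%:E| = \int[mu]_(w in P) (sT (w + z)%R)%:E)%E.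
  by apply: eq_integral => w _ /=; rewrite ger0_norm // sT_ge0.
by rewrite integral_sT ltry.
Qed.

Lemma qT_le w : qT w <= 1 + sT w.
Proof. by rewrite -qT2; have := sqr_ge0 (qT w - 1); have := sqr_ge0 (qT w); rewrite !expr2; lra. Qed.

Lemma itg_qT_shift z : itg (fun w => qT (w + z)).
Proof.
apply: (@itg_le _ _ (fun w => 1 + sT (w + z))).
- by apply: mfP; apply: mf_shift; exact: mf_qT.
- by move=> w _; rewrite ger0_norm ?qT_ge0 // qT_le.
- by apply: itgD; [exact: itg_cst|exact: itg_sT_shift].
Qed.

Lemma ip_sT_shift z : ip (fun w => sT (w - z)) = ip (@sT R).
Proof. by apply: EFin_inj; apply: etrans (EFin_ip (itg_sT_shift (- z))) (integral_sT (- z)). Qed.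

Lemma ip_qT_shift z : ip (fun w => qT (w + z)) <= hh + ip (@sT R).
Proof.
have -> : ip (@sT R) = ip (fun w => sT (w + z)) by have := ip_sT_shift (- z); rewrite opprK => ->.
rewrite -[X in X + _]mul1r -ip_cst -(ipD (itg_cst _) (itg_sT_shift z)).
apply: ip_le => [||w _]; [exact: itg_qT_shift|by apply: itgD; [exact: itg_cst|exact: itg_sT_shift]|exact: qT_le].
Qed.

Lemma mf_diff : measurable_fun [set: PT * PT] (fun p : PT * PT => p.2 - p.1 : PT).
Proof.
have -> : (fun p : PT * PT => p.2 - p.1 : PT) = (fun p => (p.2.1 - p.1.1, p.2.2 - p.1.2)) by apply/funext => -[[a b] [c d]].
apply: measurable_fun_pair; apply: measurable_funB.
- exact: (measurableT_comp measurable_fst measurable_snd).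
- exact: (measurableT_comp measurable_fst measurable_fst).
- exact: (measurableT_comp measurable_snd measurable_snd).
- exact: (measurableT_comp measurable_snd measurable_fst).
Qed.

(* The canonical sigma-finite structure of a product measure is registered for subprobabilities only. *)
Definition plane_measure : set PT -> \bar R := mu.
HB.instance Definition _ := Measure.on plane_measure.

Fact plane_measure_sigma_finite : sigma_finite setT plane_measure.
Proof.
have /sigma_finiteP[F [TF ndF Foo]] := sigma_finiteT leb.
exists (fun n => F n `*` F n).
  rewrite -setXTT TF predeqE => -[x y]; split.
    move=> [/= [n _ Fnx] [k _ Fky]]; exists (maxn n k) => //; split.
    - by move: x Fnx; exact/subsetPset/ndF/leq_maxl.
    - by move: y Fky; exact/subsetPset/ndF/leq_maxr.
  by move=> [n _ []/= ? ?]; split; exists n.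
move=> k; have [m f] := Foo k; split; first exact: measurableX.
by rewrite [X in (X < _)%E](product_measure1E leb leb m m) lte_mul_pinfty // ge0_fin_numE.
Qed.

HB.instance Definition _ := @Measure_isSigmaFinite.Build _ PT R plane_measure plane_measure_sigma_finite.

Lemma measurable_potential (E : R * R -> R) : mf E -> (forall w, 0 <= E w) ->
  measurable_fun [set: PT] (fun w : PT => \int[mu]_(v in P) (E v * qT (v - w))%:E)%E.
Proof.
move=> mE E0.
pose F (p : PT * PT) : \bar R := (\1_P p.2 * (E p.2 * qT (p.2 - p.1)))%:E.
have mP : mf (\1_P : R * R -> R) by apply: measurable_indic; exact: measP.
have mF : measurable_fun [set: PT * PT] F.
  apply/measurable_EFinP; apply: measurable_funM; first exact: (measurableT_comp mP measurable_snd).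
  apply: measurable_funM; first exact: (measurableT_comp mE measurable_snd).
  exact: (measurableT_comp mf_qT mf_diff).
have F0 p : (0 <= F p)%E by rewrite lee_fin !mulr_ge0 ?qT_ge0 // indicE.
have -> : (fun w : PT => \int[mu]_(v in P) (E v * qT (v - w))%:E)%E = (fun w => \int[mu]_v F (w, v))%E.
  apply/funext => w; rewrite integral_mkcond; apply: eq_integral => v _; rewrite /patch /F /= indicE.
  by case: ifPn => vP; rewrite ?mul1r ?mul0r.
exact: (@measurable_fun_fubini_tonelli_F _ _ _ _ _ plane_measure F mF F0).
Qed.

(* Tonelli, with q(w' - w) q(w - z) bounded by the mean of the squares. *)
Lemma double_potential (E : R * R -> R) z : mf E -> (forall w, 0 <= E w) -> itg E ->
  (\int[mu]_(w in P) ((qT (w - z))%:E * \int[mu]_(v in P) (E v * qT (v - w))%:E)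
    <= (ip E * ip (@sT R))%:E)%E.
Proof.
move=> mE E0 iE.
pose F (p : PT * PT) : \bar R := (\1_P p.1 * (\1_P p.2 * (E p.2 * (qT (p.1 - z) * qT (p.2 - p.1)))))%:E.
have mP : mf (\1_P : R * R -> R) by apply: measurable_indic; exact: measP.
have mdiff : measurable_fun [set: PT * PT] (fun p : PT * PT => p.2 - p.1 : PT).
  have -> : (fun p : PT * PT => p.2 - p.1 : PT) = (fun p => (p.2.1 - p.1.1, p.2.2 - p.1.2)) by apply/funext => -[[a b] [c d]].
  apply: measurable_fun_pair; apply: measurable_funB.
  - by apply: measurableT_comp; [exact: measurable_fst|exact: measurable_snd].
  - by apply: measurableT_comp; [exact: measurable_fst|exact: measurable_fst].
  - by apply: measurableT_comp; [exact: measurable_snd|exact: measurable_snd].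
  - by apply: measurableT_comp; [exact: measurable_snd|exact: measurable_fst].
have mF : measurable_fun [set: PT * PT] F.
  apply/measurable_EFinP; apply: measurable_funM; first exact: (measurableT_comp mP measurable_fst).
  apply: measurable_funM; first exact: (measurableT_comp mP measurable_snd).
  apply: measurable_funM; first exact: (measurableT_comp mE measurable_snd).
  apply: measurable_funM; first exact: (measurableT_comp (mf_shift (- z) mf_qT) measurable_fst).
  exact: (measurableT_comp mf_qT mdiff).
have F0 p : (0 <= F p)%E.
  by rewrite lee_fin !mulr_ge0 ?qT_ge0 // indicE.
have mEq w : mf (fun v => E v * qT (v - w)) by apply: measurable_funM => //; apply: mf_shift; exact: mf_qT.
have -> : (\int[mu]_(w in P) ((qT (w - z)%R)%:E * \int[mu]_(v in P) (E v * qT (v - w))%:E) = \int[mu]_w \int[mu]_v F (w, v))%E.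
  rewrite integral_mkcond; apply: eq_integral => w _; rewrite /patch.
  case: ifPn => wP.
    rewrite -ge0_integralZl //; first last.
    - by rewrite lee_fin qT_ge0.
    - by move=> v _; rewrite lee_fin mulr_ge0 ?qT_ge0.
    - by apply/measurable_EFinP; apply: mfP.
    - exact: measP.
    rewrite integral_mkcond; apply: eq_integral => v _; rewrite /patch /F /= !indicE wP mul1r.
    by case: ifPn => vP; rewrite ?mul1r ?mul0r // -EFinM; congr EFin; ring.
  rewrite -[LHS](integral0 mu setT); apply: eq_integral => v _.
  by rewrite /F /= indicE (negbTE wP) mul0r.
rewrite [leLHS](@fubini_tonelli _ _ _ _ _ plane_measure plane_measure F mF F0).
apply: (@le_trans _ _ (\int[mu]_(v in P) (E v * ip (@sT R))%:E)%E); last first.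
  have iE2 : itg (fun v => E v * ip (@sT R)).
    have -> : (fun v => E v * ip (@sT R)) = (fun v => ip (@sT R) * E v) by apply/funext => v; rewrite mulrC.
    exact: itgZ.
  have -> : (\int[mu]_(v in P) (E v * ip (@sT R))%:E = (ip (fun v => E v * ip (@sT R)))%:E)%E.
    by rewrite (EFin_ip iE2).
  rewrite lee_fin le_eqVlt; apply/orP; left; apply/eqP.
  by rewrite mulrC -(ipZ _ iE); apply: ip_eq => v _; rewrite mulrC.
rewrite [leRHS]integral_mkcond; apply: ge0_le_integral => //.
- by move=> v _; apply: integral_ge0.
- exact: (@measurable_fun_fubini_tonelli_G _ _ _ _ _ plane_measure F mF F0).
- apply/(measurable_restrictT _ _).1; first exact: measP.
  by apply/measurable_EFinP; apply: mfP; apply: measurable_funM.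
move=> v _; rewrite /patch; case: ifPn => vP; last first.
  rewrite integral0_eq // => w _; by rewrite /F /= !indicE (negbTE vP) mul0r mulr0.
have -> : (E v * ip (@sT R))%:E = (\int[mu]_(w in P) (E v * ((sT (w - z) + sT (w - v)) / 2))%:E)%E.
  have i1 := itg_sT_shift (- z); have i2 := itg_sT_shift (- v).
  have i3 : itg (fun w => E v / 2 * (sT (w - z) + sT (w - v))) by apply: itgZ; exact: itgD.
  have -> : E v * ip (@sT R) = ip (fun w => E v / 2 * (sT (w - z) + sT (w - v))).
    by rewrite (ipZ _ (itgD i1 i2)) (ipD i1 i2) (ip_sT_shift z) (ip_sT_shift v); move: (ip (@sT R)) => k; field.
  rewrite (EFin_ip i3).
  by apply: eq_integral => w _; congr EFin; field.
rewrite [leRHS]integral_mkcond; apply: ge0_le_integral => //.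
- by apply: (measurableT_comp mF); apply: measurable_fun_pair; [exact: measurable_id|exact: measurable_cst].
- apply/(measurable_restrictT _ _).1; first exact: measP.
  apply/measurable_EFinP; apply: mfP; apply: measurable_funM => //; apply: measurable_funM => //.
  by apply: measurable_funD; apply: mf_shift; exact: mf_sT.
move=> w _; rewrite /patch /F /= !indicE vP mul1r.
case: ifPn => wP; last by rewrite mul0r.
rewrite mul1r lee_fin ler_wpM2l //.
have -> : sT (w - v) = qT (v - w) ^+ 2 by rewrite qT2 /sT TTNB.
rewrite -qT2 ler_pdivlMr //.
by have := sqr_ge0 (qT (w - z) - qT (v - w)); rewrite !expr2; lra.
Qed.

End bound.

(** * Boundedness of [exp u] *)

Section brezis_merle.
Context {R : realType}.
Local Notation mu := (lebesgue2 R).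
Local Notation s3 := (Num.sqrt (3 : R)).
Local Notation hh := (s3 / 2).
Local Notation P := (fundamental_domain (rho R)).
Local Notation Lam := (lattice (rho R)).
Local Notation PT := (measurableTypeR R * measurableTypeR R)%type.
Local Notation mf f := (measurable_fun [set: PT] (f : PT -> R)).
Local Notation mfp f := (measurable_fun (P : set PT) (f : PT -> R)).
Implicit Types (w z c : R * R) (f g : R * R -> R) (M k : R).

Lemma ip_off f g : (forall w, P w -> ~ Lam w -> f w = g w) -> mfp f -> mfp g -> ip f = ip g.
Proof.
move=> fg mf mg; rewrite /ip /Rintegral; congr fine; apply: ae_eq_integral.
- exact: measP.
- exact/measurable_EFinP.
- exact/measurable_EFinP.
apply: negligibleS (negligible_lattice (0 : R * R)) => w /= h.
split; first by apply: contrapT => Pw; apply: h => /Pw.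
rewrite subr0; apply/TT_eq0; apply: contrapT => wL; apply: h => Pw.
by rewrite fg.
Qed.

Variable u : R * R -> R.
Hypothesis sol : mean_field_solution (rho R) (16 * pi) u.

Let pu := solution_periodic sol.
Let su := solution_smooth sol.
Let iu : itg u. Proof. exact: solution_integrable sol. Qed.
Let ieu : itg (fun w => expR (u w)). Proof. exact: solution_exp_integrable sol. Qed.

(** The values of [u] on the lattice are arbitrary. Setting [e^u] to 0 there gives a function
    measurable on the whole plane, for which a global bound makes sense. *)
Definition EE w : R := ((fun w => expR (u w)) \_ (~` Lam)) w.

Lemma EE_off w : ~ Lam w -> EE w = expR (u w).
Proof. by move=> wL; rewrite /EE /patch mem_set. Qed.
Lemma EE_on w : Lam w -> EE w = 0.
Proof. by move=> wL; rewrite /EE /patch memNset //= => /(_ wL). Qed.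
Lemma EE_ge0 w : 0 <= EE w.
Proof. by have [wL|wL] := pselect (Lam w); [rewrite EE_on|rewrite EE_off ?expR_ge0]. Qed.

Lemma mf_EE : mf EE.
Proof.
apply/(measurable_restrictT _ _).1; first exact: open_measurable2 (@open_notlattice R).
apply: cts_measurable2; first exact: open_notlattice.
by move=> w wL; exact: rd_cts (rd_comp (@smooth_rd _ _ su [::] w wL) (is_derive_expR (u w))).
Qed.

Lemma itg_EE : itg EE.
Proof.
apply: itg_le ieu; first by apply: mfP; exact: mf_EE.
move=> w _; rewrite ger0_norm ?EE_ge0 //.
by have [wL|wL] := pselect (Lam w); [rewrite EE_on ?expR_ge0|rewrite EE_off].
Qed.

Lemma representationE z : ~ Lam z -> itg (fun w => EE w * GG (w - z)) /\
  4 * pi * u z = 16 * pi * ln (TT z) + ip (fun w => EE w * GG (w - z)) - ip (fun w => u w * RR (w - z)).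
Proof.
move=> zL; have [i e] := representation sol zL.
have mE : mfp (fun w => EE w * GG (w - z)).
  by apply: mfP; apply: measurable_funM; [exact: mf_EE|apply: mf_shift; exact: mf_GG].
split.
  apply: itg_le (itg_norm i) => // w _.
  by have [wL|wL] := pselect (Lam w); [rewrite EE_on // mul0r normr0|rewrite EE_off].
rewrite e; congr (_ + _ - _); apply: ip_off => //; last exact: itg_mf i.
by move=> w _ wL; rewrite EE_off.
Qed.
Let N (d : R) : set PT := [set w | TT w < d].

Let mN d : measurable (N d).
Proof.
have := @mf_TT R measurableT `]-oo, d[%classic (measurable_itv _); rewrite setTI; congr measurable.
Qed.

(** The sets where [T < 1 / (n + 1)] shrink to the negligible lattice, so their mass tends to 0. The
    threshold [pi] is the one in [jensen_bound]. *)
Lemma small_mass : exists2 d, 0 < d <= 1 & ip (fun w => EE w * \1_(N d) w) <= pi.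
Proof.
pose dn (n : nat) : R := n.+1%:R^-1.
have mI d : mf (\1_(N d) : R * R -> R) by apply: measurable_indic; exact: mN.
have [_ lim] : itg (fun _ : R * R => 0 : R) /\
   ip (fun w => EE w * \1_(N (dn n)) w) @[n --> \oo] --> ip (fun _ : R * R => 0 : R).
  apply: (@ip_dct _ (fun n w => EE w * \1_(N (dn n)) w) _ EE _ _ _ (negligible_lattice (0 : R * R))).
  - by move=> n; apply: mfP; apply: measurable_funM => //; exact: mf_EE.
  - exact: measurable_cst.
  - move=> w Pw hN; have T0 : 0 < TT w.
      by rewrite lt_neqAle TT_ge0 andbT eq_sym; apply/negP => /eqP T0; apply: hN; split => //; rewrite subr0.
    apply: cvg_near_cst; near=> n; rewrite indicE.
    have : dn n <= TT w by near: n; apply: (cvgr_le _ (@cvg_harmonic R)).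
    move=> h; rewrite memNset ?mulr0 //= /N /= => h'.
    by have := lt_le_trans h' h; rewrite ltxx.
  - move=> n w _; rewrite normrM ger0_norm ?EE_ge0 //.
    by rewrite ler_piMr ?EE_ge0 // indicE ger0_norm // lern1 leq_b1.
  - exact: itg_EE.
rewrite ip_cst mul0r in lim.
have [n hn] : exists n, ip (fun w => EE w * \1_(N (dn n)) w) < pi.
  have : \forall n \near \oo, ip (fun w => EE w * \1_(N (dn n)) w) < pi.
    by apply: (cvgr_lt _ lim); exact: pi_gt0.
  by move=> [k _ hk]; exists k; apply: hk => /=.
exists (dn n); last exact: ltW.
by rewrite /dn invr_gt0 ltr0n /= invf_le1 // ler1n.
Unshelve. all: by end_near.
Qed.

Section fixed_radius.
Variable d : R.
Hypotheses (d01 : 0 < d <= 1) (mass : ip (fun w => EE w * \1_(N d) w) <= pi).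
Let d0 : 0 < d. Proof. by case/andP: d01. Qed.
Let d1 : d <= 1. Proof. by case/andP: d01. Qed.
Let f0 w := EE w * \1_(N d) w.

Let f0_ge0 w : 0 <= f0 w. Proof. by rewrite mulr_ge0 ?EE_ge0 // indicE. Qed.
Let mf_f0 : mf f0.
Proof. by apply: measurable_funM; [exact: mf_EE|apply: measurable_indic; exact: mN]. Qed.
Let f0_le w : f0 w <= EE w.
Proof. by rewrite /f0 ler_piMr ?EE_ge0 // indicE lern1 leq_b1. Qed.
Let itg_f0 : itg f0.
Proof.
apply: itg_le itg_EE; first exact: mfP mf_f0.
by move=> w _; rewrite ger0_norm.
Qed.
Let A : R := LL * ip (fun w => `|u w|).

Let ipRR z : `|ip (fun w => u w * RR (w - z))| <= A.
Proof.
have mRR : mf (fun w => RR (w - z)) by apply: mf_shift; exact: mf_RR.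
have i : itg (fun w => u w * RR (w - z)) by apply: (itgM iu mRR) => w; exact: RR_bound.
apply: le_trans (ip_norm i) _; rewrite /A -(ipZ _ (itg_norm iu)); apply: ip_le => [||w _].
- exact: itg_norm.
- by apply: itgZ; exact: itg_norm.
- by rewrite normrM mulrC ler_wpM2r // RR_bound.
Qed.
(** Kept in the extended reals: where it is infinite, [near_bound1] holds for free, and no
    finiteness has to be proved pointwise. *)
Let pot z : \bar R := (\int[mu]_(v in P) (f0 v * qT (v - z))%:E)%E.

Let far_bound z w (e : R) : 0 < e -> e <= TT w -> TT z <= e / 4 -> GG (w - z) <= - ln (e / 4).
Proof.
move=> e0 ew ez; have h := TT_far e0 ew ez.
by rewrite /GG lerN2 ler_ln ?posrE ?divr_gt0 //; apply: lt_le_trans h; rewrite divr_gt0.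
Qed.

(** In the representation formula the term [ln T] is nonpositive near the lattice, the [RR] term is
    at most [A], and the mass outside [N d] contributes a constant by [far_bound]. Only the mass
    inside [N d] is left, and [jensen_bound] exponentiates it. *)
Lemma near_bound1 : exists2 C, 0 < C & forall z, ~ Lam z -> TT z <= d / 4 ->
  ((EE z)%:E <= C%:E * (1 + pot z))%E.
Proof.
have pi0 := pi_gt0 R; have pi2 := pi_ge2 R.
pose l4 : R := - ln (d / 4).
have l40 : 0 <= l4 by rewrite /l4 oppr_ge0 ln_le0 //; have := d1; lra.
pose B := (l4 * ip EE + A) / (4 * pi).
exists (expR B * (expR 1 + 1)) => [|z zL Tz]; first by rewrite mulr_gt0 ?expR_gt0 // addr_gt0 // expR_gt0.
have C0 : 0 < expR B * (expR 1 + 1) by rewrite mulr_gt0 ?expR_gt0 // addr_gt0 // expR_gt0.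
have T0 := TT_gt0 zL.
have [iG e] := representationE zL.
have mI : mf (\1_(N d) : R * R -> R) by apply: measurable_indic; exact: mN.
have if0G : itg (fun w => f0 w * GG (w - z)).
  have -> : (fun w => f0 w * GG (w - z)) = (fun w => EE w * GG (w - z) * \1_(N d) w) by apply/funext => w; rewrite /f0; ring.
  by apply: (@itgM _ _ _ 1 iG) => // w; rewrite indicE ger0_norm // lern1 leq_b1.
have le1 : ip (fun w => EE w * GG (w - z)) <= ip (fun w => f0 w * GG (w - z)) + l4 * ip EE.
  rewrite -(ipZ _ itg_EE) -(ipD if0G (itgZ _ itg_EE)); apply: ip_le => //.
    by apply: itgD => //; apply: itgZ; exact: itg_EE.
  move=> w _; rewrite /f0 indicE; have [wN|wN] := boolP (w \in N d); rewrite ?mulr1 ?mulr0 ?mul0r ?add0r /=.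
    by rewrite lerDl mulr_ge0 // EE_ge0.
  rewrite mulrC ler_wpM2r ?EE_ge0 //; apply: far_bound => //.
  by rewrite leNgt; apply/negP => h; move/negP: wN; apply; rewrite inE.
have lnT : ln (TT z) <= 0 by rewrite ln_le0 //; have := d1; lra.
have uz : u z <= B + ip (fun w => f0 w * GG (w - z)) / (4 * pi).
  have := ipRR z; rewrite ler_norml => /andP[r1 r2].
  have p4 : 0 < 4 * (pi : R) by rewrite mulr_gt0.
  rewrite /B -mulrDl ler_pdivlMr // mulrC e.
  have : 16 * pi * ln (TT z) <= 0 by rewrite mulr_ge0_le0 // mulr_ge0 // ltW.
  lra.
rewrite EE_off //; apply: (@le_trans _ _ (expR B * expR (ip (fun w => f0 w * GG (w - z)) / (4 * pi)))%:E).
  by rewrite lee_fin -expRD ler_expR.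
have [poo|pfin] := eqVneq (pot z) +oo%E.
  rewrite poo addey // mulry gtr0_sg // mul1e leey //.
have mq : mf (fun w => f0 w * qT (w - z)) by apply: measurable_funM => //; apply: mf_shift; exact: mf_qT.
have iq : itg (fun w => f0 w * qT (w - z)).
  apply/integrableP; split; first by apply/measurable_EFinP; exact: mfP.
  have -> : (\int[mu]_(w in P) `|(EFin \o (fun w => (f0 w * qT (w - z))%R)) w| = pot z)%E.
    by apply: eq_integral => w _ /=; rewrite ger0_norm // mulr_ge0 ?qT_ge0.
  by rewrite ltey.
have potE : pot z = (ip (fun w => f0 w * qT (w - z)))%:E.
  by rewrite (EFin_ip iq).
have := jensen_bound f0_ge0 itg_f0 mass if0G iq; rewrite potE => J.
rewrite -EFinD -EFinM lee_fin -mulrA ler_wpM2l ?expR_ge0 //.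
apply: le_trans J _.
have X0 : 0 <= ip (fun w => f0 w * qT (w - z)) by apply: ip_ge0 => w _; rewrite mulr_ge0 ?qT_ge0.
move: (ip (fun w => f0 w * qT (w - z))) X0 => X X0.
have e1 := expR_gt0 (1 : R).
have : X / pi <= X by rewrite ler_pdivrMr // ler_peMr //; lra.
have : 0 <= expR 1 * X by rewrite mulr_ge0 // ltW.
lra.
Qed.

(** The bound of [near_bound1] is inserted for [e^u] inside the potential itself. With [GG <= 4 qT]
    there remains a double integral, bounded uniformly in [z] by [double_potential]. Passing from
    [d / 4] to [d / 16] leaves room for a second use of [far_bound]. *)
Lemma near_bound2 : exists C, forall z, ~ Lam z -> TT z <= d / 16 -> ip (fun w => EE w * GG (w - z)) <= C.
Proof.
have [C C0 hC] := near_bound1.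
pose l16 : R := - ln (d / 4 / 4).
have l160 : 0 <= l16 by rewrite /l16 oppr_ge0 ln_le0 //; have := d1; lra.
pose B := C * (hh + ip (@sT R) + ip f0 * ip (@sT R)).
exists (l16 * ip EE + 4 * B) => z zL Tz.
have [iG _] := representationE zL.
pose I : R * R -> R := \1_(N (d / 4)).
have mI : mf I by apply: measurable_indic; exact: mN.
have mq : mf (fun w => qT (w - z)) by apply: mf_shift; exact: mf_qT.
have mpot : measurable_fun [set: PT] pot by exact: measurable_potential.
have pot0 w : (0 <= pot w)%E by apply: integral_ge0 => v _; rewrite lee_fin mulr_ge0 ?qT_ge0.
have main : (\int[mu]_(w in P) (EE w * I w * qT (w - z))%:E <= B%:E)%E.
  apply: (@le_trans _ _ (\int[mu]_(w in P) (C%:E * ((qT (w - z))%:E + (qT (w - z))%:E * pot w)))%E).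
    apply: ge0_le_integral.
    - exact: measP.
    - by move=> w _; rewrite lee_fin !mulr_ge0 ?qT_ge0 ?EE_ge0 // /I indicE.
    - by apply/measurable_EFinP; apply: mfP; apply: measurable_funM => //; apply: measurable_funM => //; exact: mf_EE.
    - apply: measurable_funTS; apply: measurable_funeM; apply: emeasurable_funD; first exact/measurable_EFinP.
      by apply: emeasurable_funM => //; exact/measurable_EFinP.
    move=> w _; rewrite /I indicE; have [wN|wN] := boolP (w \in N (d / 4)); last first.
      rewrite /= mulr0 mul0r mule_ge0 ?lee_fin ?(ltW C0) // adde_ge0 ?lee_fin ?qT_ge0 // mule_ge0 ?lee_fin ?qT_ge0 //.
    rewrite mulr1; have [wL|wL] := pselect (Lam w).
      by rewrite EE_on // mul0r mule_ge0 ?lee_fin ?(ltW C0) // adde_ge0 ?lee_fin ?qT_ge0 // mule_ge0 ?lee_fin ?qT_ge0.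
    have Tw : TT w <= d / 4 by rewrite inE in wN; exact: ltW.
    have h := hC w wL Tw.
    have -> : (C%:E * ((qT (w - z))%:E + (qT (w - z))%:E * pot w) = (C%:E * (1 + pot w)) * (qT (w - z))%:E)%E.
      rewrite -muleA; congr (_ * _)%E; rewrite ge0_muleDl // mul1e; congr (_ + _)%E; exact: muleC.
    by rewrite EFinM; apply: lee_wpmul2r => //; rewrite lee_fin qT_ge0.
  rewrite ge0_integralZl //; first last.
  - by rewrite lee_fin ltW.
  - by move=> w _; rewrite adde_ge0 ?lee_fin ?qT_ge0 // mule_ge0 ?lee_fin ?qT_ge0.
  - apply: measurable_funTS; apply: emeasurable_funD; first exact/measurable_EFinP.
    by apply: emeasurable_funM => //; exact/measurable_EFinP.
  - exact: measP.
  rewrite EFinM; apply: lee_wpmul2l; first by rewrite lee_fin ltW.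
  rewrite ge0_integralD //; first last.
  - by apply: measurable_funTS; apply: emeasurable_funM => //; exact/measurable_EFinP.
  - by move=> w _; rewrite mule_ge0 ?lee_fin ?qT_ge0.
  - by apply: measurable_funTS; exact/measurable_EFinP.
  - by move=> w _; rewrite lee_fin qT_ge0.
  - exact: measP.
  rewrite EFinD; apply: leeD; last exact: (double_potential z mf_f0 f0_ge0 itg_f0).
  have -> : (\int[mu]_(w in P) (qT (w - z))%:E = (ip (fun w => qT (w - z)))%:E)%E.
    by rewrite (EFin_ip (itg_qT_shift (- z))).
  by rewrite lee_fin; exact: ip_qT_shift.
have miq : mf (fun w => EE w * I w * qT (w - z)) by apply: measurable_funM => //; apply: measurable_funM => //; exact: mf_EE.
have iq : itg (fun w => EE w * I w * qT (w - z)).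
  apply/integrableP; split; first by apply/measurable_EFinP; exact: mfP.
  have -> : (\int[mu]_(w in P) `|(EFin \o (fun w => (EE w * I w * qT (w - z))%R)) w| = \int[mu]_(w in P) (EE w * I w * qT (w - z))%:E)%E.
    by apply: eq_integral => w _ /=; rewrite ger0_norm // !mulr_ge0 ?qT_ge0 ?EE_ge0 // /I indicE.
  exact: le_lt_trans main (ltry _).
have ipq : ip (fun w => EE w * I w * qT (w - z)) <= B.
  by rewrite -lee_fin (EFin_ip iq).
apply: (@le_trans _ _ (ip (fun w => l16 * EE w + 4 * (EE w * I w * qT (w - z))))).
  apply: ip_le => //; first by apply: itgD; apply: itgZ => //; exact: itg_EE.
  move=> w _; rewrite /I indicE; have [wN|wN] := boolP (w \in N (d / 4)) => /=.
    rewrite mulr1; have h := ler_wpM2l (EE_ge0 w) (GG_le (w - z)).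
    by have : 0 <= l16 * EE w; [rewrite mulr_ge0 // EE_ge0|lra].
  rewrite mulr0 mul0r mulr0 addr0 [leRHS]mulrC ler_wpM2l ?EE_ge0 //.
  apply: far_bound; first by rewrite divr_gt0.
    by rewrite leNgt; apply/negP => h; move/negP: wN; apply; rewrite inE.
  by apply: le_trans Tz _; lra.
rewrite (ipD (itgZ _ itg_EE) (itgZ _ iq)) (ipZ _ itg_EE) (ipZ _ iq).
by rewrite lerD2l ler_wpM2l.
Qed.

Lemma near_bound3 : exists C, forall z, ~ Lam z -> TT z <= d / 16 -> expR (u z) <= C.
Proof.
have pi0 := pi_gt0 R.
have [C hC] := near_bound2; exists (expR ((C + A) / (4 * pi))) => z zL Tz.
rewrite ler_expR ler_pdivlMr ?mulr_gt0 // mulrC.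
have [_ ->] := representationE zL.
have := ipRR z; rewrite ler_norml => /andP[r1 r2]; have := hC z zL Tz.
have lnT : ln (TT z) <= 0 by rewrite ln_le0 //; have := d1; have := Tz; lra.
have : 16 * pi * ln (TT z) <= 0 by rewrite mulr_ge0_le0 // mulr_ge0 // ltW.
lra.
Qed.

End fixed_radius.

Lemma EE_bounded : exists B, forall w, EE w <= B.
Proof.
have h0 := @hh_gt0 R.
have [d d01 mass] := small_mass; have [C hC] := near_bound3 d01 mass.
have /andP[d0 d1] := d01.
have d16 : 0 < d / 16 by rewrite divr_gt0.
pose K : set (R * R) := [set w | (0 <= w.1 <= 1 /\ 0 <= w.2 <= hh) /\ d / 16 <= TT w].
have Kc : compact K.
  apply: (@compact_box _ _ 0 1 0 hh); last by move=> w [].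
  have -> : K = (`[0, 1] `*` `[0, hh]) `&` (TT @^-1` [set x | d / 16 <= x]).
    by apply/seteqP; split => w /=; rewrite !in_itv /=.
  apply: closedI.
    by apply: compact_closed; [exact: norm_hausdorff|apply: compact_setX; exact: segment_compact].
  by apply: closed_comp; [move=> w _; exact: continuous_TT|exact: closed_ge].
have KL w : K w -> ~ Lam w by move=> [_ Tw] /TT_eq0 e; move: Tw; rewrite e; lra.
have red w : ~ Lam w -> d / 16 <= TT w -> exists2 v, K v & u v = u w.
  move=> wL Tw; have [c cL [/andP[a1 a2] /andP[b1 b2]]] := cell_reduce w.
  exists (w + c); last exact: (@smooth_period _ _ pu su [::] c w cL wL).
  by split; [rewrite a1 b1 !ltW|rewrite TT_lattice].
have [K0|K0] := pselect (K !=set0); last first.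
  exists (Num.max 0 C) => w; have [wL|wL] := pselect (Lam w).
    by rewrite EE_on // le_max lexx.
  rewrite EE_off // le_max; have [Tw|Tw] := leP (TT w) (d / 16); first by rewrite hC ?orbT.
  by have [v Kv _] := red w wL (ltW Tw); case: K0; exists v.
have uc : {within K, continuous u}.
  apply: continuous_in_subspaceT => w /set_mem Kw.
  exact: (@smooth_cts _ u su [::] w (KL w Kw)).
have [z Kz hz] := compact_EVT_max K0 Kc uc.
exists (Num.max C (expR (u z))) => w; have [wL|wL] := pselect (Lam w).
  by rewrite EE_on // le_max expR_ge0 orbT.
rewrite EE_off // le_max; have [Tw|Tw] := leP (TT w) (d / 16); first by rewrite hC.
have [v Kv <-] := red w wL (ltW Tw).
by rewrite ler_expR hz ?inE // orbT.
Qed.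

End brezis_merle.

(** * Behaviour of the solution at the lattice *)

Section continuity.
Context {R : realType}.
Local Notation mu := (lebesgue2 R).
Local Notation s3 := (Num.sqrt (3 : R)).
Local Notation hh := (s3 / 2).
Local Notation P := (fundamental_domain (rho R)).
Local Notation Lam := (lattice (rho R)).
Local Notation PT := (measurableTypeR R * measurableTypeR R)%type.
Local Notation mf f := (measurable_fun [set: PT] (f : PT -> R)).
Implicit Types (w z c : R * R) (f g : R * R -> R) (M k : R).

Lemma qT_sqT w : ~ Lam w -> qT w = (Num.sqrt (sqT w))^-1.
Proof.
move=> wL; have T0 := TT_gt0 wL.
have s0 : 0 < sqT w by rewrite sqrtr_gt0.
have r0 : 0 < Num.sqrt (sqT w) by rewrite sqrtr_gt0.
have e : GG w = - (ln (Num.sqrt (sqT w)) * 4).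
  by rewrite /GG -sqT2 -[in LHS](sqr_sqrtr (ltW s0)) -exprM lnXn // mulr_natr.
by rewrite /qT e mulNr mulfK // expRN lnK.
Qed.

Lemma ln_ratio (a b s : R) : 0 < b -> b <= a -> a - b <= s -> ln a - ln b <= 2 * (Num.sqrt s / Num.sqrt b).
Proof.
move=> b0 ba abs; have a0 : 0 < a := lt_le_trans b0 ba.
have rb : 0 < Num.sqrt b by rewrite sqrtr_gt0.
have ra : 0 < Num.sqrt a by rewrite sqrtr_gt0.
have la (x : R) : 0 < x -> ln x = 2 * ln (Num.sqrt x).
  by move=> x0; rewrite -{1}(sqr_sqrtr (ltW x0)) lnXn ?sqrtr_gt0 // mulr_natl.
rewrite (la a a0) (la b b0) -mulrBr ler_pM2l // -ln_div ?posrE //.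
have h := le_ln1Dx (_ : - 1 < Num.sqrt a / Num.sqrt b - 1).
have e0 : 0 < Num.sqrt a / Num.sqrt b by rewrite divr_gt0.
apply: (@le_trans _ _ (Num.sqrt a / Num.sqrt b - 1)).
  by have := h ltac:(lra); rewrite addrC subrK.
have -> : Num.sqrt a / Num.sqrt b - 1 = (Num.sqrt a - Num.sqrt b) / Num.sqrt b by field; rewrite gt_eqF.
rewrite ler_pM2r ?invr_gt0 //.
apply: le_trans (_ : Num.sqrt (a - b) <= _); last by rewrite ler_wsqrtr.
have ab0 : 0 <= a - b by rewrite subr_ge0.
rewrite -(@ler_pXn2r _ 2) ?nnegrE ?sqrtr_ge0 ?subr_ge0 ?ler_wsqrtr //.
have := sqr_sqrtr ab0; have := sqr_sqrtr (ltW a0); have := sqr_sqrtr (ltW b0).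
have : Num.sqrt b <= Num.sqrt a by rewrite ler_wsqrtr.
move: (Num.sqrt a) (Num.sqrt b) (Num.sqrt (a - b)) ra rb => x y t x0 y0 xy hy hx ht.
rewrite ht -hy -hx; have : 0 <= y * (x - y) by rewrite mulr_ge0 ?subr_ge0 // ltW.
by rewrite !expr2; lra.
Qed.

(** A Holder bound: [ln_ratio] is applied to the values of [sqT] at [w] and [w - z], which differ by
    at most [sqT z] by the triangle inequality. *)
Lemma GG_diff w z : ~ Lam w -> ~ Lam (w - z) ->
  `|GG (w - z) - GG w| <= 4 * Num.sqrt (sqT z) * (qT (w - z) + qT w).
Proof.
move=> wL wzL; have T1 := TT_gt0 wL; have T2 := TT_gt0 wzL.
have s1 : 0 < sqT w by rewrite sqrtr_gt0.
have s2 : 0 < sqT (w - z) by rewrite sqrtr_gt0.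
have e (v : R * R) : 0 < TT v -> GG v = - (2 * ln (sqT v)).
  by move=> Tv; rewrite /GG -sqT2 lnXn ?sqrtr_gt0 // mulr_natl.
rewrite (e _ T1) (e _ T2) !qT_sqT //.
have h1 : sqT w - sqT (w - z) <= sqT z by rewrite lerBlDr addrC; have := sqT_triangle (w - z) z; rewrite subrK.
have h2 : sqT (w - z) - sqT w <= sqT z by have := sqT_triangle w (- z); rewrite sqTN; lra.
have q1 : 0 <= Num.sqrt (sqT z) / Num.sqrt (sqT w) by rewrite divr_ge0 ?sqrtr_ge0.
have q2 : 0 <= Num.sqrt (sqT z) / Num.sqrt (sqT (w - z)) by rewrite divr_ge0 ?sqrtr_ge0.
have [le|le] := leP (sqT w) (sqT (w - z)).
  have h := ln_ratio s1 le h2; have m : ln (sqT w) <= ln (sqT (w - z)) by rewrite ler_ln ?posrE.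
  by rewrite ler_norml; apply/andP; split; lra.
have h := ln_ratio s2 (ltW le) h1; have m : ln (sqT (w - z)) <= ln (sqT w) by rewrite ler_ln ?posrE // ltW.
by rewrite ler_norml; apply/andP; split; lra.
Qed.

Lemma ip_le_off (N : set (R * R)) f g : mu.-negligible N -> itg f -> itg g ->
  (forall w, P w -> ~ N w -> f w <= g w) -> ip f <= ip g.
Proof.
move=> N0 fi gi fg.
have -> : ip g = ip (fun w => Num.max (f w) (g w)).
  rewrite /ip /Rintegral; congr fine; apply: ae_eq_integral.
  - exact: measP.
  - by apply/measurable_EFinP; exact: itg_mf.
  - by apply/measurable_EFinP; apply: measurable_maxr; exact: itg_mf.
  apply: negligibleS N0 => w /= h; apply: contrapT => wN; apply: h => Pw.
  by congr EFin; rewrite max_r // fg.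
have mi : itg (fun w => Num.max (f w) (g w)).
  apply: (@itg_le _ _ (fun w => `|f w| + `|g w|)).
  - by apply: measurable_maxr; exact: itg_mf.
  - by move=> w _; have [_|_] := leP (f w) (g w); rewrite ?lerDl ?lerDr.
  - by apply: itgD; exact: itg_norm.
by apply: ip_le => // w _; rewrite le_max lexx.
Qed.

Lemma itg_GG_shift z : itg (fun w => GG (w - z)).
Proof.
apply: (@itg_le _ _ (fun w => ln 6 + 4 * qT (w - z))).
- by apply: mfP; apply: mf_shift; exact: mf_GG.
- move=> w _; have q0 := qT_ge0 (w - z); have l6 : 0 <= ln (6 : R) by rewrite ln_ge0 //; lra.
  have h1 := GG_le (w - z).
  have h2 : - ln 6 <= GG (w - z).
    rewrite /GG lerN2; have [T0|T0] := eqVneq (TT (w - z)) 0; first by rewrite T0 ln0.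
    by rewrite ler_ln ?posrE ?TT_le6 // lt_neqAle TT_ge0 eq_sym T0.
  by rewrite ler_norml; apply/andP; split; lra.
- by apply: itgD; [exact: itg_cst|apply: itgZ; exact: itg_qT_shift].
Qed.

Lemma negligible_shift2 z : mu.-negligible [set w | P w /\ (Lam w \/ Lam (w - z))].
Proof.
apply: negligibleS (negligibleU (negligible_lattice (0 : R * R)) (negligible_lattice z)) => w /= [Pw [wL|wL]].
  by left; split => //; rewrite subr0; apply/TT_eq0.
by right; split => //; apply/TT_eq0.
Qed.

Lemma sqT_cvg0 : Num.sqrt (sqT z) @[z --> (0 : R * R)] --> (0 : R).
Proof.
have -> : (0 : R) = Num.sqrt (sqT (0 : R * R)) by rewrite /sqT TT_0 !sqrtr0.
apply: cvg_comp; last exact: sqrt_continuous.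
apply: cvg_comp; last exact: sqrt_continuous.
exact: continuous_TT.
Qed.

(** For a bounded density the potentials at [z] and at 0 differ by a multiple of [sqrt (sqT z)],
    because the integrals of the translates of [qT] are bounded together. *)
Lemma potential_cvg (E : R * R -> R) B : mf E -> (forall w, 0 <= E w <= B) ->
  ip (fun w => E w * GG (w - z)) @[z --> (0 : R * R)] --> ip (fun w => E w * GG w).
Proof.
move=> mE EB.
have Eb w : `|E w| <= B by have /andP[h1 h2] := EB w; rewrite ger0_norm.
have B0 : 0 <= B by have /andP[h1 h2] := EB 0; exact: le_trans h1 h2.
have iG z : itg (fun w => E w * GG (w - z)).
  have -> : (fun w => E w * GG (w - z)) = (fun w => GG (w - z) * E w) by apply/funext => w; rewrite mulrC.
  exact: itgM (itg_GG_shift z) mE Eb.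
have iG0 : itg (fun w => E w * GG w) by have := iG 0; under eq_fun do rewrite subr0.
pose K := B * (4 * (2 * (hh + ip (@sT R)))).
have bd z : `|ip (fun w => E w * GG (w - z)) - ip (fun w => E w * GG w)| <= K * Num.sqrt (sqT z).
  rewrite -(ipB (iG z) iG0).
  apply: le_trans (ip_norm _) _; first by apply: itgB.
  have r0 := sqrtr_ge0 (sqT z).
  have i1 : itg (fun w => qT (w - z)) := itg_qT_shift (- z).
  have i2 : itg (fun w => qT w) by have := itg_qT_shift (0 : R * R); under eq_fun do rewrite addr0.
  apply: (@le_trans _ _ (ip (fun w => B * (4 * Num.sqrt (sqT z)) * (qT (w - z) + qT w)))).
    apply: (ip_le_off (negligible_shift2 z)).
    - by apply: itg_norm; apply: itgB.
    - by apply: itgZ; apply: itgD.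
    move=> w Pw wN; have wL : ~ Lam w by move=> h; apply: wN; split => //; left.
    have wzL : ~ Lam (w - z) by move=> h; apply: wN; split => //; right.
    rewrite -mulrBr normrM -mulrA; apply: ler_pM => //.
    exact: GG_diff.
  rewrite (ipZ _ (itgD i1 i2)) (ipD i1 i2) /K.
  have a1 : ip (fun w => qT (w - z)) <= hh + ip (@sT R) := ip_qT_shift (- z).
  have a2 : ip (fun w => qT w) <= hh + ip (@sT R).
    by have := ip_qT_shift (0 : R * R); under eq_fun do rewrite addr0.
  move: (ip (fun w => qT (w - z))) (ip (fun w => qT w)) (ip (@sT R)) a1 a2 => x y t a1 a2.
  have := ler_wpM2l (mulr_ge0 B0 r0) (lerD a1 a2).
  by set r := Num.sqrt (sqT z); lra.
have c0 : K * Num.sqrt (sqT z) @[z --> (0 : R * R)] --> (0 : R).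
  by rewrite -[X in _ --> X](mulr0 K); apply: cvgM; [exact: cvg_cst|exact: sqT_cvg0].
apply/cvgrPdist_lt => e e0; near=> z.
rewrite distrC; apply: le_lt_trans (bd z) _.
by near: z; apply: (cvgr_lt _ c0).
Unshelve. all: by end_near.
Qed.

(** With [u] merely integrable there is no rate. If convergence failed, it would fail along a
    sequence [zs], where dominated convergence applies: [RR] is bounded, and continuous off the
    lattice. *)
Lemma RR_cvg_ip (u : R * R -> R) : itg u ->
  ip (fun w => u w * RR (w - z)) @[z --> (0 : R * R)] --> ip (fun w => u w * RR w).
Proof.
move=> iu; apply: contrapT => ncv.
have [e e0 he] : exists2 e : R, 0 < e & forall n : nat, exists z, ball (0 : R * R) n.+1%:R^-1 z /\
   e <= `|ip (fun w => u w * RR (w - z)) - ip (fun w => u w * RR w)|.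
  apply: contrapT => H; apply: ncv; apply/cvgrPdist_lt => e e0.
  apply: contrapT => H2; apply: H; exists e => // n; apply: contrapT => H3; apply: H2.
  have : \forall t \near (0 : R * R), ball (0 : R * R) n.+1%:R^-1 t by apply: nbhsx_ballx; rewrite invr_gt0.
  apply: filterS => z bz; rewrite distrC ltNge; apply/negP => h; apply: H3; by exists z.
have [zs hz] := choice he.
have zs0 : zs n @[n --> \oo] --> (0 : R * R).
  apply/cvg_ballP => r r0; near=> n; apply: le_ball (hz n).1.
  by near: n; apply: (cvgr_le _ (@cvg_harmonic R)).
have [_ lim] : itg (fun w => u w * RR w) /\
   ip (fun w => u w * RR (w - zs n)) @[n --> \oo] --> ip (fun w => u w * RR w).
  apply: (@ip_dct _ (fun n w => u w * RR (w - zs n)) _ (fun w => LL * `|u w|) _ _ _ (negligible_lattice (0 : R * R))).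
  - by move=> n; apply: measurable_funM; [exact: itg_mf|apply: mfP; apply: mf_shift; exact: mf_RR].
  - by apply: measurable_funM; [exact: itg_mf|apply: mfP; exact: mf_RR].
  - move=> w Pw hN.
    have wL : ~ Lam w by move=> /TT_eq0 h; apply: hN; split => //; rewrite subr0.
    have T0 := TT_gt0 wL.
    apply: cvgM; first exact: cvg_cst.
    have c : w - zs n @[n --> \oo] --> w - (0 : R * R) by apply: cvgB => //; exact: cvg_cst.
    rewrite subr0 in c.
    rewrite /RR; apply: cvgM.
      by apply: (cvg_comp _ _ c); exact: smf_cts (@smf_WW R).
    apply: cvgV; first by rewrite gt_eqF // exprn_gt0.
    by apply: cvg_sqr; apply: (cvg_comp _ _ c); exact: continuous_TT.
  - by move=> n w _; rewrite normrM mulrC ler_wpM2r // RR_bound.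
  - by apply: itgZ; exact: itg_norm.
have /cvgrPdist_lt /(_ e e0) [k _ hk] := lim.
have := hk k (leqnn k); rewrite /= distrC ltNge => /negP; apply; exact: (hz k).2.
Unshelve. all: by end_near.
Qed.

Lemma near0_off : \forall z \near (0 : R * R)^', ~ Lam z.
Proof.
have h0 := @hh_gt0 R.
apply/nbhs_ballP; exists (Num.min 2^-1 (hh / 2)) => /=; first by rewrite lt_min invr_gt0 ltr0n divr_gt0.
move=> z; rewrite /ball /= /prod_ball /= /ball /= !sub0r !normrN !lt_min => -[/andP[a1 a2] /andP[b1 b2]] /eqP z0 zL.
have := TT_ge (ltW a1) (ltW b2); rewrite (TT_eq0 z).2 // => h.
apply: z0; case: z a1 a2 b1 b2 zL h => x y _ _ _ _ _; rewrite /nr2 /= => h.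
have hx := sqr_ge0 x; have hy := sqr_ge0 y.
have x0 : x ^+ 2 = 0 by lra.
have y0 : y ^+ 2 = 0 by lra.
by move/eqP: x0; move/eqP: y0; rewrite !expf_eq0 /= => /eqP -> /eqP ->.
Qed.

Lemma nr2_cvg0 : nr2 z @[z --> (0 : R * R)] --> (0 : R).
Proof.
have -> : (0 : R) = nr2 (0 : R * R) by rewrite /nr2 /= expr0n /= addr0.
by apply: cvgD; apply: cvg_sqr; [exact: cvg_fst|exact: cvg_snd].
Qed.

Lemma nr2_gt0 z : z != 0 -> 0 < nr2 z.
Proof.
move=> z0; rewrite lt_neqAle nr2_ge0 andbT eq_sym; apply/negP => /eqP h; move/negP: z0; apply.
case: z h => x y; rewrite /nr2 /= => h.
have hx := sqr_ge0 x; have hy := sqr_ge0 y.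
have /eqP x0 : x ^+ 2 = 0 by lra.
have /eqP y0 : y ^+ 2 = 0 by lra.
by move: x0 y0; rewrite !expf_eq0 /= => /eqP -> /eqP ->.
Qed.

Lemma TT_nr2_cvg : ln (TT z) - ln (nr2 z) @[z --> (0 : R * R)^'] --> ln (4 * pi ^+ 2 : R).
Proof.
have p2 : 0 < 4 * (pi : R) ^+ 2 by rewrite mulr_gt0 // exprn_gt0 // pi_gt0.
have n0 : nr2 z @[z --> (0 : R * R)^'] --> (0 : R) by apply: cvg_trans nr2_cvg0; apply: cvg_app; exact: nbhs_dnbhs.
have q : TT z / nr2 z @[z --> (0 : R * R)^'] --> (4 * pi ^+ 2 : R).
  have c0 : 8 * pi ^+ 4 * nr2 z @[z --> (0 : R * R)^'] --> (0 : R).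
    by rewrite -[X in _ --> X](mulr0 (8 * pi ^+ 4)); apply: cvgM => //; exact: cvg_cst.
  apply/cvgrPdist_lt => e e0; near=> z.
  have z0 : 0 < nr2 z by apply: nr2_gt0; near: z; exact: nbhs_dnbhs_neq.
  rewrite distrC; have -> : TT z / nr2 z - 4 * pi ^+ 2 = (TT z - 4 * pi ^+ 2 * nr2 z) / nr2 z.
    by move: (pi : R) => p; field; rewrite gt_eqF.
  rewrite normrM normfV (gtr0_norm z0) ltr_pdivrMr //.
  apply: le_lt_trans (TT_quartic z) _; rewrite expr2 mulrA ltr_pM2r //.
  by near: z; apply: (cvgr_lt _ c0).
apply: cvg_trans (cvg_comp _ _ q (continuous_ln p2)).
apply: near_eq_cvg; near=> z.
have z0 : 0 < nr2 z by apply: nr2_gt0; near: z; exact: nbhs_dnbhs_neq.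
have zL : ~ Lam z by near: z; exact: near0_off.
by rewrite /= ln_div ?posrE // TT_gt0.
Unshelve. all: by end_near.
Qed.

Variable u : R * R -> R.
Hypothesis sol : mean_field_solution (rho R) (16 * pi) u.

Lemma solution_liouville z : ~ Lam z -> laplacian u z = - expR (u z).
Proof.
move=> zL; apply/eqP; rewrite -addr_eq0; apply/eqP.
exact: (liouville (solution_periodic sol) (solution_smooth sol) (solution_equation sol) zL).
Qed.

(** Both integrals of the representation formula converge as [z] tends to 0, and [ln T - ln |z|^2]
    has a limit. The coefficient is [16 pi / (4 pi) = 4], so the singular part is [8 ln |z|]. *)
Lemma solution_asymptotics : exists L : R, u z - 4 * ln (nr2 z) @[z --> (0 : R * R)^'] --> L.
Proof.
have p0 := pi_gt0 R.
have [B hB] := EE_bounded sol.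
have c1 := @potential_cvg (EE u) B (mf_EE sol) (fun w => introT andP (conj (EE_ge0 u w) (hB w))).
have c2 := RR_cvg_ip (solution_integrable sol).
set l1 := ip _ in c1; set l2 := ip _ in c2.
exists ((l1 - l2) / (4 * pi) + 4 * ln (4 * pi ^+ 2)).
have c3 : (ip (fun w => EE u w * GG (w - z)) - ip (fun w => u w * RR (w - z))) / (4 * pi) + 4 * (ln (TT z) - ln (nr2 z))
    @[z --> (0 : R * R)^'] --> (l1 - l2) / (4 * pi) + 4 * ln (4 * pi ^+ 2).
  apply: cvgD; last by apply: cvgM; [exact: cvg_cst|exact: TT_nr2_cvg].
  apply: cvgM; last exact: cvg_cst.
  have : (ip (fun w => EE u w * GG (w - z)) - ip (fun w => u w * RR (w - z))) @[z --> (0 : R * R)] --> l1 - l2 by apply: cvgB.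
  by apply: cvg_trans; apply: cvg_app; exact: nbhs_dnbhs.
apply: cvg_trans c3; apply: near_eq_cvg; near=> z.
have zL : ~ Lam z by near: z; exact: near0_off.
have [_] := representationE sol zL.
move: (ip _) (ip _) => x y; move: (ln _) (ln _) => a b; move: (pi : R) p0 => p p0 e.
have -> : u z = (16 * p * b + y - x) / (4 * p) by rewrite -e; field; rewrite gt_eqF.
by field; rewrite gt_eqF.
Unshelve. all: by end_near.
Qed.

End continuity.

(** * Holomorphy of finite order *)

Section hol.
Context {R : realType}.
Local Notation C := R[i].
Implicit Types (f g : R * R -> C) (z w : R * R) (U V : set (R * R)) (k l c : C) (n : nat).

(** [n] successive complex derivatives on [U]. Analyticity is never invoked: an argument asks for
    the few derivatives that it uses, and closure properties are inductions on [n]. *)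
Fixpoint hol U n f : Prop :=
  if n is m.+1 then exists2 f', (forall z, U z -> wd f z (f' z) 0) & hol U m f' else True.

Lemma hol_sub U V n f : U `<=` V -> hol V n f -> hol U n f.
Proof.
move=> UV; elim: n f => //= n IH f [f' d h]; exists f'; last exact: IH.
by move=> z /UV; exact: d.
Qed.

Lemma hol_ext U n f g : open U -> (forall z, U z -> f z = g z) -> hol U n f -> hol U n g.
Proof.
move=> Uo fg; case: n => //= n [f' d h]; exists f' => // z Uz.
apply: wd_near (d z Uz).
by apply: filterS (open_nbhs_nbhs (conj Uo Uz)) => w /fg.
Qed.

Lemma holW U n f : hol U n.+1 f -> hol U n f.
Proof. by elim: n f => //= n IH f [f' d [f'' d' h]]; exists f' => //; apply: IH; exists f''. Qed.
Lemma hol_cst U n c : hol U n (fun=> c).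
Proof. by elim: n c => //= n IH c; exists (fun=> 0) => // z _; exact: wd_cst. Qed.
Lemma hol_cx U n : hol U n (@cx R).
Proof. by case: n => //= n; exists (fun=> 1); [move=> z _; exact: wd_cx|exact: hol_cst]. Qed.

Lemma holD U n f g : hol U n f -> hol U n g -> hol U n (fun z => f z + g z).
Proof.
elim: n f g => //= n IH f g [f' df hf] [g' dg hg]; exists (fun z => f' z + g' z); last exact: IH.
by move=> z Uz; apply: wd_eq; [exact: (wdD (df z Uz) (dg z Uz))|..]; rewrite ?addr0.
Qed.

Lemma holM U n f g : hol U n f -> hol U n g -> hol U n (fun z => f z * g z).
Proof.
elim: n f g => // n IH f g hf hg; case: (hf) => f' df hf'; case: (hg) => g' dg hg' /=.
exists (fun z => f' z * g z + f z * g' z).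
  by move=> z Uz; apply: wd_eq; [exact: (wdM (df z Uz) (dg z Uz))|..]; rewrite ?mul0r ?mulr0 ?addr0.
by apply: holD; apply: IH => //; exact: holW.
Qed.

Lemma holZ U n c f : hol U n f -> hol U n (fun z => c * f z).
Proof. by apply: holM; exact: hol_cst. Qed.
Lemma holN U n f : hol U n f -> hol U n (fun z => - f z).
Proof. by move=> h; have -> : (fun z => - f z) = (fun z => (-1) * f z); [apply/funext => z; rewrite mulN1r|exact: holZ]. Qed.
Lemma holB U n f g : hol U n f -> hol U n g -> hol U n (fun z => f z - g z).
Proof. by move=> hf hg; apply: holD => //; exact: holN. Qed.

Lemma holX U n f m : hol U n f -> hol U n (fun z => f z ^+ m).
Proof.
move=> hf; elim: m => [|m IH]; first exact: hol_cst.
have -> : (fun z => f z ^+ m.+1) = (fun z => f z * f z ^+ m) by apply/funext => z; rewrite exprS.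
exact: holM.
Qed.

Lemma holV U n f : (forall z, U z -> f z != 0) -> hol U n f -> hol U n (fun z => (f z)^-1).
Proof.
move=> f0; elim: n f f0 => // n IH f f0 hf; case: (hf) => f' df hf' /=.
exists (fun z => - f' z * ((f z)^-1 * (f z)^-1)).
  by move=> z Uz; apply: wd_eq; [exact: (wdV (f0 z Uz) (df z Uz))|..]; rewrite ?oppr0 ?mul0r // expr2 invfM.
by apply: holM; [exact: holN|apply: holM; apply: IH => //; exact: holW].
Qed.

Lemma hol_affine U n k l f : (forall z, U z -> U (xc (k * cx z + l))) -> hol U n f ->
  hol U n (fun z => f (xc (k * cx z + l))).
Proof.
move=> Uk; elim: n f => //= n IH f [f' df hf]; exists (fun z => k * f' (xc (k * cx z + l))); last by apply: holZ; exact: IH.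
by move=> z /Uk Uz; apply: wd_eq; [exact: (wd_mulc (df _ Uz))|..]; rewrite ?mulr0.
Qed.

Definition conjp z : R * R := (z.1, - z.2).

Lemma hol_conj U n f : (forall z, U z -> U (conjp z)) -> hol U n f -> hol U n (fun z => cj (f (conjp z))).
Proof.
move=> Uk; elim: n f => //= n IH f [f' df hf]; exists (fun z => cj (f' (conjp z))); last exact: IH.
by move=> z /Uk Uz; apply: wd_eq; [exact: (wdJ (wd_conjc (df _ Uz)))|..]; rewrite ?cJ0.
Qed.

End hol.

(** * The Hopf differential *)

Section alg.
Context {R : realType}.
Local Notation C := R[i].
Local Notation Lam := (lattice (rho R)).
Implicit Types (F : R * R -> C) (z w : R * R) (n : nat).
Variable u : R * R -> R.
Hypothesis pu : doubly_periodic_on (rho R) (~` Lam) u.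
Hypothesis su : smooth_on (~` Lam) u.
Local Notation it vs := (foldr (fun v g => 'D_v g) u vs).

(** The polynomial algebra over the iterated partials of [u]. It is stable under both Wirtinger
    derivatives, so one application of the Cauchy-Riemann equations can be iterated to every
    order. *)
Inductive alg : (R * R -> C) -> Prop :=
| alg_it vs : alg (fun z => (it vs z)%:C)
| alg_cst c : alg (fun=> c)
| alg_add f g : alg f -> alg g -> alg (fun z => f z + g z)
| alg_mul f g : alg f -> alg g -> alg (fun z => f z * g z).

(** That the same [c] serves for [a] and for [b] says that the two Wirtinger derivatives commute. It
    comes from [smooth_swap] on the generators and passes to sums and products. *)
Lemma alg_wd F : alg F -> exists a b d c e, [/\ [/\ alg a, alg b & alg d],
  forall z, ~ Lam z -> wd F z (a z) (b z), forall z, ~ Lam z -> wd a z (d z) (c z) &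
  forall z, ~ Lam z -> wd b z (c z) (e z)].
Proof.
elim=> [vs|k|f g _ [a [b [d [c [e [[aA aB aD] h1 h2 h3]]]]]] _ [a' [b' [d' [c' [e' [[aA' aB' aD'] h1' h2' h3']]]]]]
  |f g af [a [b [d [c [e [[aA aB aD] h1 h2 h3]]]]]] ag [a' [b' [d' [c' [e' [[aA' aB' aD'] h1' h2' h3']]]]]]].
- pose X := (1, 0) : R * R; pose Y := (0, 1) : R * R.
  have ii : ci * ci = -1 :> C := ciM.
  have w1 vs' z (zL : ~ Lam z) := wd_real (@smooth_rd _ _ su vs' z zL).
  have e1 (x y : R) : (x / 2) -i* (y / 2) = 2^-1 * x%:C + (- ci / 2) * y%:C.
    by apply: eqReIm; rewrite -cRn -cRV !ReImE /=; field.
  have e2 (x y : R) : (x / 2) +i* (y / 2) = 2^-1 * x%:C + (ci / 2) * y%:C.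
    by apply: eqReIm; rewrite -cRn -cRV !ReImE /=; field.
  pose p vs' z := 2^-1 * (it (X :: vs') z)%:C + (- ci / 2) * (it (Y :: vs') z)%:C.
  pose q vs' z := 2^-1 * (it (X :: vs') z)%:C + (ci / 2) * (it (Y :: vs') z)%:C.
  have w2 vs' z : ~ Lam z -> wd (fun z => (it vs' z)%:C) z (p vs' z) (q vs' z).
    by move=> zL; apply: wd_eq; [exact: w1|exact: e1|exact: e2].
  have ap vs' : alg (p vs').
    by apply: alg_add; apply: (alg_mul (alg_cst _)); exact: (alg_it (_ :: vs')).
  have aq vs' : alg (q vs').
    by apply: alg_add; apply: (alg_mul (alg_cst _)); exact: (alg_it (_ :: vs')).
  exists (p vs), (q vs), (fun z => 2^-1 * p (X :: vs) z + (- ci / 2) * p (Y :: vs) z),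
    (fun z => 2^-1 * p (X :: vs) z + (ci / 2) * p (Y :: vs) z), (fun z => 2^-1 * q (X :: vs) z + (ci / 2) * q (Y :: vs) z).
  split; first split => //; first by apply: alg_add; apply: (alg_mul (alg_cst _)).
  - exact: w2.
  - move=> z zL; have h1 := w2 (X :: vs) z zL; have h2 := w2 (Y :: vs) z zL.
    apply: wd_eq; [exact: (wdD (wdZ 2^-1 h1) (wdZ (- ci / 2) h2))|by []|].
    have sw := @smooth_swap _ u su vs z zL; rewrite -/X -/Y in sw.
    rewrite /p /q sw; move: (it _ z) (it [:: Y, X & vs] z) (it [:: Y, Y & vs] z) => x y t; ring.
  - by move=> z zL; exact: (wdD (wdZ 2^-1 (w2 (X :: vs) z zL)) (wdZ (ci / 2) (w2 (Y :: vs) z zL))).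
- by exists (fun=> 0), (fun=> 0), (fun=> 0), (fun=> 0), (fun=> 0); split; [split; exact: alg_cst|move=> z _; exact: wd_cst..].
- exists (fun z => a z + a' z), (fun z => b z + b' z), (fun z => d z + d' z), (fun z => c z + c' z), (fun z => e z + e' z).
  split; first by split; exact: alg_add.
  - by move=> z zL; exact: wdD (h1 z zL) (h1' z zL).
  - by move=> z zL; exact: wdD (h2 z zL) (h2' z zL).
  - by move=> z zL; exact: wdD (h3 z zL) (h3' z zL).
- exists (fun z => a z * g z + f z * a' z), (fun z => b z * g z + f z * b' z),
    (fun z => d z * g z + a z * a' z + (a z * a' z + f z * d' z)),
    (fun z => c z * g z + a z * b' z + (b z * a' z + f z * c' z)),
    (fun z => e z * g z + b z * b' z + (b z * b' z + f z * e' z)).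
  split; first by split; do ?[exact: alg_mul|apply: alg_add].
  - by move=> z zL; exact: wdM (h1 z zL) (h1' z zL).
  - by move=> z zL; exact: wdD (wdM (h2 z zL) (h1' z zL)) (wdM (h1 z zL) (h2' z zL)).
  - move=> z zL; apply: wd_eq; [exact: wdD (wdM (h3 z zL) (h1' z zL)) (wdM (h1 z zL) (h3' z zL))|..]; cbv beta; ring.
Qed.

Lemma wd_zero (f : R * R -> C) z : (forall w, ~ Lam w -> f w = 0) -> ~ Lam z -> wd f z 0 0.
Proof.
move=> f0 zL; apply: wd_near (wd_cst 0 z).
by apply: filterS (near_off zL) => w /f0 ->.
Qed.

(** If the antiholomorphic derivative of [F] vanishes off the lattice, so does that of [a], the
    holomorphic one, because the two commute; and [a] is again in the algebra. *)
Lemma alg_hol n F : alg F -> (forall z, ~ Lam z -> exists a, wd F z a 0) -> hol (~` Lam) n F.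
Proof.
elim: n F => //= n IH F aF hF.
have [a [b [d [c [e [[aA aB _] h1 h2 h3]]]]]] := alg_wd aF.
have b0 z : ~ Lam z -> b z = 0.
  by move=> zL; have [k hk] := hF z zL; have [_ ->] := wd_inj (h1 z zL) hk.
exists a; first by move=> z zL; rewrite -(b0 z zL); exact: h1.
apply: IH => // z zL; exists (d z).
by have [<- _] := wd_inj (h3 z zL) (wd_zero b0 zL); exact: h2.
Qed.

Hypothesis pde : forall z, ~ Lam z -> laplacian u z = - expR (u z).
Local Notation eu z := ((expR (u z))%:C : C).

(** The equation reads [u_{z zbar} = - e^u / 4]. Both [u_zz] and [u_z^2 / 2] then have the
    antiholomorphic derivative [- e^u u_z / 4], so their difference is holomorphic. *)
Lemma hopf_differential : exists U1 U2 U3 : R * R -> C,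
  [/\ forall z, ~ Lam z -> wd (fun z => (u z)%:C) z (U1 z) (cj (U1 z)),
      forall z, ~ Lam z -> wd U1 z (U2 z) (- (eu z / 4)),
      forall z, ~ Lam z -> wd U2 z (U3 z) (- (eu z / 4 * U1 z)) &
      forall n, hol (~` Lam) n (fun z => U2 z - U1 z ^+ 2 / 2)].
Proof.
have [a [b [d [c [e [[aA aB aD] h1 h2 h3]]]]]] := alg_wd (alg_it [::]).
have [a' [b' [d' [c' [e' [_ k1 k2 k3]]]]]] := alg_wd aA.
have bE z : ~ Lam z -> b z = cj (a z).
  move=> zL; have h := h1 z zL; have h' := wdJ h; rewrite /= in h'.
  have e1 : (fun w => cj ((u w)%:C : C)) = (fun w => (u w)%:C) by apply/funext => w; rewrite cJR.
  by rewrite e1 in h'; have [_ ->] := wd_inj h h'.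
have cE z : ~ Lam z -> c z = - (eu z / 4).
  move=> zL; have w1 vs' := wd_real (@smooth_rd _ _ su vs' z zL).
  have aE w : ~ Lam w -> a w = 2^-1 * (it [:: (1, 0)] w)%:C + (- ci / 2) * (it [:: (0, 1)] w)%:C.
    move=> wL; have [-> _] := wd_inj (h1 w wL) (wd_real (@smooth_rd _ _ su [::] w wL)).
    by move: (it _ w) (it _ w) => x y; apply: eqReIm; rewrite -cRn -cRV !ReImE /=; field.
  have h : wd a z (d z) (2^-1 * ((it [:: (1, 0); (1, 0)] z / 2) +i* (it [:: (0, 1); (1, 0)] z / 2)) +
      (- ci / 2) * ((it [:: (1, 0); (0, 1)] z / 2) +i* (it [:: (0, 1); (0, 1)] z / 2))).
    have t := wdD (wdZ 2^-1 (w1 [:: (1, 0)])) (wdZ (- ci / 2) (w1 [:: (0, 1)])).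
    have near : \forall w \near z, 2^-1 * (it [:: (1, 0)] w)%:C + (- ci / 2) * (it [:: (0, 1)] w)%:C = a w.
      by apply: filterS (near_off zL) => w /aE.
    have t2 := wd_near near t; have [q _] := wd_inj (h2 z zL) t2.
    by rewrite q; exact: t2.
  have [_ ->] := wd_inj (h2 z zL) h.
  have := pde zL; rewrite /laplacian => E.
  have sw := @smooth_swap _ u su [::] z zL; rewrite sw.
  have -> : expR (u z) = - (it [:: (1, 0); (1, 0)] z + it [:: (0, 1); (0, 1)] z) by rewrite /= E opprK.
  move: (it [:: (1, 0); (1, 0)] z) (it [:: (0, 1); (0, 1)] z) (it [:: (0, 1); (1, 0)] z) => x y t.
  by apply: eqReIm; rewrite -!cRn -!cRV !ReImE /=; field.
have f1 z : ~ Lam z -> wd (fun z => (u z)%:C) z (a z) (cj (a z)).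
  by move=> zL; rewrite -bE //; exact: h1.
have f2 z : ~ Lam z -> wd a z (d z) (- (eu z / 4)).
  by move=> zL; rewrite -cE //; exact: h2.
have bE' z : ~ Lam z -> b' z = - (eu z / 4).
  by move=> zL; have [_ ->] := wd_inj (k1 z zL) (f2 z zL).
have deu z : ~ Lam z -> wd (fun z => eu z) z (eu z * a z) (eu z * cj (a z)).
  by move=> zL; exact: wd_rcomp (f1 z zL) (is_derive_expR (u z)).
have dE z : ~ Lam z -> a' z = d z by move=> zL; have [-> _] := wd_inj (k1 z zL) (f2 z zL).
have f3 z : ~ Lam z -> wd d z (d' z) (- (eu z / 4 * a z)).
  move=> zL; have t : wd b' z (- (4^-1 * (eu z * a z))) (- (4^-1 * (eu z * cj (a z)))).
    apply: wd_near (wdN (wdZ 4^-1 (deu z zL))).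
    by apply: filterS (near_off zL) => w /bE' ->; rewrite mulrC.
  have [q _] := wd_inj (k3 z zL) t.
  have -> : - (eu z / 4 * a z) = c' z by rewrite q; ring.
  apply: wd_near (k2 z zL).
  by apply: filterS (near_off zL) => w /dE.
exists a, d, d'; split => // n.
have aQ : alg (fun z => d z - a z ^+ 2 / 2).
  have -> : (fun z => d z - a z ^+ 2 / 2) = (fun z => d z + (- 2^-1) * (a z * a z)).
    by apply/funext => z; field.
  by apply: alg_add => //; apply: alg_mul; [exact: alg_cst|exact: alg_mul].
apply: alg_hol aQ _ => z zL; exists (d' z - a z * d z).
have -> : (fun z => d z - a z ^+ 2 / 2) = (fun z => d z + (- 2^-1) * (a z * a z)).
  by apply/funext => w; field.
apply: wd_eq; [exact: (wdD (f3 z zL) (wdZ _ (wdM (f2 z zL) (f2 z zL))))|..]; cbv beta; by field.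
Qed.

End alg.

(** * Gradient and Hopf differential at the singularity *)

Section estimates.
Context {R : realType}.
Local Notation C := R[i].
Local Notation Lam := (lattice (rho R)).
Implicit Types (z w : R * R) (x y : C).

Lemma nr2E z : nr2 z = nrm2 (cx z). Proof. by []. Qed.

Lemma nrm2V x : nrm2 x^-1 = (nrm2 x)^-1.
Proof.
have [->|x0] := eqVneq x 0; first by rewrite invr0 /nrm2 /= expr0n /= addr0 invr0.
have n0 : nrm2 x != 0 by rewrite nrm2_eq0.
by apply: (mulIf n0); rewrite -nrm2M !mulVf // /nrm2 /= expr1n expr0n /= addr0.
Qed.

Lemma nrm2N x : nrm2 (- x) = nrm2 x.
Proof. by rewrite /nrm2 !ReImE !sqrrN. Qed.
Lemma nrm2n n : nrm2 (n%:R : C) = n%:R ^+ 2.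
Proof. by rewrite -cRn /nrm2 /= expr0n /= addr0. Qed.

Lemma Re_cj_mul x y : Re (cj x * y) <= nrm2 x + nrm2 y / 4.
Proof.
rewrite /nrm2 !ReImE; have := sqr_ge0 (Re x - Re y / 2); have := sqr_ge0 (Im x - Im y / 2).
by rewrite !expr2; lra.
Qed.

Lemma nrm2_add3 x y (t : C) : nrm2 (x + y + t) <= 3 * (nrm2 x + nrm2 y + nrm2 t).
Proof.
rewrite /nrm2 !ReImE; have := sqr_ge0 (Re x - Re y); have := sqr_ge0 (Re x - Re t); have := sqr_ge0 (Re y - Re t).
have := sqr_ge0 (Im x - Im y); have := sqr_ge0 (Im x - Im t); have := sqr_ge0 (Im y - Im t).
by rewrite !expr2; lra.
Qed.

Lemma dev_le (a E : R) : 0 <= E -> a ^+ 2 <= 1 -> a * E <= E.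
Proof.
move=> E0 a1; rewrite ler_piMl //; have := sqr_ge0 (a - 1); move: a1; rewrite !expr2; lra.
Qed.

Lemma sqr_le9 (a b : R) : 0 <= a -> a <= 9 * b -> a ^+ 2 <= 81 * b ^+ 2.
Proof. by move=> a0 ab; have := ler_pM a0 a0 ab ab; rewrite -expr2; lra. Qed.

Lemma add3_le (A B D a n b m : R) : A <= 81 * a * n -> B <= 9 * b * m -> D <= B -> 0 <= b * m ->
  3 * (A + 16 * B + D / 4) <= 243 * a * n + 439 * b * m.
Proof. lra. Qed.

(** The cross term of [bernstein] as a statement on numbers: [s = r^2], [Z = |w - z|^2],
    [N = |V1|^2], [E = e^u], and [X] is the real part of the conjugate of [V1] times [U1]. *)
Lemma bernstein_arith (s Z N X E e : R) : 0 < s -> s <= 1 -> 0 <= Z -> Z <= s -> 0 <= N -> 0 <= E ->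
  E <= e -> e <= 1 -> X <= 2 * N + 4 / s -> (s - Z) ^+ 2 * (E * X) <= 2 * s * N + 4 * s * e.
Proof.
move=> s0 s1 Z0 Zs N0 E0 Ee e1 XY.
have Y0 : 0 <= 2 * N + 4 / s by apply: addr_ge0; [rewrite mulr_ge0|rewrite divr_ge0 // ltW].
have a1 : (s - Z) ^+ 2 * (E * X) <= s ^+ 2 * (E * (2 * N + 4 / s)).
  apply: (@le_trans _ _ ((s - Z) ^+ 2 * (E * (2 * N + 4 / s)))).
    by rewrite ler_wpM2l ?sqr_ge0 // ler_wpM2l.
  rewrite ler_wpM2r ?mulr_ge0 // ler_pXn2r ?nnegrE ?subr_ge0 ?(ltW s0) //; lra.
have e2 : s ^+ 2 * (E * (2 * N + 4 / s)) = s * E * (2 * (s * N)) + 4 * (s * E) by field; rewrite gt_eqF.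
have a2 : s * E <= 1 by rewrite mulr_ile1 ?(ltW s0) // (le_trans Ee).
have a3 : s * E * (2 * (s * N)) <= 2 * (s * N) by rewrite ler_piMl // mulr_ge0 // mulr_ge0 // ltW.
have a4 : s * E <= s * e by rewrite ler_pM2l.
by lra.
Qed.

(** The budget for [hopf_estimate]: [1944 = 8 * 243] pays for [|V2|^2]; of [6000 s^2 N], the amounts
    [8 * 439] and [1944] are spent; and [5400] covers the errors [3888 + 1500]. *)
Lemma hopf_arith (s X E VE NF N N2 e : R) : s ^+ 2 * VE <= s ^+ 2 * e ->
  s * NF <= s * (243 * s ^+ 2 * N2 + 439 * s * N) -> s * (s ^+ 2 * (E * X)) <= s * (2 * s * N + 4 * s * e) ->
  0 <= s ^+ 3 * E ^+ 2 -> 0 <= s ^+ 2 * N -> 0 <= s ^+ 2 * e ->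
  8 * s * NF <= 1944 * s ^+ 3 * (N2 + E ^+ 2 / 16 - E / 2 * X) + 3000 * s ^+ 2 * (2 * N - VE / 2) + 5400 * s ^+ 2 * e.
Proof. by move=> *; lra. Qed.

Lemma near0P (A : R * R -> Prop) : (\forall z \near (0 : R * R)^', A z) <->
  exists2 d : R, 0 < d & forall z, 0 < nr2 z < d -> A z.
Proof.
split=> [|[d d0 hd]].
  rewrite /dnbhs /within /= => /nbhs_ballP[e /= e0 he]; exists (e ^+ 2); first by rewrite exprn_gt0.
  move=> z /andP[z0 ze]; apply: he; last by apply/eqP => h; move: z0; rewrite h /nr2 /= expr0n /= addr0 ltxx.
  have q1 := sqr_ge0 z.1; have q2 := sqr_ge0 z.2; rewrite /nr2 in ze.
  by split; rewrite /ball /= sub0r normrN -(@ltr_pXn2r _ 2) ?nnegrE ?(ltW e0) // real_normK ?num_real //; lra.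
have c0 : nr2 z @[z --> (0 : R * R)^'] --> (0 : R) by apply: cvg_trans (@nr2_cvg0 R); apply: cvg_app; exact: nbhs_dnbhs.
near=> z; apply: hd; apply/andP; split; first by apply: nr2_gt0; near: z; exact: nbhs_dnbhs_neq.
by near: z; apply: (cvgr_lt _ c0).
Unshelve. all: by end_near.
Qed.

Lemma disc_annulus z w (r : R) : nr2 z = 4 * r ^+ 2 -> disc z r w -> r ^+ 2 <= nr2 w <= 9 * r ^+ 2.
Proof.
rewrite /disc /= /nrm2 /nr2 !ReImE /= => h1 h2.
have := sqr_ge0 (z.1 + w.1 * 2); have := sqr_ge0 (z.2 + w.2 * 2).
have := sqr_ge0 (3 * z.1 - w.1 * 2); have := sqr_ge0 (3 * z.2 - w.2 * 2).
have := sqr_ge0 (z.1 - w.1 * 2); have := sqr_ge0 (z.2 - w.2 * 2).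
move: h1 h2; rewrite !expr2 => h1 h2 a b c d e f.
by apply/andP; split; lra.
Qed.

Variables (u : R * R -> R) (L : R) (U1 U2 U3 : R * R -> C).
Local Notation eu z := ((expR (u z))%:C : C).
Hypothesis d1 : forall z, ~ Lam z -> wd (fun z => (u z)%:C) z (U1 z) (cj (U1 z)).
Hypothesis d2 : forall z, ~ Lam z -> wd U1 z (U2 z) (- (eu z / 4)).
Hypothesis d3 : forall z, ~ Lam z -> wd U2 z (U3 z) (- (eu z / 4 * U1 z)).
Local Notation Q := (fun z => U2 z - U1 z ^+ 2 / 2).
Hypothesis hQ : hol (~` Lam) 2 Q.
Hypothesis asym : u z - 4 * ln (nr2 z) @[z --> (0 : R * R)^'] --> L.
(** The logarithmic singularity removed: [v = u - 8 ln |z|], with [V1 = v_z] and [V2 = v_zz]. *)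
Let v z := u z - 4 * ln (nr2 z).
Let V1 z : C := U1 z - 4 / cx z.
Let V2 z : C := U2 z + 4 / cx z ^+ 2.

(** [e^u = |z|^8 e^v], and [v] converges to [L]. *)
Lemma small_near0 (e : R) : 0 < e -> exists2 d, 0 < d <= 1 &
  forall z, 0 < nr2 z < d -> [/\ ~ Lam z, (v z - L) ^+ 2 <= e & expR (u z) <= e].
Proof.
move=> e0.
have n0 : nr2 z @[z --> (0 : R * R)^'] --> (0 : R) by apply: cvg_trans (@nr2_cvg0 R); apply: cvg_app; exact: nbhs_dnbhs.
have c1 : (v z - L) ^+ 2 @[z --> (0 : R * R)^'] --> (0 : R).
  rewrite -[X in _ --> X](expr0n R 2) /= -(subrr L).
  by apply: cvg_sqr; apply: cvgB => //; exact: cvg_cst.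
have c2 : (nr2 z ^+ 2) ^+ 2 * expR (v z) @[z --> (0 : R * R)^'] --> (0 : R).
  rewrite -[X in _ --> X](mul0r (expR L)); apply: cvgM.
    rewrite -[X in _ --> X](expr0n R 2) /=; apply: cvg_sqr.
    by rewrite -[X in _ --> X](expr0n R 2) /=; exact: cvg_sqr.
  by apply: (cvg_cont _ (asym)); exact: continuous_expR.
have : \forall z \near (0 : R * R)^', [/\ ~ Lam z, (v z - L) ^+ 2 <= e & expR (u z) <= e].
  near=> z; have z0 : 0 < nr2 z by apply: nr2_gt0; near: z; exact: nbhs_dnbhs_neq.
  split; first by near: z; exact: near0_off.
    by near: z; apply: (cvgr_le _ c1).
  have -> : expR (u z) = (nr2 z ^+ 2) ^+ 2 * expR (v z).
    have {1}-> : u z = ln (nr2 z) *+ 4 + v z by rewrite /v -mulr_natl; ring.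
    by rewrite expRD -lnXn // lnK ?posrE ?exprn_gt0 // -exprM.
  by near: z; apply: (cvgr_le _ c2).
move=> /near0P[d d0 hd]; exists (Num.min d 1); first by rewrite lt_min d0 ltr01 ge_min lexx orbT.
by move=> z /andP[z0]; rewrite lt_min => /andP[zd _]; apply: hd; rewrite z0.
Unshelve. all: by end_near.
Qed.
Let dv z : ~ Lam z -> 0 < nr2 z -> wd (fun z => (v z)%:C) z (V1 z) (cj (V1 z)).
Proof.
move=> zL z0; have h := d1 zL.
have n0 : nrm2 (cx z) != 0 by rewrite -nr2E gt_eqF.
have c0 : cx z != 0 by rewrite -nrm2_eq0.
have j0 : cj (cx z) != 0 by rewrite cJ_eq0.
have hl : wd (fun z => (ln (nr2 z))%:C) z ((cx z)^-1) ((cj (cx z))^-1).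
  have t := wd_nrm2 (wd_cx z).
  apply: wd_eq; [exact: (wd_rcomp t (is_derive1_ln z0))|..]; rewrite cRV nr2E nrm2E ?cJ0 ?cJ1; field; by rewrite c0 j0.
have -> : (fun z => (v z)%:C) = (fun z => (u z)%:C - 4 * (ln (nr2 z))%:C).
  by apply/funext => w; rewrite /v cRD cRN cRM cRn.
by apply: wd_eq; [exact: (wdB h (wdZ 4 hl))|..]; rewrite /V1 // !cJE.
Qed.
Let dV1 z : ~ Lam z -> 0 < nr2 z -> wd V1 z (V2 z) (- (eu z / 4)).
Proof.
move=> zL z0; have c0 : cx z != 0 by rewrite -nrm2_eq0 -nr2E gt_eqF.
by apply: wd_eq; [exact: (wdB (d2 zL) (wdZ 4 (wdV c0 (wd_cx z))))|..]; rewrite /V2; cbv beta; field.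
Qed.
Let dV2 z : ~ Lam z -> 0 < nr2 z -> wd V2 z (U3 z - 8 / cx z ^+ 3) (- (eu z / 4 * U1 z)).
Proof.
move=> zL z0; have c0 : cx z != 0 by rewrite -nrm2_eq0 -nr2E gt_eqF.
have c2 : cx z ^+ 2 != 0 by rewrite expf_neq0.
have h : wd (fun z => 4 / cx z ^+ 2) z (- (8 / cx z ^+ 3)) 0.
  apply: wd_eq; [exact: (wdZ 4 (wdV c2 (wdX 1 (wd_cx z))))|..]; rewrite expr1.
    by move: (cx z) c0 => x x0; field.
  by rewrite mulr0 oppr0 mul0r mulr0.
by apply: wd_eq; [exact: (wdD (d3 zL) h)|..]; rewrite ?addr0.
Qed.
Let deu z : ~ Lam z -> wd (fun z => eu z) z (eu z * U1 z) (eu z * cj (U1 z)).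
Proof. by move=> zL; exact: wd_rcomp (d1 zL) (is_derive_expR (u z)). Qed.
Let U1E z : U1 z = V1 z + 4 / cx z. Proof. by rewrite /V1 subrK. Qed.
Let cross z (r : R) : 0 < r -> r ^+ 2 <= nr2 z -> Re (cj (V1 z) * U1 z) <= 2 * nrm2 (V1 z) + 4 / r ^+ 2.
Proof.
move=> r0 rz; rewrite U1E mulrDr ReD.
have -> : Re (cj (V1 z) * V1 z) = nrm2 (V1 z) by rewrite mulrC -nrm2E.
have h := Re_cj_mul (V1 z) (4 / cx z).
have r2 : 0 < r ^+ 2 by rewrite exprn_gt0.
have e : nrm2 (4 / cx z) / 4 = 4 / nr2 z.
  rewrite nrm2M nrm2V -nr2E (_ : nrm2 4 = 16); last by rewrite -cRn /nrm2 /=; ring.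
  by field; rewrite gt_eqF // (lt_le_trans r2).
have : 4 / nr2 z <= 4 / r ^+ 2 by rewrite ler_pM2l // lef_pV2 ?posrE // (lt_le_trans r2).
by rewrite e in h; lra.
Qed.
Let radius z : 0 < nr2 z -> exists2 r : R, 0 < r & nr2 z = 4 * r ^+ 2.
Proof.
move=> z0; exists (Num.sqrt (nr2 z) / 2); first by rewrite divr_gt0 // sqrtr_gt0.
by rewrite expr_div_n sqr_sqrtr ?ltW //; field.
Qed.
Let dzeta z w : wd (fun w => (nrm2 (cx w - cx z))%:C) w (cj (cx w - cx z)) (cx w - cx z).
Proof.
have h : wd (fun w => cx w - cx z) w 1 0 by apply: wd_eq; [exact: (wdB (wd_cx w) (wd_cst _ w))|..]; rewrite subr0.
by apply: wd_eq; [exact: (wd_nrm2 h)|..]; rewrite ?cJ0 ?cJ1; ring.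
Qed.
Let dzeta2 z w : wd (fun w => cj (cx w - cx z)) w 0 1.
Proof.
have h : wd (fun w => cx w - cx z) w 1 0 by apply: wd_eq; [exact: (wdB (wd_cx w) (wd_cst _ w))|..]; rewrite subr0.
by apply: wd_eq; [exact: (wdJ h)|..]; rewrite ?cJ0 ?cJ1.
Qed.
Let dv2 w : ~ Lam w -> 0 < nr2 w -> wd (fun w => ((v w - L) ^+ 2)%:C) w (2 * (v w - L)%:C * V1 w) (2 * (v w - L)%:C * cj (V1 w)).
Proof.
move=> wL w0.
have -> : (fun w => ((v w - L) ^+ 2)%:C) = (fun w => ((v w)%:C - L%:C) ^+ 2).
  by apply/funext => t; rewrite cRX cRD cRN.
by apply: wd_eq; [exact: (wdX 1 (wdB (dv wL w0) (wd_cst L%:C w)))|..]; rewrite expr1 cRD cRN; cbv beta; ring.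
Qed.
Let dvV1 w : ~ Lam w -> 0 < nr2 w -> wd (fun w => 2 * (v w - L)%:C * V1 w) w
  (2 * V1 w * V1 w + 2 * (v w - L)%:C * V2 w) (2 * cj (V1 w) * V1 w - 2 * (v w - L)%:C * (eu w / 4)).
Proof.
move=> wL w0.
have -> : (fun w => 2 * (v w - L)%:C * V1 w) = (fun w => 2 * ((v w)%:C - L%:C) * V1 w).
  by apply/funext => t; rewrite cRD cRN.
by apply: wd_eq; [exact: (wdM (wdZ 2 (wdB (dv wL w0) (wd_cst L%:C w))) (dV1 wL w0))|..]; cbv beta; rewrite cRD cRN; ring.
Qed.

(** A scale-invariant estimate: on the disc of radius [|z| / 2] around [z] the deviation [v - L] is
    uniformly small, and Bernstein with [H] built on [(v - L)^2] turns this into smallness of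
    [z v_z]. The term [k |w - z|^2] absorbs what [e^u] contributes. *)
Lemma gradient_estimate (e : R) : 0 < e -> exists2 d, 0 < d &
  forall z, 0 < nr2 z < d -> nr2 z * nrm2 (V1 z) <= e.
Proof.
move=> e0.
(* Since [|z|^2 = 4 r^2], the final bound [r^2 |V1|^2 <= 14 e'] costs [56 e'], below 64. *)
pose e' := Num.min (e / 64) 1.
have e'0 : 0 < e' by rewrite lt_min divr_gt0 ?ltr01.
have e'e : e' <= e / 64 by rewrite ge_min lexx.
have e'1 : e' <= 1 by rewrite ge_min lexx orbT.
have [d /andP[d0 d1'] hd] := small_near0 e'0.
exists (4 / 9 * d) => [|z /andP[z0 zd]]; first by rewrite mulr_gt0.
have [r r0 zr] := radius z0; have r2 : 0 < r ^+ 2 by rewrite exprn_gt0.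
have inD w : disc z r w -> [/\ ~ Lam w, 0 < nr2 w, r ^+ 2 <= nr2 w, (v w - L) ^+ 2 <= e' & expR (u w) <= e'].
  move=> /(disc_annulus zr)/andP[a1 a2]; have w0 := lt_le_trans r2 a1.
  have [|h1 h2 h3] := hd w; last by split.
  by rewrite w0; lra.
pose k : R := 6 * r ^+ 2 * e'.
have := @bernstein _ z r V1 V2 (fun w => - (eu w / 4)) (fun w => - (eu w / 4 * U1 w)) (fun w => U3 w - 8 / cx w ^+ 3)
  (fun w => - (4^-1 * (eu w * cj (U1 w)))) (fun w => 8 * r ^+ 2 * (v w - L) ^+ 2 + k * nrm2 (cx w - cx z))
  (fun w => 8 * r%:C ^+ 2 * (2 * (v w - L)%:C * V1 w) + k%:C * cj (cx w - cx z))
  (fun w => 8 * r%:C ^+ 2 * (2 * V1 w * V1 w + 2 * (v w - L)%:C * V2 w) + k%:C * 0)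
  (fun w => 8 * r%:C ^+ 2 * (2 * cj (V1 w) * V1 w - 2 * (v w - L)%:C * (eu w / 4)) + k%:C * 1)
  (8 * r ^+ 2 * e' + k * r ^+ 2) r0.
move=> /(_ _ _ _ _) B.
have {}B : r ^+ 4 * nrm2 (V1 z) + (8 * r ^+ 2 * (v z - L) ^+ 2 + k * nrm2 (cx z - cx z)) <= 8 * r ^+ 2 * e' + k * r ^+ 2.
  apply: B.
  - move=> w /inD[wL w0 _ _ _]; split; [exact: dV1|exact: dV2|].
    have -> : (fun w => - (eu w / 4)) = (fun w => - (4^-1 * eu w)) by apply/funext => t; rewrite mulrC.
    by apply: wd_eq; [exact: (wdN (wdZ 4^-1 (deu wL)))|..]; ring.
  - move=> w /inD[wL w0 _ _ _]; split.
      have -> : (fun w => (8 * r ^+ 2 * (v w - L) ^+ 2 + k * nrm2 (cx w - cx z))%:C) =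
         (fun w => 8 * r%:C ^+ 2 * ((v w - L) ^+ 2)%:C + k%:C * (nrm2 (cx w - cx z))%:C).
        by apply/funext => t; rewrite !cRE.
      apply: wd_eq; [exact: (wdD (wdZ _ (dv2 wL w0)) (wdZ _ (dzeta z w)))|by []|].
      by move: (v w - L) (V1 w) (cx w - cx z) k => a b c k'; rewrite !cJE; ring.
    exact: (wdD (wdZ _ (dvV1 wL w0)) (wdZ _ (dzeta2 z w))).
  - move=> w Dw; have [wL w0 rw h2 h3] := inD w Dw.
    have -> : Re (8 * r%:C ^+ 2 * (2 * cj (V1 w) * V1 w - 2 * (v w - L)%:C * (eu w / 4)) + k%:C * 1) =
        16 * r ^+ 2 * nrm2 (V1 w) - 4 * r ^+ 2 * ((v w - L) * expR (u w)) + k.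
      move: (expR (u w)) (v w - L) (V1 w) k => E a x k'.
      by rewrite /nrm2 -!cRn -!cRV !ReImE /=; field.
    have -> : Re (cj (V1 w) * - (eu w / 4 * U1 w)) = - (expR (u w) / 4 * Re (cj (V1 w) * U1 w)).
      have -> : cj (V1 w) * - (eu w / 4 * U1 w) = - ((expR (u w) / 4)%:C * (cj (V1 w) * U1 w)).
        by rewrite !cRE; field.
      by move: (expR (u w) / 4) (cj (V1 w) * U1 w) => a b; rewrite !ReImE /=; ring.
    have c := cross r0 rw.
    have c' : r ^+ 2 * Re (cj (V1 w) * U1 w) <= 2 * r ^+ 2 * nrm2 (V1 w) + 4.
      have := ler_wpM2l (ltW r2) c; rewrite mulrDr [X in _ + X]mulrCA mulfV ?gt_eqF // mulr1; lra.
    have N0 := nrm2_ge0 (V1 w); have E0 := expR_gt0 (u w).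
    move: Dw; rewrite /disc /=; have := nrm2_ge0 (cx w - cx z).
    have r21 : r ^+ 2 <= 1 by move: zr zd; lra.
    have vb := dev_le (expR_ge0 (u w)) (le_trans h2 e'1).
    move=> Z0 Zr; have := bernstein_arith r2 r21 Z0 Zr N0 (expR_ge0 (u w)) h3 e'1 c.
    have rE : r ^+ 2 * ((v w - L) * expR (u w)) <= r ^+ 2 * e' by rewrite ler_pM2l //; lra.
    have r2N : 0 <= r ^+ 2 * nrm2 (V1 w) by rewrite mulr_ge0 // ltW.
    by rewrite /k; move: rE r2N; lra.
  - move=> w hw; have [_ _ _ h2 _] : [/\ ~ Lam w, 0 < nr2 w, r ^+ 2 <= nr2 w, (v w - L) ^+ 2 <= e' & expR (u w) <= e'] by apply: inD; rewrite /disc /= hw.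
    by rewrite hw lerD2r ler_wpM2l // mulr_ge0 // ltW.
rewrite subrr (_ : nrm2 0 = 0) ?mulr0 ?addr0 in B; last by rewrite /nrm2 /= expr0n /= addr0.
have r21 : r ^+ 2 <= 1 by move: zr zd; lra.
have q : r ^+ 2 * nrm2 (V1 z) <= 14 * e'.
  rewrite -(ler_pM2l r2); have := mulr_ge0 (ltW r2) (sqr_ge0 (v z - L)).
  have : r ^+ 2 * (r ^+ 2 * e') <= r ^+ 2 * e' by rewrite ler_pM2l // ler_piMl // ltW.
  by move: B; rewrite /k; lra.
by rewrite zr; lra.
Qed.

(** In terms of [v], the function [z^2 Q + 12] is [z^2 v_zz - 4 z v_z - (z v_z)^2 / 2]; the 12 is
    [4 + 4^2 / 2]. It is holomorphic, so Bernstein applies to it directly, with [|V1|^2] added to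
    [H] because the Laplacian of [|V1|^2] contains [|V2|^2]. *)
Lemma hopf_estimate (e : R) : 0 < e -> exists2 d, 0 < d &
  forall z, 0 < nr2 z < d -> nrm2 (cx z ^+ 2 * Q z + 12) <= e.
Proof.
move=> e0.
have [Q1 dQ [Q2 dQ1 _]] := hQ.
(* [102^2 = 10404] exceeds [1944 + 3000 + 5400], the sum of the three boundary contributions. *)
pose e' := Num.min (e / 102 / 102) 1.
have c102 : 0 < (102 : R) by rewrite ltr0n.
have e'0 : 0 < e' by rewrite lt_min !divr_gt0 ?ltr01.
have e'e : e' <= e / 102 / 102 by rewrite ge_min lexx.
have e'1 : e' <= 1 by rewrite ge_min lexx orbT.
have [d /andP[d0 d1'] hd] := small_near0 e'0.
have [d' d'0 hd'] := gradient_estimate e'0.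
exists (4 / 9 * Num.min d d') => [|z /andP[z0 zd]]; first by rewrite mulr_gt0 // lt_min d0.
have zd1 : nr2 z < 4 / 9 * d by apply: lt_le_trans zd _; rewrite ler_pM2l // ge_min lexx.
have zd2 : nr2 z < 4 / 9 * d' by apply: lt_le_trans zd _; rewrite ler_pM2l // ge_min lexx orbT.
have [r r0 zr] := radius z0; have r2 : 0 < r ^+ 2 by rewrite exprn_gt0.
have r21 : r ^+ 2 <= 1 by move: zr zd1; lra.
have inD w : disc z r w -> [/\ ~ Lam w /\ 0 < nr2 w, r ^+ 2 <= nr2 w <= 9 * r ^+ 2, (v w - L) ^+ 2 <= e', expR (u w) <= e' & nr2 w * nrm2 (V1 w) <= e'].
  move=> /(disc_annulus zr)/andP[a1 a2]; have w0 := lt_le_trans r2 a1.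
  have [|h1 h2 h3] := hd w; first by rewrite w0; lra.
  by split => //; [rewrite a1|apply: hd'; rewrite w0; lra].
pose F w : C := cx w ^+ 2 * Q w + 12.
have dF w : ~ Lam w -> wd F w (2 * cx w * Q w + cx w ^+ 2 * Q1 w) 0.
  move=> wL; apply: wd_eq; [exact: (wdD (wdM (wdX 1 (wd_cx w)) (dQ w wL)) (wd_cst 12 w))|..]; cbv beta; rewrite /=; ring.
have dF1 w : ~ Lam w -> wd (fun w => 2 * cx w * Q w + cx w ^+ 2 * Q1 w) w (2 * Q w + 4 * cx w * Q1 w + cx w ^+ 2 * Q2 w) 0.
  move=> wL; apply: wd_eq; [exact: (wdD (wdM (wdZ 2 (wd_cx w)) (dQ w wL)) (wdM (wdX 1 (wd_cx w)) (dQ1 w wL)))|..]; cbv beta; rewrite /=; ring.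
pose k : R := 5400 * (r ^+ 2) ^+ 2 * e'.
pose al : R := 1944 * (r ^+ 2) ^+ 3.
pose be : R := 3000 * (r ^+ 2) ^+ 2.
have al0 : 0 <= al by apply: mulr_ge0; [exact: ler0n|exact: exprn_ge0 (ltW r2)].
have be0 : 0 <= be by apply: mulr_ge0; [exact: ler0n|exact: sqr_ge0].
pose nz w : C := V2 w * cj (V1 w) - V1 w * (eu w / 4).
have dN w : ~ Lam w -> 0 < nr2 w -> wd (fun w => (nrm2 (V1 w))%:C) w (nz w) (cj (nz w)).
  have e4 : cj (eu w / 4) = eu w / 4 by rewrite cJM cJR cJV cJn.
  move=> wL w0; apply: wd_eq; [exact: (wd_nrm2 (dV1 wL w0))|..]; rewrite /nz; move: (V1 w) (V2 w) (eu w / 4) e4 => a b c e4.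
    by rewrite cJN e4; ring.
  by rewrite cJD cJN !cJM e4 cJK; ring.
pose Z w : C := - (eu w / 4 * U1 w) * cj (V1 w) + V2 w * cj (V2 w) + (eu w / 4) ^+ 2 - V1 w * (eu w * cj (U1 w) / 4).
have dnz w : ~ Lam w -> 0 < nr2 w -> exists e, wd nz w e (Z w).
  move=> wL w0; eexists; apply: wd_eq; [|reflexivity|].
    apply: (wdB (wdM (dV2 wL w0) (wdJ (dV1 wL w0))) (wdM (dV1 wL w0) _)).
    have -> : (fun w => eu w / 4) = (fun w => 4^-1 * eu w) by apply/funext => t; rewrite mulrC.
    exact: (wdZ 4^-1 (deu wL)).
  by rewrite /Z; cbv beta; field.
have ez0 w : exists e, (~ Lam w -> 0 < nr2 w -> wd nz w e (Z w)).
  have [[wL w0]|h] := pselect (~ Lam w /\ 0 < nr2 w); first by have [e1 he] := dnz w wL w0; exists e1.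
  by exists 0 => wL w0; case: h.
have [ez hez] := choice ez0.
have := @bernstein_holo _ z r F (fun w => 2 * cx w * Q w + cx w ^+ 2 * Q1 w) (fun w => 2 * Q w + 4 * cx w * Q1 w + cx w ^+ 2 * Q2 w)
  (fun w => al * nrm2 (V1 w) + be * (v w - L) ^+ 2 + k * nrm2 (cx w - cx z))
  (fun w => al%:C * nz w + be%:C * (2 * (v w - L)%:C * V1 w) + k%:C * cj (cx w - cx z))
  (fun w => al%:C * ez w + be%:C * (2 * V1 w * V1 w + 2 * (v w - L)%:C * V2 w) + k%:C * 0)
  (fun w => al%:C * Z w + be%:C * (2 * cj (V1 w) * V1 w - 2 * (v w - L)%:C * (eu w / 4)) + k%:C * 1)
  (1944 * (r ^+ 2) ^+ 2 * e' + be * e' + k * r ^+ 2) r0.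
move=> /(_ _ _ _ _) B.
have {}B : r ^+ 4 * nrm2 (F z) + (al * nrm2 (V1 z) + be * (v z - L) ^+ 2 + k * nrm2 (cx z - cx z)) <=
   1944 * (r ^+ 2) ^+ 2 * e' + be * e' + k * r ^+ 2.
  apply: B.
  - by move=> w /inD[[wL w0] _ _ _ _]; split; [exact: dF|exact: dF1].
  - move=> w /inD[[wL w0] _ _ _ _]; split.
      have -> : (fun w => (al * nrm2 (V1 w) + be * (v w - L) ^+ 2 + k * nrm2 (cx w - cx z))%:C) =
         (fun w => al%:C * (nrm2 (V1 w))%:C + be%:C * ((v w - L) ^+ 2)%:C + k%:C * (nrm2 (cx w - cx z))%:C).
        by apply/funext => t; rewrite 2!cRD 3!cRM.
      apply: wd_eq; [exact: (wdD (wdD (wdZ _ (dN w wL w0)) (wdZ _ (dv2 wL w0))) (wdZ _ (dzeta z w)))|by []|].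
      by move: (v w - L) (V1 w) (cx w - cx z) k (nz w) al al0 be be0 => a b c k' n' al' _ be' _; rewrite !cJE; ring.
    exact: (wdD (wdD (wdZ _ (hez w wL w0)) (wdZ _ (dvV1 wL w0))) (wdZ _ (dzeta2 z w))).
  - move=> w Dw; have [[wL w0] /andP[rw wr] h2 h3 h4] := inD w Dw.
    have -> : Re (al%:C * Z w + be%:C * (2 * cj (V1 w) * V1 w - 2 * (v w - L)%:C * (eu w / 4)) + k%:C * 1) =
        al * (nrm2 (V2 w) + expR (u w) ^+ 2 / 16 - expR (u w) / 2 * Re (cj (V1 w) * U1 w)) +
        be * (2 * nrm2 (V1 w) - (v w - L) * expR (u w) / 2) + k.
      rewrite /Z; move: (expR (u w)) (v w - L) (V1 w) (U1 w) (V2 w) al al0 be be0 k => E a x y t al' _ be' _ k'.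
      by rewrite /nrm2 -!cRn -!cRV !ReImE /=; field.
    have c := cross r0 rw.
    have N0 := nrm2_ge0 (V1 w); have N20 := nrm2_ge0 (V2 w); have E0 := expR_ge0 (u w).
    have vb := dev_le E0 (le_trans h2 e'1).
    have s0 := ltW r2.
    have B1 := bernstein_arith r2 r21 (lexx 0) s0 N0 E0 h3 e'1 c; rewrite subr0 in B1.
    have F3 : nrm2 (F w) <= 243 * (r ^+ 2) ^+ 2 * nrm2 (V2 w) + 439 * r ^+ 2 * nrm2 (V1 w).
      have c0 : cx w != 0 by rewrite -nrm2_eq0 -nr2E gt_eqF.
      have -> : F w = cx w ^+ 2 * V2 w + (- (4 * (cx w * V1 w))) + (- (2^-1 * ((cx w * V1 w) * (cx w * V1 w)))).
        by rewrite /F /V1 /V2; field.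
      apply: le_trans (nrm2_add3 _ _ _) _.
      have -> : nrm2 (cx w ^+ 2 * V2 w) = nr2 w ^+ 2 * nrm2 (V2 w) by rewrite nrm2M expr2 nrm2M -nr2E -expr2.
      have -> : nrm2 (- (4 * (cx w * V1 w))) = 16 * (nr2 w * nrm2 (V1 w)) by rewrite nrm2N 2!nrm2M nrm2n -nr2E; ring.
      have -> : nrm2 (- (2^-1 * ((cx w * V1 w) * (cx w * V1 w)))) = (nr2 w * nrm2 (V1 w)) * (nr2 w * nrm2 (V1 w)) / 4.
        by rewrite nrm2N !nrm2M nrm2V nrm2n -nr2E; field.
      have a1 : nr2 w ^+ 2 * nrm2 (V2 w) <= 81 * (r ^+ 2) ^+ 2 * nrm2 (V2 w).
        by rewrite ler_wpM2r //; exact: sqr_le9 (ltW w0) wr.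
      have a2 : nr2 w * nrm2 (V1 w) <= 9 * r ^+ 2 * nrm2 (V1 w) by rewrite ler_wpM2r.
      have a3 : (nr2 w * nrm2 (V1 w)) * (nr2 w * nrm2 (V1 w)) <= nr2 w * nrm2 (V1 w).
        by rewrite ler_piMl ?(le_trans h4) // mulr_ge0 // ltW.
      by exact: add3_le a1 a2 a3 (mulr_ge0 s0 N0).
    have vE : (v w - L) * expR (u w) <= e' := le_trans vb h3.
    have S2 : 0 <= (r ^+ 2) ^+ 2 by rewrite sqr_ge0.
    have p1 := ler_wpM2l S2 vE.
    have p2 := ler_wpM2l s0 F3.
    have p3 := ler_wpM2l s0 B1.
    have p4 : 0 <= (r ^+ 2) ^+ 3 * expR (u w) ^+ 2 by apply: mulr_ge0; [exact: exprn_ge0|exact: sqr_ge0].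
    have p5 : 0 <= (r ^+ 2) ^+ 2 * nrm2 (V1 w) by rewrite mulr_ge0.
    exact: hopf_arith p1 p2 p3 p4 p5 (mulr_ge0 S2 (ltW e'0)).
  - move=> w hw; have [[wL w0] /andP[h0 h0'] h2 _ h3] := inD w ltac:(by rewrite /disc /= hw).
    rewrite hw lerD2r; apply: lerD; last by rewrite (ler_wpM2l be0).
    have h5 : r ^+ 2 * nrm2 (V1 w) <= e' by apply: le_trans h3; rewrite ler_wpM2r // nrm2_ge0.
    have := ler_wpM2l (sqr_ge0 (r ^+ 2)) h5; rewrite /al; lra.
rewrite subrr (_ : nrm2 0 = 0) ?mulr0 ?addr0 in B; last by rewrite /nrm2 /= expr0n /= addr0.
rewrite -/(F z); have r4 : 0 < r ^+ 4 by rewrite exprn_gt0.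
rewrite -(ler_pM2l r4); have g1 : 0 <= al * nrm2 (V1 z) by exact: mulr_ge0 al0 (nrm2_ge0 _).
have g2 : 0 <= be * (v z - L) ^+ 2 by exact: mulr_ge0 be0 (sqr_ge0 _).
have g3 : r ^+ 4 * e' <= r ^+ 4 * (e / 102 / 102) by rewrite ler_pM2l.
have g4 : r ^+ 4 * e' * r ^+ 2 <= r ^+ 4 * e' by rewrite ler_piMr // mulr_ge0 // ltW.
have g5 : 0 <= r ^+ 4 * e by exact: mulr_ge0 (ltW r4) (ltW e0).
have {}B : r ^+ 4 * nrm2 (F z) <= 1944 * (r ^+ 2) ^+ 2 * e' + be * e' + k * r ^+ 2.
  by apply: le_trans B; rewrite lerDl addr_ge0.
by move: B; rewrite /be /k -!exprM /=; move: g3 g4 g5; lra.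
Qed.

End estimates.

(** * Hexagonal symmetries and a sector argument *)

Section sector.
Context {R : realType}.
Local Notation C := R[i].
Local Notation s3 := (Num.sqrt (3 : R)).
Local Notation hh := (s3 / 2).
Implicit Types (z w : R * R) (x y : C) (f g : R * R -> C).

Definition rr : C := 2^-1 +i* hh.
Definition rot z : R * R := xc (rr * cx z).

Let s33 : s3 ^+ 2 = 3. Proof. by rewrite sqr_sqrtr. Qed.
Lemma rotE z : rot z = (z.1 / 2 - hh * z.2, hh * z.1 + z.2 / 2).
Proof. by rewrite /rot /xc !ReImE /=; congr pair; ring. Qed.
Lemma cx_rot z : cx (rot z) = rr * cx z. Proof. exact: xcK. Qed.

Lemma cx_conjp z : cx (conjp z) = cj (cx z). Proof. by []. Qed.
Lemma rr_nrm2 : nrm2 rr = 1.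
Proof. by rewrite /nrm2 /= expr_div_n s33; field. Qed.
Lemma rr_cj : rr * cj rr = 1.
Proof. by rewrite -nrm2E rr_nrm2. Qed.
Lemma rr2 : rr ^+ 2 = rr - 1.
Proof. by apply: eqReIm; rewrite expr2 !ReImE /=; move: s33; rewrite expr2; lra. Qed.
Lemma rr3 : rr ^+ 3 = -1.
Proof. by rewrite exprS rr2 mulrBr mulr1 -expr2 rr2; ring. Qed.
Lemma nr2_rot z : nr2 (rot z) = nr2 z.
Proof. by rewrite !nr2E cx_rot nrm2M rr_nrm2 mul1r. Qed.
Lemma nr2_conjp z : nr2 (conjp z) = nr2 z.
Proof. by rewrite /nr2 /= sqrrN. Qed.

Lemma rot2E z : rot (rot z) = (- z.1 / 2 - hh * z.2, hh * z.1 - z.2 / 2).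
Proof.
have e (x : R) : s3 * (s3 * x) = 3 * x by rewrite mulrA -expr2 s33.
by rewrite !rotE /=; congr pair; have := e z.1; have := e z.2; lra.
Qed.

Lemma rot3E z : rot (rot (rot z)) = - z.
Proof. by rewrite -[LHS]cxK !cx_rot !mulrA -!expr2 -exprSr rr3 mulN1r; case: z. Qed.

(** The twelve symmetries generated by [rot] and [conjp] carry the sector [0 <= arg <= pi / 6] over
    the whole plane. *)
Lemma sector_fold (A : R * R -> Prop) : (forall z, A (rot z) -> A z) -> (forall z, A (conjp z) -> A z) ->
  (forall z, 0 <= z.2 -> s3 * z.2 <= z.1 -> A z) -> forall z, A z.
Proof.
move=> Ar Ac As.
have wedge z : 0 <= z.2 -> z.2 <= s3 * z.1 -> A z.
  move=> z2 z1; have [h|h] := leP (s3 * z.2) z.1; first exact: As.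
  apply: (Ac); apply: (Ar); apply: (As); rewrite rotE /=; first by lra.
  by have : s3 * (s3 * z.1) = 3 * z.1; [rewrite mulrA -expr2 s33|lra].
have upper z : 0 <= z.2 -> A z.
  move=> z2; have [h|h] := leP z.2 (s3 * z.1); first exact: wedge.
  have e3 : s3 * (s3 * z.1) = 3 * z.1 by rewrite mulrA -expr2 s33.
  have e4 : s3 * (s3 * z.2) = 3 * z.2 by rewrite mulrA -expr2 s33.
  have [k|k] := leP 0 (s3 * z.1 + z.2).
    by apply: (Ac); apply: (Ar); apply: (Ar); apply: wedge; rewrite rot2E /=; lra.
  by apply: (Ac); apply: (Ar); apply: (Ar); apply: (Ar); apply: wedge; rewrite rot3E /=; lra.
move=> z; have [h|h] := leP 0 z.2; first exact: upper.
by apply: (Ac); apply: upper; rewrite /= oppr_ge0 ltW.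
Qed.

(** In the sector the argument of [z^4], less [pi / 3], lies between [- pi / 3] and [pi / 3], where
    the cosine is at least 1/2. *)
Lemma sector_barrier z : 0 <= z.2 -> s3 * z.2 <= z.1 -> nr2 z ^+ 2 / 2 <= Re (cj rr * cx z ^+ 4).
Proof.
move=> z2 z1.
have x0 : 0 <= z.1 by apply: le_trans z1; rewrite mulr_ge0 // ltW.
have b0 : 0 <= 2 * z.1 * z.2 by rewrite !mulr_ge0.
have c0 : 0 <= s3 * (z.1 ^+ 2 - z.2 ^+ 2) - 2 * z.1 * z.2.
  have -> : s3 * (z.1 ^+ 2 - z.2 ^+ 2) - 2 * z.1 * z.2 = (z.1 - s3 * z.2) * (s3 * z.1 + z.2) + (s3 ^+ 2 - 3) * z.1 * z.2 by ring.
  rewrite s33 subrr !mul0r addr0 mulr_ge0 // ?subr_ge0 // addr_ge0 // mulr_ge0 // ltW.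
rewrite -subr_ge0; have -> : Re (cj rr * cx z ^+ 4) - nr2 z ^+ 2 / 2 =
    (2 * z.1 * z.2) * (s3 * (z.1 ^+ 2 - z.2 ^+ 2) - 2 * z.1 * z.2).
  by rewrite /nr2 -[4%N]/(2 * 2)%N exprM !expr2 !ReImE /=; field.
exact: mulr_ge0.
Qed.

Lemma sector_barrierV z : 0 <= z.2 -> s3 * z.2 <= z.1 -> 0 < nr2 z ->
  (2 * nr2 z ^+ 2)^-1 <= Re (rr * cx z ^- 4).
Proof.
move=> z2 z1 z0; have c0 : cx z != 0 by rewrite -nrm2_eq0 -nr2E gt_eqF.
have n4 : 0 < nr2 z ^+ 4 by rewrite exprn_gt0.
have -> : rr * cx z ^- 4 = cj (cj rr * cx z ^+ 4) * ((nr2 z ^+ 4)^-1)%:C.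
  rewrite cJM cJK cJX cRV cRX nr2E nrm2E exprMn; field; by rewrite c0 cJ_eq0 c0.
have -> : Re (cj (cj rr * cx z ^+ 4) * ((nr2 z ^+ 4)^-1)%:C) = Re (cj rr * cx z ^+ 4) / nr2 z ^+ 4.
  by move: (cj rr * _) (_^-1) => x k; rewrite !ReImE /=; ring.
rewrite ler_pdivlMr //; apply: le_trans (sector_barrier z2 z1).
by rewrite le_eqVlt; apply/orP; left; apply/eqP; field; rewrite gt_eqF.
Qed.

Lemma wd_Im_hol g z (g1 : C) : wd g z g1 0 -> wd (fun w => (Im (g w))%:C) z (- ci / 2 * g1) (cj (- ci / 2 * g1)).
Proof.
move=> h; have -> : (fun w => (Im (g w))%:C) = (fun w => - ci / 2 * (g w - cj (g w))).
  apply/funext => t; have -> : g t - cj (g t) = 2 * (ci * (Im (g t))%:C).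
    by rewrite -cRn; apply: eqReIm; rewrite !ReImE /=; ring.
  rewrite (_ : - ci / 2 * (2 * (ci * (Im (g t))%:C)) = - (ci * ci) * (Im (g t))%:C); last by field.
  by rewrite ciM opprK mul1r.
by apply: wd_eq; [exact: (wdZ _ (wdB h (wdJ h)))|..]; rewrite ?cJM ?cJN ?cJV ?cJi ?cJn ?cJ0; cbv beta; ring.
Qed.

Lemma hol_Im_max (K : set (R * R)) U g m : compact K -> open U -> K `<=` U -> hol U 2 g ->
  (forall z, K z -> Im (g z) <= m \/ nbhs z K) -> forall z, K z -> Im (g z) <= m.
Proof.
move=> Kc Uo KU [g1 d1 [g2 d2 _]] bd.
apply: (weak_max_principle Kc).
  apply: continuous_in_subspaceT => w /set_mem Kw; exact: rd_cts (wd_Im (d1 w (KU w Kw))).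
move=> z Kz; case: (bd z Kz) => [|h]; first by left.
right; exists (fun w => - ci / 2 * g1 w), (- ci / 2 * g2 z), 0; split => //.
  by apply: filterS (open_nbhs_nbhs (conj Uo (KU z Kz))) => w Uw; exact: wd_Im_hol (d1 w Uw).
by apply: wd_eq; [exact: (wdZ _ (d2 z (KU z Kz)))|..]; rewrite ?mulr0.
Qed.

Definition pdisc (d : R) : set (R * R) := [set z | 0 < nr2 z < d].

Lemma continuous_nr2 : continuous (@nr2 R).
Proof. by move=> z; apply: cvgD; apply: cvg_sqr; [exact: cvg_fst|exact: cvg_snd]. Qed.

Lemma pdisc_open d : open (pdisc d).
Proof.
have -> : pdisc d = (@nr2 R @^-1` [set x | 0 < x]) `&` (@nr2 R @^-1` [set x | x < d]).
  by apply/seteqP; split => z; rewrite /pdisc /=; [move=> /andP[]|move=> [-> ->]].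
by apply: openI; apply: open_comp => [z _|]; [exact: continuous_nr2|exact: open_gt|exact: continuous_nr2|exact: open_lt].
Qed.

Definition sector (a b : R) : set (R * R) := [set z | [/\ a <= nr2 z, nr2 z <= b, 0 <= z.2 & s3 * z.2 <= z.1]].

Lemma sector_compact a b : compact (sector a b).
Proof.
pose q := Num.max b 0 + 1.
have q0 : 0 < q by rewrite ltr_wpDl // le_max lexx orbT.
apply: (@compact_box _ _ (- q) q (- q) q); last first.
  move=> z [_ zb _ _]; have h1 := sqr_ge0 z.1; have h2 := sqr_ge0 z.2; rewrite /nr2 in zb.
  have bq : b < q by rewrite ltr_pwDr // le_max lexx.
  have Q : q <= q ^+ 2 by rewrite expr2 ler_peMr ?(ltW q0) // lerDr le_max lexx orbT.
  have b1 : `|z.1| <= q by rewrite -(@ler_pXn2r _ 2) ?nnegrE ?(ltW q0) // real_normK ?num_real //; lra.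
  have b2 : `|z.2| <= q by rewrite -(@ler_pXn2r _ 2) ?nnegrE ?(ltW q0) // real_normK ?num_real //; lra.
  by rewrite -!ler_norml.
have -> : sector a b = ((@nr2 R @^-1` [set x | a <= x]) `&` (@nr2 R @^-1` [set x | x <= b])) `&`
    ((snd @^-1` [set x | 0 <= x]) `&` ((fun z : R * R => z.1 - s3 * z.2) @^-1` [set x | 0 <= x])).
  by apply/seteqP; split => z /= => [[]|[[? ?] []]]; rewrite subr_ge0.
apply: closedI; apply: closedI; apply: closed_comp => [z _|]; try exact: closed_ge; try exact: closed_le.
- exact: continuous_nr2.
- exact: continuous_nr2.
- exact: cvg_snd.
- by apply: cvgB; [exact: cvg_fst|apply: cvgM; [exact: cvg_cst|exact: cvg_snd]].
Qed.

Lemma sector_interior a b z : a < nr2 z -> nr2 z < b -> 0 < z.2 -> s3 * z.2 < z.1 -> nbhs z (sector a b).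
Proof.
move=> h1 h2 h3 h4.
have c4 : (fun w : R * R => w.1 - s3 * w.2) @ z --> z.1 - s3 * z.2.
  by apply: cvgB; [exact: cvg_fst|apply: cvgM; [exact: cvg_cst|exact: cvg_snd]].
rewrite -subr_gt0 in h4.
near=> w; split; apply: ltW.
- by near: w; apply: (cvgr_gt _ (@continuous_nr2 z)).
- by near: w; apply: (cvgr_lt _ (@continuous_nr2 z)).
- by near: w; apply: (cvgr_gt _ (@cvg_snd _ _ _ _ _)).
- by rewrite -subr_gt0; near: w; apply: (cvgr_gt _ c4).
Unshelve. all: by end_near.
Qed.

Lemma hol_cts U n g z : U z -> hol U n.+1 g -> {for z, continuous (fun w => Im (g w))} /\ {for z, continuous (fun w => Re (g w))}.
Proof. by move=> Uz [g1 d1 _]; split; [exact: rd_cts (wd_Im (d1 z Uz))|exact: rd_cts (wd_Re (d1 z Uz))]. Qed.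

(** That is, [g = o(|z|^-4)] in squared form: growth below the barrier [z^-4] of the sector. *)
Definition quartic_small g := forall e, 0 < e ->
  exists2 d', 0 < d' & forall z, 0 < nr2 z < d' -> nr2 z ^+ 4 * nrm2 (g z) <= e.

(* Phragmen-Lindelof in the sector 0 < arg < pi/6, on whose two sides g is real, with barriers Re (c z^(+-4)). *)
Lemma phragmen_lindelof d g : 0 < d -> hol (pdisc d) 2 g ->
  (forall z, pdisc d z -> g (rot z) = g z) -> (forall z, pdisc d z -> g (conjp z) = cj (g z)) ->
  quartic_small g ->
  exists2 K, 0 <= K & forall z, 0 < nr2 z <= d / 2 -> `|Im (g z)| <= K * nr2 z ^+ 2.
Proof.
move=> d0 hg gr gc gs.
have d20 : 0 < d / 2 by rewrite divr_gt0.
have dd : d / 2 < d by lra.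
have inU z : 0 < nr2 z <= d / 2 -> pdisc d z by move=> /andP[h1 h2]; rewrite /pdisc /= h1 (le_lt_trans h2).
have inUV z : 0 < nr2 z <= d / 2 -> pdisc d z := inU z.
have [M M0 hM] : exists2 M, 0 <= M & forall z, sector (d / 2) (d / 2) z -> `|Im (g z)| <= M.
  have [[z0 Sz0]|h] := pselect (sector (d / 2) (d / 2) !=set0); last first.
    by exists 0 => // z Sz; case: h; exists z.
  have [|z Sz hz] := @compact_EVT_max _ _ (fun w => `|Im (g w)|) (sector (d / 2) (d / 2)) (ex_intro _ z0 Sz0) (@sector_compact _ _).
    apply: continuous_in_subspaceT => w /set_mem [h1 h2 _ _].
    have [c _] := hol_cts (inU w (introT andP (conj (lt_le_trans d20 h1) h2))) hg.
    by apply: cvg_norm.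
  by exists `|Im (g z)| => // w Sw; apply: hz; rewrite inE.
pose K := 2 * M / (d / 2) ^+ 2.
have K0 : 0 <= K by rewrite /K divr_ge0 ?sqr_ge0 // mulr_ge0.
have side z : pdisc d z -> z.2 = 0 \/ s3 * z.2 = z.1 -> Im (g z) = 0.
  move=> Uz; have Uc : pdisc d (conjp z) by rewrite /pdisc /= nr2_conjp.
  have real x : x = cj x -> Im x = 0 by case: x => a b [] /= e; lra.
  case=> e; apply: real; rewrite -gc //.
    by congr g; rewrite /conjp e oppr0 -e; case: z {Uz Uc e}.
  rewrite -[RHS]gr // rotE /conjp /=; congr g; case: z e {Uz Uc} => a b /= <-.
  by congr pair; move: s33; rewrite ?expr2 => e; [|have -> : s3 / 2 * (s3 * b) = (s3 * s3) * b / 2 by ring]; rewrite ?e; field.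
have main (sg : R) : sg = 1 \/ sg = -1 -> forall z, 0 < nr2 z <= d / 2 -> 0 <= z.2 -> s3 * z.2 <= z.1 ->
    forall e, 0 < e -> sg * Im (g z) - (e * Re (rr * cx z ^- 4) + K * Re (cj rr * cx z ^+ 4)) <= 0.
  move=> hsg z /andP[z0 zd] z2 z1 e e0.
  have [d' d'0 hd'] := gs ((e / 2) ^+ 2) (exprn_gt0 2 (divr_gt0 e0 (ltr0Sn _ 1))).
  pose a := Num.min (nr2 z) (Num.min (d' / 2) (d / 2)).
  have a0 : 0 < a by rewrite !lt_min z0 !divr_gt0.
  have az : a <= nr2 z by rewrite ge_min lexx.
  have ad' : a < d' by apply: (@le_lt_trans _ _ (d' / 2)); [rewrite /a !ge_min lexx orbT|lra].
  pose F w : C := sg%:C * g w - ci * (e%:C * (rr * cx w ^- 4) + K%:C * (cj rr * cx w ^+ 4)).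
  have FE w : Im (F w) = sg * Im (g w) - (e * Re (rr * cx w ^- 4) + K * Re (cj rr * cx w ^+ 4)).
    by rewrite /F; move: (g w) (rr * _) (cj rr * _) => x y t; rewrite !ReImE /=; ring.
  have KU : sector a (d / 2) `<=` pdisc d by move=> w [h1 h2 _ _]; apply: inU; rewrite (lt_le_trans a0 h1).
  have c0 w : pdisc d w -> cx w != 0 by move=> /andP[h _]; rewrite -nrm2_eq0 -nr2E gt_eqF.
  have hF : hol (pdisc d) 2 F.
    apply: holB; first exact: holZ.
    apply: holZ; apply: holD; apply: holZ; apply: holZ; last by apply: holX; exact: hol_cx.
    by apply: holV => [w /c0 h|]; [rewrite expf_neq0|apply: holX; exact: hol_cx].
  have bar w : 0 <= w.2 -> s3 * w.2 <= w.1 -> 0 < nr2 w ->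
     0 <= e * Re (rr * cx w ^- 4) /\ 0 <= K * Re (cj rr * cx w ^+ 4).
    move=> w2 w1 w0; split; apply: mulr_ge0 => //; first exact: ltW.
      by apply: le_trans (sector_barrierV w2 w1 w0); rewrite invr_ge0 mulr_ge0 // sqr_ge0.
    by apply: le_trans (sector_barrier w2 w1); rewrite divr_ge0 // sqr_ge0.
  rewrite -FE; apply: (hol_Im_max (@sector_compact a (d / 2)) (@pdisc_open d) KU hF); last by split.
  have sgle x : sg * Im x <= `|Im x|.
    by case: hsg => ->; rewrite ?mul1r ?mulN1r ?ler_norm // -normrN ler_norm.
  move=> w Sw; have [h1 h2 h3 h4] := Sw; have w0 := lt_le_trans a0 h1.
  have [b1 b2] := bar w h3 h4 w0.
  have [e3|n3] := eqVneq w.2 0; first by left; rewrite FE (side w (KU w Sw)) ?mulr0; [lra|left].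
  have [e4|n4] := eqVneq (s3 * w.2) w.1; first by left; rewrite FE (side w (KU w Sw)) ?mulr0; [lra|right].
  have [e2|n2] := eqVneq (nr2 w) (d / 2).
    left; rewrite FE; have := hM w ltac:(by split; rewrite ?e2) => m.
    have : M <= K * Re (cj rr * cx w ^+ 4).
      apply: (@le_trans _ _ (K * (nr2 w ^+ 2 / 2))); last by rewrite ler_wpM2l // sector_barrier.
      by rewrite e2 /K le_eqVlt; apply/orP; left; apply/eqP; field; rewrite gt_eqF.
    by have := sgle (g w); lra.
  have [e1|n1] := eqVneq (nr2 w) a.
    left; rewrite FE; have wd' : 0 < nr2 w < d' by rewrite w0 e1.
    have m : `|Im (g w)| <= e * (2 * nr2 w ^+ 2)^-1.
      have p2 : 0 < nr2 w ^+ 2 by rewrite exprn_gt0.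
      have q0 : 0 <= e * (2 * nr2 w ^+ 2)^-1.
        by apply: mulr_ge0; [exact: ltW|rewrite invr_ge0; apply: mulr_ge0 => //; exact: ltW].
      rewrite -(@ler_pXn2r _ 2) ?nnegrE ?normr_ge0 //.
      rewrite real_normK ?num_real //; apply: (@le_trans _ _ (nrm2 (g w))); first by rewrite /nrm2 lerDr sqr_ge0.
      have -> : (e * (2 * nr2 w ^+ 2)^-1) ^+ 2 = (e / 2) ^+ 2 / nr2 w ^+ 4 by field; rewrite gt_eqF.
      by rewrite ler_pdivlMr ?exprn_gt0 // mulrC; exact: hd'.
    have : e * (2 * nr2 w ^+ 2)^-1 <= e * Re (rr * cx w ^- 4) by rewrite ler_pM2l // sector_barrierV.
    by have := sgle (g w); lra.
  right; apply: sector_interior; rewrite lt_neqAle ?h1 ?h2 ?h3 ?h4 andbT //; by rewrite eq_sym.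
have main2 (sg : R) : sg = 1 \/ sg = -1 -> forall z, 0 < nr2 z <= d / 2 -> 0 <= z.2 -> s3 * z.2 <= z.1 ->
    sg * Im (g z) <= K * nr2 z ^+ 2.
  move=> hsg z zd z2 z1; apply: (@le_trans _ _ (K * Re (cj rr * cx z ^+ 4))); last first.
    rewrite ler_wpM2l //; apply: le_trans (_ : `|Re (cj rr * cx z ^+ 4)| <= _); first exact: ler_norm.
    rewrite -(@ler_pXn2r _ 2) ?nnegrE ?normr_ge0 ?sqr_ge0 // real_normK ?num_real //.
    apply: (@le_trans _ _ (nrm2 (cj rr * cx z ^+ 4))); first by rewrite /nrm2 lerDl sqr_ge0.
    have -> : nrm2 (cj rr * cx z ^+ 4) = nr2 z ^+ 4.
      rewrite nrm2M (_ : nrm2 (cj rr) = 1) ?mul1r; last by rewrite -rr_nrm2 /nrm2 !ReImE sqrrN.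
      by rewrite -[4%N]/(2 * 2)%N !exprM !expr2 !nrm2M -!nr2E.
    by rewrite -exprM.
  rewrite -subr_le0 leNgt; apply/negP => h.
  pose b := Re (rr * cx z ^- 4); have b0 : 0 < b.
    apply: lt_le_trans (sector_barrierV z2 z1 _); last by case/andP: zd.
    by rewrite invr_gt0 mulr_gt0 // exprn_gt0 //; case/andP: zd.
  pose e := (sg * Im (g z) - K * Re (cj rr * cx z ^+ 4)) / (2 * b).
  have e0 : 0 < e by rewrite divr_gt0 // mulr_gt0.
  have := main sg hsg z zd z2 z1 e e0; rewrite -/b.
  have -> : e * b = (sg * Im (g z) - K * Re (cj rr * cx z ^+ 4)) / 2 by rewrite /e; field; rewrite gt_eqF.
  by lra.
exists K => //.
apply: sector_fold => [z h zd|z h zd|z z2 z1 zd].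
- have := h; rewrite nr2_rot gr; first by apply.
  exact: inU.
- have := h; rewrite nr2_conjp gc ?ImJ ?normrN; first by apply.
  exact: inU.
- have h1 := main2 1 (or_introl erefl) z zd z2 z1; have h2 := main2 (-1) (or_intror erefl) z zd z2 z1.
  by rewrite ler_norml; apply/andP; split; lra.
Qed.

End sector.

(** * Removable singularities of symmetric functions *)

Section laurent.
Context {R : realType}.
Local Notation C := R[i].
Local Notation s3 := (Num.sqrt (3 : R)).
Implicit Types (z w : R * R) (f g : R * R -> C).

Lemma holS U n f : hol U n.+1 f -> exists2 f', (forall z, U z -> wd f z (f' z) 0) & hol U n f'.
Proof. by []. Qed.

(** [cauchy_estimate_Im] on the disc of radius [r = |z| / 2], where [r^2 <= |w|^2 <= 9 r^2]. This is
    the source of the powers of 9, and of the factor [4 / 9] that keeps the disc inside. *)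
Lemma cauchy_pdisc d n K g (g1 : R * R -> C) : (forall z, pdisc d z -> wd g z (g1 z) 0) -> hol (pdisc d) 2 g1 ->
  0 <= K -> (forall z, pdisc d z -> Im (g z) ^+ 2 <= K * nr2 z ^+ n.+1) ->
  forall z, pdisc (4 / 9 * d) z -> nrm2 (g1 z) <= 16 * K * 9 ^+ n.+1 * nr2 z ^+ n.
Proof.
move=> dg [g2 dg1 [g3 dg2 _]] K0 hg z /andP[z0 zd].
pose r := Num.sqrt (nr2 z) / 2; have r0 : 0 < r by rewrite divr_gt0 // sqrtr_gt0.
have zr : nr2 z = 4 * r ^+ 2 by rewrite expr_div_n sqr_sqrtr ?ltW //; field.
have r2 : 0 < r ^+ 2 by rewrite exprn_gt0.
have inD w : disc z r w -> pdisc d w /\ nr2 w <= 9 * r ^+ 2.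
  move=> /(disc_annulus zr)/andP[a1 a2]; split => //; rewrite /pdisc /= (lt_le_trans r2) //=; lra.
pose m := Num.sqrt (K * (9 * r ^+ 2) ^+ n.+1).
have m2 : m ^+ 2 = K * (9 * r ^+ 2) ^+ n.+1 by rewrite sqr_sqrtr // mulr_ge0 // exprn_ge0 // mulr_ge0 // ltW.
have := @cauchy_estimate_Im _ z r g g1 g2 g3 m r0 => /(_ _ _) h.
have {}h : r ^+ 2 * nrm2 (g1 z) <= 16 * m ^+ 2.
  apply: h => w /inD[Dw wr]; first by split; [exact: dg|exact: dg1|exact: dg2].
  rewrite -(@ler_pXn2r _ 2) ?nnegrE ?normr_ge0 ?sqrtr_ge0 // real_normK ?num_real // m2.
  apply: le_trans (hg w Dw) _; rewrite ler_wpM2l // lerXn2r ?nnegrE ?(ltW r2) //; last first.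
    by apply: mulr_ge0 => //; exact: ltW.
  by case/andP: Dw => /ltW.
rewrite -(ler_pM2l r2); apply: le_trans h _; rewrite m2 exprMn [(r ^+ 2) ^+ n.+1]exprS.
have le : (r ^+ 2) ^+ n <= nr2 z ^+ n by rewrite lerXn2r ?nnegrE ?(ltW r2) ?(ltW z0) // zr; lra.
have : 0 <= 16 * K * 9 ^+ n.+1 * r ^+ 2 by rewrite !mulr_ge0 // ?exprn_ge0 // ltW.
move: ((r ^+ 2) ^+ n) (nr2 z ^+ n) (9 ^+ n.+1) (r ^+ 2) le => A B D s le h.
by have := ler_wpM2l h le; lra.
Qed.

Lemma dv_line (f : R * R -> C) z v (t : R) a : wd f (z.1 + t * v.1, z.2 + t * v.2) a 0 ->
  is_derive t 1 (fun s => Re (f (z.1 + s * v.1, z.2 + s * v.2))) (Re (a * cx v)).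
Proof.
move=> h; have := rd_line (wd_Re h); rewrite !addr0 subr0 => k; apply: (dv_eq k).
by rewrite !ReImE /=; ring.
Qed.

Lemma nrm2J (x : C) : nrm2 (cj x) = nrm2 x.
Proof. by rewrite /nrm2 !ReImE sqrrN. Qed.

Lemma nrm2_shift (x : C) (c : R) : nrm2 x <= 2 * (nrm2 (x - c%:C) + c ^+ 2).
Proof.
case: x => a b; rewrite /nrm2 /= oppr0 addr0.
by have := sqr_ge0 (a - 2 * c); have := sqr_ge0 b; lra.
Qed.

Lemma Re_le_nrm2 (x : C) : Re x ^+ 2 <= nrm2 x.
Proof. by rewrite /nrm2 lerDl sqr_ge0. Qed.

Lemma sqr_le_abs (a b : R) : 0 <= b -> a ^+ 2 <= b ^+ 2 -> - b <= a <= b.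
Proof.
by move=> b0 h; rewrite -ler_norml -(@ler_pXn2r _ 2) ?nnegrE ?normr_ge0 // real_normK ?num_real.
Qed.

(** With [k = sqrt K], the derivative [4 k x^3] of [k x^4] exceeds that of [Re g] in absolute value,
    so [k x^4 + Re g] and [k x^4 - Re g] both increase. The constant is the infimum of the first of
    them. *)
Lemma real_axis_limit d K g (g1 : R * R -> C) : 0 < d -> 0 <= K -> (forall z, pdisc d z -> wd g z (g1 z) 0) ->
  (forall z, pdisc d z -> nrm2 (g1 z) <= K * nr2 z ^+ 3) ->
  exists c : R, forall x : R, 0 < x -> x ^+ 2 < d -> (Re (g (x, 0)) - c) ^+ 2 <= K * x ^+ 8.
Proof.
move=> d0 K0 dg hg1; pose k := Num.sqrt K; have k2 : k ^+ 2 = K by rewrite sqr_sqrtr.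
have k0 : 0 <= k by exact: sqrtr_ge0.
pose ga x := Re (g (x, 0)).
have inU x : 0 < x -> x ^+ 2 < d -> pdisc d (x, 0) by move=> x0 xd; rewrite /pdisc /nr2 /= expr0n /= addr0 xd exprn_gt0.
have dga x : 0 < x -> x ^+ 2 < d -> is_derive x 1 ga (Re (g1 (x, 0))).
  move=> x0 xd; pose o : R * R := 0; pose v : R * R := (1, 0).
  have oE s : (o.1 + s * v.1, o.2 + s * v.2) = (s, 0) by rewrite /= mulr1 mulr0 !add0r.
  have e : (fun s => Re (g (o.1 + s * v.1, o.2 + s * v.2))) = ga by apply/funext => s; rewrite oE.
  have h : wd g (o.1 + x * v.1, o.2 + x * v.2) (g1 (x, 0)) 0 by rewrite oE; apply: dg; exact: inU.
  by have := dv_line h; rewrite e => t; apply: (dv_eq t); rewrite !ReImE /=; ring.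
have bd x : 0 < x -> x ^+ 2 < d -> - (k * x ^+ 3) <= Re (g1 (x, 0)) <= k * x ^+ 3.
  move=> x0 xd; apply: sqr_le_abs; first by rewrite mulr_ge0 // exprn_ge0 // ltW.
  apply: le_trans (Re_le_nrm2 _) _; apply: le_trans (hg1 _ (inU x x0 xd)) _.
  by rewrite /nr2 /= expr0n /= addr0 [(k * _) ^+ 2]exprMn k2 -!exprM.
have d4 (x : R) : is_derive x 1 (fun t : R => k * t ^+ 4) (4 * k * x ^+ 3).
  have h := dv_sqr (dv_sqr (dv_id x)); have := dvM (dv_cst k x) h.
  have -> : (fun t : R => k * (t ^+ 2) ^+ 2) = (fun t => k * t ^+ 4) by apply/funext => t; rewrite -exprM.
  by move=> t; apply: (dv_eq t); ring.
have xx x y : 0 < x -> x < y -> y ^+ 2 < d -> forall t, x <= t <= y -> 0 < t /\ t ^+ 2 < d.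
  move=> x0 xy yd t /andP[h1 h2]; have t0 := lt_le_trans x0 h1; split => //; apply: le_lt_trans yd.
  by rewrite ler_pXn2r ?nnegrE ?(ltW t0) // (le_trans (ltW t0)).
have mono (sg : R) : sg = 1 \/ sg = -1 -> forall x y, 0 < x -> x < y -> y ^+ 2 < d ->
   sg * ga x + k * x ^+ 4 <= sg * ga y + k * y ^+ 4.
  move=> hsg x y x0 xy yd.
  have [t tI e] := @dv_mvt _ (fun t => sg * ga t + k * t ^+ 4) (fun t => sg * Re (g1 (t, 0)) + 4 * k * t ^+ 3) x y xy
    ltac:(by move=> t tI; have [t0 td] := xx x y x0 xy yd t tI; apply: (dv_eq (dvD (dvM (dv_cst sg t) (dga t t0 td)) (d4 t))); cbv beta; ring).
  have [t0 td] := xx x y x0 xy yd t ltac:(by case/andP: tI => *; rewrite !ltW).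
  rewrite -subr_ge0 e mulr_ge0 ?subr_ge0 ?(ltW xy) //.
  have /andP[b1 b2] := bd t t0 td; have : 0 <= k * t ^+ 3 by rewrite mulr_ge0 // exprn_ge0 // ltW.
  by case: hsg => ->; lra.
pose S : set R := [set y | exists x, [/\ 0 < x, x ^+ 2 < d & y = ga x + k * x ^+ 4]].
have low x : 0 < x -> x ^+ 2 < d -> lbound S (ga x - k * x ^+ 4).
  move=> x0 xd _ [y [y0 yd ->]]; have X4 : 0 <= k * x ^+ 4 by rewrite mulr_ge0 // exprn_ge0 // ltW.
  have Y4 : 0 <= k * y ^+ 4 by rewrite mulr_ge0 // exprn_ge0 // ltW.
  have [lt|lt|->] := ltgtP x y; last by lra.
    by have := mono 1 (or_introl erefl) x y x0 lt yd; lra.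
  by have := mono (-1) (or_intror erefl) y x y0 lt xd; lra.
exists (inf S) => x x0 xd.
have Sx : S (ga x + k * x ^+ 4) by exists x.
have hl : has_lbound S by exists (ga x - k * x ^+ 4); exact: low.
have i1 : inf S <= ga x + k * x ^+ 4 by apply: ge_inf.
have i2 : ga x - k * x ^+ 4 <= inf S by apply: lb_le_inf; [by exists (ga x + k * x ^+ 4)|exact: low].
have -> : K * x ^+ 8 = (k * x ^+ 4) ^+ 2 by rewrite exprMn k2 -exprM.
rewrite -/(ga x) -[leLHS]real_normK ?num_real // ler_pXn2r ?nnegrE ?normr_ge0 ?mulr_ge0 ?exprn_ge0 ?(ltW x0) //.
by rewrite ler_norml; apply/andP; split; lra.
Qed.
Let s30 : 0 < s3. Proof. by rewrite sqrtr_gt0. Qed.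

Definition symmetric d g := [/\ forall n, hol (pdisc d) n g, forall z, pdisc d z -> g (rot z) = g z &
  forall z, pdisc d z -> g (conjp z) = cj (g z)].

Lemma pdisc_sub d d' : d' <= d -> pdisc d' `<=` @pdisc R d.
Proof. by move=> h z /andP[a b]; rewrite /pdisc /= a (lt_le_trans b). Qed.

Lemma Im_bound d g : 0 < d -> symmetric d g ->
  quartic_small g ->
  exists2 K, 0 <= K & forall z, pdisc (d / 2) z -> Im (g z) ^+ 2 <= K * nr2 z ^+ 4.
Proof.
move=> d0 [hg gr gc] gs; have [K K0 hK] := phragmen_lindelof d0 (hg 2) gr gc gs.
exists (K ^+ 2); first exact: sqr_ge0.
move=> z /andP[z0 zd]; have := hK z ltac:(by rewrite z0 ltW) => h.
have -> : K ^+ 2 * nr2 z ^+ 4 = (K * nr2 z ^+ 2) ^+ 2 by rewrite exprMn -exprM.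
rewrite -[leLHS]real_normK ?num_real // ler_pXn2r ?nnegrE ?normr_ge0 //.
by apply: mulr_ge0 => //; exact: sqr_ge0.
Qed.

(** Phragmen-Lindelof gives [Im g = O(|z|^4)], hence [g' = O(|z|^3)]. The limit found on the real
    axis is carried to the rest of the sector along vertical segments, and to the plane by
    [sector_fold]. *)
Lemma laurent1 d g : 0 < d -> symmetric d g ->
  quartic_small g ->
  exists c K : R, 0 <= K /\ forall z, pdisc (2 / 9 * d) z -> nrm2 (g z - c%:C) <= K * nr2 z ^+ 4.
Proof.
move=> d0 sg gs; have [K K0 hK] := Im_bound d0 sg gs; have [hg gr gc] := sg.
have [g1 dg hg1] := holS (hg 3).
have d20 : 0 < d / 2 by rewrite divr_gt0.
have s1 : pdisc (d / 2) `<=` pdisc d by apply: pdisc_sub; lra.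
have [d' d'E] : exists d', d' = 2 / 9 * d by eexists.
have d'0 : 0 < d' by rewrite d'E mulr_gt0 // divr_gt0.
have s2 : pdisc d' `<=` pdisc d by apply: pdisc_sub; lra.
have s4 : pdisc d' `<=` pdisc (d / 2) by apply: pdisc_sub; lra.
pose K' := 16 * K * 9 ^+ 4.
have K'0 : 0 <= K' by rewrite /K' !mulr_ge0 // exprn_ge0.
have hg1' z : pdisc d' z -> nrm2 (g1 z) <= K' * nr2 z ^+ 3.
  move=> Dz; apply: (@cauchy_pdisc (d / 2) 3 K g g1) => //; first by move=> w /s1; exact: dg.
    exact: hol_sub s1 hg1.
  by move: Dz; rewrite d'E; congr pdisc; field.
have [c hc] := real_axis_limit d'0 K'0 (fun z Dz => dg z (s2 z Dz)) hg1'.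
exists c, (4 * K' + K); split; first by apply: addr_ge0 => //; apply: mulr_ge0.
rewrite -d'E; apply: sector_fold => [z h Dz|z h Dz|z z2 z1 Dz].
- by have := h; rewrite /pdisc /= nr2_rot gr; [apply|exact: s2].
- have := h; rewrite /pdisc /= nr2_conjp gc; last exact: s2.
  by move=> /(_ Dz); rewrite (_ : cj (g z) - c%:C = cj (g z - c%:C)) ?nrm2J // cJD cJN cJR.
have /andP[z0 zd] := Dz.
have x0 : 0 < z.1.
  rewrite lt_neqAle (le_trans _ z1) ?mulr_ge0 ?(ltW s30) // andbT eq_sym; apply/negP => /eqP e.
  have y0 : z.2 = 0 by apply/eqP; rewrite eq_le z2 andbT; move: z1; rewrite e pmulr_rle0.
  by move: z0; rewrite /nr2 e y0 expr0n /= addr0 ltxx.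
have q1 := sqr_ge0 z.1; have q2 := sqr_ge0 z.2.
have xd : z.1 ^+ 2 < d' by move: zd; rewrite /nr2; lra.
have h1 := hc z.1 x0 xd.
have h2 : (Re (g z) - Re (g (z.1, 0))) ^+ 2 <= K' * nr2 z ^+ 4.
  have [y0|y0] := eqVneq z.2 0.
    have -> : (z.1, 0) = z by rewrite -y0; case: (z).
    by rewrite subrr expr0n /=; apply: mulr_ge0 => //; apply: exprn_ge0; exact: ltW.
  have yp : 0 < z.2 by rewrite lt_neqAle eq_sym y0.
  pose a : R * R := (z.1, 0); pose v : R * R := (0, 1).
  have pE t : (a.1 + t * v.1, a.2 + t * v.2) = (z.1, t) by rewrite /= mulr0 mulr1 addr0 add0r.
  have inI t : 0 <= t <= z.2 -> pdisc d' (z.1, t) /\ nr2 (z.1, t) <= nr2 z.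
    move=> /andP[t0 t1]; have le : t ^+ 2 <= z.2 ^+ 2 by rewrite ler_pXn2r ?nnegrE.
    have N : nr2 (z.1, t) <= nr2 z by rewrite /nr2 /= lerD2l.
    by split => //; rewrite /pdisc /= (le_lt_trans N zd) andbT /nr2 /= ltr_wpDr ?sqr_ge0 // exprn_gt0.
  have [t tI] := @dv_mvt _ (fun s => Re (g (a.1 + s * v.1, a.2 + s * v.2))) (fun s => Re (g1 (z.1, s) * cx v)) 0 z.2 yp
    ltac:(by move=> t /inI[Dt _]; apply: dv_line; rewrite pE; apply: dg; exact: s2).
  rewrite !pE subr0 => e.
  have [Dt Nt] := inI t ltac:(by case/andP: tI => *; rewrite !ltW).
  have -> : Re (g z) = Re (g (z.1, z.2)) by case: (z).
  rewrite e exprMn; have b1 := hg1' _ Dt.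
  have b2 : Re (g1 (z.1, t) * cx v) ^+ 2 <= K' * nr2 z ^+ 3.
    apply: le_trans (Re_le_nrm2 _) _; rewrite nrm2M (_ : nrm2 (cx v) = 1) ?mulr1; last by rewrite /nrm2 /= expr0n expr1n add0r.
    apply: le_trans b1 _; rewrite ler_wpM2l // lerXn2r ?nnegrE ?nr2_ge0 //.
  have y2 : z.2 ^+ 2 <= nr2 z by rewrite /nr2 lerDr.
  by apply: le_trans (ler_pM (sqr_ge0 _) (sqr_ge0 _) b2 y2) _; rewrite -mulrA -exprSr.
have h3 := hK z (s4 z Dz).
have N8 : z.1 ^+ 8 <= nr2 z ^+ 4.
  by rewrite -[8%N]/(2 * 4)%N exprM lerXn2r ?nnegrE ?q1 ?(ltW z0) // /nr2 lerDl.
have h4 : K' * z.1 ^+ 8 <= K' * nr2 z ^+ 4 by rewrite ler_wpM2l.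
have -> : nrm2 (g z - c%:C) = ((Re (g z) - Re (g (z.1, 0))) + (Re (g (z.1, 0)) - c)) ^+ 2 + Im (g z) ^+ 2.
  by rewrite /nrm2 !ReImE /=; ring.
move: h1 h2 h3 h4; move: (Re (g z) - _) (Re (g (z.1, 0)) - c) => a b h1 h2 h3 h4.
by have := sqr_ge0 (a - b); rewrite !expr2 in h1 h2 *; rewrite -!expr2; lra.
Qed.

Lemma symmetricX d n : symmetric d (fun z => cx z ^+ (6 * n)).
Proof.
split=> [m|z _|z _]; first by apply: holX; exact: hol_cx.
  by rewrite cx_rot exprMn [rr ^+ _]exprM -[6%N]/(3 * 2)%N exprM rr3 sqrrN expr1n expr1n mul1r.
by rewrite cx_conjp cJX.
Qed.

Lemma pdisc_cx d z : pdisc d z -> cx z != 0.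
Proof. by move=> /andP[h _]; rewrite -nrm2_eq0 -nr2E gt_eqF. Qed.

Lemma symmetric_sub d d' g : d' <= d -> symmetric d g -> symmetric d' g.
Proof.
move=> dd [h1 h2 h3]; have s := pdisc_sub dd.
by split=> [n|z /s|z /s]; [apply: hol_sub (h1 n)|exact: h2|exact: h3].
Qed.

(** [(g - c) / z^6] has the same symmetries and is [O(|z|^-2)], so [laurent1] applies a second time.
    Rotation invariance is what excludes the powers strictly between 0 and 6. *)
Lemma laurent d g : 0 < d -> symmetric d g ->
  quartic_small g ->
  exists (c : R) (G G1 G2 : R * R -> C) (d' M : R), [/\ 0 < d' <= d,
    forall z, pdisc d' z -> g z = c%:C + cx z ^+ 6 * G z,
    forall z, pdisc d' z -> wd G z (G1 z) 0 /\ wd G1 z (G2 z) 0 &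
    forall z, pdisc d' z -> [/\ nrm2 (G z) <= M, nrm2 (G1 z) <= M & nrm2 (G2 z) <= M]].
Proof.
move=> d0 sg gs; have [c [K [K0 hK]]] := laurent1 d0 sg gs.
have [d1 d1E] : exists d1, d1 = 2 / 9 * d by eexists.
have d10 : 0 < d1 by rewrite d1E mulr_gt0 // divr_gt0.
have d1d : d1 <= d by lra.
rewrite -d1E in hK; have [hg gr gc] := symmetric_sub d1d sg.
pose G z : C := (g z - c%:C) / cx z ^+ 6.
have sG : symmetric d1 G.
  have [h1 h2 h3] := symmetricX d1 1; split=> [n|z Dz|z Dz].
  - apply: holM; first by apply: holB => //; exact: hol_cst.
    by apply: holV; [move=> z /pdisc_cx h; rewrite expf_neq0|exact: h1].
  - by rewrite /G gr // h2.
  - by rewrite /G gc // h3 // cJM cJV cJD cJN cJR.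
have Gb z : pdisc d1 z -> nrm2 (G z) * nr2 z ^+ 2 <= K.
  move=> Dz; have /andP[z0 _] := Dz; have := hK z Dz.
  have -> : g z - c%:C = G z * cx z ^+ 6 by rewrite /G divfK // expf_neq0 // (pdisc_cx Dz).
  have -> : nrm2 (G z * cx z ^+ 6) = nrm2 (G z) * nr2 z ^+ 2 * nr2 z ^+ 4.
    by rewrite nrm2M -mulrA -exprD nr2E -[6%N]/(2 + 4)%N; congr (_ * _); rewrite !exprS !nrm2M expr0 mulr1 (_ : nrm2 1 = 1) ?mulr1 // /nrm2 /= expr1n expr0n addr0.
  by rewrite ler_pM2r // exprn_gt0.
have Gs e : 0 < e -> exists2 d', 0 < d' & forall z, 0 < nr2 z < d' -> nr2 z ^+ 4 * nrm2 (G z) <= e.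
  move=> e0; exists (Num.min d1 (Num.min 1 (e / (K + 1)))); first by rewrite !lt_min d10 ltr01 divr_gt0 // ltr_wpDl.
  move=> z /andP[z0]; rewrite !lt_min => /and3P[z1 z2 z3].
  have h := Gb z ltac:(by rewrite /pdisc /= z0).
  rewrite -[4%N]/(2 + 2)%N exprD -mulrA [_ * nrm2 _]mulrC.
  apply: (@le_trans _ _ (nr2 z ^+ 2 * K)); first by rewrite ler_wpM2l // sqr_ge0.
  have h2 : nr2 z ^+ 2 <= nr2 z by rewrite expr2 ler_piMr // ltW.
  apply: (@le_trans _ _ (nr2 z * (K + 1))); last by rewrite -ler_pdivlMr ?ltW // ltr_wpDl.
  by apply: ler_pM => //; [exact: sqr_ge0|rewrite lerDl].
have [c' [K' [K'0 hK']]] := laurent1 d10 sG Gs.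
have [A A0 hA] := Im_bound d10 sG Gs.
have [hG _ _] := sG.
have [G1 dG hG1] := holS (hG 4); have [G2 dG1 hG2] := holS hG1.
have [d2 d2E] : exists d2, d2 = Num.min 1 (2 / 81 * d1) by eexists.
have d20 : 0 < d2 by rewrite d2E lt_min ltr01 mulr_gt0 // divr_gt0 // ltr0n.
have d21 : d2 <= 1 by rewrite d2E ge_min lexx.
have d2l : d2 <= 2 / 81 * d1 by rewrite d2E ge_min lexx orbT.
have small z n : pdisc d2 z -> nr2 z ^+ n <= 1.
  by move=> /andP[z0 zd]; rewrite exprn_ile1 ?(ltW z0) // ltW // (lt_le_trans zd).
pose B1 := 16 * A * 9 ^+ 4; have B10 : 0 <= B1 by rewrite /B1 !mulr_ge0 // exprn_ge0.
pose B2 := 16 * B1 * 9 ^+ 3; have B20 : 0 <= B2 by rewrite /B2 !mulr_ge0 // exprn_ge0.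
have s1 : pdisc (d1 / 2) `<=` pdisc d1 by apply: pdisc_sub; lra.
have s2 : pdisc (4 / 9 * (d1 / 2)) `<=` pdisc d1 by apply: pdisc_sub; lra.
have b1 z : pdisc (4 / 9 * (d1 / 2)) z -> nrm2 (G1 z) <= B1 * nr2 z ^+ 3.
  apply: (@cauchy_pdisc (d1 / 2) 3 A G G1) => //; first by move=> w /s1; exact: dG.
  by apply: hol_sub s1 _; exact: holW.
have b2 z : pdisc (4 / 9 * (4 / 9 * (d1 / 2))) z -> nrm2 (G2 z) <= B2 * nr2 z ^+ 2.
  apply: (@cauchy_pdisc (4 / 9 * (d1 / 2)) 2 B1 G1 G2) => //; first by move=> w /s2; exact: dG1.
    by apply: hol_sub s2 hG2.
  by move=> w Dw; apply: le_trans (b1 w Dw); rewrite /nrm2 lerDr sqr_ge0.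
exists c, G, G1, G2, d2, (2 * (K' + c' ^+ 2) + B1 + B2).
have i1 : pdisc d2 `<=` pdisc d1 by apply: pdisc_sub; lra.
have i2 : pdisc d2 `<=` pdisc (4 / 9 * (d1 / 2)) by apply: pdisc_sub; lra.
have i3 : pdisc d2 `<=` pdisc (4 / 9 * (4 / 9 * (d1 / 2))) by apply: pdisc_sub; lra.
have i4 : pdisc d2 `<=` pdisc (2 / 9 * d1) by apply: pdisc_sub; lra.
have c20 := sqr_ge0 c'.
split=> [|z Dz|z Dz|z Dz].
- by rewrite d20; lra.
- have : cx z ^+ 6 != 0 by rewrite expf_neq0 // (pdisc_cx Dz).
  by rewrite /G; move: (cx z ^+ 6) => t t0; field.
- by split; [exact: dG (i1 z Dz)|exact: dG1 (i1 z Dz)].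
- split.
  + have h := hK' z (i4 z Dz); have k : K' * nr2 z ^+ 4 <= K' by rewrite ler_piMr // small.
    apply: (@le_trans _ _ (2 * (nrm2 (G z - c'%:C) + c' ^+ 2))); last by lra.
    exact: nrm2_shift.
  + have h := b1 z (i2 z Dz); have k : B1 * nr2 z ^+ 3 <= B1 by rewrite ler_piMr // small.
    by lra.
  + have h := b2 z (i3 z Dz); have k : B2 * nr2 z ^+ 2 <= B2 by rewrite ler_piMr // small.
    by lra.
Qed.

End laurent.

(** * Elliptic functions of weight [j] *)

Section elliptic.
Context {R : realType}.
Local Notation C := R[i].
Local Notation s3 := (Num.sqrt (3 : R)).
Local Notation hh := (s3 / 2).
Local Notation Lam := (lattice (rho R)).
Local Notation rr := (@rr R).
Implicit Types (z w c : R * R) (f g : R * R -> C) (j k : nat).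

Let s33 : s3 ^+ 2 = 3. Proof. by rewrite sqr_sqrtr. Qed.
Lemma lattice_conjp z : Lam (conjp z) <-> Lam z.
Proof.
suff h w : Lam w -> Lam (conjp w) by split=> [/h|/h //]; rewrite /conjp /= opprK; case: z.
move=> /latticeP[m [n ->]]; apply/latticeP; exists (m + n), (- n).
by rewrite /conjp /= rmorphD rmorphN /=; congr pair; lra.
Qed.

Lemma lattice_rot z : Lam (rot z) <-> Lam z.
Proof.
have h w : Lam w -> Lam (rot w).
  move=> /latticeP[m [n ->]]; apply/latticeP; exists (- n), (m + n).
  rewrite rotE /= rmorphD rmorphN /=; congr pair; last by lra.
  have -> : s3 / 2 * (n%:~R * (s3 / 2)) = s3 ^+ 2 * n%:~R / 4 by field.
  by rewrite s33; lra.
split=> [/h/h/h/h/h|]; last exact: h.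
by rewrite !rot3E opprK.
Qed.

Lemma off_rot z : ~ Lam z -> ~ Lam (rot z). Proof. by move=> h /lattice_rot. Qed.
Lemma off_conjp z : ~ Lam z -> ~ Lam (conjp z). Proof. by move=> h /lattice_conjp. Qed.
Lemma off_shift z c : Lam c -> ~ Lam z -> ~ Lam (z + c).
Proof. by move=> cL h k; apply: h; rewrite -[z](addrK c); apply: latticeD => //; exact: latticeN. Qed.
Lemma notlatticeN z : ~ Lam z -> ~ Lam (- z). Proof. by move=> h /latticeN; rewrite opprK. Qed.

(** [j] is a weight modulo 6 for the rotation by [pi / 3]: at 0 only exponents congruent to [j]
    modulo 6 are possible. The last clause makes the function real on the real axis. *)
Definition ell j f := [/\ forall n, hol (~` Lam) n f, forall z c, Lam c -> ~ Lam z -> f (z + c) = f z,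
  forall z, ~ Lam z -> f (rot z) = rr ^+ j * f z & forall z, ~ Lam z -> f (conjp z) = cj (f z)].

Lemma rr6 : rr ^+ 6 = 1. Proof. by rewrite -[6%N]/(3 * 2)%N exprM rr3 sqrrN expr1n. Qed.

Lemma ell_mod j k f : j = k %[mod 6] -> ell j f -> ell k f.
Proof.
move=> jk [h1 h2 h3 h4]; split => // z zL; rewrite h3 //; congr (_ * _).
by rewrite (divn_eq j 6) (divn_eq k 6) jk !exprD ![(_ * 6)%N]mulnC !exprM rr6 !expr1n.
Qed.

Lemma ellM j k f g : ell j f -> ell k g -> ell (j + k) (fun z => f z * g z).
Proof.
move=> [f1 f2 f3 f4] [g1 g2 g3 g4]; split => [n|z c cL zL|z zL|z zL]; first exact: holM.
- by rewrite f2 // g2.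
- by rewrite f3 // g3 // exprD; ring.
- by rewrite f4 // g4 // cJM.
Qed.

Lemma ellD j f g : ell j f -> ell j g -> ell j (fun z => f z + g z).
Proof.
move=> [f1 f2 f3 f4] [g1 g2 g3 g4]; split => [n|z c cL zL|z zL|z zL]; first exact: holD.
- by rewrite f2 // g2.
- by rewrite f3 // g3 // mulrDr.
- by rewrite f4 // g4 // cJD.
Qed.

Lemma ell_cst (a : R) : ell 0 (fun=> a%:C).
Proof. by split => [n|//|z _|z _]; [exact: hol_cst|rewrite expr0 mul1r|rewrite cJR]. Qed.
Lemma ellZ (a : R) j f : ell j f -> ell j (fun z => a%:C * f z).
Proof. exact: ellM (ell_cst a). Qed.

Lemma wd_shift f z c a b : wd f (z + c) a b -> wd (fun w => f (w + c)) z a b.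
Proof.
have e w : w + c = xc (1 * cx w + cx c) by rewrite mul1r; case: w; case: c.
have -> : (fun w => f (w + c)) = (fun w => f (xc (1 * cx w + cx c))) by apply/funext => w; rewrite e.
by rewrite e => h; apply: wd_eq; [exact: (wd_mulc h)|..]; rewrite ?cJ1 mul1r.
Qed.

Lemma hol_derive f (f' : R * R -> C) : (forall n, hol (~` Lam) n f) -> (forall z, ~ Lam z -> wd f z (f' z) 0) ->
  forall n, hol (~` Lam) n f'.
Proof.
move=> hf df n; have [f1 d1 h1] := holS (hf n.+1); apply: hol_ext h1 => [|z zL]; first exact: open_notlattice.
by have [] := wd_inj (d1 z zL) (df z zL).
Qed.

(** Differentiating the rotation rule divides by [rr], which is multiplication by [rr^5]; as weights
    are natural numbers, [j + 5] stands for [j - 1]. *)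
Lemma ell_derive j f (f' : R * R -> C) : ell j f -> (forall z, ~ Lam z -> wd f z (f' z) 0) -> ell (j + 5) f'.
Proof.
move=> [h1 h2 h3 h4] df; split => [|z c cL zL|z zL|z zL].
- exact: hol_derive h1 df.
- have k := wd_shift (df _ (off_shift cL zL)).
  have [] := wd_inj k (_ : wd _ z (f' z) 0) => //.
  by apply: wd_near (df z zL); apply: filterS (near_off zL) => w wL; rewrite h2.
- have k : wd (fun w => f (rot w)) z (rr * f' (rot z)) 0.
    have e w : rot w = xc (rr * cx w + 0) by rewrite addr0.
    have -> : (fun w => f (rot w)) = (fun w => f (xc (rr * cx w + 0))) by apply/funext => w; rewrite e.
    have := df _ (off_rot zL); rewrite e => t.
    by apply: wd_eq; [exact: (wd_mulc t)|..]; rewrite ?mulr0.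
  have k2 : wd (fun w => f (rot w)) z (rr ^+ j * f' z) 0.
    apply: wd_near (wd_eq (wdZ (rr ^+ j) (df z zL)) erefl (mulr0 _)).
    by apply: filterS (near_off zL) => w wL; rewrite h3.
  have [e _] := wd_inj k k2.
  by rewrite exprD mulrAC -e mulrAC -exprS rr6 mul1r.
- have k := wdJ (wd_conjc (df _ (off_conjp zL))); rewrite cJ0 in k.
  have [e _] : cj (f' (conjp z)) = f' z /\ (0 : C) = 0.
    apply: (wd_inj k); apply: wd_near (df z zL).
    by apply: filterS (near_off zL) => w wL; rewrite -[(w.1, - w.2)]/(conjp w) h4 // cJK.
  by rewrite -e cJK.
Qed.

Lemma ellN_arg j f z : ell j f -> ~ Lam z -> f (- z) = (-1) ^+ j * f z.
Proof.
move=> [_ _ h _] zL; have h1 := off_rot zL; have h2 := off_rot h1.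
rewrite -rot3E (h _ h2) (h _ h1) (h _ zL).
by rewrite !mulrA -!exprD -[(j + j + j)%N]/(j + j + j)%N (_ : j + j + j = 3 * j)%N ?exprM ?rr3 // mulSn mul2n -addnn addnA.
Qed.

Lemma lattice_imag : Lam (0, 2 * hh).
Proof. by apply/latticeP; exists (-1), 2; congr pair; rewrite ?rmorphN /=; lra. Qed.
Lemma lattice_two : Lam (2, 0).
Proof. by apply/latticeP; exists 2, 0; congr pair; rewrite /=; lra. Qed.
Let cj_real (x : C) : x = cj x -> Im x = 0.
Proof. by case: x => a b [] /= e; lra. Qed.
Lemma ell_real_axis j f (x : R) : ell j f -> ~ Lam (x, 0) -> Im (f (x, 0)) = 0.
Proof. by move=> [_ _ _ h] zL; apply: cj_real; rewrite -h // /conjp /= oppr0. Qed.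

(** An even weight makes [f] an even function, and the reflection in the vertical line through [k]
    is then conjugation, a sign and a period. *)
Lemma ell_vertical j f (k y : R) : ~~ odd j -> ell j f -> Lam (2 * k, 0) -> ~ Lam (k, y) -> Im (f (k, y)) = 0.
Proof.
move=> ej E kL zL; have [_ h2 _ h] := E; have cL := off_conjp zL.
have pe : (k, y) = - conjp (k, y) + (2 * k, 0).
  by rewrite /conjp -[- (_, _)]/(- k, - - y) -[(_, _) + _]/(- k + 2 * k, - - y + 0); congr pair; ring.
have q : f (k, y) = f (conjp (k, y)).
  by rewrite {1}pe (h2 _ _ kL (notlatticeN cL)) (ellN_arg E cL) -signr_odd (negbTE ej) expr0 mul1r.
by apply: cj_real; rewrite -h.
Qed.

Lemma ell_top j f (x : R) : ell j f -> ~ Lam (x, hh) -> Im (f (x, hh)) = 0.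
Proof.
move=> [_ h2 _ h] zL; apply: cj_real; rewrite -h // -[in RHS](h2 _ _ lattice_imag (off_conjp zL)).
by congr f; rewrite /conjp -[(_, _) + _]/(x + 0, - hh + 2 * hh); congr pair; ring.
Qed.

Definition vanishing f := forall e : R, 0 < e -> exists2 d, 0 < d & forall z, 0 < nr2 z < d -> nrm2 (f z) <= e.
Definition Im_vanishing f := forall e : R, 0 < e -> exists2 d, 0 < d & forall z, 0 < nr2 z < d -> `|Im (f z)| <= e.

Lemma vanishing_Im f : vanishing f -> Im_vanishing f.
Proof.
move=> h e e0; have [d d0 hd] := h (e ^+ 2) (exprn_gt0 2 e0); exists d => // z zd.
rewrite -(@ler_pXn2r _ 2) ?nnegrE ?normr_ge0 ?(ltW e0) // real_normK ?num_real //.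
by apply: le_trans (hd z zd); rewrite /nrm2 lerDr sqr_ge0.
Qed.

(** All four sides of the rectangle [[0, 1] x [0, hh]] are reflection axes, on which [f] is real.
    Extended by 0 to the lattice points, [Im f] is continuous and obeys the maximum principle
    there. *)
Lemma Im_le0 j f : ~~ odd j -> ell j f -> Im_vanishing f -> forall z, ~ Lam z -> Im (f z) <= 0.
Proof.
move=> ej E fv; have [hf per _ _] := E; have [f1 d1 h1] := holS (hf 2); have [f2 d2 _] := holS h1.
have h0 := @hh_gt0 R.
pose S z := if pselect (Lam z) then 0 else Im (f z).
have Soff z : ~ Lam z -> S z = Im (f z) by rewrite /S; case: pselect.
have Son z : Lam z -> S z = 0 by rewrite /S; case: pselect.
have Snear z : ~ Lam z -> \forall w \near z, S w = Im (f w) by move=> zL; apply: filterS (near_off zL) => w /Soff.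
pose K : set (R * R) := [set z | 0 <= z.1 <= 1 /\ 0 <= z.2 <= hh].
have Kc : compact K.
  apply: (@compact_box _ _ 0 1 0 hh) => //.
  have -> : K = `[0, 1] `*` `[0, hh] by apply/seteqP; split => w /=; rewrite !in_itv /=.
  by apply: compact_closed; [exact: norm_hausdorff|apply: compact_setX; exact: segment_compact].
have Scts : continuous S.
  move=> z; have [zL|zL] := pselect (Lam z); last first.
    rewrite /continuous_at (Soff z zL); apply: cvg_trans (rd_cts (wd_Im (d1 z zL))).
    by apply: near_eq_cvg; apply: filterS (Snear z zL) => w ->.
  apply/cvgrPdist_lt => e e0; rewrite (Son z zL).
  have [d d0 hd] := fv (e / 2) (divr_gt0 e0 (ltr0Sn _ 1)).
  have c0 : nr2 (w - z) @[w --> z] --> (0 : R).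
    have c1 : w - z @[w --> z] --> z - z by apply: cvgB; [exact: cvg_id|exact: cvg_cst].
    rewrite subrr in c1; have -> : (0 : R) = nr2 (0 : R * R) by rewrite /nr2 /= expr0n /= addr0.
    by apply: (cvg_comp _ _ c1); exact: continuous_nr2.
  near=> w; rewrite sub0r normrN; have [wL|wL] := pselect (Lam w); first by rewrite Son // normr0.
  rewrite Soff // -[w](subrK z) per //; last first.
    by move=> h; apply: wL; rewrite -[w](subrK z); exact: latticeD.
  have n0 : 0 < nr2 (w - z).
    by apply: nr2_gt0; apply/negP => /eqP h; apply: wL; move/eqP: h; rewrite subr_eq0 => /eqP ->.
  have nd : nr2 (w - z) < d by near: w; apply: (cvgr_lt _ c0).
  by apply: le_lt_trans (hd _ (introT andP (conj n0 nd))) _; lra.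
have main z : K z -> S z <= 0.
  apply: (weak_max_principle Kc); first exact: continuous_subspaceT.
  move=> w [/andP[x0 x1] /andP[y0 y1]]; have [wL|wL] := pselect (Lam w); first by left; rewrite Son.
  rewrite Soff //; have [e|nx0] := eqVneq w.1 0.
    have we : w = (0, w.2) by rewrite -e -surjective_pairing.
    left; rewrite we (ell_vertical ej E) //; first by rewrite mulr0; exact: lattice0.
    by rewrite -we.
  have [e|nx1] := eqVneq w.1 1.
    have we : w = (1, w.2) by rewrite -e -surjective_pairing.
    left; rewrite we (ell_vertical ej E) //; first by rewrite mulr1; exact: lattice_two.
    by rewrite -we.
  have [e|ny0] := eqVneq w.2 0.
    have we : w = (w.1, 0) by rewrite -e -surjective_pairing.
    by left; rewrite we (ell_real_axis E) // -we.
  have [e|ny1] := eqVneq w.2 hh.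
    have we : w = (w.1, hh) by rewrite -e -surjective_pairing.
    by left; rewrite we (ell_top E) // -we.
  right; exists (fun w => - ci / 2 * f1 w), (- ci / 2 * f2 w), 0; split => //.
  - have a1 : 0 < w.1 by rewrite lt_neqAle eq_sym nx0.
    have a2 : w.1 < 1 by rewrite lt_neqAle nx1.
    have a3 : 0 < w.2 by rewrite lt_neqAle eq_sym ny0.
    have a4 : w.2 < hh by rewrite lt_neqAle ny1.
    near=> v; split; apply/andP; split; apply: ltW; near: v.
    + by apply: (cvgr_gt _ (@cvg_fst _ _ _ _ _)).
    + by apply: (cvgr_lt _ (@cvg_fst _ _ _ _ _)).
    + by apply: (cvgr_gt _ (@cvg_snd _ _ _ _ _)).
    + by apply: (cvgr_lt _ (@cvg_snd _ _ _ _ _)).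
  - apply: filterS2 (near_off wL) (nbhs_interior (near_off wL)) => v vL nv.
    apply: wd_near (wd_Im_hol (d1 v vL)).
    by apply: filterS (near_off vL) => t tL; rewrite Soff.
  - by apply: wd_eq; [exact: (wdZ _ (d2 w wL))|..]; rewrite ?mulr0.
move=> z zL; have [c cL [/andP[a1 a2] /andP[b1 b2]]] := cell_reduce z.
rewrite -(per z c cL zL) -Soff; last exact: off_shift.
by apply: main; split; rewrite ?a1 ?b1 ltW.
Unshelve. all: by end_near.
Qed.

Lemma Im_eq0 j f : ~~ odd j -> ell j f -> Im_vanishing f -> forall z, ~ Lam z -> Im (f z) = 0.
Proof.
move=> ej E fv z zL; apply/eqP; rewrite eq_le (Im_le0 ej E fv zL) /=.
have E' := ellZ (-1) E; have : Im_vanishing (fun z => (-1)%:C * f z).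
  by move=> e /fv[d d0 hd]; exists d => // w /hd; rewrite !ReImE /= mul0r addr0 mulN1r normrN.
by move=> /(Im_le0 ej E') /(_ z zL); rewrite !ReImE /= mul0r addr0 mulN1r oppr_le0.
Qed.

(** By [Im_eq0] both [f z] and the value [rr^j f z] at the rotated point are real, but [rr^j] is
    not. *)
Lemma ell_kill j f : j = 2%N \/ j = 4%N -> ell j f -> vanishing f -> forall z, ~ Lam z -> f z = 0.
Proof.
move=> hj E /vanishing_Im fv z zL; have ej : ~~ odd j by case: hj => ->.
have h := Im_eq0 ej E fv; have := h _ (off_rot zL); have [_ _ -> // _] := E.
have key (x y : C) : Im x != 0 -> Im y = 0 -> Im (x * y) = 0 -> y = 0.
  case: x y => a b [a' b'] /= b0 -> /eqP; rewrite mulr0 add0r mulf_eq0 (negbTE b0) /= => /eqP ->.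
  by [].
move=> e; apply: key e; last exact: h.
case: hj => ->; first by rewrite rr2 !ReImE /= subr0 gt_eqF // hh_gt0.
by rewrite (exprD _ 3 1) rr3 mulN1r !ReImE /= oppr_eq0 gt_eqF // hh_gt0.
Qed.

Lemma off_strip z : 0 <= z.2 < hh -> (z.2 = 0 -> 0 < z.1 < 1) -> ~ Lam z.
Proof.
have h0 := @hh_gt0 R; move=> /andP[y0 y1] hx /latticeP[m [n e]].
have n0 : n = 0.
  have a : 0 <= n%:~R * hh < hh by move: y0 y1; rewrite e /= => -> ->.
  move: a; rewrite pmulr_lge0 // -[X in _ < X]mul1r ltr_pM2r // ler0z ltrz1 => /andP[a b].
  by apply/eqP; rewrite eq_le a andbT -ltzD1 add0r.
move: hx; rewrite e n0 /= !mul0r addr0 => /(_ erefl); rewrite ltr0z ltrz1 => /andP[a b].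
by move: b; rewrite -[X in _ < X]add0r ltzD1 leNgt a.
Qed.

(** Segments from the centre of the cell to its points miss the lattice, so the mean value theorem
    along them suffices. *)
Lemma ell_const f (f' : R * R -> C) : (forall z c, Lam c -> ~ Lam z -> f (z + c) = f z) ->
  (forall z, ~ Lam z -> wd f z 0 0) -> forall z, ~ Lam z -> f z = f (2^-1, hh / 2).
Proof.
have h0 := @hh_gt0 R.
move=> per df z zL; have [c cL [/andP[a1 a2] /andP[b1 b2]]] := cell_reduce z.
rewrite -(per z c cL zL); have := off_shift cL zL; move: (z + c) a1 a2 b1 b2 => {zL}z a1 a2 b1 b2 zL.
have x0 : z.2 = 0 -> 0 < z.1.
  move=> e; rewrite lt_neqAle a1 andbT; apply/negP => /eqP e1; apply: zL; rewrite (surjective_pairing z) e -e1.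
  exact: lattice0.
pose a : R * R := (2^-1, hh / 2); pose v := z - a.
have offs t : 0 <= t <= 1 -> ~ Lam (a.1 + t * v.1, a.2 + t * v.2).
  move=> /andP[t0 t1]; rewrite /v -[(z - a).1]/(z.1 - 2^-1) -[(z - a).2]/(z.2 - hh / 2) /=.
  have m1 : 0 <= t * z.2 by rewrite mulr_ge0.
  have m2 : t * z.2 <= t * hh by rewrite ler_wpM2l // ltW.
  have m3 : 0 <= (1 - t) * hh by rewrite mulr_ge0 ?subr_ge0 // ltW.
  have m4 : 0 <= t * z.1 by rewrite mulr_ge0.
  have m5 : t * z.1 <= t by rewrite ler_piMr // ltW.
  apply: off_strip => /=.
    apply/andP; split; first by lra.
    have [->|tn] := eqVneq t 1; first by lra.
    have tl : 0 < (1 - t) * hh by rewrite mulr_gt0 // subr_gt0 lt_neqAle tn.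
    by lra.
  move=> e; have t1' : t = 1.
    have e' : (1 - t) * hh / 2 + t * z.2 = 0 by lra.
    have : (1 - t) * hh = 0 by lra.
    by move/eqP; rewrite mulf_eq0 (gt_eqF h0) orbF subr_eq0 => /eqP.
  by rewrite t1' in e *; have := x0 ltac:(lra); lra.
have re (g : R * R -> C) : (forall z, ~ Lam z -> wd g z 0 0) -> Re (g z) = Re (g a).
  move=> dg; have [t _] := @dv_mvt _ (fun s => Re (g (a.1 + s * v.1, a.2 + s * v.2))) (fun=> Re (0 * cx v)) 0 1 ltr01
    ltac:(by move=> t tI; apply: dv_line; apply: dg; exact: offs).
  rewrite !mul0r mul1r !mul1r !addr0 => /eqP; rewrite subr_eq0 => /eqP.
  rewrite -[v.1]/(z.1 - a.1) -[v.2]/(z.2 - a.2) !(addrC _ (_ - _)) !subrK -!surjective_pairing //.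
apply: eqReIm; first exact: re.
have := re (fun z => (- ci) * f z) ltac:(by move=> w wL; apply: wd_eq; [exact: (wdZ _ (df w wL))|..]; rewrite mulr0).
by rewrite !ReImE /= !oppr0 !mul0r !sub0r !mulN1r !opprK.
Qed.

End elliptic.

(** * The Weierstrass function of the hexagonal lattice *)

Section vanishing.
Context {R : realType}.
Local Notation C := R[i].
Local Notation s3 := (Num.sqrt (3 : R)).
Local Notation hh := (s3 / 2).
Local Notation Lam := (lattice (rho R)).
Local Notation rr := (@rr R).
Implicit Types (z w c : R * R) (f g : R * R -> C) (j k n : nat).

Lemma nrm2X (x : C) n : nrm2 (x ^+ n) = nrm2 x ^+ n.
Proof. by elim: n => [|n IH]; [rewrite /nrm2 /= expr1n expr0n addr0|rewrite !exprS nrm2M IH]. Qed.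

Lemma nrm2D (x y : C) : nrm2 (x + y) <= 2 * (nrm2 x + nrm2 y).
Proof.
case: x y => a b [c d]; rewrite /nrm2 /=; have := sqr_ge0 (a - c); have := sqr_ge0 (b - d); lra.
Qed.

Definition bnd f := exists M : R, \forall z \near (0 : R * R)^', nrm2 (f z) <= M.

Lemma vanishingP f : vanishing f <-> forall e : R, 0 < e -> \forall z \near (0 : R * R)^', nrm2 (f z) <= e.
Proof. by split=> h e /h; [move=> k; apply/near0P|move=> /near0P]. Qed.
Lemma van_ext f g : (\forall z \near (0 : R * R)^', f z = g z) -> vanishing f -> vanishing g.
Proof. by move=> fg /vanishingP h; apply/vanishingP => e /h; apply: filterS2 fg => z ->. Qed.
Lemma van_bnd f : vanishing f -> bnd f.
Proof. by move=> /vanishingP /(_ 1 ltr01) h; exists 1. Qed.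
Lemma bnd_ext f g : (\forall z \near (0 : R * R)^', f z = g z) -> bnd f -> bnd g.
Proof. by move=> fg [M h]; exists M; apply: filterS2 fg h => z ->. Qed.
Lemma bnd_cst (a : C) : bnd (fun=> a).
Proof. by exists (nrm2 a); near=> z. Unshelve. all: by end_near. Qed.

Lemma bndD f g : bnd f -> bnd g -> bnd (fun z => f z + g z).
Proof.
move=> [M h] [N k]; exists (2 * (M + N)); apply: filterS2 h k => z a b.
by apply: le_trans (nrm2D _ _) _; rewrite ler_pM2l // lerD.
Qed.

Lemma bndM f g : bnd f -> bnd g -> bnd (fun z => f z * g z).
Proof.
move=> [M h] [N k]; exists (M * N); apply: filterS2 h k => z a b.
by rewrite nrm2M ler_pM ?nrm2_ge0.
Qed.

Lemma vanD f g : vanishing f -> vanishing g -> vanishing (fun z => f z + g z).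
Proof.
move=> /vanishingP h /vanishingP k; apply/vanishingP => e e0.
have e4 : 0 < e / 4 by rewrite divr_gt0.
by apply: filterS2 (h _ e4) (k _ e4) => z a b; apply: le_trans (nrm2D _ _) _; lra.
Qed.

Lemma vanM f g : vanishing f -> bnd g -> vanishing (fun z => f z * g z).
Proof.
move=> /vanishingP h [M k]; apply/vanishingP => e e0.
have M0 : 0 < `|M| + 1 by rewrite ltr_wpDl.
apply: filterS2 (h _ (divr_gt0 e0 M0)) k => z a b.
rewrite nrm2M; apply: (@le_trans _ _ (e / (`|M| + 1) * (`|M| + 1))); last by rewrite divfK // gt_eqF.
by apply: ler_pM => //; rewrite ?nrm2_ge0 //; have := ler_norm M; lra.
Qed.

Lemma van_cx : vanishing (@cx R).
Proof. by move=> e e0; exists e => // z /andP[_ /ltW]. Qed.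

Lemma van_cxX n : vanishing (fun z : R * R => cx z ^+ n.+1).
Proof.
elim: n => [|n IH]; first exact: van_cx.
have := vanM IH (van_bnd van_cx); apply: van_ext; near=> z; by rewrite [RHS]exprSr.
Unshelve. all: by end_near.
Qed.

Lemma pdisc_near d : 0 < d -> \forall z \near (0 : R * R)^', pdisc d z.
Proof. by move=> d0; apply/near0P; exists d. Qed.

Lemma van_cst (a : C) : vanishing (fun=> a) -> a = 0.
Proof.
move=> h; apply/eqP; rewrite -nrm2_eq0; apply/negPn/negP => a0.
have n0 : 0 < nrm2 a by rewrite lt_neqAle eq_sym a0 nrm2_ge0.
have [d d0 /(_ (Num.sqrt (d / 2), 0))] := h (nrm2 a / 2) (divr_gt0 n0 (ltr0Sn _ 1)).
have d2 : 0 < d / 2 by rewrite divr_gt0.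
have -> : nr2 (Num.sqrt (d / 2), 0) = d / 2 by rewrite /nr2 /= expr0n addr0 sqr_sqrtr // ltW.
by rewrite d2 /= => /(_ ltac:(lra)); lra.
Qed.

Lemma wd_on U f g z (a b : C) : open U -> U z -> (forall w, U w -> f w = g w) -> wd g z a b -> wd f z a b.
Proof. by move=> Uo Uz fg; apply: wd_near; apply: filterS (open_nbhs_nbhs (conj Uo Uz)) => w /fg. Qed.

(** Since [j + k] is 0 modulo 6, [z^k f] is invariant under [rot]; the bound on [z^2 f] supplies the
    growth condition of [laurent]. *)
Lemma ell_laurent j k f : (j + k)%N = 0%N \/ (j + k)%N = 6%N -> ell j f -> bnd (fun z => cx z ^+ 2 * f z) ->
  exists (a d : R) (G G1 G2 : R * R -> C), [/\ 0 < d, [/\ bnd G, bnd G1 & bnd G2],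
    forall z, pdisc d z -> ~ Lam z /\ cx z ^+ k * f z = a%:C + cx z ^+ 6 * G z &
    forall z, pdisc d z -> wd G z (G1 z) 0 /\ wd G1 z (G2 z) 0].
Proof.
move=> jk [h1 h2 h3 h4] [M hM].
have [d0 d00 hd0] := (near0P _).1 (@near0_off R).
have offd z : pdisc d0 z -> ~ Lam z by exact: hd0.
have sg : symmetric d0 (fun z => cx z ^+ k * f z).
  split=> [n|z /offd zL|z /offd zL].
  - by apply: holM; [apply: holX; exact: hol_cx|apply: hol_sub (h1 n)].
  - rewrite cx_rot h3 // exprMn mulrACA -exprD addnC (_ : rr ^+ (j + k) = 1) ?mul1r //.
    by case: jk => ->; rewrite ?expr0 ?rr6.
  - by rewrite h4 // cx_conjp cJM cJX.
have gs e : 0 < e -> exists2 d', 0 < d' & forall z, 0 < nr2 z < d' -> nr2 z ^+ 4 * nrm2 (cx z ^+ k * f z) <= e.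
  move=> e0; apply/near0P.
  have b : bnd (fun z => cx z ^+ k * (cx z ^+ 2 * f z)).
    apply: bndM; last by exists M.
    by case: (k) => [|k']; [exact: bnd_cst|exact: van_bnd (van_cxX k')].
  have /vanishingP /(_ e e0) := vanM (van_cxX 1) b.
  by apply: filterS => z; rewrite nr2E -nrm2X -nrm2M; congr (nrm2 _ <= _); ring.
have [c [G [G1 [G2 [d [N [/andP[dp dd] q1 q2 q3]]]]]]] := laurent d00 sg gs.
exists c, d, G, G1, G2; split => //; last first.
  by move=> z Dz; split; [exact: offd (pdisc_sub dd Dz)|exact: q1].
by split; exists N; apply: filterS (pdisc_near dp) => z /q3[].
Qed.

Lemma cx_neq0 z : ~ Lam z -> cx z != 0.
Proof.
move=> zL; rewrite -nrm2_eq0 -nr2E; apply/negP => /eqP h; apply: zL.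
have -> : z = 0; last exact: lattice0.
by apply/eqP/negPn/negP => /nr2_gt0; rewrite h ltxx.
Qed.

(** [z^(k-1) f] is rotation invariant, hence a constant plus [O(z^6)]. The constant is its limit 0,
    which leaves [f = O(z^(j+1))]. *)
Lemma ell_vanishing j k f : (j + k)%N = 6%N -> ell j.+1 f -> bnd (fun z => cx z ^+ 2 * f z) ->
  vanishing (fun z => cx z ^+ k.-1 * f z) -> vanishing f.
Proof.
case: k => [|k] jk E b v; first by case: E => _ _ _ _; move: v; rewrite /= ; apply: van_ext; near=> z; rewrite expr0 mul1r.
have jk' : (j.+1 + k)%N = 6%N by rewrite addSnnS.
have [a [d [G [G1 [G2 [d0 [bG _ _] q _]]]]]] := ell_laurent (or_intror jk') E b.
have a0 : a%:C = 0 :> C.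
  apply: van_cst; have := vanD v (vanM (van_cxX 5) (bndM (bnd_cst (-1)) bG)); apply: van_ext.
  by apply: filterS (pdisc_near d0) => z /q[_ ->]; ring.
have := vanM (van_cxX j) bG; apply: van_ext.
apply: filterS (pdisc_near d0) => z /q[zL]; rewrite a0 add0r => e.
apply: (mulfI (expf_neq0 k (cx_neq0 zL))); rewrite e mulrA -exprD; congr (_ ^+ _ * _).
by rewrite addnC.
Unshelve. all: by end_near.
Qed.

Lemma bnd_van k f : bnd (fun z => cx z ^+ 2 * f z) -> vanishing (fun z => cx z ^+ k.+3 * f z).
Proof.
move=> b; have := vanM (van_cxX k) b; apply: van_ext; near=> z.
by rewrite mulrA -exprD addn2.
Unshelve. all: by end_near.
Qed.

Lemma Im_vanishing_near f g (a : R) : (\forall z \near (0 : R * R)^', f z = a%:C + g z) -> vanishing g -> Im_vanishing f.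
Proof.
move=> h /vanishing_Im k e e0; apply/near0P; have /near0P := k e e0.
by apply: filterS2 h => z ->; rewrite !ReImE /= add0r.
Qed.

Lemma ell_Im0_const j f : ell j f -> (forall z, ~ Lam z -> Im (f z) = 0) -> exists a : R, forall z, ~ Lam z -> f z = a%:C.
Proof.
move=> [h1 h2 _ _] hI; have [f1 d1 _] := holS (h1 1%N).
have f10 z : ~ Lam z -> f1 z = 0.
  move=> zL; have k : wd (fun w => (Im (f w))%:C) z 0 0.
    by apply: wd_near (wd_cst 0 z); apply: filterS (near_off zL) => w /hI ->.
  have [/eqP + _] := wd_inj (wd_Im_hol (d1 z zL)) k; rewrite mulf_eq0 => /orP[|/eqP //].
  rewrite mulf_eq0 oppr_eq0 invr_eq0 pnatr_eq0 orbF => /eqP /(congr1 Im) /= /eqP.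
  by rewrite oner_eq0.
have h := ell_const f1 h2 (fun z zL => wd_eq (d1 z zL) (f10 z zL) erefl).
exists (Re (f (2^-1, hh / 2))) => z zL; rewrite (h z zL); apply: eqReIm => //.
by rewrite -(h z zL) hI.
Qed.

Lemma ell0_const f : ell 0 f -> bnd (fun z => cx z ^+ 2 * f z) -> exists a : R, forall z, ~ Lam z -> f z = a%:C.
Proof.
move=> E b; have [a [d [G [G1 [G2 [d0 [bG _ _] q _]]]]]] := @ell_laurent 0 0 f (or_introl erefl) E b.
apply: (ell_Im0_const E); apply: (Im_eq0 _ E) => //.
apply: (@Im_vanishing_near f (fun z => cx z ^+ 6 * G z) a); last exact: vanM (van_cxX 5) bG.
by apply: filterS (pdisc_near d0) => z /q[_]; rewrite expr0 mul1r.
Qed.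

Lemma ell0_vanishing f : ell 0 f -> vanishing f -> forall z, ~ Lam z -> f z = 0.
Proof.
move=> E v; have [|a h] := ell0_const E; first exact: bndM (van_bnd (van_cxX 1)) (van_bnd v).
have a0 : (a%:C : C) = 0 by apply: van_cst; apply: van_ext v; apply: filterS (@near0_off R) => z /h.
by move=> z zL; rewrite h.
Qed.

Lemma sqr_kill f z : f z * f z = 0 -> f z = 0.
Proof. by move=> /eqP; rewrite mulf_eq0 orbb => /eqP. Qed.

(** Weights 1, 2 and 3 admit none of the exponents -2, -1, 0, so [f] vanishes at the lattice.
    Squaring brings the odd weights 1 and 3 to 2 and 0, where the maximum principle is available. *)
Lemma ell_zero j f : j = 1%N \/ j = 2%N \/ j = 3%N -> ell j f -> bnd (fun z => cx z ^+ 2 * f z) ->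
  forall z, ~ Lam z -> f z = 0.
Proof.
move=> hj E b z zL.
have v : vanishing f.
  case: hj => [e|[e|e]]; rewrite e in E.
  - exact: (@ell_vanishing 0 6 f _ E b (bnd_van 2 b)).
  - exact: (@ell_vanishing 1 5 f _ E b (bnd_van 1 b)).
  - exact: (@ell_vanishing 2 4 f _ E b (bnd_van 0 b)).
have v2 : vanishing (fun z => f z * f z) := vanM v (van_bnd v).
case: hj => [e|[e|e]]; rewrite e in E.
- by apply: sqr_kill; apply: (ell_kill _ (ellM E E) v2 zL); left.
- by apply: (ell_kill _ E v zL); left.
- by apply: sqr_kill; apply: (ell0_vanishing (ell_mod _ (ellM E E)) v2 zL).
Qed.

Lemma ell4_zero f : ell 4 f -> vanishing (fun z => cx z ^+ 2 * f z) -> forall z, ~ Lam z -> f z = 0.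
Proof.
move=> E v; apply: (ell_kill _ E); first by right.
exact: (@ell_vanishing 3 3 f _ E (van_bnd v) v).
Qed.

(** The centroid of the triangle 0, 1, [rho], fixed modulo the lattice by the rotation of order
    three. *)
Definition wpt : R * R := (2^-1, s3 / 6).

Lemma wpt_off : ~ Lam wpt.
Proof.
have h0 := @hh_gt0 R; apply: off_strip => /=; first by apply/andP; split; lra.
by lra.
Qed.

Lemma half_off (y : R) : 0 <= y < hh -> ~ Lam (2^-1, y).
Proof. by move=> h; apply: off_strip => //= _; lra. Qed.

Lemma ell_wpt j f : rr ^+ (2 * j) != 1 -> ell j f -> f wpt = 0.
Proof.
move=> rj E; have [_ h2 h3 _] := E; have wL := wpt_off.
have e : rot (rot wpt) + (1, 0) = wpt.
  rewrite rot2E /wpt -[(_, _) + _]/(- 2^-1 / 2 - hh * (s3 / 6) + 1, hh / 2 - s3 / 6 / 2 + 0) /=.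
  have -> : hh * (s3 / 6) = s3 ^+ 2 / 12 by field.
  by rewrite sqr_sqrtr //; congr pair; lra.
have k := h2 _ _ (@lattice_1 R) (off_rot (off_rot wL)).
rewrite e (h3 _ (off_rot wL)) (h3 _ wL) mulrA -exprD addnn -mul2n in k.
have : (1 - rr ^+ (2 * j)) * f wpt = 0 by rewrite mulrBl mul1r -k subrr.
by move/eqP; rewrite mulf_eq0 subr_eq0 eq_sym (negbTE rj) => /eqP.
Qed.

Lemma ell_odd_half j f : odd j -> ell j f -> f (2^-1, 0) = 0.
Proof.
move=> oj E; have [_ h2 _ _] := E; have h0 := @hh_gt0 R.
have zL : ~ Lam (2^-1 : R, 0) by apply: half_off; rewrite lexx.
have := h2 _ _ (@lattice_1 R) (notlatticeN zL).
have -> : - (2^-1, 0) + (1, 0) = (2^-1, 0) :> R * R.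
  by rewrite -[- (_, _) + _]/(- 2^-1 + 1, - 0 + 0); congr pair; lra.
rewrite (ellN_arg E zL) -signr_odd oj expr1 mulN1r => e.
have : 2 * f (2^-1, 0) = 0 by rewrite mulr2n mulrDl mul1r {1}e addNr.
by move/eqP; rewrite mulf_eq0 pnatr_eq0 => /eqP.
Qed.

Section weierstrass.
Variables p p1 p2 : R * R -> C.
Hypotheses (Ep : ell 4 p) (vp : vanishing (fun z => cx z ^+ 2 * p z - 1)).
Hypotheses (dp : forall z, ~ Lam z -> wd p z (p1 z) 0) (dp1 : forall z, ~ Lam z -> wd p1 z (p2 z) 0).

Let bp : bnd (fun z => cx z ^+ 2 * p z).
Proof.
have := bndD (van_bnd vp) (bnd_cst 1); apply: bnd_ext; near=> z; by rewrite subrK.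
Unshelve. all: by end_near.
Qed.
Let lp : exists (d : R) (G G1 G2 : R * R -> C), [/\ 0 < d, [/\ bnd G, bnd G1 & bnd G2],
    forall z, pdisc d z -> ~ Lam z /\ p z = cx z ^- 2 + cx z ^+ 4 * G z &
    forall z, pdisc d z -> wd G z (G1 z) 0 /\ wd G1 z (G2 z) 0].
Proof.
have [a [d [G [G1 [G2 [d0 bG q1 q2]]]]]] := @ell_laurent 4 2 p (or_intror erefl) Ep bp.
have [g1 g2 g3] := bG.
have a1 : a%:C - 1 = 0 :> C.
  apply: van_cst; have := vanD vp (vanM (van_cxX 5) (bndM (bnd_cst (-1)) g1)); apply: van_ext.
  by apply: filterS (pdisc_near d0) => z /q1[_ ->]; ring.
exists d, G, G1, G2; split => // z Dz; have [zL e] := q1 z Dz; split => //.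
have c0 := cx_neq0 zL; apply: (mulfI (expf_neq0 2 c0)); rewrite e.
by move/eqP: a1; rewrite subr_eq0 => /eqP ->; field.
Qed.

(** The poles of [p''] and [6 p^2] cancel, and their difference has weight 2 and tends to 0, so
    [ell_kill] applies. The invariant [g2] is thus excluded by symmetry. *)
Lemma wp_second z : ~ Lam z -> p2 z = 6 * p z ^+ 2.
Proof.
have [d [G [G1 [G2 [d0 [b0 b1 b2] q1 q2]]]]] := lp.
have e1 w : pdisc d w -> p1 w = -2 * cx w ^- 3 + 4 * cx w ^+ 3 * G w + cx w ^+ 4 * G1 w.
  move=> Dw; have [wL _] := q1 w Dw; have c0 := cx_neq0 wL; have c2 := expf_neq0 2 c0; have [g1 _] := q2 w Dw.
  have h := wdD (wdV c2 (wdX 1 (wd_cx w))) (wdM (wdX 3 (wd_cx w)) g1).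
  have k := wd_on (@pdisc_open _ d) Dw (fun t Dt => (q1 t Dt).2) h.
  have [-> _] := wd_inj (dp wL) k; rewrite expr1; move: (cx w) c0 => x x0; by field.
have e2 w : pdisc d w -> p2 w = 6 * cx w ^- 4 + 12 * cx w ^+ 2 * G w + 8 * cx w ^+ 3 * G1 w + cx w ^+ 4 * G2 w.
  move=> Dw; have [wL _] := q1 w Dw; have c0 := cx_neq0 wL; have c3 := expf_neq0 3 c0; have [g1 g2] := q2 w Dw.
  have h := wdD (wdD (wdZ (-2) (wdV c3 (wdX 2 (wd_cx w)))) (wdM (wdZ 4 (wdX 2 (wd_cx w))) g1)) (wdM (wdX 3 (wd_cx w)) g2).
  have k := wd_on (@pdisc_open _ d) Dw e1 h.
  have [-> _] := wd_inj (dp1 wL) k; move: (cx w) c0 => x x0; by field.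
have E1 := ell_derive Ep dp; have E2 := ell_derive E1 dp1.
have E2' : ell 2 p2 by apply: ell_mod E2.
have Epp : ell 2 (fun z => (-6)%:C * (p z * p z)) by apply: ell_mod (ellZ (-6) (ellM Ep Ep)).
have := ell_kill (or_introl erefl) (ellD E2' Epp).
have v : vanishing (fun z => p2 z + (-6)%:C * (p z * p z)).
  have v1 := vanM (van_cxX 2) (bndM (bnd_cst 8) b1).
  have v2 := vanM (van_cxX 3) b2.
  have v3 := vanM (van_cxX 7) (bndM (bnd_cst (-6)) (bndM b0 b0)).
  apply: van_ext (vanD (vanD v1 v2) v3); apply: filterS (pdisc_near d0) => w Dw.
  have [wL ->] := q1 w Dw; rewrite (e2 w Dw) cRN cRn; move: (cx w) (cx_neq0 wL) => x x0; by field.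
by move=> /(_ v z) h /h /eqP; rewrite cRN cRn mulNr subr_eq0 => /eqP ->.
Qed.

Definition ee : R := Re (p (2^-1, 0)).

Lemma p_half : p (2^-1, 0) = ee%:C.
Proof.
have h0 := @hh_gt0 R; apply: eqReIm => //=; apply: (ell_real_axis Ep).
by apply: half_off; rewrite lexx.
Qed.

(** By [wp_second] the function [p'^2 - 4 p^3] is constant; it is evaluated at the half period 1/2,
    where the odd function [p'] vanishes. *)
Lemma wp_first z : ~ Lam z -> p1 z ^+ 2 = 4 * p z ^+ 3 - 4 * ee%:C ^+ 3.
Proof.
have h0 := @hh_gt0 R; have E1 := ell_derive Ep dp; have [_ per _ _] := Ep; have [_ per1 _ _] := E1.
have k := @ell_const R (fun z => p1 z ^+ 2 - 4 * p z ^+ 3) (fun=> 0).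
have {}k : forall z, ~ Lam z -> p1 z ^+ 2 - 4 * p z ^+ 3 = p1 (2^-1, hh / 2) ^+ 2 - 4 * p (2^-1, hh / 2) ^+ 3.
  apply: k => [w c cL wL|w wL]; first by rewrite per // per1.
  apply: wd_eq; [exact: (wdB (wdX 1 (dp1 wL)) (wdZ 4 (wdX 2 (dp wL))))|..]; last by ring.
  by rewrite wp_second //; ring.
have zL : ~ Lam (2^-1 : R, 0) by apply: half_off; rewrite lexx.
move=> zL'; have := k _ zL; rewrite -(k z zL') (ell_odd_half _ E1) // p_half expr0n /= sub0r => e.
by rewrite -[LHS](subrK (4 * p z ^+ 3)) -e addrC.
Qed.
(** [p] along the vertical segment from the half period 1/2 to the centroid [wpt]. It is real there,
    decreases, and ends at 0; this determines the sign of [ee]. *)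
Let A (y : R) := Re (p (2^-1, y)).
Let I (y : R) : Prop := 0 <= y <= s3 / 6.
Let offI y : I y -> ~ Lam (2^-1, y).
Proof. by have h0 := @hh_gt0 R; move=> /andP[a b]; apply: half_off; rewrite a /=; lra. Qed.
Let s60 : 0 < s3 / 6. Proof. by rewrite divr_gt0 // sqrtr_gt0. Qed.

Lemma dv_vertical (f f' : R * R -> C) (k y : R) : wd f (k, y) (f' (k, y)) 0 ->
  is_derive y 1 (fun t => Re (f (k, t))) (- Im (f' (k, y))).
Proof.
move=> h; pose a : R * R := (k, 0); pose v : R * R := (0, 1).
have aE t : (a.1 + t * v.1, a.2 + t * v.2) = (k, t) by rewrite /= mulr0 mulr1 addr0 add0r.
have -> : (fun t => Re (f (k, t))) = (fun t => Re (f (a.1 + t * v.1, a.2 + t * v.2))) by apply/funext => t; rewrite aE.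
have := @dv_line _ f a v y (f' (k, y)); rewrite aE => /(_ h) e; apply: (dv_eq e).
by rewrite !ReImE /=; ring.
Qed.

Lemma dv_horizontal (f f' : R * R -> C) (k x : R) : wd f (x, k) (f' (x, k)) 0 ->
  is_derive x 1 (fun t => Re (f (t, k))) (Re (f' (x, k))).
Proof.
move=> h; pose a : R * R := (0, k); pose v : R * R := (1, 0).
have aE t : (a.1 + t * v.1, a.2 + t * v.2) = (t, k) by rewrite /= mulr0 mulr1 addr0 add0r.
have -> : (fun t => Re (f (t, k))) = (fun t => Re (f (a.1 + t * v.1, a.2 + t * v.2))) by apply/funext => t; rewrite aE.
have := @dv_line _ f a v x (f' (x, k)); rewrite aE => /(_ h) e; apply: (dv_eq e).
by rewrite !ReImE /=; ring.
Qed.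
Let p_real y : I y -> p (2^-1, y) = (A y)%:C.
Proof.
move=> /offI zL; apply: eqReIm => //=; apply: (ell_vertical (j := 4) _ Ep _ zL) => //.
by rewrite mulfV //; exact: lattice_1.
Qed.
Let dA y : I y -> is_derive y 1 A (- Im (p1 (2^-1, y))).
Proof. by move=> /offI zL; exact: dv_vertical (dp zL). Qed.
Let dA_le0 y : I y -> - Im (p1 (2^-1, y)) <= 0.
Proof.
move=> Iy; have [->|y0] := eqVneq y 0.
  by have h0 := @hh_gt0 R; rewrite (ell_odd_half _ (ell_derive Ep dp)) //= oppr0.
have /andP[a b] := Iy; have yp : 0 < y by rewrite lt_neqAle eq_sym y0.
have [t /andP[t0 t1]] := @dv_mvt _ (fun s => Re (ci * p1 (2^-1, s))) (fun s => - Im (ci * p2 (2^-1, s))) 0 y yp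
  ltac:(by move=> t /andP[t0 t1]; apply: (@dv_vertical (fun w => ci * p1 w) (fun w => ci * p2 w)); apply: wd_eq; [exact: (wdZ _ (dp1 (offI (introT andP (conj t0 (le_trans t1 b))))))|..]; rewrite ?mulr0).
have It : I t by rewrite /I (ltW t0) (ltW (lt_le_trans t1 b)).
rewrite !Re_ci Im_ci (ell_odd_half _ (ell_derive Ep dp)) //= subr0 oppr0 subr0 => ->.
rewrite (wp_second (offI It)) (p_real It) mulNr oppr_le0 mulr_ge0 ?(ltW yp) //.
by rewrite -cRX -cRn -cRM /= mulr_ge0 // sqr_ge0.
Qed.
Let A_mono x y : I x -> I y -> x <= y -> A y <= A x.
Proof.
move=> /andP[x0 x1] /andP[y0 y1]; rewrite le_eqVlt => /orP[/eqP -> //|xy].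
have II t : x <= t <= y -> I t by move=> /andP[a b]; rewrite /I (le_trans x0 a) (le_trans b y1).
have [t /andP[t0 t1] e] := dv_mvt xy (fun t tI => dA (II t tI)).
rewrite -subr_le0 e mulr_le0_ge0 ?subr_ge0 ?(ltW xy) //.
by apply: dA_le0; apply: II; rewrite !ltW.
Qed.
Let A_end : A (s3 / 6) = 0.
Proof.
rewrite /A -/wpt (ell_wpt _ Ep) // (exprD _ 6 2) rr6 mul1r rr2 subr_eq -[1 + 1]/(2%:R).
by apply/negP => /eqP /(congr1 Im); rewrite -cRn /=; have := @hh_gt0 R; lra.
Qed.
Let I0 : I 0. Proof. by rewrite /I lexx ltW. Qed.
Let I6 : I (s3 / 6). Proof. by rewrite /I lexx ltW. Qed.

Lemma ee_ge0 : 0 <= ee.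
Proof. by rewrite -A_end -[ee]/(A 0); apply: A_mono => //; exact: ltW. Qed.
Let P (x : R) := Re (p (x, 0)).

Lemma axis_off (x : R) : 0 < x < 1 -> ~ Lam (x, 0).
Proof. by have h0 := @hh_gt0 R; move=> h; apply: off_strip => //=; rewrite lexx. Qed.
Lemma p_axis x : 0 < x < 1 -> p (x, 0) = (P x)%:C.
Proof. by move=> /axis_off zL; apply: eqReIm => //=; exact: (ell_real_axis Ep zL). Qed.
Lemma dP (x : R) : 0 < x < 1 -> is_derive x 1 P (Re (p1 (x, 0))).
Proof. by move=> /axis_off zL; exact: dv_horizontal (dp zL). Qed.

Lemma p1_axis x : 0 < x < 1 -> Re (p1 (x, 0)) ^+ 2 = 4 * P x ^+ 3 - 4 * ee ^+ 3.
Proof.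
move=> hx; have zL := axis_off hx; have := wp_first zL; rewrite (p_axis hx).
have := ell_real_axis (ell_derive Ep dp) zL; case: (p1 _) => a b /= -> e.
have e' : (a ^+ 2)%:C = (4 * P x ^+ 3 - 4 * ee ^+ 3)%:C :> C by rewrite !cRE; exact: e.
exact: (congr1 Re e').
Qed.

Lemma P_large : exists2 x : R, 0 < x < 2^-1 & 0 < P x.
Proof.
have h4 : 0 < 4^-1 :> R by rewrite invr_gt0.
have [d d0 hd] := vp h4.
pose x : R := Num.min (Num.sqrt (d / 2)) 4^-1.
have d2 : 0 < d / 2 by rewrite divr_gt0.
have x0 : 0 < x by rewrite lt_min sqrtr_gt0 d2 h4.
have x4 : x <= 4^-1 by rewrite ge_min lexx orbT.
have xd : x ^+ 2 <= d / 2.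
  rewrite -[leRHS](sqr_sqrtr (ltW d2)) ler_pXn2r ?nnegrE ?sqrtr_ge0 ?(ltW x0) //.
  by rewrite ge_min lexx.
exists x; first by apply/andP; split => //; lra.
have hx : 0 < x < 1 by rewrite x0; lra.
have x2 : 0 < x ^+ 2 by rewrite exprn_gt0.
have := hd (x, 0); rewrite (p_axis hx) {1 2}/nr2 /= expr0n /= addr0 x2 /= => /(_ ltac:(lra)).
have -> : cx (x, 0) = x%:C by [].
have -> : x%:C ^+ 2 * (P x)%:C - 1 = (x ^+ 2 * P x - 1)%:C by rewrite cRD cRN cRM cRX.
rewrite /nrm2 /= expr0n /= addr0 => h.
rewrite -(pmulr_rgt0 _ x2) ltNge; apply/negP => k.
by have := sqr_ge0 (x ^+ 2 * P x); move: h k; rewrite !expr2; lra.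
Qed.

(** If [ee] were 0, then [p'^2 = 4 p^3] on the real axis, and [(P + eps)^(-1/2)] would have slope at
    most 1. But it would reach [eps^(-1/2)] at 1/2, too high a climb over a length below 1/2 once
    [eps] is small. *)
Lemma ee_gt0 : 0 < ee.
Proof.
rewrite lt_neqAle ee_ge0 andbT eq_sym; apply/negP => /eqP e0.
have [x1 /andP[x10 x12] Px1] := P_large.
(* With [eps = M^-2] the value at 1/2 is [M], and [M] is one more than a bound for the value at
   [x1]. *)
pose M := expR (- (ln (P x1) / 2)) + 1.
have M0 : 0 < M by rewrite addr_gt0 // expR_gt0.
pose eps := expR (- (2 * ln M)); have eps0 : 0 < eps by exact: expR_gt0.
have I1 x : x1 <= x <= 2^-1 -> 0 < x < 1 by move=> /andP[a b]; apply/andP; split; lra.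
have P0 x : 0 < x < 1 -> 0 <= P x.
  move=> hx; have := p1_axis hx; rewrite e0 expr0n /= mulr0 subr0 => h.
  have := sqr_ge0 (Re (p1 (x, 0))); rewrite h pmulr_rge0 // => h3.
  by rewrite leNgt; apply/negP => h4; move: h3; rewrite exprS pmulr_lge0 ?exprn_even_gt0 //= ?leNgt ?h4 // lt_eqF.
pose F x := expR (- (ln (P x + eps) / 2)).
have Pe x : 0 < x < 1 -> 0 < P x + eps by move=> /P0 h; rewrite ltr_wpDl.
pose F' x := F x * (- (Re (p1 (x, 0)) / (P x + eps) / 2)).
have dF (x : R) : 0 < x < 1 -> is_derive x 1 F (F' x).
  move=> hx; have h1 := dvD (dP hx) (dv_cst eps x).
  have h2 := dvC h1 (is_derive1_ln (Pe x hx)).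
  have h3 := dvN (dvM h2 (dv_cst 2^-1 x)).
  have h4 := dvC h3 (is_derive_expR _).
  apply: (dv_eq h4); rewrite /F' /F; cbv beta; ring.
have F2 x : 0 < x < 1 -> F x ^+ 2 = (P x + eps)^-1.
  move=> hx; rewrite /F expr2 -expRD -opprD -splitr.
  by rewrite expRN lnK // posrE Pe.
have F1 x : 0 < x < 1 -> - 1 <= F' x <= 1.
  move=> hx; apply: sqr_le_abs => //; rewrite expr1n /F' exprMn (F2 x hx) sqrrN !exprMn (p1_axis hx) e0 expr0n /= mulr0 subr0.
  have Q := Pe x hx; have P0x := P0 x hx.
  have -> : (P x + eps)^-1 * (4 * P x ^+ 3 * ((P x + eps)^-1) ^+ 2 * 2^-1 ^+ 2) = P x ^+ 3 / (P x + eps) ^+ 3 by field; rewrite gt_eqF.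
  by rewrite ler_pdivrMr ?exprn_gt0 // mul1r lerXn2r ?nnegrE ?(ltW Q) // lerDl ltW.
have [t tI e] := dv_mvt x12 (fun t tI => dF t (I1 t tI)).
have /andP[_ t1] := F1 t ltac:(by case/andP: tI => a b; apply: I1; rewrite !ltW).
have : F 2^-1 - F x1 <= 2^-1.
  rewrite e; apply: le_trans (_ : 1 * (2^-1 - x1) <= _); last by lra.
  by rewrite ler_wpM2r // subr_ge0 ltW.
have -> : F 2^-1 = M.
  by rewrite /F -[P 2^-1]/ee e0 add0r /eps expRK mulNr mulrC mulKf // opprK lnK.
have : F x1 <= M - 1.
  rewrite /M addrK /F ler_expR lerN2 ler_wpM2r ?invr_ge0 // ler_ln ?posrE ?lerDl ?(ltW eps0) //.
  by apply: Pe; apply/andP; split; lra.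
by lra.
Qed.
Let A_gt0 y : 0 <= y < s3 / 6 -> 0 < A y.
Proof.
move=> /andP[y0 y1]; rewrite ltNge; apply/negP => Ay.
have Iy : I y by rewrite /I y0 ltW.
have II t : y <= t <= s3 / 6 -> I t by move=> /andP[a b]; rewrite /I (le_trans y0 a).
have [t /andP[t0 t1] e] := dv_mvt y1 (fun t tI => dA (II t tI)).
have It : I t by apply: II; rewrite !ltW.
have sy : 0 < s3 / 6 - y by rewrite subr_gt0.
have d0 : - Im (p1 (2^-1, t)) = 0.
  apply/eqP; rewrite eq_le dA_le0 //= -(pmulr_lge0 _ sy) -e A_end sub0r oppr_ge0 //.
have At : A t = 0.
  apply/eqP; rewrite eq_le; apply/andP; split; first by apply: le_trans (A_mono Iy It (ltW t0)) Ay.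
  by rewrite -A_end; apply: A_mono => //; exact: ltW.
have := wp_first (offI It); rewrite (p_real It) At.
move: d0; case: (p1 _) => a b /= /eqP; rewrite oppr_eq0 => /eqP -> k.
have h : (a ^+ 2)%:C = (4 * 0 ^+ 3 - 4 * ee ^+ 3)%:C :> C by rewrite !cRE; exact: k.
have := exprn_gt0 3 ee_gt0; have := sqr_ge0 a; have := congr1 Re h; rewrite /= expr0n /=; lra.
Qed.

(** Near 0 such an [f] is [a / z] up to [O(z^5)], which forces [f' = - a p]. It vanishes at both
    ends of the segment from 1/2 to [wpt], in whose interior [p > 0]; so [a = 0], and [f] is
    constant. This takes the place of the residue theorem. *)
Lemma ell5_zero f : ell 5 f -> bnd (fun z => cx z ^+ 2 * f z) -> forall z, ~ Lam z -> f z = 0.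
Proof.
move=> E b; have h0 := @hh_gt0 R.
have [a [d [G [G1 [G2 [d0 [b0 b1 b2] q1 q2]]]]]] := @ell_laurent 5 1 f (or_intror erefl) E b.
have [dp' [H [H1 [H2 [dp'0 [bH _ _] r1 _]]]]] := lp.
have [hf per _ _] := E; have [f1 df _] := holS (hf 1%N).
have fE w : pdisc d w -> f w = a%:C * (cx w)^-1 + cx w ^+ 5 * G w.
  move=> Dw; have [wL e] := q1 w Dw; have c0 := cx_neq0 wL.
  by apply: (mulfI c0); rewrite -[cx w * f w]/(cx w ^+ 1 * f w) e; field.
have e1 w : pdisc d w -> f1 w = - a%:C * cx w ^- 2 + 5 * cx w ^+ 4 * G w + cx w ^+ 5 * G1 w.
  move=> Dw; have [wL _] := q1 w Dw; have c0 := cx_neq0 wL; have [g1 _] := q2 w Dw.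
  have h := wdD (wdZ a%:C (wdV c0 (wd_cx w))) (wdM (wdX 4 (wd_cx w)) g1).
  have k := wd_on (@pdisc_open _ d) Dw fE h.
  by have [-> _] := wd_inj (df w wL) k; move: (cx w) c0 => x x0; field.
have E1 : ell 4 f1 by apply: ell_mod (ell_derive E df).
have v : vanishing (fun z => f1 z + a%:C * p z).
  have v1 := vanM (van_cxX 3) (bndM (bnd_cst 5) b0).
  have v2 := vanM (van_cxX 4) b1.
  have v3 := vanM (van_cxX 3) (bndM (bnd_cst a%:C) bH).
  apply: van_ext (vanD (vanD v1 v2) v3); apply: filterS2 (pdisc_near d0) (pdisc_near dp'0) => w Dw Dw'.
  by have [wL ->] := r1 w Dw'; rewrite (e1 w Dw); move: (cx w) (cx_neq0 wL) => x x0; field.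
have f1E z : ~ Lam z -> f1 z = - (a%:C * p z).
  by move=> zL; apply/eqP; rewrite -addr_eq0; apply/eqP; exact: (ell_kill (or_intror erefl) (ellD E1 (ellZ a Ep)) v zL).
have fw : f wpt = 0.
  apply: (ell_wpt _ E); rewrite (exprD _ 6 4) rr6 mul1r (exprD _ 3 1) rr3 mulN1r.
  by apply/negP => /eqP /(congr1 Im) /=; lra.
have a0 : a = 0.
  have [t /andP[t0 t1]] := @dv_mvt _ (fun s => Re (- ci * f (2^-1, s))) (fun s => - Im (- ci * f1 (2^-1, s))) 0 (s3 / 6) s60
    ltac:(by move=> t tI; apply: (@dv_vertical (fun w => - ci * f w) (fun w => - ci * f1 w)); apply: wd_eq; [exact: (wdZ _ (df _ (offI tI)))|..]; rewrite ?mulr0).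
  have It : I t by rewrite /I !ltW.
  rewrite -/wpt fw (ell_odd_half _ E) // mulr0 subrr subr0 f1E ?(p_real It); last exact: offI.
  have -> : - Im (- ci * - (a%:C * (A t)%:C)) = - (a * A t) by rewrite !ReImE /=; ring.
  move=> /esym /eqP; rewrite mulf_eq0 (gt_eqF s60) orbF oppr_eq0 mulf_eq0 => /orP[/eqP //|].
  by rewrite gt_eqF // A_gt0 // t1 ltW.
move=> z zL; have k := ell_const f1 per (fun w wL => wd_eq (df w wL) (etrans (f1E w wL) _) erefl).
have {}k : forall z, ~ Lam z -> f z = f (2^-1, hh / 2) by apply: k => w; rewrite a0 mul0r oppr0.
by rewrite (k z zL) -(k _ wpt_off) fw.
Qed.

End weierstrass.
End vanishing.

(** * Isotypic components of the Hopf differential *)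

Section components.
Context {R : realType}.
Local Notation C := R[i].
Local Notation Lam := (lattice (rho R)).
Local Notation rr := (@rr R).
Implicit Types (z w c : R * R) (f g : R * R -> C) (j k n : nat).

Lemma near0_rot (A : R * R -> Prop) : (\forall z \near (0 : R * R)^', A z) -> \forall z \near (0 : R * R)^', A (rot z).
Proof. by move=> /near0P[d d0 h]; apply/near0P; exists d => // z zd; apply: h; rewrite nr2_rot. Qed.
Lemma near0_conjp (A : R * R -> Prop) : (\forall z \near (0 : R * R)^', A z) -> \forall z \near (0 : R * R)^', A (conjp z).
Proof. by move=> /near0P[d d0 h]; apply/near0P; exists d => // z zd; apply: h; rewrite nr2_conjp. Qed.
Lemma van_rot f : vanishing f -> vanishing (fun z => f (rot z)).
Proof. by move=> /vanishingP h; apply/vanishingP => e /h /near0_rot. Qed.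
Lemma van_conjp f : vanishing f -> vanishing (fun z => cj (f (conjp z))).
Proof. by move=> /vanishingP h; apply/vanishingP => e /h /near0_conjp; apply: filterS => z; rewrite nrm2J. Qed.
Lemma vanZ (a : C) f : vanishing f -> vanishing (fun z => a * f z).
Proof. by move=> h; apply: van_ext (vanM h (bnd_cst a)); near=> z; rewrite mulrC. Unshelve. all: by end_near. Qed.

Definition graded j f := [/\ forall n, hol (~` Lam) n f, forall z c, Lam c -> ~ Lam z -> f (z + c) = f z &
  forall z, ~ Lam z -> f (rot z) = rr ^+ j * f z].

Lemma hol_rot n f : hol (~` Lam) n f -> hol (~` Lam) n (fun z => f (rot z)).
Proof.
have e z : rot z = xc (rr * cx z + 0) by rewrite addr0.
have -> : (fun z => f (rot z)) = (fun z => f (xc (rr * cx z + 0))) by apply/funext => z; rewrite e.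
by apply: hol_affine => z; rewrite -e; exact: off_rot.
Qed.

(** With [ipart], the splitting of [f] under the reflection; the factor [- ci] in [ipart] lets both
    pieces satisfy the reality clause of [ell]. *)
Definition rpart f z : C := 2^-1 * (f z + cj (f (conjp z))).
Definition ipart f z : C := (- ci / 2) * (f z - cj (f (conjp z))).

Lemma rpart_ipart f z : f z = rpart f z + ci * ipart f z.
Proof.
rewrite /rpart /ipart; have -> : ci * (- ci / 2 * (f z - cj (f (conjp z)))) = - (ci * ci) / 2 * (f z - cj (f (conjp z))) by ring.
by rewrite ciM; field.
Qed.

Lemma rot_conjp_rot z : rot (conjp (rot z)) = conjp z.
Proof. by rewrite -[LHS]cxK cx_rot cx_conjp cx_rot cJM mulrA rr_cj mul1r. Qed.
Lemma cxD z c : cx (z + c) = cx z + cx c.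
Proof. by []. Qed.
Lemma rot_shift z c : rot (z + c) = rot z + rot c.
Proof. by rewrite -[LHS]cxK -[RHS]cxK cxD !cx_rot cxD mulrDr. Qed.
Lemma conjp_shift z c : conjp (z + c) = conjp z + conjp c.
Proof. by rewrite -[LHS]cxK -[RHS]cxK cxD !cx_conjp cxD cJD. Qed.

Lemma graded_conj j f : graded j f -> graded j (fun z => cj (f (conjp z))).
Proof.
move=> [h1 h2 h3]; split=> [n|z c cL zL|z zL].
- by apply: hol_conj => // z; exact: off_conjp.
- by rewrite conjp_shift h2 //; [exact/lattice_conjp|exact: off_conjp].
- have := h3 _ (off_conjp (off_rot zL)); rewrite rot_conjp_rot => ->.
  by rewrite cJM cJX mulrA -exprMn rr_cj expr1n mul1r.
Qed.

Lemma ell_rpart j f : graded j f -> ell j (rpart f).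
Proof.
move=> g; have [h1 h2 h3] := g; have [k1 k2 k3] := graded_conj g; split=> [n|z c cL zL|z zL|z zL].
- by apply: holZ; apply: holD.
- by rewrite /rpart h2 // k2.
- by rewrite /rpart h3 // k3 //; ring.
- by rewrite /rpart cJM cJD cJV cJn cJK [conjp (conjp z)]surjective_pairing /= opprK -surjective_pairing addrC.
Qed.

Lemma ell_ipart j f : graded j f -> ell j (ipart f).
Proof.
move=> g; have [h1 h2 h3] := g; have [k1 k2 k3] := graded_conj g; split=> [n|z c cL zL|z zL|z zL].
- by apply: holZ; apply: holB.
- by rewrite /ipart h2 // k2.
- by rewrite /ipart h3 // k3 //; ring.
- rewrite /ipart !cJM cJD !cJN cJV cJn cJi cJK [conjp (conjp z)]surjective_pairing /= opprK -surjective_pairing; ring.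
Qed.

Lemma van_parts (a : R) f : vanishing (fun z => cx z ^+ 2 * f z - a%:C) ->
  vanishing (fun z => cx z ^+ 2 * rpart f z - a%:C) /\ vanishing (fun z => cx z ^+ 2 * ipart f z).
Proof.
move=> v; have vc := van_conjp v; split.
  apply: van_ext (vanZ 2^-1 (vanD v vc)); near=> z.
  by rewrite /rpart cJD cJM cJX cJN cJR cx_conjp cJK; field.
apply: van_ext (vanZ (- ci / 2) (vanD v (vanZ (-1) vc))); near=> z.
by rewrite /ipart cJD cJM cJX cJN cJR cx_conjp cJK; ring.
Unshelve. all: by end_near.
Qed.

Variable Q : R * R -> C.
Hypotheses (hQ : forall n, hol (~` Lam) n Q) (perQ : forall z c, Lam c -> ~ Lam z -> Q (z + c) = Q z).
Hypothesis vQ : vanishing (fun z => cx z ^+ 2 * Q z + 12).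

(** For [q = rr^(5 j)], the inverse of [rr^j], this is six times the projection of [Q] to weight
    [j]. *)
Definition comp (q : C) z : C := Q z + q * Q (rot z) + q ^+ 2 * Q (rot (rot z)) + q ^+ 3 * Q (rot (rot (rot z)))
  + q ^+ 4 * Q (rot (rot (rot (rot z)))) + q ^+ 5 * Q (rot (rot (rot (rot (rot z))))).

Lemma comp_graded j : graded j (comp (rr ^+ (5 * j))).
Proof.
set q := rr ^+ _; have q6 : q ^+ 6 = 1 by rewrite /q -exprM mulnC exprM rr6 expr1n.
split=> [n|z c cL zL|z zL].
- have k1 := hol_rot (hQ n); have k2 := hol_rot k1; have k3 := hol_rot k2; have k4 := hol_rot k3; have k5 := hol_rot k4.
  by do ![apply: holD|apply: holZ|exact: hQ].
- have rL d : Lam d -> Lam (rot d) by move/lattice_rot.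
  have c1 := rL _ cL; have c2 := rL _ c1; have c3 := rL _ c2; have c4 := rL _ c3; have c5 := rL _ c4.
  have z1 := off_rot zL; have z2 := off_rot z1; have z3 := off_rot z2.
  have z4 := off_rot z3; have z5 := off_rot z4.
  by rewrite /comp !rot_shift (perQ cL zL) (perQ c1 z1) (perQ c2 z2) (perQ c3 z3) (perQ c4 z4) (perQ c5 z5).
- have -> : rr ^+ j = q ^+ 5.
    by rewrite /q -exprM [RHS](_ : _ = rr ^+ (6 * (4 * j) + j)); [rewrite exprD exprM rr6 expr1n mul1r|congr (_ ^+ _); lia].
  rewrite /comp rot3E !rot3E opprK.
  move: (Q z) (Q (rot z)) (Q (rot (rot z))) (Q (- z)) (Q (rot (- z))) (Q (rot (rot (- z)))) => a b c d e f.
  move: (q) q6 => s s6.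
  transitivity (b + s * c + s ^+ 2 * d + s ^+ 3 * e + s ^+ 4 * f + s ^+ 5 * a + (s ^+ 6 - 1) * (b + s * c + s ^+ 2 * d + s ^+ 3 * e + s ^+ 4 * f)).
    by rewrite s6 subrr mul0r addr0.
  by ring.
Qed.

(** [z^2 Q] tends to -12, and each rotation divides [z^-2] by [rr^2], that is, multiplies it by
    [rr^4]; the leading coefficients form a geometric sum. *)
Lemma comp_limit (q S : C) : S = 1 + q * rr ^+ 4 + (q * rr ^+ 4) ^+ 2 + (q * rr ^+ 4) ^+ 3 + (q * rr ^+ 4) ^+ 4 + (q * rr ^+ 4) ^+ 5 ->
  vanishing (fun z => cx z ^+ 2 * comp q z + 12 * S).
Proof.
move=> ->; have v1 := van_rot vQ; have v2 := van_rot v1; have v3 := van_rot v2; have v4 := van_rot v3; have v5 := van_rot v4.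
have := vanD (vanD (vanD (vanD (vanD vQ (vanZ (q * rr ^+ 4) v1)) (vanZ ((q * rr ^+ 4) ^+ 2) v2)) (vanZ ((q * rr ^+ 4) ^+ 3) v3))
  (vanZ ((q * rr ^+ 4) ^+ 4) v4)) (vanZ ((q * rr ^+ 4) ^+ 5) v5).
apply: van_ext; near=> z; rewrite /comp !cx_rot.
move: (Q z) (Q (rot z)) (Q (rot (rot z))) (Q (rot (rot (rot z)))) (Q (rot (rot (rot (rot z))))) (Q (rot (rot (rot (rot (rot z)))))) (cx z) => a b c d e f x.
have p n m : rr ^+ (6 * n + m) = rr ^+ m by rewrite exprD exprM rr6 expr1n mul1r.
have -> : (q * rr ^+ 4) * ((rr * x) ^+ 2 * b + 12) = q * rr ^+ 4 * 12 + q * x ^+ 2 * b * rr ^+ (6 * 1 + 0) by ring.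
have -> : (q * rr ^+ 4) ^+ 2 * ((rr * (rr * x)) ^+ 2 * c + 12) = (q * rr ^+ 4) ^+ 2 * 12 + q ^+ 2 * x ^+ 2 * c * rr ^+ (6 * 2 + 0) by ring.
have -> : (q * rr ^+ 4) ^+ 3 * ((rr * (rr * (rr * x))) ^+ 2 * d + 12) = (q * rr ^+ 4) ^+ 3 * 12 + q ^+ 3 * x ^+ 2 * d * rr ^+ (6 * 3 + 0) by ring.
have -> : (q * rr ^+ 4) ^+ 4 * ((rr * (rr * (rr * (rr * x)))) ^+ 2 * e + 12) = (q * rr ^+ 4) ^+ 4 * 12 + q ^+ 4 * x ^+ 2 * e * rr ^+ (6 * 4 + 0) by ring.
have -> : (q * rr ^+ 4) ^+ 5 * ((rr * (rr * (rr * (rr * (rr * x))))) ^+ 2 * f + 12) = (q * rr ^+ 4) ^+ 5 * 12 + q ^+ 5 * x ^+ 2 * f * rr ^+ (6 * 5 + 0) by ring.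
by rewrite !p expr0; ring.
Unshelve. all: by end_near.
Qed.

Lemma comp_sum z : comp (rr ^+ (5 * 0)) z + comp (rr ^+ (5 * 1)) z + comp (rr ^+ (5 * 2)) z + comp (rr ^+ (5 * 3)) z
  + comp (rr ^+ (5 * 4)) z + comp (rr ^+ (5 * 5)) z = 6 * Q z.
Proof.
have r2 := rr2; have r3 := rr3.
have r4 : rr ^+ 4 = - rr by rewrite (exprD _ 3 1) r3 mulN1r.
have r5 : rr ^+ 5 = 1 - rr by rewrite (exprD _ 3 2) r3 r2; ring.
have -> : rr ^+ (5 * 1) = 1 - rr by rewrite muln1.
have -> : rr ^+ (5 * 2) = - rr by rewrite (exprD _ 6 4) rr6 mul1r.
have -> : rr ^+ (5 * 3) = -1 by rewrite (exprD _ 6 9) rr6 mul1r (exprD _ 6 3) rr6 mul1r.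
have -> : rr ^+ (5 * 4) = rr - 1 by rewrite (exprD _ 6 14) rr6 mul1r (exprD _ 6 8) rr6 mul1r (exprD _ 6 2) rr6 mul1r.
have -> : rr ^+ (5 * 5) = rr by rewrite (exprM _ 5 5) r5 -r5 -exprM (exprD _ 24 1) (exprM _ 6 4) rr6 expr1n mul1r expr1.
rewrite muln0 expr0 /comp; have e : rr ^+ 2 - rr + 1 = 0 by rewrite r2; ring.
move: (Q z) (Q (rot z)) (Q (rot (rot z))) (Q (rot (rot (rot z)))) (Q (rot (rot (rot (rot z))))) (Q (rot (rot (rot (rot (rot z)))))) rr e => a b c d f g r e.
transitivity (6 * a + 4 * (r ^+ 2 - r + 1) * c + 4 * (r ^+ 2 - r + 1) ^+ 2 * f); first by ring.
by rewrite e expr0n /=; ring.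
Qed.
Let S j : C := let s := rr ^+ (5 * j) * rr ^+ 4 in 1 + s + s ^+ 2 + s ^+ 3 + s ^+ 4 + s ^+ 5.

Let S0 j : rr ^+ (5 * j + 4) != 1 -> S j = 0.
Proof.
rewrite exprD -subr_eq0 => s1; apply: (mulfI s1); rewrite mulr0 /S.
have s6 : (rr ^+ (5 * j) * rr ^+ 4) ^+ 6 = 1 by rewrite exprMn -!exprM mulnC exprM rr6 expr1n mul1r (exprM _ 6 4) rr6 expr1n.
move: (rr ^+ (5 * j) * rr ^+ 4) s6 {s1} => s s6; transitivity (s ^+ 6 - 1); first by ring.
by rewrite s6 subrr.
Qed.
Let rneq n : (n = 1 \/ n = 2 \/ n = 3 \/ n = 4 \/ n = 5)%N -> rr ^+ n != 1.
Proof.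
have h0 := @hh_gt0 R; have r3 := rr3; have r2 := rr2.
have I (x y : C) : Im x != Im y -> x != y by apply: contra => /eqP ->.
case=> [->|[->|[->|[->|->]]]].
- by apply: I; rewrite expr1 /= gt_eqF.
- by apply: I; rewrite r2 !ReImE /= subr0 gt_eqF.
- by rewrite r3 -subr_eq0 -opprD oppr_eq0 -[1 + 1]/(2%:R) pnatr_eq0.
- by apply: I; rewrite (exprD _ 3 1) r3 mulN1r !ReImE /= lt_eqF // oppr_lt0.
- by apply: I; rewrite (exprD _ 3 2) r3 r2 mulN1r !ReImE /= subr0 lt_eqF // oppr_lt0.
Qed.
Let rmod n m : rr ^+ (6 * n + m) = rr ^+ m.
Proof. by rewrite exprD exprM rr6 expr1n mul1r. Qed.
Let limit0 j : S j = 0 -> vanishing (fun z => cx z ^+ 2 * comp (rr ^+ (5 * j)) z - 0%:C).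
Proof.
move=> S0'; have := @comp_limit (rr ^+ (5 * j)) _ erefl; rewrite -/(S j) S0'.
by apply: van_ext; near=> z; rewrite mulr0 subr0 addr0.
Unshelve. all: by end_near.
Qed.

(** The pole has weight 4 only. Weights 1, 2, 3 and 5 vanish, weight 0 leaves a constant, complex
    because its two reflection parts are independent, and weight 4 is [- 72 p] with
    [72 = 6 * 12]. *)
Lemma hopf_decomposition : exists (p : R * R -> C) (B : C), [/\ ell 4 p, vanishing (fun z => cx z ^+ 2 * p z - 1) &
  forall z, ~ Lam z -> Q z = - 12 * p z - 2 * B].
Proof.
have sub0 f : vanishing (fun z => cx z ^+ 2 * f z - 0%:C) -> vanishing (fun z => cx z ^+ 2 * f z).
  by apply: van_ext; near=> z; rewrite subr0.
have s0 : S 0 = 0 by apply: S0; apply: rneq; do 3 right; left.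
have v0 := limit0 s0.
have s1 : S 1 = 0 by apply: S0; rewrite (rmod 1 3); apply: rneq; do 2 right; left.
have s2 : S 2 = 0 by apply: S0; rewrite (rmod 2 2); apply: rneq; right; left.
have s3 : S 3 = 0 by apply: S0; rewrite (rmod 3 1); apply: rneq; left.
have s5 : S 5 = 0 by apply: S0; rewrite (rmod 4 5); apply: rneq; do 4 right.
have v4 : vanishing (fun z => cx z ^+ 2 * comp (rr ^+ (5 * 4)) z - (- 72)%:C).
  have := @comp_limit (rr ^+ (5 * 4)) _ erefl; rewrite -exprD (rmod 4 0) expr0 !expr1n.
  by apply: van_ext; near=> z; rewrite cRN cRn; ring.
have zero j : (j = 1 \/ j = 2 \/ j = 3)%N -> S j = 0 -> forall z, ~ Lam z -> comp (rr ^+ (5 * j)) z = 0.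
  move=> hj /limit0 /van_parts[/sub0 a b] z zL; have g := comp_graded j.
  rewrite rpart_ipart (ell_zero hj (ell_rpart g) (van_bnd a) zL) (ell_zero hj (ell_ipart g) (van_bnd b) zL).
  by rewrite mulr0 addr0.
have [v4r v4i] := van_parts v4; have g4 := comp_graded 4.
pose p z : C := (- 72^-1)%:C * rpart (comp (rr ^+ (5 * 4))) z.
have c72 : (72 : R) != 0 by rewrite pnatr_eq0.
have Ep : ell 4 p := ellZ _ (ell_rpart g4).
have vp : vanishing (fun z => cx z ^+ 2 * p z - 1).
  apply: van_ext (vanZ (- 72^-1)%:C v4r); near=> z; rewrite /p mulrBr.
  have -> : (- 72^-1)%:C * (- 72)%:C = 1 :> C by rewrite -cRM mulrNN mulVf.
  by rewrite mulrCA.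
have [p1 dp hp1] : exists2 p1, (forall z, ~ Lam z -> wd p z (p1 z) 0) & hol (~` Lam) 1 p1.
  by have [h _ _ _] := Ep; have [p1 d h1] := holS (h 2); exists p1.
have [p2 dp1 _] := holS hp1.
have [v0r v0i] := van_parts v0; have g0 := comp_graded 0.
have [a ha] := ell0_const (ell_rpart g0) (van_bnd (sub0 _ v0r)).
have [b hb] := ell0_const (ell_ipart g0) (van_bnd v0i).
have [v5r v5i] := van_parts (limit0 s5); have g5 := comp_graded 5.
have z5 := ell5_zero Ep vp dp dp1 (ell_rpart g5) (van_bnd (sub0 _ v5r)).
have z5' := ell5_zero Ep vp dp dp1 (ell_ipart g5) (van_bnd v5i).
have z4 := ell4_zero (ell_ipart g4) v4i.
exists p, (- 12^-1 * (a%:C + ci * b%:C)); split; [exact: Ep|exact: vp|move=> z zL].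
have z1 := zero 1%N (or_introl erefl) s1 z zL.
have z2 := zero 2%N (or_intror (or_introl erefl)) s2 z zL.
have z3 := zero 3%N (or_intror (or_intror erefl)) s3 z zL.
have e0 : comp (rr ^+ (5 * 0)) z = a%:C + ci * b%:C by rewrite (rpart_ipart _ z) (ha z zL) (hb z zL).
have e5 : comp (rr ^+ (5 * 5)) z = 0 by rewrite (rpart_ipart _ z) (z5 z zL) (z5' z zL) mulr0 addr0.
have e4 : comp (rr ^+ (5 * 4)) z = rpart (comp (rr ^+ (5 * 4))) z by rewrite {1}(rpart_ipart _ z) (z4 z zL) mulr0 addr0.
have := comp_sum z; rewrite z1 z2 z3 e0 e5 e4.
have -> : rpart (comp (rr ^+ (5 * 4))) z = - 72 * p z.
  by rewrite /p cRN cRV cRn; move: (rpart _ z) => x; field.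
move: (Q z) (p z) a%:C b%:C => x y r t E; have -> : x = (6 * x) / 6 by field.
by rewrite -E; field.
Unshelve. all: by end_near.
Qed.

End components.

(** * A real potential built from the Lame equation *)

Section potential.
Context {R : realType}.
Local Notation C := R[i].
Local Notation Lam := (lattice (rho R)).
Implicit Types (z w c : R * R).

Lemma wd_real_conj (f : R * R -> R) z (a b : C) : wd (fun w => (f w)%:C) z a b -> b = cj a.
Proof.
move=> h; have h' := wdJ h; have e : (fun w => cj ((f w)%:C : C)) = (fun w => (f w)%:C) by apply/funext => w; rewrite cJR.
by rewrite e in h'; have [_ ->] := wd_inj h h'.
Qed.

Variables (u : R * R -> R) (U1 U2 p p1 : R * R -> C) (b : C) (e : R).
Local Notation eu z := ((expR (u z))%:C : C).
Hypothesis pu : forall z c, Lam c -> ~ Lam z -> u (z + c) = u z.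
Hypothesis d1 : forall z, ~ Lam z -> wd (fun z => (u z)%:C) z (U1 z) (cj (U1 z)).
Hypothesis d2 : forall z, ~ Lam z -> wd U1 z (U2 z) (- (eu z / 4)).
Hypothesis Qp : forall z, ~ Lam z -> U2 z - U1 z ^+ 2 / 2 = - 12 * p z - 2 * (3 * b).
Hypothesis pp : forall z c, Lam c -> ~ Lam z -> p (z + c) = p z.
Hypothesis dp : forall z, ~ Lam z -> wd p z (p1 z) 0.
Hypothesis dp1 : forall z, ~ Lam z -> wd p1 z (6 * p z ^+ 2) 0.
Hypothesis wp : forall z, ~ Lam z -> p1 z ^+ 2 = 4 * p z ^+ 3 - 4 * e%:C ^+ 3.

Lemma wd_periodic (f f1 : R * R -> C) (f2 : R * R -> C) : (forall z c, Lam c -> ~ Lam z -> f (z + c) = f z) ->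
  (forall z, ~ Lam z -> wd f z (f1 z) (f2 z)) -> forall z c, Lam c -> ~ Lam z -> f1 (z + c) = f1 z.
Proof.
move=> per df z c cL zL; have k := wd_shift (df _ (off_shift cL zL)).
have h : wd (fun w => f (w + c)) z (f1 z) (f2 z).
  by apply: wd_near (df z zL); apply: filterS (near_off zL) => w wL; rewrite per.
by have [] := wd_inj k h.
Qed.
Let pU1 z c : Lam c -> ~ Lam z -> U1 (z + c) = U1 z.
Proof. by apply: (@wd_periodic (fun z => (u z)%:C) U1 (fun z => cj (U1 z))) => // w d dL wL; rewrite pu. Qed.
Let pp1 z c : Lam c -> ~ Lam z -> p1 (z + c) = p1 z.
Proof. exact: (@wd_periodic p p1 (fun=> 0)). Qed.

Definition psi z : R := expR (- (u z / 2)).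
(** [a] is [psi_z], [m] is [psi_{z zbar}] and [q] the Lame potential, with [psi_zz = q psi]. The
    Liouville equation takes the form [psi m - |a|^2 = 1 / 8]. *)
Let a z : C := - (U1 z / 2) * (psi z)%:C.
Let m z : R := (8^-1 + nrm2 (a z)) / psi z.
Let q z : C := 6 * p z + 3 * b.

Let psi0 z : 0 < psi z. Proof. exact: expR_gt0. Qed.
Let psiC z : (psi z)%:C != 0 :> C.
Proof. by rewrite -nrm2_eq0 /nrm2 /= expr0n addr0 gt_eqF // exprn_gt0. Qed.
Let psi2 z : eu z * (psi z)%:C ^+ 2 = 1.
Proof. by rewrite -cRX -cRM /psi expr2 -expRD -opprD -splitr -expRD subrr expR0. Qed.
Let dpsi z : ~ Lam z -> wd (fun z => (psi z)%:C) z (a z) (cj (a z)).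
Proof.
move=> zL; have h : wd (fun z => (- (u z / 2))%:C) z (- (2^-1 * U1 z)) (- (2^-1 * cj (U1 z))).
  have -> : (fun z => (- (u z / 2))%:C : C) = (fun z => - (2^-1 * (u z)%:C)).
    by apply/funext => w; rewrite cRN cRM cRV cRn mulrC.
  exact: wdN (wdZ 2^-1 (d1 zL)).
have k := wd_rcomp h (is_derive_expR _); have e' : a z = (psi z)%:C * - (2^-1 * U1 z) by rewrite /a; ring.
have k' : wd (fun z => (psi z)%:C) z ((psi z)%:C * - (2^-1 * U1 z)) ((psi z)%:C * - (2^-1 * cj (U1 z))) := k.
by rewrite e'; rewrite -{1}(wd_real_conj k').
Qed.
Let mE z : (m z)%:C = (8^-1 + a z * cj (a z)) / (psi z)%:C.
Proof. by rewrite /m cRM cRV cRD nrm2E cRV cRn. Qed.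
Let da z : ~ Lam z -> wd a z (q z * (psi z)%:C) (m z)%:C.
Proof.
move=> zL; have h : wd (fun z => - (2^-1 * U1 z)) z (- (2^-1 * U2 z)) (- (2^-1 * - (eu z / 4))) := wdN (wdZ 2^-1 (d2 zL)).
have -> : a = (fun z => - (2^-1 * U1 z) * (psi z)%:C) by apply/funext => w; rewrite /a mulrC [U1 w / 2]mulrC mulrC.
apply: wd_eq; [exact: (wdM h (dpsi zL))|..].
  have -> : U2 z = - 12 * p z - 2 * (3 * b) + U1 z ^+ 2 / 2 by rewrite -Qp // subrK.
  by rewrite /a /q; field.
rewrite mE /a cJM cJN cJM cJV cJn cJR; have P0 := psiC z; have E := psi2 z.
apply: (mulIf P0); rewrite divfK //.
have -> : (- (2^-1 * - (eu z / 4)) * (psi z)%:C + - (2^-1 * U1 z) * (- (cj (U1 z) / 2) * (psi z)%:C)) * (psi z)%:C =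
  8^-1 * (eu z * (psi z)%:C ^+ 2) + - (U1 z / 2) * (psi z)%:C * (- (cj (U1 z) / 2) * (psi z)%:C) by field.
by rewrite E mulr1.
Qed.
Let dcja z : ~ Lam z -> wd (fun z => cj (a z)) z (m z)%:C (cj (q z) * (psi z)%:C).
Proof. by move=> zL; apply: wd_eq; [exact: (wdJ (da zL))|..]; rewrite ?cJR // cJM cJR. Qed.
Let dm z : ~ Lam z -> exists t, wd (fun z => (m z)%:C) z (q z * cj (a z)) t.
Proof.
move=> zL; have h := wd_div (psiC z) (wdD (wd_cst (8^-1) z) (wdM (da zL) (dcja zL))) (dpsi zL).
have -> : (fun z => (m z)%:C) = (fun z => (8^-1 + a z * cj (a z)) / (psi z)%:C) by apply/funext => w; rewrite mE.
eexists; apply: wd_eq; [exact: h| |reflexivity].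
have -> : 8^-1 + a z * cj (a z) = (m z)%:C * (psi z)%:C by rewrite mE divfK ?psiC.
by move: (psiC z) (cj (a z)) (a z) (m z)%:C (q z) => P0 x y t r; field.
Qed.

Definition YY z : C := p z ^+ 2 - b * p z + b ^+ 2.
Let Y1 z : C := (2 * p z - b) * p1 z.
Let Y2 z : C := 20 * p z ^+ 3 - 6 * b * p z ^+ 2 - 8 * e%:C ^+ 3.

Let dY z : ~ Lam z -> wd YY z (Y1 z) 0.
Proof.
move=> zL; apply: wd_eq; [exact: (wdD (wdB (wdX 1 (dp zL)) (wdZ b (dp zL))) (wd_cst _ z))|..]; rewrite /Y1; ring.
Qed.
Let dY1 z : ~ Lam z -> wd Y1 z (Y2 z) 0.
Proof.
move=> zL; apply: wd_eq; [exact: (wdM (wdB (wdZ 2 (dp zL)) (wd_cst b z)) (dp1 zL))|..]; last by ring.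
have -> : (2 * p1 z - 0) * p1 z = 2 * p1 z ^+ 2 by ring.
by rewrite wp // /Y2; ring.
Qed.

(** The first integral [Y^2 q - Y Y'' / 2 + Y'^2 / 4] of the equation for [Y], evaluated in [nnE].
    When [Y] is a product of two Lame solutions it is a quarter of their squared Wronskian. *)
Definition nn : C := 3 * b ^+ 2 * (b ^+ 3 + e%:C ^+ 3).

Let nnE z : ~ Lam z -> nn = YY z ^+ 2 * q z - YY z * Y2 z / 2 + Y1 z ^+ 2 / 4.
Proof. by move=> zL; rewrite /Y1 exprMn wp // /nn /YY /q /Y2; field. Qed.
Let cJ_comb (A B D : C) (P : R) : cj (A * B - 2^-1 * D * P%:C) = cj A * cj B - 2^-1 * cj D * P%:C.
Proof. by rewrite cJD cJN !cJM cJR cJV cJn. Qed.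
Let cJ_comb' (A B D : C) (P : R) : cj (A * P%:C - 2^-1 * D * cj B) = cj A * P%:C - 2^-1 * cj D * B.
Proof. by rewrite cJD cJN !cJM cJR cJK cJV cJn. Qed.
Let cJ_half (A B : C) : cj (2^-1 * A * B) = 2^-1 * cj A * cj B.
Proof. by rewrite !cJM cJV cJn. Qed.
(** Put [D f = Y f' - Y' f / 2]. Then [al] is [D psi], and [dd] is [psi] acted on by [D] and by its
    conjugate. For [f'' = q f] one has [Y (D f)' = Y' (D f) / 2 + nn f], the computation behind
    [ddd] and [dphi]. *)
Let al z : C := YY z * a z - 2^-1 * Y1 z * (psi z)%:C.
Let dd z : C := YY z * cj (YY z) * (m z)%:C - 2^-1 * cj (Y1 z) * YY z * a z - 2^-1 * Y1 z * cj (YY z) * cj (a z)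
  + 4^-1 * Y1 z * cj (Y1 z) * (psi z)%:C.

Let cJ_al z : cj (al z) = cj (YY z) * cj (a z) - 2^-1 * cj (Y1 z) * (psi z)%:C.
Proof. exact: cJ_comb. Qed.
Let dal z : ~ Lam z -> wd al z (2^-1 * Y1 z * a z + (YY z * q z - Y2 z / 2) * (psi z)%:C)
   (YY z * (m z)%:C - 2^-1 * Y1 z * cj (a z)).
Proof.
move=> zL; apply: wd_eq; [exact: (wdB (wdM (dY zL) (da zL)) (wdM (wdZ 2^-1 (dY1 zL)) (dpsi zL)))|..];
  move: (YY z) (Y1 z) (Y2 z) (a z) (cj (a z)) (m z)%:C (psi z)%:C (q z) => A1 A2 A3 A4 A5 A6 A7 A8; by field.
Qed.
Let ddd z : ~ Lam z -> exists t s, wd dd z t s /\ YY z * t = 2^-1 * Y1 z * dd z + nn * cj (al z).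
Proof.
move=> zL; have [mt hm] := dm zL; have hY := dY zL; have hY1 := dY1 zL; have ha := da zL; have hj := dcja zL.
have jY := wdJ hY; have jY1 := wdJ hY1; rewrite cJ0 in jY jY1.
have h := wdD (wdB (wdB (wdM (wdM hY jY) hm) (wdM (wdM (wdZ 2^-1 jY1) hY) ha)) (wdM (wdM (wdZ 2^-1 hY1) jY) hj))
  (wdM (wdM (wdZ 4^-1 hY1) jY1) (dpsi zL)).
eexists; eexists; split; first exact: h.
rewrite (nnE zL) cJ_al /dd.
move: (YY z) (cj (YY z)) (Y1 z) (cj (Y1 z)) (Y2 z) (cj (Y2 z)) (a z) (cj (a z)) (m z)%:C (psi z)%:C (q z) => A1 A2 A3 A4 A5 A6 A7 A8 A9 B1 B2.
by field.
Qed.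
Let dd_real z : cj (dd z) = dd z.
Proof.
rewrite /dd; move: (YY z) (Y1 z) (a z) (m z) (psi z) => A1 A2 A3 A4 A5.
by rewrite !cJD !cJN !cJM !cJK !cJR !cJV !cJn; ring.
Qed.
(** The Liouville equation enters here: [psi m - |a|^2 = 1 / 8] makes [dd] positive wherever [Y] is
    nonzero. *)
Let dd_psi z : (Re (dd z) * psi z)%:C = al z * cj (al z) + 8^-1 * (YY z * cj (YY z)).
Proof.
have e1 : (Re (dd z))%:C = dd z.
  by have := dd_real z; case: (dd z) => x y [] /= e'; apply: eqReIm => //=; lra.
rewrite cRM e1 cJ_al /dd /al mE; have := psiC z.
by move: (psi z)%:C (a z) (cj (a z)) (YY z) (cj (YY z)) (Y1 z) (cj (Y1 z)) => P A1 A2 A3 A4 A5 A6 P0; field.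
Qed.
Let dd_psi_re z : Re (dd z) * psi z = nrm2 (al z) + nrm2 (YY z) / 8.
Proof.
have := congr1 Re (dd_psi z); rewrite /= -!nrm2E => ->.
by rewrite -(cRn 8) -cRV -cRM -cRD /=; ring.
Qed.
Let realval (f : R * R -> C) : (forall z, cj (f z) = f z) -> f = (fun z => (Re (f z))%:C).
Proof. by move=> h; apply/funext => z; have := h z; case: (f z) => x y [] /= e'; apply: eqReIm => //=; lra. Qed.
Let perall z c : Lam c -> ~ Lam z -> [/\ al (z + c) = al z, dd (z + c) = dd z & psi (z + c) = psi z].
Proof. by move=> cL zL; split; rewrite /al /dd /m /a /Y1 /YY /psi ?pp ?pp1 ?pu ?pU1. Qed.

Section nonzero.
Variable nu : C.
Hypotheses (nu2 : nu ^+ 2 = nn) (nu0 : nu != 0).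

(** [psi] acted on by [D + s nu] and by its conjugate. As [nu^2 = nn], the sign [s] being 1 or -1,
    it satisfies [Y phi_z = (s nu + Y' / 2) phi]. *)
Let phi (s : R) z : C := dd z + (nrm2 nu)%:C * (psi z)%:C + s%:C * (cj nu * al z + nu * cj (al z)).

Let phi_real s z : cj (phi s z) = phi s z.
Proof.
have r := dd_real z; rewrite /phi; move: (dd z) (al z) (nrm2 nu) (psi z) r => D A N P r.
by rewrite !cJD !cJM !cJD !cJM !cJR !cJK r; ring.
Qed.
Let phi_pos s z : s = 1 \/ s = -1 -> YY z != 0 -> 0 < Re (phi s z).
Proof.
move=> hs Y0; rewrite -(pmulr_lgt0 _ (psi0 z)).
have -> : Re (phi s z) = Re (dd z) + nrm2 nu * psi z + s * (2 * Re (cj nu * al z)).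
  by rewrite /phi; move: (dd z) (al z) => x y; rewrite !ReImE /=; ring.
have Yp : 0 < nrm2 (YY z) by rewrite lt_neqAle eq_sym nrm2_eq0 Y0 nrm2_ge0.
have -> : (Re (dd z) + nrm2 nu * psi z + s * (2 * Re (cj nu * al z))) * psi z =
    nrm2 (al z + (s * psi z)%:C * nu) + nrm2 (YY z) / 8 + nrm2 nu * psi z ^+ 2 * (1 - s ^+ 2).
  rewrite !mulrDl dd_psi_re; move: (al z) nu => x y; rewrite /nrm2 !ReImE /=; ring.
have -> : 1 - s ^+ 2 = 0 by case: hs => ->; rewrite ?sqrrN expr1n subrr.
by rewrite mulr0 addr0 ltr_wpDl ?nrm2_ge0 // divr_gt0.
Qed.
Let dphi s z : s = 1 \/ s = -1 -> ~ Lam z -> exists t t', wd (phi s) z t t' /\ YY z * t = (s%:C * nu + 2^-1 * Y1 z) * phi s z.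
Proof.
move=> hs zL; have [t [t' [ht et]]] := ddd zL; have ha := dal zL.
have h := wdD (wdD ht (wdZ (nrm2 nu)%:C (dpsi zL))) (wdZ s%:C (wdD (wdZ (cj nu) ha) (wdZ nu (wdJ ha)))).
eexists; eexists; split; first exact: h.
have s2 : s%:C * s%:C = 1 :> C by rewrite -cRM; case: hs => ->; rewrite ?mulrNN mulr1.
have n2 : nn = nu * nu by rewrite -nu2 expr2.
have k1 : YY z * (2^-1 * Y1 z * a z + (YY z * q z - Y2 z / 2) * (psi z)%:C) = 2^-1 * Y1 z * al z + nn * (psi z)%:C.
  by rewrite (nnE zL) /al; move: (a z) (psi z)%:C => x y; field.
have k2 : YY z * (cj (YY z) * (m z)%:C - 2^-1 * cj (Y1 z) * a z) = dd z + 2^-1 * Y1 z * cj (al z).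
  rewrite cJ_al /dd; move: (YY z) (cj (YY z)) (a z) (cj (a z)) (psi z)%:C (m z)%:C (Y1 z) (cj (Y1 z)) => v v' x x' y y' w w'; by field.
have gen (y T N A X W S c n : C) : y * (T + N * A + S * (c * X + n * W)) = y * T + N * (y * A) + S * c * (y * X) + S * n * (y * W) by ring.
rewrite cJ_comb' gen k1 k2 et nrm2E.
have -> : YY z * a z = al z + 2^-1 * Y1 z * (psi z)%:C by rewrite /al subrK.
rewrite /phi nrm2E n2; move: (dd z) (al z) (cj (al z)) (psi z)%:C (Y1 z) (cj nu) => D A A' P W N'.
transitivity ((s%:C * nu + 2^-1 * W) * (D + nu * N' * P + s%:C * (N' * A + nu * A')) + (1 - s%:C * s%:C) * nu * (N' * A + nu * A')); first by ring.
by rewrite s2 subrr !mul0r addr0.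
Qed.

(** Half the logarithm of the quotient of the positive functions [phi 1] and [phi (-1)]: the terms
    in [Y'] cancel and [nu / Y] is left. *)
Lemma potential_nonzero : exists G : R * R -> R, (forall z c, Lam c -> ~ Lam z -> G (z + c) = G z) /\
  forall z, ~ Lam z -> YY z != 0 -> wd (fun w => (G w)%:C) z (nu / YY z) (cj (nu / YY z)).
Proof.
exists (fun z => 2^-1 * (ln (Re (phi 1 z)) - ln (Re (phi (-1) z)))); split=> [z c cL zL|z zL Y0].
  by have [e1 e2 e3] := perall cL zL; rewrite /phi e1 e2 e3.
have dl s : s = 1 \/ s = -1 -> exists t', wd (fun w => (ln (Re (phi s w)))%:C) z ((s%:C * nu + 2^-1 * Y1 z) / YY z) t'.
  move=> hs; have [t [t' [h ht]]] := dphi hs zL; have P0 := phi_pos hs Y0; rewrite (realval (phi_real s)) in h.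
  have k := wd_rcomp h (is_derive1_ln P0); eexists; apply: wd_eq; [exact: k| |reflexivity].
  have Pc : (Re (phi s z))%:C = phi s z by rewrite [in RHS](realval (phi_real s)).
  have Pn : phi s z != 0 by rewrite -Pc; apply/eqP => /(congr1 Re) /= /eqP; rewrite gt_eqF.
  rewrite cRV Pc; apply: (mulfI Y0); rewrite mulrCA ht [RHS]mulrCA divff // mulr1.
  by rewrite mulrC mulfK.
have [t1 h1] := dl 1 (or_introl erefl); have [t2 h2] := dl (-1) (or_intror erefl).
have h := wdZ 2^-1 (wdB h1 h2).
have e1 : (fun w => (2^-1 * (ln (Re (phi 1 w)) - ln (Re (phi (-1) w))))%:C : C) =
    (fun w => 2^-1 * ((ln (Re (phi 1 w)))%:C - (ln (Re (phi (-1) w)))%:C)).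
  by apply/funext => w; rewrite cRM cRV cRn cRD cRN.
rewrite -e1 in h; have c := wd_real_conj h; rewrite c in h.
apply: (wd_eq h); rewrite ?cRN; first by field.
by congr cj; field.
Qed.

End nonzero.

(** For [nu = 0] the two functions [phi] would coincide. Instead the conjugate of [al], divided by
    [dd], is holomorphic with derivative [1 / Y], and real parts of its multiples serve for every
    [k]. *)
Lemma potential_zero (k : C) : nn = 0 -> exists G : R * R -> R, (forall z c, Lam c -> ~ Lam z -> G (z + c) = G z) /\
  forall z, ~ Lam z -> YY z != 0 -> wd (fun w => (G w)%:C) z (k / YY z) (cj (k / YY z)).
Proof.
move=> n0; exists (fun z => Re (2 * k * (cj (al z) / dd z))); split=> [z c cL zL|z zL Y0].
  by have [e1 e2 _] := perall cL zL; rewrite e1 e2.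
have Yp : 0 < nrm2 (YY z) by rewrite lt_neqAle eq_sym nrm2_eq0 Y0 nrm2_ge0.
have D0 : dd z != 0.
  apply/eqP => h; have := dd_psi_re z; rewrite h mul0r; have := nrm2_ge0 (al z); lra.
have [t [t' [ht et]]] := ddd zL; rewrite n0 mul0r addr0 in et.
have et' : cj (YY z) * t' = 2^-1 * cj (Y1 z) * dd z.
  have r : t' = cj t by move: ht; rewrite (realval dd_real) => /wd_real_conj.
  by rewrite r -cJM et cJ_half dd_real.
have ha := wdJ (dal zL).
have hK := wd_div D0 ha ht.
have e1 : (cj (YY z * (m z)%:C - 2^-1 * Y1 z * cj (a z)) * dd z - cj (al z) * t) / dd z ^+ 2 = (YY z)^-1.
  apply: (mulfI Y0); rewrite divff // mulrA mulrBr [YY z * (cj (al z) * t)]mulrCA et.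
  rewrite cJ_comb'.
  have k2 : YY z * (cj (YY z) * (m z)%:C - 2^-1 * cj (Y1 z) * a z) = dd z + 2^-1 * Y1 z * cj (al z).
    rewrite cJ_al /dd; move: (YY z) (cj (YY z)) (a z) (cj (a z)) (psi z)%:C (m z)%:C (Y1 z) (cj (Y1 z)) => v v' x x' y y' w w'; by field.
  rewrite [YY z * (_ * dd z)]mulrA k2; move: (dd z) D0 (cj (al z)) => D D0 A; by field.
have e2 : (cj (2^-1 * Y1 z * a z + (YY z * q z - Y2 z / 2) * (psi z)%:C) * dd z - cj (al z) * t') / dd z ^+ 2 = 0.
  have jY0 : cj (YY z) != 0 by rewrite cJ_eq0.
  apply: (mulfI jY0); rewrite mulr0 mulrA mulrBr [cj (YY z) * (cj (al z) * t')]mulrCA et' mulrA -cJM.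
  have -> : YY z * (2^-1 * Y1 z * a z + (YY z * q z - Y2 z / 2) * (psi z)%:C) = 2^-1 * Y1 z * al z + nn * (psi z)%:C.
    by rewrite (nnE zL) /al; move: (a z) (psi z)%:C => x y; field.
  by rewrite n0 mul0r addr0 cJ_half; move: (cj (Y1 z)) (cj (al z)) (dd z) D0 => x y D D0; field.
rewrite e1 e2 in hK.
have h := wdZ k hK; have h2 := wdD h (wdJ h); rewrite mulr0 cJ0 addr0 add0r in h2.
apply: wd_near h2; near=> w; move: (cj (al w) / dd w) => x.
by apply: eqReIm; rewrite -(cRn 2) !ReImE /=; ring.
Unshelve. all: by end_near.
Qed.

End potential.

(** * Monotonicity along periods *)

Section rays.
Context {R : realType}.
Local Notation C := R[i].
Local Notation s3 := (Num.sqrt (3 : R)).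
Local Notation hh := (s3 / 2).
Local Notation Lam := (lattice (rho R)).
Local Notation rr := (@rr R).
Local Notation dv f x a := (is_derive (x : R) (1 : R) f a).
Implicit Types (z w v : R * R).

(** A weak form of equal boundary values: [F] need not have limits at 0 and [L]. It is enough to
    contradict strict monotonicity in [no_monotone]. *)
Definition gap (L : R) (F : R -> R) := forall e, 0 < e -> exists2 d, 0 < d & forall s : R, 0 < s < d -> `|F s - F (L - s)| <= e.

Lemma gapD L F G : gap L F -> gap L G -> gap L (fun s => F s + G s).
Proof.
move=> hF hG e e0; have e2 : 0 < e / 2 by rewrite divr_gt0.
have [d1 d10 h1] := hF _ e2; have [d2 d20 h2] := hG _ e2.
exists (Num.min d1 d2) => [|s]; first by rewrite lt_min d10 d20.
rewrite lt_min => /andP[s0 /andP[a b]]; have := h1 s; have := h2 s; rewrite s0 a b => /(_ isT) k2 /(_ isT) k1.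
have -> : F s + G s - (F (L - s) + G (L - s)) = (F s - F (L - s)) + (G s - G (L - s)) by ring.
by apply: le_trans (ler_normD _ _) _; lra.
Qed.

Lemma gapZ L c F : gap L F -> gap L (fun s => c * F s).
Proof.
move=> hF e e0; have c1 : 0 < `|c| + 1 by rewrite ltr_wpDl ?normr_ge0.
have [d d0 h] := hF _ (divr_gt0 e0 c1); exists d => // s /h k.
rewrite -mulrBr normrM; apply: (@le_trans _ _ ((`|c| + 1) * (e / (`|c| + 1)))); last by rewrite mulrC divfK // gt_eqF.
by apply: ler_pM; rewrite ?normr_ge0 // lerDl.
Qed.

Lemma no_monotone L (F F' : R -> R) : 0 < L -> gap L F -> (forall x, 0 < x < L -> dv F x (F' x)) ->
  (forall x, 0 < x < L -> 0 < F' x) -> False.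
Proof.
move=> L0 hg dF F0.
have mono a b : 0 < a -> a < b -> b < L -> F a < F b.
  move=> a0 ab bL; have dF' x : a <= x <= b -> dv F x (F' x).
    by move=> /andP[x0 x1]; apply: dF; rewrite (lt_le_trans a0 x0) (le_lt_trans x1 bL).
  have [c /andP[c0 c1] ec] := dv_mvt ab dF'.
  by rewrite -subr_gt0 ec mulr_gt0 ?subr_gt0 // F0 // (lt_trans a0 c0) (lt_trans c1 bL).
have m : F (L / 3) < F (2 * L / 3) by apply: mono; lra.
have e0 : 0 < (F (2 * L / 3) - F (L / 3)) / 2 by lra.
have [d d0 hd] := hg _ e0; pose s := Num.min (d / 2) (L / 4).
have s0 : 0 < s by rewrite lt_min !divr_gt0.
have sL : s <= L / 4 by rewrite ge_min lexx orbT.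
have sd : s < d by apply: (@le_lt_trans _ _ (d / 2)); [rewrite ge_min lexx|lra].
have := hd s; rewrite s0 sd => /(_ isT); rewrite ler_norml => /andP[k _].
have m1 : F s < F (L / 3) by apply: mono; lra.
have m2 : F (2 * L / 3) < F (L - s) by apply: mono; lra.
lra.
Qed.

Definition ray v (s : R) : R * R := (s * v.1, s * v.2).

Lemma cx_ray v s : cx (ray v s) = s%:C * cx v.
Proof. by apply: eqReIm; rewrite !ReImE /=; ring. Qed.
Lemma nr2_ray v s : nr2 (ray v s) = s ^+ 2 * nr2 v.
Proof. by rewrite !nr2E cx_ray nrm2M {1}/nrm2 /= expr0n addr0. Qed.

Lemma dv_ray (G : R * R -> R) v s (a : C) : wd (fun w => (G w)%:C) (ray v s) a (cj a) ->
  dv (fun t => G (ray v t)) s (2 * Re (a * cx v)).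
Proof.
have e t : ((0 : R * R).1 + t * v.1, (0 : R * R).2 + t * v.2) = ray v t by rewrite /= !add0r.
rewrite -e => /wd_Re/rd_line h; have -> : (fun t => G (ray v t)) = (fun t => G ((0 : R * R).1 + t * v.1, (0 : R * R).2 + t * v.2)).
  by apply/funext => t; rewrite e.
by apply: (dv_eq h); rewrite !ReImE /=; ring.
Qed.

Lemma cx_iter j z : cx (iter j rot z) = rr ^+ j * cx z.
Proof. by elim: j => [|j IH]; rewrite ?mul1r //= cx_rot IH mulrA exprS. Qed.
Lemma cx_inj z w : cx z = cx w -> z = w.
Proof. by move=> h; rewrite -[z]cxK h cxK. Qed.
Lemma ray_iter j v s : ray (iter j rot v) s = iter j rot (ray v s).
Proof. by apply: cx_inj; rewrite cx_ray !cx_iter cx_ray mulrCA. Qed.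
Lemma off_iter j z : ~ Lam z -> ~ Lam (iter j rot z).
Proof. by move=> zL; elim: j => //= j IH; exact: off_rot. Qed.
Lemma lattice_iter j z : Lam z -> Lam (iter j rot z).
Proof. by move=> zL; elim: j => //= j IH; exact/lattice_rot. Qed.
Lemma rrj6 j : (rr ^+ j) ^+ 6 = 1.
Proof. by rewrite -exprM mulnC exprM rr6 expr1n. Qed.
Lemma rrj_neq0 j : rr ^+ j != 0.
Proof. by have := rrj6 j; apply: contra_eqN => /eqP ->; rewrite expr0n eq_sym oner_eq0. Qed.

Lemma imag_axis_off (y : R) : 0 < y < 2 * hh -> ~ Lam (0, y).
Proof.
have h0 := @hh_gt0 R; move=> /andP[y0 y1] /latticeP[m [n [xE yE]]].
have n1 : n = 1.
  have a : 0 < n%:~R :> R by rewrite -(pmulr_lgt0 _ h0) -yE.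
  have b : n%:~R < (2 : int)%:~R :> R by rewrite -(ltr_pM2r h0) -yE.
  by move: a b; rewrite ltr0z ltr_int; lia.
have : (2 * m + 1)%:~R = 0 :> R by move: xE; rewrite n1 intrD intrM; lra.
by move/eqP; rewrite intr_eq0 => /eqP; lia.
Qed.

Variables (p p1 : R * R -> C) (b : C).
Hypotheses (Ep : ell 4 p) (vp : vanishing (fun z => cx z ^+ 2 * p z - 1)).
Local Notation Y := (YY p b).

Definition potential k (G : R * R -> R) := (forall z c, Lam c -> ~ Lam z -> G (z + c) = G z) /\
  forall z, ~ Lam z -> Y z != 0 -> wd (fun w => (G w)%:C) z (k / Y z) (cj (k / Y z)).

(** [z^4 Y] tends to 1, so [Y] has no zeros near 0, and [k / Y] is bounded there. *)
Lemma YY_near (k : C) : exists d, exists2 M, 0 < d & forall z, pdisc d z -> [/\ ~ Lam z, Y z != 0 & nrm2 (k / Y z) <= M].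
Proof.
have v : vanishing (fun z => cx z ^+ 4 * Y z - 1).
  have := vanD (vanD (vanM vp (bndD (van_bnd vp) (bnd_cst 2))) (vanM (van_cxX 1) (bndM (bnd_cst (- b)) (bndD (van_bnd vp) (bnd_cst 1)))))
    (vanM (van_cxX 3) (bnd_cst (b ^+ 2))).
  by apply: van_ext; near=> z; rewrite /YY; move: (cx z) (p z) => x q; ring.
have q0 : 0 < 4^-1 :> R by rewrite invr_gt0.
have [d1 d10 h1] := v _ q0; have [d2 d20 h2] := (near0P _).1 (@near0_off R).
exists (Num.min (Num.min d1 d2) 1), (4 * nrm2 k) => [|z]; first by rewrite !lt_min d10 d20 ltr01.
rewrite /pdisc /= !lt_min => /andP[z0 /andP[/andP[z1 z2] z3]].
have zL : ~ Lam z by apply: h2; rewrite z0.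
have := h1 z; rewrite z0 z1 => /(_ isT); set x := cx z ^+ 4 * Y z => hx.
have x4 : 4^-1 <= nrm2 x.
  have := nrm2D x (- (x - 1)); rewrite nrm2N; have -> : x - (x - 1) = 1 by ring.
  by rewrite {1}/nrm2 /= expr1n expr0n addr0; lra.
have le1 : nr2 z ^+ 4 <= 1 by rewrite exprn_ile1 // ltW.
have Y4 : 4^-1 <= nrm2 (Y z).
  apply: le_trans x4 _; rewrite /x nrm2M nrm2X -nr2E -[leRHS]mul1r; apply: ler_wpM2r => //; exact: nrm2_ge0.
have Y0 : 0 < nrm2 (Y z) by apply: lt_le_trans Y4.
split; [exact: zL|by rewrite -nrm2_eq0 gt_eqF|].
rewrite nrm2M nrm2V ler_pdivrMr // mulrC mulrA; rewrite -[leLHS]mul1r; apply: ler_wpM2r; [exact: nrm2_ge0|].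
by have := ler_wpM2r (_ : 0 <= 4 :> R) Y4; rewrite mulVf ?pnatr_eq0 //; apply; exact: ler0n.
Unshelve. all: by end_near.
Qed.

(** A quarter turn around 0 along the chord, which stays at distance at least [|w| / sqrt 2] from 0;
    the mean value theorem does the rest. *)
Lemma turn_step d (M : R) (G : R * R -> R) (g : R * R -> C) w : 0 <= M ->
  (forall z, pdisc d z -> wd (fun w => (G w)%:C) z (g z) (cj (g z))) -> (forall z, pdisc d z -> nrm2 (g z) <= M) ->
  pdisc d w -> (G (- w.2, w.1) - G w) ^+ 2 <= 8 * M * nr2 w.
Proof.
move=> M0 dG gM /andP[w0 wd']; pose v : R * R := (- w.2 - w.1, w.1 - w.2).
have inD t : 0 <= t <= 1 -> pdisc d (w.1 + t * v.1, w.2 + t * v.2).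
  move=> /andP[t0 t1]; rewrite /pdisc /=.
  have -> : nr2 (w.1 + t * (- w.2 - w.1), w.2 + t * (w.1 - w.2)) = (1 - 2 * (t * (1 - t))) * nr2 w by rewrite /nr2 /=; ring.
  have tt : 0 <= t * (1 - t) by rewrite mulr_ge0 // subr_ge0.
  have t2 : 2 * (t * (1 - t)) < 1 by have := sqr_ge0 (2 * t - 1); rewrite -subr_gt0; move=> h; nra.
  apply/andP; split; first by rewrite mulr_gt0 // subr_gt0.
  by apply: le_lt_trans wd'; rewrite ger_pMl // gerBl mulr_ge0.
have dF t : 0 <= t <= 1 -> dv (fun t => G (w.1 + t * v.1, w.2 + t * v.2)) t (2 * Re (g (w.1 + t * v.1, w.2 + t * v.2) * cx v)).
  by move=> /inD/dG/wd_Re/rd_line h; apply: (dv_eq h); rewrite !ReImE /=; ring.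
have [t /andP[t0 t1] e] := dv_mvt ltr01 dF.
have tI : 0 <= t <= 1 by rewrite !ltW.
move: e; rewrite !mul1r !mul0r !addr0 subr0 mulr1.
have -> : (w.1 + v.1, w.2 + v.2) = (- w.2, w.1) by rewrite /v /=; congr (_, _); ring.
rewrite -surjective_pairing => ->; rewrite exprMn.
have := Re_le_nrm2 (g (w.1 + t * v.1, w.2 + t * v.2) * cx v); rewrite nrm2M -nr2E.
have -> : nr2 v = 2 * nr2 w by rewrite /nr2 /v /=; ring.
have := gM _ (inD _ tI); move: (nrm2 _) (Re _ ^+ 2) (nr2 w) w0 => x y n n0 xM yx.
have : x * (2 * n) <= M * (2 * n) by apply: ler_wpM2r => //; lra.
lra.
Qed.

(** Nothing is known of [G] at 0 itself, so [w] and [- w] are joined by two quarter turns around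
    it. *)
Lemma potential_detour k G : potential k G -> forall e, 0 < e -> exists2 d, 0 < d & forall w, pdisc d w -> `|G w - G (- w)| <= e.
Proof.
move=> [_ dG] e e0; have [d [M d0 h]] := YY_near k.
have M0 : 0 <= Num.max M 0 by rewrite le_max lexx orbT.
have gN z : pdisc d z -> nrm2 (k / Y z) <= Num.max M 0 by move=> /h[_ _]; rewrite le_max => ->.
move: (Num.max M 0) M0 gN => N N0 gN.
have dG' z : pdisc d z -> wd (fun w => (G w)%:C) z (k / Y z) (cj (k / Y z)) by move=> /h[zL Y0 _]; exact: dG.
have N1 : 0 < 32 * (N + 1) by lra.
exists (Num.min d (e ^+ 2 / (32 * (N + 1)))) => [|w]; first by rewrite lt_min d0 divr_gt0 // exprn_gt0.
rewrite /pdisc /= lt_min ltr_pdivlMr // => /andP[w0 /andP[w1 w2]].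
have k1 := @turn_step d N G _ w N0 dG' gN; have k2 := @turn_step d N G _ (- w.2, w.1) N0 dG' gN.
have n2 : nr2 (- w.2, w.1) = nr2 w by rewrite /nr2 /= sqrrN addrC.
have wm : (- w.1, - w.2) = - w by [].
rewrite /pdisc /= n2 w0 w1 in k1 k2; rewrite wm in k2; move: (k1 isT) (k2 isT) => {}k1 {}k2.
have le : 8 * N * nr2 w <= (e / 2) ^+ 2.
  move: w0 w2 N0; move: (nr2 w) => n n0 n2' N0; rewrite exprMn; have : 0 <= n * N by rewrite mulr_ge0 // ltW.
  lra.
have e2 : 0 <= e / 2 by lra.
have := sqr_le_abs e2 (le_trans k1 le); have := sqr_le_abs e2 (le_trans k2 le).
by rewrite ler_norml; move=> /andP[a1 a2] /andP[a3 a4]; apply/andP; split; lra.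
Qed.

Lemma potential_gap k G v L : potential k G -> nr2 v = 1 -> Lam (ray v L) -> gap L (fun s => G (ray v s)).
Proof.
move=> hG v1 vL e e0; have [d d0 h] := potential_detour hG e0.
have [d' d'0 h'] := (near0P _).1 (@near0_off R).
exists (Num.min 1 (Num.min d d')) => [|s]; first by rewrite !lt_min ltr01 d0.
rewrite !lt_min => /andP[s0 /andP[s1 /andP[s2 s4]]].
have ss : s ^+ 2 <= s by rewrite expr2 ger_pMl // ltW.
have n0 : 0 < nr2 (ray v s) by rewrite nr2_ray v1 mulr1 exprn_gt0.
have nd : nr2 (ray v s) < d by rewrite nr2_ray v1 mulr1; apply: le_lt_trans ss _.
have zL : ~ Lam (- ray v s).
  by apply: notlatticeN; apply: h'; rewrite n0 nr2_ray v1 mulr1 (le_lt_trans ss).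
have -> : ray v (L - s) = - ray v s + ray v L by apply: cx_inj; rewrite cxD !cx_ray /ray; apply: eqReIm; rewrite !ReImE /=; ring.
by rewrite hG.1 //; apply: h; rewrite /pdisc /= n0.
Qed.

Lemma potential_dv k G v s : potential k G -> ~ Lam (ray v s) -> Y (ray v s) != 0 ->
  dv (fun t => G (ray v t)) s (2 * Re (k / Y (ray v s) * cx v)).
Proof. by move=> hG zL Y0; apply: dv_ray; exact: hG.2. Qed.

Lemma p_iter j z : ~ Lam z -> p (iter j rot z) = (rr ^+ j) ^+ 4 * p z.
Proof.
move=> zL; have [_ _ h _] := Ep; elim: j => [|j IH]; first by rewrite expr1n mul1r.
by rewrite iterS h; [rewrite IH mulrA -exprMn -exprS|exact: off_iter].
Qed.

Lemma YY_iter j z : ~ Lam z -> Y (iter j rot z) = (rr ^+ j) ^+ 8 * (p z ^+ 2 - (rr ^+ j) ^+ 2 * b * p z + (rr ^+ j) ^+ 4 * b ^+ 2).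
Proof.
move=> zL; rewrite /YY p_iter //; have := rrj6 j; move: (rr ^+ j) (p z) => r q r6.
transitivity ((r ^+ 4 * q) ^+ 2 - r ^+ 6 * b * (r ^+ 4 * q) + (r ^+ 6) ^+ 2 * b ^+ 2); last by ring.
by rewrite r6 expr1n !mul1r.
Qed.

(** With [r = rr^j] and [b = - s r^4], on the rotated ray [Y] is the constant [r^8] times the
    positive number [f^2 + s f + s^2]. The phase of [k] is such that the derivative of [G] becomes
    [2 c / (f^2 + s f + s^2)], so [G] would increase from one lattice point to another. *)
Lemma ray_contradiction j (v : R * R) (L s c : R) (f : R -> R) k G : nr2 v = 1 -> 0 < L -> Lam (ray v L) ->
  (forall t, 0 < t < L -> [/\ ~ Lam (ray v t), p (ray v t) = (f t)%:C & 0 < f t ^+ 2 + s * f t + s ^+ 2]) ->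
  b = - (s%:C * (rr ^+ j) ^+ 4) -> potential k G -> k * cx v * (rr ^+ j) ^+ 5 = c%:C -> 0 < c -> False.
Proof.
move=> v1 L0 vL hf bE hG kE c0; have v1' : nr2 (iter j rot v) = 1 by elim: j {bE kE} => //= j <-; rewrite nr2_rot.
have vL' : Lam (ray (iter j rot v) L) by rewrite ray_iter; exact: lattice_iter.
have gp := potential_gap hG v1' vL'.
have r0 := rrj_neq0 j; have r6 := rrj6 j.
have Yt t : 0 < t < L -> Y (ray (iter j rot v) t) = (rr ^+ j) ^+ 8 * (f t ^+ 2 + s * f t + s ^+ 2)%:C.
  move=> /hf[tL pE _]; rewrite ray_iter YY_iter // pE bE !cRE; move: r6; move: (rr ^+ j) (f t)%:C s%:C => r x y r6.
  transitivity (r ^+ 8 * (x ^+ 2 + r ^+ 6 * y * x + (r ^+ 6) ^+ 2 * y ^+ 2)); first by ring.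
  by rewrite r6 expr1n !mul1r.
have pos t : 0 < t < L -> (f t ^+ 2 + s * f t + s ^+ 2)%:C != 0 :> C.
  by move=> /hf[_ _ h]; rewrite -nrm2_eq0 /nrm2 /= expr0n addr0 gt_eqF // exprn_gt0.
apply: (@no_monotone L (fun t => G (ray (iter j rot v) t)) (fun t => 2 * (c / (f t ^+ 2 + s * f t + s ^+ 2))) L0 gp) => t tI.
  have [tL _ _] := hf t tI.
  have h : dv (fun t => G (ray (iter j rot v) t)) t _ :=
    potential_dv hG (_ : ~ Lam (ray (iter j rot v) t)) (_ : Y (ray (iter j rot v) t) != 0).
  apply: dv_eq; first apply: h.
  - by rewrite ray_iter; exact: off_iter.
  - by rewrite (Yt t tI); apply: mulf_neq0; [exact: expf_neq0|exact: (pos t tI)].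
  congr (2 * _); rewrite Yt // cx_iter; have := pos t tI.
  have -> : c / (f t ^+ 2 + s * f t + s ^+ 2) = Re (c%:C / (f t ^+ 2 + s * f t + s ^+ 2)%:C) by rewrite -cRV -cRM.
  rewrite -kE; move: (_ + _ + _)%:C => T T0; congr Re.
  move: r0 r6; move: (rr ^+ j) (cx v) => r x r0 r6.
  transitivity (k * x * r ^+ 5 / ((r ^+ 6) ^+ 2 * T)); first by field; rewrite ?T0 ?r0.
  by rewrite r6 expr1n mul1r.
have [_ _ h] := hf t tI; by rewrite mulr_gt0 // divr_gt0.
Qed.

End rays.

(** * Case analysis on [b] and the contradiction *)

Section nonexistence.
Context {R : realType}.
Local Notation C := R[i].
Local Notation s3 := (Num.sqrt (3 : R)).
Local Notation hh := (s3 / 2).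
Local Notation Lam := (lattice (rho R)).
Local Notation rr := (@rr R).
Local Notation dv f x a := (is_derive (x : R) (1 : R) f a).
Implicit Types (z w v : R * R).

Lemma Re_div (t : R) (w : C) : w != 0 -> Re (t%:C / w) = t * Re w / nrm2 w.
Proof.
move=> w0; have n0 : nrm2 w != 0 by rewrite nrm2_eq0.
have -> : t%:C / w = (t / nrm2 w)%:C * cj w.
  by apply: (mulIf w0); rewrite divfK // -mulrA [cj w * w]mulrC -nrm2E -cRM divfK.
by rewrite !ReImE /=; field.
Qed.

Lemma Re_div2 (q w : C) : w != 0 -> Re (q / w) = Re (q * cj w) / nrm2 w.
Proof.
move=> w0; have n0 : nrm2 w != 0 by rewrite nrm2_eq0.
have -> : q / w = (nrm2 w)^-1%:C * (q * cj w).
  by apply: (mulIf w0); rewrite divfK // -!mulrA [cj w * w]mulrC -nrm2E mulrCA -cRM mulVf // mulr1.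
by rewrite !ReImE /=; field.
Qed.

(** [ln t <= t - 1] reduces the claim to a quadratic inequality; the hypothesis quantifies that [c]
    is small against [a]. *)
Lemma ln_nrm2_ratio (a e : R) (c : C) : 0 < e -> 0 < nrm2 (a%:C - c) -> 0 < nrm2 (a%:C + c) -> nrm2 c * (64 + 8 * e ^+ 2) <= e ^+ 2 * a ^+ 2 ->
  ln (nrm2 (a%:C - c)) - ln (nrm2 (a%:C + c)) <= e.
Proof.
move=> e0 A0 B0 h; set A := nrm2 (a%:C - c); set B := nrm2 (a%:C + c).
have k : 1 + (ln A - ln B) <= A / B.
  by apply: le_trans (expR_ge1Dx _) _; rewrite expRD expRN !lnK ?posrE.
suff : A / B <= 1 + e by lra.
rewrite ler_pdivrMr //; move: h; rewrite /A /B; case: c {A0 B0 A B k} => r i; rewrite /nrm2 /= => h.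
have s1 := sqr_ge0 (e * (a + 2 * r)); have s2 := sqr_ge0 (e * a / 2 + 4 * r); have s4 := sqr_ge0 (e * i).
have s5 := sqr_ge0 i; have s6 := sqr_ge0 (e * r).
rewrite -subr_ge0 -(pmulr_rge0 _ e0).
have -> : e * ((1 + e) * ((a + r) ^+ 2 + (0 + i) ^+ 2) - ((a - r) ^+ 2 + (0 - i) ^+ 2)) =
  e ^+ 2 * ((a + r) ^+ 2 + i ^+ 2) + 4 * e * a * r by ring.
rewrite !exprMn in s1 s4 s6; lra.
Qed.

Variables (p p1 : R * R -> C) (b : C) (e : R).
Hypotheses (Ep : ell 4 p) (vp : vanishing (fun z => cx z ^+ 2 * p z - 1)).
Hypothesis dp1 : forall z, ~ Lam z -> wd p1 z (6 * p z ^+ 2) 0.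
Let P x : R := Re (p (x, 0)).
Let P1 x : R := Re (p1 (x, 0)).
Hypothesis e0 : 0 < e.
Hypothesis P1sq : forall x : R, 0 < x < 1 -> Re (p1 (x, 0)) ^+ 2 = 4 * Re (p (x, 0)) ^+ 3 - 4 * e ^+ 3.
Hypothesis pot_zero : nn b e = 0 -> forall k, exists G, potential p b k G.
Hypothesis pot : forall k, k ^+ 2 = nn b e -> exists G, potential p b k G.

Let pP x : 0 < x < 1 -> p (x, 0) = (P x)%:C. Proof. exact: p_axis Ep x. Qed.
Let dP1 x : 0 < x < 1 -> dv P1 x (6 * P x ^+ 2).
Proof.
move=> x01; have := @dv_horizontal _ p1 (fun z => 6 * p z ^+ 2) 0 x (dp1 (axis_off x01)); rewrite pP // => h.
by apply: (dv_eq h); rewrite -(cRn 6) -cRX -cRM.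
Qed.
Let Pe x : 0 < x < 1 -> e <= P x.
Proof.
move=> x01; have := P1sq x01; rewrite -/(P x) -/(P1 x) => h; have k := sqr_ge0 (P1 x).
rewrite leNgt; apply/negP => l; have : P x ^+ 3 < e ^+ 3.
  have [p0|p0] := leP 0 (P x); first by rewrite ltrXn2r.
  apply: (@le_lt_trans _ _ 0); last exact: exprn_gt0.
  by rewrite exprS; apply: mulr_le0_ge0; [exact: ltW|exact: sqr_ge0].
lra.
Qed.
Let Psym x : 0 < x < 1 -> P (1 - x) = P x.
Proof.
move=> x01; have x01' : 0 < 1 - x < 1 by move/andP: x01 => [a c]; apply/andP; split; lra.
have [_ h2 h3 _] := Ep; have zL := axis_off x01.
have s1 : (-1 : C) ^+ 4 = 1 by rewrite -signr_odd.
have := p_iter Ep 3 zL; rewrite /= rot3E rr3 s1 mul1r => hm.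
have := h2 (- (x, 0)) (1, 0) (@lattice_1 R) (notlatticeN zL); rewrite hm.
have -> : - (x, 0) + (1, 0) = (1 - x, 0) :> R * R by congr (_, _) => /=; ring.
by rewrite /P => ->.
Qed.
(** [P] behaves like [x^-2] at 0 and is symmetric about 1/2, so [P1^2 = 4 P^3 - 4 e^3] exceeds every
    bound near both ends. *)
Let end_large K : exists2 d, 0 < d & forall x : R, 0 < x < d -> [/\ 0 < x < 1, 0 < 1 - x < 1, K <= P1 x ^+ 2 & K <= P1 (1 - x) ^+ 2].
Proof.
have q0 : 0 < 4^-1 :> R by rewrite invr_gt0.
have [d d0 hd] := vp q0; pose T := Num.max 1 (K / 4 + e ^+ 3).
have T1 : 1 <= T by rewrite le_max lexx.
have TK : K / 4 + e ^+ 3 <= T by rewrite le_max lexx orbT.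
have T0 : 0 < T by lra.
exists (Num.min (Num.min 1 d) (2 * T)^-1) => [|x]; first by rewrite !lt_min ltr01 d0 invr_gt0 mulr_gt0.
rewrite !lt_min => /andP[x0 /andP[/andP[x1 xd] xT]].
have x01 : 0 < x < 1 by rewrite x0.
have x01' : 0 < 1 - x < 1 by apply/andP; split; lra.
have xx : x ^+ 2 <= x by rewrite expr2 ger_pMl // ltW.
have n2 : nr2 (x, 0) = x ^+ 2 by rewrite /nr2 /= expr0n addr0.
have PT : T <= P x.
  have := hd (x, 0); rewrite n2 exprn_gt0 // (le_lt_trans xx) // pP // => /(_ isT) h.
  have k : (x ^+ 2 * P x - 1) ^+ 2 <= 4^-1.
    apply: le_trans h; have -> : cx (x, 0) ^+ 2 * (P x)%:C - 1 = (x ^+ 2 * P x - 1)%:C.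
      by rewrite (_ : cx (x, 0) = x%:C) // !cRE.
    by rewrite /nrm2 /= expr0n addr0.
  have y2 : 2^-1 <= x ^+ 2 * P x.
    have : (x ^+ 2 * P x - 1) ^+ 2 <= (2^-1) ^+ 2 by apply: le_trans k _; rewrite exprVn; lra.
    by move=> /sqr_le_abs => /(_ (ltac:(by rewrite invr_ge0)))/andP[m _]; lra.
  have xT' : x ^+ 2 * (2 * T) <= 1.
    by rewrite -ler_pdivlMr ?mulr_gt0 // mul1r; apply: le_trans xx _; exact: ltW.
  rewrite -(ler_pM2l (exprn_gt0 2 x0)); lra.
have KP y : 0 < y < 1 -> T <= P y -> K <= P1 y ^+ 2.
  move=> y01 Ty; rewrite /P1 P1sq // -/(P y); have : P y <= P y ^+ 3.
    by rewrite -[leLHS]expr1; apply: ler_weXn2l => //; lra.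
  lra.
by split=> //; apply: KP; rewrite ?Psym.
Qed.
Let sqC (x y z : R) : x ^+ 2 = 4 * y ^+ 3 - 4 * z ^+ 3 -> x%:C ^+ 2 = 4 * y%:C ^+ 3 - 4 * z%:C ^+ 3 :> C.
Proof. by move=> h; rewrite -cRX h !cRE. Qed.
(** [ln |(p' - q) / (p' + q)|] on the real axis. Because [p'^2 - q^2 = 4 (p^3 + b^3)] for the chosen
    [q], its derivative has the denominator [p^3 + b^3]. *)
Let l (q : C) x := 2^-1 * (ln (nrm2 ((P1 x)%:C - q)) - ln (nrm2 ((P1 x)%:C + q))).

Let P1_neq (q : C) x : q ^+ 2 = 4 * (- b ^+ 3 - e%:C ^+ 3) -> (forall t : R, e <= t -> t%:C ^+ 3 != - b ^+ 3) -> 0 < x < 1 ->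
  ((P1 x)%:C - q != 0) /\ ((P1 x)%:C + q != 0).
Proof.
move=> q2 hs x01; have h : ((P1 x)%:C - q) * ((P1 x)%:C + q) != 0.
  have -> : ((P1 x)%:C - q) * ((P1 x)%:C + q) = (P1 x)%:C ^+ 2 - q ^+ 2 by ring.
  have s : (P1 x)%:C ^+ 2 = 4 * (P x)%:C ^+ 3 - 4 * e%:C ^+ 3 by apply: sqC; exact: P1sq.
  rewrite q2 s; apply: contra_neq (hs _ (Pe x01)) => k.
  have -> : (P x)%:C ^+ 3 = (4 * (P x)%:C ^+ 3 - 4 * e%:C ^+ 3 - 4 * (- b ^+ 3 - e%:C ^+ 3)) / 4 + - b ^+ 3 by field.
  by rewrite k mul0r add0r.
by move: h; rewrite mulf_eq0 negb_or => /andP[].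
Qed.
Let dln (c : C) x : 0 < x < 1 -> (P1 x)%:C + c != 0 ->
  dv (fun t => ln (nrm2 ((P1 t)%:C + c))) x (Re ((12 * P x ^+ 2)%:C / ((P1 x)%:C + c))).
Proof.
move=> x01 w0; have N0 : 0 < nrm2 ((P1 x)%:C + c) by rewrite lt_neqAle eq_sym nrm2_eq0 w0 nrm2_ge0.
have E t : nrm2 ((P1 t)%:C + c) = (P1 t + Re c) ^+ 2 + Im c ^+ 2 by case: c {w0 N0} => u v; rewrite /nrm2 /= add0r.
have h : dv (fun t => nrm2 ((P1 t)%:C + c)) x (2 * (P1 x + Re c) * (6 * P x ^+ 2)).
  have -> : (fun t => nrm2 ((P1 t)%:C + c)) = (fun t => (P1 t + Re c) ^+ 2 + Im c ^+ 2) by apply/funext.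
  have := dvD (dv_sqr (dvD (dP1 x01) (dv_cst (Re c) x))) (dv_cst (Im c ^+ 2) x).
  by move=> k; apply: (dv_eq k); rewrite !addr0.
apply: (dv_eq (dvC h (is_derive1_ln N0))).
rewrite Re_div // [Re (_ + c)]ReD -[Re (P1 x)%:C]/(P1 x).
have gen (N a d r : R) : N^-1 * (2 * (a + r) * (6 * d ^+ 2)) = 12 * d ^+ 2 * (a + r) / N by ring.
exact: gen.
Qed.
Let dl (q : C) x : q ^+ 2 = 4 * (- b ^+ 3 - e%:C ^+ 3) -> (forall t : R, e <= t -> t%:C ^+ 3 != - b ^+ 3) -> 0 < x < 1 ->
  dv (l q) x (3 * Re (q * (P x)%:C ^+ 2 / ((P x)%:C ^+ 3 + b ^+ 3))).
Proof.
move=> q2 hs x01; have [w1 w2] := P1_neq q2 hs x01.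
have h := dvM (dv_cst 2^-1 x) (dvB (dln x01 w1) (dln x01 w2)).
apply: (dv_eq h); rewrite mul0r add0r; move: (w1) (w2) (P1sq x01); rewrite -/(P x) -/(P1 x) => v1 v2 s.
have s' : (P1 x)%:C ^+ 2 = 4 * (P x)%:C ^+ 3 - 4 * e%:C ^+ 3 by exact: sqC.
have D : (P x)%:C ^+ 3 + b ^+ 3 = ((P1 x)%:C - q) * ((P1 x)%:C + q) / 4.
  transitivity (((P1 x)%:C ^+ 2 - q ^+ 2) / 4); last by field.
  by rewrite s' q2; field.
have -> : q * (P x)%:C ^+ 2 / ((P x)%:C ^+ 3 + b ^+ 3) = 6^-1%:C * ((12 * P x ^+ 2)%:C / ((P1 x)%:C - q) - (12 * P x ^+ 2)%:C / ((P1 x)%:C + q)).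
  rewrite D !cRE; move: v1 v2; move: (P1 x)%:C (P x)%:C => X Z v1 v2; field.
  by rewrite v1 v2.
have r2 (A B : C) : Re (6^-1%:C * (A - B)) = 6^-1 * (Re A - Re B) by rewrite !ReImE /=; ring.
by rewrite r2; move: (Re _ - Re _) => t; field.
Qed.
Let l_gap (q : C) : q ^+ 2 = 4 * (- b ^+ 3 - e%:C ^+ 3) -> (forall t : R, e <= t -> t%:C ^+ 3 != - b ^+ 3) -> gap 1 (l q).
Proof.
move=> q2 hs d d0; have [r r0 h] := end_large (nrm2 q * (64 + 8 * d ^+ 2) / d ^+ 2); exists r => // x /h[x1 x2 k1 k2].
have small y : 0 < y < 1 -> nrm2 q * (64 + 8 * d ^+ 2) / d ^+ 2 <= P1 y ^+ 2 -> `|l q y| <= d / 2.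
  move=> y01; rewrite ler_pdivrMr ?exprn_gt0 // mulrC [leRHS]mulrC => k.
  have [w1 w2] := P1_neq q2 hs y01.
  have N1 : 0 < nrm2 ((P1 y)%:C - q) by rewrite lt_neqAle eq_sym nrm2_eq0 w1 nrm2_ge0.
  have N2 : 0 < nrm2 ((P1 y)%:C + q) by rewrite lt_neqAle eq_sym nrm2_eq0 w2 nrm2_ge0.
  have a := @ln_nrm2_ratio (P1 y) d q d0 N1 N2; have c := @ln_nrm2_ratio (P1 y) d (- q) d0; rewrite opprK nrm2N in c.
  have {}a := a (ltac:(by rewrite mulrC)); have {}c := c N2 N1 (ltac:(by rewrite mulrC)).
  by rewrite /l ler_norml; apply/andP; split; lra.
apply: le_trans (ler_normB _ _) _; have := small _ x1 k1; have := small _ x2 k2; lra.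
Qed.
Let h2 : hh * hh = 3 / 4.
Proof. by rewrite mulrACA -expr2 sqr_sqrtr // -invfM -natrM. Qed.
(** The derivative of [G] along the real period rotated by [j pi / 3]; in [dG], [X] and [V] are
    [- b q P] and [b^2 q] over [P^3 + b^3]. *)
Let dd (j : nat) (X V : C) := - 2 * hh * Im ((rr ^+ j) ^+ 5 * X - rr ^+ j * V).

Let dG_alg (y r q a X T : C) : r != 0 -> T != 0 -> X + r ^+ 2 * a != 0 -> r ^+ 6 = 1 ->
  ci * y * - a * q / (r ^+ 8 * T) * (r * 1) = ci * y * (r ^+ 5 * (- a * q * X / (T * (X + r ^+ 2 * a))) - r * (a ^+ 2 * q / (T * (X + r ^+ 2 * a)))).
Proof.
move=> r0 T0 W0 r6; transitivity (ci * y * - a * q * r * (r ^+ 6) ^+ 2 / (r ^+ 8 * T)); first by rewrite r6 expr1n !mulr1; ring.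
transitivity (ci * y * - a * q * r ^+ 5 / T); first by field; rewrite ?T0 ?r0.
transitivity (ci * y * (r ^+ 5 * (- a * q * X) - r * r ^+ 6 * (a ^+ 2 * q)) / (T * (X + r ^+ 2 * a))); first by field; rewrite ?W0 ?T0.
by rewrite r6 mulr1; field; rewrite ?W0 ?T0.
Qed.
Let dG k G (q : C) j x : potential p b k G -> k = ci * hh%:C * (- b) * q -> 0 < x < 1 -> (P x)%:C ^+ 3 + b ^+ 3 != 0 ->
  dv (fun t => G (ray (iter j rot (1, 0)) t)) x (dd j (- b * q * (P x)%:C / ((P x)%:C ^+ 3 + b ^+ 3)) (b ^+ 2 * q / ((P x)%:C ^+ 3 + b ^+ 3))).
Proof.
move=> hG kE x01 D0; have xE : ray (1, 0) x = (x, 0) by rewrite /ray /= mulr1 mulr0.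
have zL := axis_off x01; have r0 := @rrj_neq0 R j; have r6 := @rrj6 R j.
have YE := @YY_iter _ p b Ep j (x, 0) zL; rewrite pP // in YE.
set r := rr ^+ j in r0 r6 YE *; set T := _ - _ + _ in YE.
have TD : T * ((P x)%:C + r ^+ 2 * b) = (P x)%:C ^+ 3 + b ^+ 3.
  transitivity ((P x)%:C ^+ 3 + r ^+ 6 * b ^+ 3); first by rewrite /T; ring.
  by rewrite r6 mul1r.
have T0 : T != 0 by apply: contraNneq D0 => T0; rewrite -TD T0 mul0r.
have Y0 : YY p b (ray (iter j rot (1, 0)) x) != 0 by rewrite ray_iter xE YE mulf_neq0 // expf_neq0.
have zL' : ~ Lam (ray (iter j rot (1, 0)) x) by rewrite ray_iter xE; exact: off_iter.
have h := potential_dv hG zL' Y0; apply: (dv_eq h); rewrite ray_iter xE YE cx_iter -/r kE.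
have -> : cx (1, 0) = 1 :> C by [].
have -> : ci * hh%:C * - b * q / (r ^+ 8 * T) * (r * 1) = ci * hh%:C * (r ^+ 5 * (- b * q * (P x)%:C / ((P x)%:C ^+ 3 + b ^+ 3)) - r * (b ^+ 2 * q / ((P x)%:C ^+ 3 + b ^+ 3))).
  rewrite -TD; have W0 : (P x)%:C + r ^+ 2 * b != 0 by apply: contraNneq D0 => W0; rewrite -TD W0 mulr0.
  by apply: dG_alg.
by rewrite /dd -/r; move: (_ - _) => Z; rewrite !ReImE /=; ring.
Qed.
(** For a cube root of unity [eta], expand [q / (P + eta b)] as [q (P^2 - eta b P + eta^2 b^2) /
    (P^3 + b^3)]. The real part of the first term is the derivative of [l / 3], that of the others a
    real combination of the [dd j]. The sum is positive because [Re q >= 0], [P >= e] and the real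
    part of [q] times the conjugate of [eta b] is positive. *)
Let case3_end (q k : C) G (eta : C) (c0 c1 c2 : R) : q ^+ 2 = 4 * (- b ^+ 3 - e%:C ^+ 3) -> (forall t : R, e <= t -> t%:C ^+ 3 != - b ^+ 3) ->
  potential p b k G -> k = ci * hh%:C * (- b) * q -> 0 <= Re q -> eta ^+ 3 = 1 ->
  (forall X V, Re (eta * X + eta ^+ 2 * V) = (c0 * dd 0 X V + c1 * dd 1 X V + c2 * dd 2 X V) / 3) ->
  0 < Re (q * cj (eta * b)) -> False.
Proof.
move=> q2 hs hG kE q0 eta3 hd m0.
have v1 j : nr2 (iter j rot (1, 0) : R * R) = 1.
  by elim: j => [|j IH] /=; [rewrite /nr2 /= expr1n expr0n addr0|rewrite nr2_rot].
have vL j : Lam (ray (iter j rot (1, 0)) 1).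
  rewrite ray_iter; apply: lattice_iter; rewrite (_ : ray (1, 0) 1 = (1, 0)); [exact: (@lattice_1 R)|by rewrite /ray /= mulr1 mulr0].
have gp j := potential_gap vp hG (v1 j) (vL j).
pose F x := 3^-1 * l q x + 3^-1 * (c0 * G (ray (iter 0 rot (1, 0)) x) + c1 * G (ray (iter 1 rot (1, 0)) x) + c2 * G (ray (iter 2 rot (1, 0)) x)).
have gF : gap 1 F.
  by apply: gapD; [apply: gapZ; exact: l_gap|apply: gapZ; apply: gapD; [apply: gapD|]; apply: gapZ; exact: gp].
have Dn x : 0 < x < 1 -> (P x)%:C ^+ 3 + b ^+ 3 != 0 by move=> /Pe/hs; rewrite -subr_eq0 opprK.
have W x : 0 < x < 1 -> (P x)%:C + eta * b != 0.
  move=> /Dn; apply: contraNneq => w; have -> : (P x)%:C ^+ 3 + b ^+ 3 = (P x)%:C ^+ 3 + eta ^+ 3 * b ^+ 3 by rewrite eta3 mul1r.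
  have -> : (P x)%:C ^+ 3 + eta ^+ 3 * b ^+ 3 = ((P x)%:C + eta * b) * ((P x)%:C ^+ 2 - eta * b * (P x)%:C + eta ^+ 2 * b ^+ 2) by ring.
  by rewrite w mul0r.
apply: (@no_monotone R 1 F (fun x => Re (q / ((P x)%:C + eta * b))) ltr01 gF) => x x01; last first.
  have w0 := W x x01; rewrite Re_div2 //; apply: divr_gt0; last by rewrite lt_neqAle eq_sym nrm2_eq0 w0 nrm2_ge0.
  rewrite cJD cJR mulrDr ReD; apply: ltr_wpDl => //.
  have -> : Re (q * (P x)%:C) = Re q * P x by rewrite !ReImE /=; ring.
  by apply: mulr_ge0 => //; apply: le_trans (Pe x01); exact: ltW.
have D0 := Dn x x01; have g j := dG j hG kE x01 D0.
have h := dvD (dvM (dv_cst 3^-1 x) (dl q2 hs x01)) (dvM (dv_cst 3^-1 x) (dvD (dvD (dvM (dv_cst c0 x) (g 0%N)) (dvM (dv_cst c1 x) (g 1%N))) (dvM (dv_cst c2 x) (g 2%N)))).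
apply: (dv_eq h); rewrite !mul0r !add0r; set X := - b * q * _ / _; set V := b ^+ 2 * q / _.
have := hd X V; set S := c0 * _ + _ + _ => hS.
have -> : 3^-1 * S = Re (eta * X + eta ^+ 2 * V) by rewrite hS; field.
rewrite mulrA mulVf ?pnatr_eq0 // mul1r -ReD; congr Re; rewrite /X /V.
have w0 := W x x01; move: D0 w0; move: (P x)%:C => Z D0 w0.
have DE : Z ^+ 3 + b ^+ 3 = (Z + eta * b) * (Z ^+ 2 - eta * b * Z + eta ^+ 2 * b ^+ 2).
  by transitivity (Z ^+ 3 + eta ^+ 3 * b ^+ 3); [rewrite eta3 mul1r|ring].
rewrite [in RHS](_ : q / (Z + eta * b) = q * (Z ^+ 2 - eta * b * Z + eta ^+ 2 * b ^+ 2) / (Z ^+ 3 + b ^+ 3)); first by field.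
have T0 : Z ^+ 2 - eta * b * Z + eta ^+ 2 * b ^+ 2 != 0 by apply: contraNneq D0 => T0; rewrite DE T0 mulr0.
by rewrite DE invfM mulrA [RHS]mulrAC mulfK.
Qed.
Let rr2E : rr ^+ 2 = (- 2^-1) +i* hh.
Proof. by rewrite rr2; apply: eqReIm; rewrite !ReImE /=; lra. Qed.
Let rr4E : rr ^+ 4 = (- 2^-1) +i* (- hh).
Proof. by rewrite (exprD _ 3 1) rr3 mulN1r expr1; apply: eqReIm. Qed.
Let rr5E : rr ^+ 5 = 2^-1 +i* (- hh).
Proof. by rewrite (exprD _ 3 2) rr3 mulN1r rr2E; apply: eqReIm; rewrite !ReImE /= ?opprK. Qed.
Let d0E X V : dd 0 X V = - 2 * hh * (Im X - Im V).
Proof. by rewrite /dd !expr0 expr1n !mul1r ImD ImN. Qed.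
Let d1E X V : dd 1 X V = - 2 * hh * (Im X / 2 - hh * Re X - (Im V / 2 + hh * Re V)).
Proof. by rewrite /dd expr1 rr5E; congr (_ * _); rewrite !ReImE /=; ring. Qed.
Let d2E X V : dd 2 X V = - 2 * hh * (- Im X / 2 - hh * Re X - (- Im V / 2 + hh * Re V)).
Proof. by rewrite /dd -exprM (exprD _ 6 4) rr6 mul1r rr4E rr2E; congr (_ * _); rewrite !ReImE /=; ring. Qed.
Let h2M (x : R) : hh * (hh * x) = 3 / 4 * x. Proof. by rewrite mulrA h2. Qed.

Lemma complex_sqrt (x : C) : exists2 y : C, y ^+ 2 = x & 0 <= Re y.
Proof.
have [a|a] := leP 0 (Re (sqrtc x)); first by exists (sqrtc x); rewrite ?sqr_sqrtc.
exists (- sqrtc x); first by rewrite sqrrN sqr_sqrtc.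
by rewrite ReN oppr_ge0 ltW.
Qed.
(** The real parts of [w] times the three cube roots of unity add up to 0, so for [w != 0] one of
    them is positive; it selects [eta] and the coefficients of the combination. *)
Let case3 : b != 0 -> (forall t : R, e <= t -> t%:C ^+ 3 != - b ^+ 3) -> False.
Proof.
move=> b0 hs; have [q q2 q0] := complex_sqrt (4 * (- b ^+ 3 - e%:C ^+ 3)).
have qn : q != 0.
  apply/eqP => q00; move: q2; rewrite q00 expr0n /= => /esym/eqP; rewrite mulf_eq0 pnatr_eq0 /= subr_eq0 eq_sym.
  exact/negP/hs.
pose k := ci * hh%:C * (- b) * q.
have k2 : k ^+ 2 = nn b e.
  have ch : hh%:C ^+ 2 = 3 / 4 :> C by rewrite -cRX [hh ^+ 2]expr2 h2 cRM cRV !cRn.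
  have gen (i h x y : C) : (i * h * (- x) * y) ^+ 2 = (i * i) * h ^+ 2 * x ^+ 2 * y ^+ 2 by ring.
  by rewrite /k /nn gen ciM ch q2; field.
have [G hG] := pot k2.
have H := @case3_end q k G _ _ _ _ q2 hs hG erefl q0.
pose w := q * cj b; have w0 : w != 0 by rewrite mulf_neq0 // cJ_eq0.
have W (t : C) : Re (q * cj (t * b)) = Re (cj t * w) by congr Re; rewrite cJM /w; ring.
have [m|m] := ltP 0 (Re w).
  apply: (H 1 0 1 1); [exact: expr1n| |by rewrite mul1r].
  move=> X V; rewrite expr1n !mul1r d1E d2E ReD; have := h2M (Re X); have := h2M (Re V); lra.
have [m1|m1] := ltP 0 (Re (cj (rr ^+ 2) * w)).
  apply: (H (rr ^+ 2) 1 0 (-1)); [by rewrite -exprM rr6| |by rewrite W].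
  move=> X V; rewrite -exprM rr4E rr2E d0E d2E !ReImE /=; have := h2M (Re X); have := h2M (Re V); lra.
have [m2|m2] := ltP 0 (Re (cj (rr ^+ 4) * w)).
  apply: (H (rr ^+ 4) (-1) (-1) 0); [by rewrite -exprM (exprM _ 6 2) rr6 expr1n| |by rewrite W].
  move=> X V; rewrite -exprM (exprD _ 6 2) rr6 mul1r rr4E rr2E d0E d1E !ReImE /=; have := h2M (Re X); have := h2M (Re V); lra.
have h0 := @hh_gt0 R.
move: (w) w0 m m1 m2 => [x y] /eqP w0; rewrite rr2E rr4E !ReImE /= => m m1 m2; apply: w0.
have y0 : hh * y = 0 by lra.
have x0 : x = 0 by lra.
by move/eqP: y0; rewrite mulf_eq0 gt_eqF //= => /eqP ->; rewrite x0.
Qed.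
Let cube_root (t : R) : t%:C ^+ 3 = - b ^+ 3 -> exists j, b = - (t%:C * (rr ^+ j) ^+ 4).
Proof.
move=> h; have e1 : rr ^+ 4 = - rr by rewrite (exprD _ 3 1) rr3 mulN1r expr1.
have k : (b + t%:C) * ((b + t%:C * rr ^+ 4) * (b + t%:C * rr ^+ 2)) = 0.
  transitivity (b ^+ 3 + t%:C ^+ 3); last by rewrite h subrr.
  have r2 := @rr2 R; rewrite e1; move: r2; move: t%:C rr b => y r x r2.
  rewrite r2; transitivity (x ^+ 3 + y ^+ 3 - (r ^+ 2 - r + 1) * (y ^+ 2 * (x + y))); first by ring.
  by rewrite r2; ring.
move/eqP: k; rewrite !mulf_eq0 => /orP[|/orP[]] /eqP/eqP; rewrite addr_eq0 => /eqP ->.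
- by exists 0%N; rewrite expr0 expr1n mulr1.
- by exists 1%N; rewrite expr1.
- by exists 2%N; rewrite -exprM (exprD _ 6 2) rr6 mul1r.
Qed.

(** If [- b^3] is the cube of a real [t > e], the phase of [nn] suits a rotated imaginary period. If
    [b = 0] or [t = e], then [nn = 0], the constant [k] is free, and a real period is used. In all
    other cases [p^3 + b^3] has no zero on the real axis, and [case3] applies. *)
Lemma weierstrass_contradiction : False.
Proof.
have xE t : ray (1, 0) t = (t, 0) :> R * R by rewrite /ray /= mulr1 mulr0.
have n1 : nr2 ((1, 0) : R * R) = 1 by rewrite /nr2 /= expr1n expr0n addr0.
have L1 : Lam (ray (1, 0) 1) by rewrite xE; exact: lattice_1.
have hor s : 0 <= s -> forall t : R, 0 < t < 1 -> [/\ ~ Lam (ray (1, 0) t), p (ray (1, 0) t) = (P t)%:C & 0 < P t ^+ 2 + s * P t + s ^+ 2].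
  move=> s0 t t01; rewrite xE; split; [exact: axis_off|exact: pP|].
  have Pt : 0 < P t by apply: lt_le_trans e0 (Pe t01).
  have := exprn_gt0 2 Pt; have := mulr_ge0 s0 (ltW Pt); have := sqr_ge0 s; lra.
have [b0|b0] := eqVneq b 0.
  have [G hG] := pot_zero (ltac:(by rewrite /nn b0 expr0n mulr0 mul0r)) 1.
  apply: (ray_contradiction Ep vp (j := 0) n1 ltr01 L1 (hor 0 (lexx 0)) _ hG (c := 1)) => //.
    by rewrite b0 mul0r oppr0.
  by rewrite expr0 expr1n !mul1r.
have [[t et tb]|hs] := pselect (exists2 t : R, e <= t & t%:C ^+ 3 = - b ^+ 3); last first.
  by apply: (case3 b0) => t et; apply/eqP => tb; apply: hs; exists t.
have [j bj] := cube_root tb.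
have t0 : 0 < t by apply: lt_le_trans e0 et.
have b3 : b ^+ 3 = - t%:C ^+ 3 by rewrite tb opprK.
have r6 := @rrj6 R j.
have [te|te] := eqVneq t e.
  have [G hG] := pot_zero (ltac:(by rewrite /nn b3 te addNr mulr0)) (rr ^+ j).
  apply: (ray_contradiction Ep vp (j := j) n1 ltr01 L1 (hor t (ltW t0)) bj hG (c := 1)) => //.
  by rewrite (_ : cx (1, 0) = 1) // mulr1 -exprS.
have h0 := @hh_gt0 R.
have et3 : e ^+ 3 < t ^+ 3 by rewrite ltrXn2r ?ltW // lt_neqAle eq_sym te et.
(* Then [- ci * c * rr^j] is a square root of [nn], and its factor [- ci] cancels the direction of
   the imaginary period. *)
pose c := Num.sqrt (3 * t ^+ 2 * (t ^+ 3 - e ^+ 3)).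
have c2 : c ^+ 2 = 3 * t ^+ 2 * (t ^+ 3 - e ^+ 3).
  by rewrite sqr_sqrtr // !mulr_ge0 ?exprn_ge0 ?ltW ?subr_gt0.
have c0 : 0 < c by rewrite sqrtr_gt0 !mulr_gt0 ?exprn_gt0 ?subr_gt0.
have kE : (- ci * c%:C * rr ^+ j) ^+ 2 = nn b e.
  have gen (i h x : C) : (- i * h * x) ^+ 2 = (i * i) * h ^+ 2 * x ^+ 2 by ring.
  rewrite gen ciM -cRX c2 /nn b3 bj !cRE; move: r6; move: (rr ^+ j) t%:C e%:C => r x y r6.
  transitivity (-1 * (3 * x ^+ 2 * (x ^+ 3 - y ^+ 3)) * (r ^+ 6 * r ^+ 2)); first by rewrite r6 mul1r.
  by ring.
have [G hG] := pot kE.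
have yE y : ray (0, 1) y = (0, y) :> R * R by rewrite /ray /= mulr1 mulr0.
have n2 : nr2 ((0, 1) : R * R) = 1 by rewrite /nr2 /= expr1n expr0n add0r.
have L2 : Lam (ray (0, 1) (2 * hh)) by rewrite yE; exact: lattice_imag.
have L20 : 0 < 2 * hh by rewrite mulr_gt0.
apply: (ray_contradiction Ep vp (j := j) (s := t) (f := fun y => Re (p (0, y))) n2 L20 L2 _ bj hG (c := c)) => //.
  move=> y /imag_axis_off yL; rewrite yE; split; [exact: yL| |].
    apply: eqReIm => //=; apply: (ell_vertical (j := 4) _ Ep _ yL) => //.
    by rewrite mulr0; exists 0, 0; rewrite !mulr0z addr0.
  move: (Re _) => x; have := sqr_ge0 (x + t / 2); have := exprn_gt0 2 t0; lra.
rewrite (_ : cx (0, 1) = ci) //; move: (rr ^+ j) r6 c%:C => r r6 x.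
transitivity (- (ci * ci) * x * r ^+ 6); first by ring.
by rewrite r6 ciM opprK mul1r mulr1.
Qed.

End nonexistence.

Theorem theorem3p1 (R : realType) :
  ~ exists u : R * R -> R, mean_field_solution (rho R) (16 * pi) u.
Proof.
move=> [u sol]; have pu := solution_periodic sol; have su := solution_smooth sol.
have perU z c : lattice (rho R) c -> ~ lattice (rho R) z -> u (z + c) = u z.
  by move=> cL zL; exact: (@smooth_period R u pu su [::] c z cL zL).
have [L asym] := solution_asymptotics sol.
have [U1 [U2 [U3 [d1 d2 d3 hQ]]]] := hopf_differential su (@solution_liouville R u sol).
have vQ := hopf_estimate d1 d2 d3 (hQ 2) asym.
have perC z c : lattice (rho R) c -> ~ lattice (rho R) z -> (u (z + c))%:C%C = (u z)%:C%C by move=> cL zL; rewrite perU.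
have p1 := wd_periodic perC d1; have p2 := wd_periodic p1 d2.
have perQ z c : lattice (rho R) c -> ~ lattice (rho R) z -> U2 (z + c) - U1 (z + c) ^+ 2 / 2 = U2 z - U1 z ^+ 2 / 2.
  by move=> cL zL; rewrite p1 // p2.
have [p [B [Ep vp QE]]] := hopf_decomposition hQ perQ vQ.
have [h1 pp _ _] := Ep.
have [q1 dp hq] : exists2 q1, (forall z, ~ lattice (rho R) z -> wd p z (q1 z) 0) & hol (~` lattice (rho R)) 1 q1.
  by have [q d h] := holS (h1 2); exists q.
have [q2 dq _] := holS hq.
have w2 := wp_second Ep vp dp dq; have w1 := wp_first Ep vp dp dq; have e0 := ee_gt0 Ep vp dp dq.
have dq' z : ~ lattice (rho R) z -> wd q1 z (6 * p z ^+ 2) 0 by move=> zL; rewrite -(w2 z zL); exact: dq.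
(* The constant is written as [2 (3 b)] with [b = B / 3], the normalisation in which the Lame
   potential is [6 p + 3 b] and [Y] is [p^2 - b p + b^2]. *)
have QB z : ~ lattice (rho R) z -> U2 z - U1 z ^+ 2 / 2 = - 12 * p z - 2 * (3 * (B / 3)).
  by move=> zL; rewrite QE //; congr (_ - 2 * _); field.
exact: (@weierstrass_contradiction R p q1 (B / 3) (ee p) Ep vp dq' e0 (fun x x01 => p1_axis Ep vp dp dq x01)
  (fun n0 k => potential_zero perU d1 d2 QB pp dp dq' w1 k n0) (fun k kE => potential_nonzero perU d1 d2 QB pp dp dq' w1 kE)).
Qed.
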